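(* Let $\mathbb H=\{\tau\in\mathbb C:\operatorname{Im}\tau>0\}$, $$ z(\tau)=9\,\frac{\eta^3(9\tau)}{\eta^3(\tau)}+1\quad(\tau\in\mathbb H),\qquad \mathfrak u_{\mathrm o}=\frac{i}{6}\,\mathrm B\!\left(\tfrac16,\tfrac13\right), $$ where $\mathrm B$ is the Euler beta-function. The function $\mathfrak u$ given, for either choice of sign, by $$ \pm\mathfrak u(\tau)=\mathfrak u_{\mathrm o}+\frac i2\,z(\tau)\cdot{}_2F_1\!\left(\tfrac12,\tfrac13;\tfrac43\,\Big|\,z(\tau)^3\right), $$ where the hypergeometric function is understood by analytic continuation, is single-valued and is a solution of the Schwarz equation $$ [\mathfrak u,\tau]=-2\,\wp(2\mathfrak u;0,4), $$ where $\wp(\,\cdot\,;g_2,g_3)$ is the Weierstrass function satisfying $\wp'^2=4\wp^3-g_2\wp-g_3$.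
   Context: For a nonconstant analytic function $f(\tau)$ (with $f_\tau\neq0$) put $$ [f,\tau]:=\frac{f_{\tau\tau\tau}}{f_\tau^{3}}-\frac32\,\frac{f_{\tau\tau}^{2}}{f_\tau^{4}}, $$ where subscripts denote derivatives with respect to $\tau$. The Dedekind eta-function is $\eta(\tau)=e^{\frac{\pi i}{12}\tau}\prod_{k\ge1}(1-e^{2\pi i k\tau})$. ${}_2F_1(\alpha,\beta;\gamma|x)$ is the Gauss hypergeometric function, given by its power series for $|x|<1$ and continued analytically. ''Understood by analytic continuation'' means: take the formula, using the power series, near a point of $\mathbb H$ where $|z(\tau)|<1$, and continue the resulting analytic germ along paths in $\mathbb H$. ''Single-valued'' means that this continuation is possible along every path in $\mathbb H$ and yields a holomorphic function on $\mathbb H$. *)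

(* Defs.v *)
From Stdlib Require Import Reals ZArith ClassicalEpsilon.
From Coquelicot Require Import Coquelicot.

Local Open Scope C_scope.

(** Limits, series and products of complex numbers: total operators, taken
    componentwise, which return the limit whenever the sequence converges. *)

Definition Clim_seq (u : nat -> C) : C :=
  (real (Lim_seq (fun n => Re (u n))), real (Lim_seq (fun n => Im (u n)))).

Definition Cseries (a : nat -> C) : C := Clim_seq (fun n => sum_n a n).

(** [Cprod a n] is a 1 * ... * a n: the index starts at 1. *)
Fixpoint Cprod (a : nat -> C) (n : nat) : C :=
  match n with
  | O => 1
  | S m => Cprod a m * a n
  end.

Definition Cexp (x : C) : C :=
  RtoC (exp (Re x)) * (cos (Im x), sin (Im x)).

Definition holomorphic_on (D : C -> Prop) (f : C -> C) : Prop :=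
  forall x : C, D x -> @ex_derive C_AbsRing C_NormedModule f x.

Definition analytic_at (f : C -> C) (x0 : C) : Prop :=
  exists a : nat -> C,
    locally x0 (fun x : C => @is_pseries C_AbsRing C_NormedModule a (x - x0) (f x)).

Definition same_germ (x0 : C) (f g : C -> C) : Prop :=
  locally x0 (fun x : C => f x = g x).

Definition unit_interval (t : R) : Prop := (0 <= t <= 1)%R.

Definition path_in (D : C -> Prop) (gamma : R -> C) : Prop :=
  continuous_on unit_interval gamma /\
  forall t : R, unit_interval t -> D (gamma t).

(** [F t] is a representative, near [gamma t], of the germ obtained from the
    germ of [f] at [gamma 0] by continuation along [gamma] up to time [t]. *)
Definition continuation_along (f : C -> C) (gamma : R -> C) (F : R -> C -> C)
  : Prop :=
  (forall t : R, unit_interval t -> analytic_at (F t) (gamma t)) /\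
  same_germ (gamma 0%R) (F 0%R) f /\
  (forall t : R, unit_interval t ->
     locally t (fun s : R => unit_interval s -> same_germ (gamma s) (F s) (F t))).

(** The germ of [f] at [x0] can be continued along every path in [D] starting
    at [x0], and all these continuations are germs of the one function [g],
    holomorphic on [D]. *)
Definition single_valued_continuation
    (D : C -> Prop) (f : C -> C) (x0 : C) (g : C -> C) : Prop :=
  holomorphic_on D g /\
  forall gamma : R -> C, path_in D gamma -> gamma 0%R = x0 ->
    (exists F : R -> C -> C, continuation_along f gamma F) /\
    (forall F : R -> C -> C, continuation_along f gamma F ->
       same_germ (gamma 1%R) (F 1%R) g).

Definition schwarz_bracket (f : C -> C) (tau : C) : C :=
  let f1 := C_derive f in
  let f2 := C_derive f1 in
  let f3 := C_derive f2 in
  f3 tau / f1 tau ^ 3 - 3 / 2 * (f2 tau ^ 2 / f1 tau ^ 4).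

Definition upper_half_plane (tau : C) : Prop := (0 < Im tau)%R.

Definition eta (tau : C) : C :=
  Cexp (PI * Ci / 12 * tau) *
  Clim_seq (Cprod (fun k => 1 - Cexp (2 * PI * Ci * INR k * tau))).

Definition Beta (a b : R) : R :=
  RInt_gen (fun t => Rpower t (a - 1) * Rpower (1 - t) (b - 1))%R
    (at_right 0) (at_left 1).

Fixpoint rising (a : C) (n : nat) : C :=
  match n with
  | O => 1
  | S m => rising a m * (a + INR m)
  end.

(** The power series of the Gauss function, to be used for |x| < 1 only. *)
Definition hyp2F1 (a b c x : C) : C :=
  Cseries (fun n =>
    rising a n * rising b n / (rising c n * INR (fact n)) * x ^ n).

(** The Weierstrass function of the lattice Z w1 + Z w2; the lattice sum
    converges absolutely and is taken over the squares |m|, |n| <= N. *)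

Definition lattice_point (w : C * C) (m n : Z) : C :=
  IZR m * fst w + IZR n * snd w.

Definition in_lattice (w : C * C) (x : C) : Prop :=
  exists m n : Z, x = lattice_point w m n.

Definition square_sum (f : Z -> Z -> C) (N : nat) : C :=
  sum_n (fun i =>
    sum_n (fun j => f (Z.of_nat i - Z.of_nat N)%Z (Z.of_nat j - Z.of_nat N)%Z)
      (2 * N)) (2 * N).

Definition lattice_wp (w : C * C) (x : C) : C :=
  1 / x ^ 2 +
  Clim_seq (square_sum (fun m n =>
    if ((m =? 0) && (n =? 0))%Z%bool then 0
    else 1 / (x - lattice_point w m n) ^ 2 - 1 / lattice_point w m n ^ 2)).

(** The first condition says that the two periods are linearly independent
    over the reals. The conditions determine the lattice, not its basis. *)
Definition is_period_basis (g2 g3 : C) (w : C * C) : Prop :=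
  Im (snd w * Cconj (fst w)) <> 0%R /\
  forall x : C, ~ in_lattice w x ->
    C_derive (lattice_wp w) x ^ 2 =
    4 * lattice_wp w x ^ 3 - g2 * lattice_wp w x - g3.

Definition wp_periods (g2 g3 : C) : C * C :=
  epsilon (inhabits ((0 : C), (0 : C))) (is_period_basis g2 g3).

Definition wp (x g2 g3 : C) : C := lattice_wp (wp_periods g2 g3) x.

Definition wp_pole (x g2 g3 : C) : Prop := in_lattice (wp_periods g2 g3) x.

Definition zfun (tau : C) : C := 9 * (eta (9 * tau) ^ 3 / eta tau ^ 3) + 1.

Definition u_o : C := Ci / 6 * Beta (1 / 6) (1 / 3).

Definition u_series (tau : C) : C :=
  u_o + Ci / 2 * zfun tau * hyp2F1 (1 / 2) (1 / 3) (4 / 3) (zfun tau ^ 3).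

(* Main.v *)
Require Import Defs.
From Stdlib Require Import Reals ZArith List Lia Lra Psatz Classical ClassicalEpsilon FunctionalExtensionality Permutation ssreflect.
From Coquelicot Require Import Coquelicot.
Import ListNotations.
Local Open Scope R_scope.
Local Open Scope C_scope.

(** Let f be the odd Jacobi theta function for tau/4, [th k] its k-th derivative
    at the third-torsion point pi/3, and J = f'(0). The formula for
    f(x+y) f(x-y), differentiated at pi/3, gives for z = 2 th 1 / J
      z' = (pi i / 2) (J / th 0)^2 (z^3 - 1),   z^3 - 1 = kappa th0^12 / J^4.
    Jacobi's J = 2 i eta^3 identifies z with the eta quotient. Hence, with
    g' = c th0^4 and c^2 = - pi^2 kappa / 16, one has z'^2 = 4 (z^3 - 1) g'^2:
    z is a solution of the Weierstrass equation as a function of g, and a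
    primitive g of c th0^4 is holomorphic on the whole half-plane. The
    derivative of the hypergeometric expression is (i/2) z' / sqrt (1 - z^3),
    which is such a g'. Therefore z = P(g) as soon as this holds at one
    point, and the duplication formula turns the Schwarzian of g, a rational
    function of z, into -2 P(2g).

    The initial value P(u_o) = 0, P'(u_o) = -2 i is obtained by integrating
    the equation from the pole at 0 along the segment [0, u_o], on which the
    solution is the algebraic curve x^6 + c^3 = 1 parametrized by the Beta
    integral; the segment [0, 2 u_o] and the path from z = 0 are treated in
    the same way, so that 2 g is never a pole. That a lattice with invariants
    (0, 4) exists is proved for the hexagonal lattice: the rotation by
    exp(pi i / 3) kills the sums of the inverse powers 3, 4, 5, and the
    difference P'^2 - 4 P^3 is an elliptic function without poles, which is
    constant by the maximum principle. *)

(** * Complex derivatives *)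

(** The point pi/3 is special because 2 pi/3 = pi - pi/3: reflection sends the doubled point back,
    so the duplication formula and its derivatives become algebraic relations among the [th k],
    while by the heat equation a tau-derivative raises the order of a theta derivative by two. The
    argument tau/4 comes from (2n+1)^2 = 8 (n(n+1)/2) + 1, which makes exp (pi i tau/4) the
    exponential factor of eta^3. Neither kappa nor c is evaluated: kappa is the value of a quotient
    with zero derivative, and c is read off at the base point. The lattice is obtained by choice
    from its invariants alone, so nothing is known of P beforehand except its equation and its
    behaviour at lattice points; this is why integration starts at a pole. Every comparison of P(g)
    with a known function is made along a path: the difference satisfies a homogeneous linear system
    and vanishes by Gronwall, and g cannot run into a pole because the known function stays bounded.
    The statement P(2g) = duplication of z is transported in the same way, in parallel with P(g) =
    z, instead of being derived from a general addition theorem. *)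

Lemma Cmod_minus_sym (x y : C) : Cmod (x - y) = Cmod (y - x).
Proof. rewrite -Cmod_opp. f_equal. ring. Qed.

Lemma Cmod_sub_le (x y : C) : (Cmod (x - y) <= Cmod x + Cmod y).
Proof. rewrite -(Cmod_opp y). apply Cmod_triangle. Qed.

Lemma Cmod_sub_ge (x y : C) : (Cmod x - Cmod y <= Cmod (x - y)).
Proof.
  have := Cmod_triangle (x - y) y.
  replace (x - y + y) with x by ring. lra.
Qed.

Lemma Cmod_add_ge (x y : C) : (Cmod x - Cmod y <= Cmod (x + y)).
Proof. have := Cmod_sub_ge x (- y). rewrite Cmod_opp. by replace (x - - y) with (x + y) by ring. Qed.

Lemma Cmod_dist (x y z : C) : (Cmod (x - z) <= Cmod (x - y) + Cmod (y - z)).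
Proof. replace (x - z) with ((x - y) + (y - z)) by ring. apply Cmod_triangle. Qed.

Lemma im_le_Cmod (c : C) : (Rabs (Im c) <= Cmod c).
Proof. apply Rle_trans with (2 := Rmax_Cmod c). apply Rmax_r. Qed.

Lemma Cmod_le_re_im (c : C) : (Cmod c <= Rabs (Re c) + Rabs (Im c)).
Proof.
  have h := Cmod2_alt c. have h0 := Cmod_ge_0 c.
  have h1 := Rabs_pos (Re c). have h2 := Rabs_pos (Im c).
  rewrite -(pow2_abs (Re c)) -(pow2_abs (Im c)) in h. nra.
Qed.

Lemma Cmod_pos (x : C) : x <> 0 -> (0 < Cmod x).
Proof. apply Cmod_gt_0. Qed.

Lemma Cmod_pos_neq (x : C) : (0 < Cmod x) -> x <> 0.
Proof. apply Cmod_gt_0. Qed.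

Lemma Cmod_small_eq (x y : C) : (forall e : R, 0 < e -> Cmod (x - y) < e) -> x = y.
Proof.
  move=> h. apply Ceq_minus. apply Cmod_eq_0.
  have h0 := Cmod_ge_0 (x - y).
  case: (Rle_lt_or_eq_dec _ _ h0) => h1; last by [].
  move: (h _ h1). lra.
Qed.

Lemma RtoC_neq (r : R) : (r <> 0)%R -> RtoC r <> 0.
Proof. move=> h h1. apply h. by apply RtoC_inj. Qed.

(** Increments are confined to [D], so that one set of rules serves complex derivatives ([cder]) and
    derivatives in a real parameter ([rder]). For the latter a curve is read as a function of the
    real part and the increments are real. *)
Definition der (D : C -> Prop) (f : C -> C) (x l : C) : Prop :=
  forall e : R, (0 < e) -> exists d : R, (0 < d) /\
    forall h : C, D h -> (Cmod h < d) ->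
      (Cmod (f (x + h) - f x - l * h) <= e * Cmod h).

Definition cder : (C -> C) -> C -> C -> Prop := der (fun _ => True).

Definition rder (f : R -> C) (t : R) (l : C) : Prop :=
  der (fun h => Im h = 0%R) (fun z => f (Re z)) (RtoC t) l.

Definition contc (f : C -> C) (x : C) : Prop :=
  forall e : R, (0 < e) -> exists d : R, (0 < d) /\
    forall y : C, (Cmod (y - x) < d) -> (Cmod (f y - f x) < e).

Definition contr (f : R -> C) (t : R) : Prop :=
  forall e : R, (0 < e) -> exists d : R, (0 < d) /\
    forall s : R, (Rabs (s - t) < d) -> (Cmod (f s - f t) < e).

Lemma der_ext D f g x l l' :
  (exists d, (0 < d) /\ forall h, D h -> (Cmod h < d) -> f (x + h) = g (x + h)) ->
  f x = g x -> l = l' -> der D f x l -> der D g x l'.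
Proof.
  move=> [d [hd E]] Ex <- H e he.
  have [d' [hd' H']] := H e he.
  exists (Rmin d d'); split; first by apply Rmin_glb_lt.
  move=> h Dh hh. rewrite -E //; last by apply (Rlt_le_trans _ _ _ hh), Rmin_l.
  rewrite -Ex. apply H' => //. by apply (Rlt_le_trans _ _ _ hh), Rmin_r.
Qed.

Lemma der_const D c x : der D (fun _ => c) x 0.
Proof.
  move=> e he. exists 1%R; split; first lra. move=> h _ _.
  replace (c - c - 0 * h) with (RtoC 0) by ring. rewrite Cmod_0.
  have := Cmod_ge_0 h. nra.
Qed.

Lemma der_id D x : der D (fun y => y) x 1.
Proof.
  move=> e he. exists 1%R; split; first lra. move=> h _ _.
  replace (x + h - x - 1 * h) with (RtoC 0) by ring. rewrite Cmod_0.
  have := Cmod_ge_0 h. nra.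
Qed.

Lemma der_plus D f g x l m :
  der D f x l -> der D g x m -> der D (fun y => f y + g y) x (l + m).
Proof.
  move=> F G e he.
  have he2 : (0 < e / 2) by lra.
  have [d1 [hd1 H1]] := F _ he2. have [d2 [hd2 H2]] := G _ he2.
  exists (Rmin d1 d2); split; first by apply Rmin_glb_lt.
  move=> h Dh hh.
  have A1 := H1 h Dh (Rlt_le_trans _ _ _ hh (Rmin_l _ _)).
  have A2 := H2 h Dh (Rlt_le_trans _ _ _ hh (Rmin_r _ _)).
  replace (f (x + h) + g (x + h) - (f x + g x) - (l + m) * h) with
    ((f (x + h) - f x - l * h) + (g (x + h) - g x - m * h)) by ring.
  have := Cmod_triangle (f (x + h) - f x - l * h) (g (x + h) - g x - m * h). lra.
Qed.

Lemma der_lip D f x l : der D f x l -> exists d, (0 < d) /\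
  forall h, D h -> (Cmod h < d) -> (Cmod (f (x + h) - f x) <= (Cmod l + 1) * Cmod h).
Proof.
  move=> F. have [d [hd H]] := F 1%R Rlt_0_1.
  exists d; split => // h Dh hh. have A := H h Dh hh.
  replace (f (x + h) - f x) with (f (x + h) - f x - l * h + l * h) by ring.
  have := Cmod_triangle (f (x + h) - f x - l * h) (l * h). rewrite Cmod_mult. lra.
Qed.

Lemma der_comp D g f x l m :
  cder g (f x) m -> der D f x l -> der D (fun y => g (f y)) x (m * l).
Proof.
  move=> G F e he.
  have [d0 [hd0 L]] := der_lip _ _ _ _ F.
  have l0 := Cmod_ge_0 l. have m0 := Cmod_ge_0 m.
  have hg : (0 < e / 2 / (Cmod l + 1)) by apply Rdiv_lt_0_compat; lra.
  have hf : (0 < e / 2 / (Cmod m + 1)) by apply Rdiv_lt_0_compat; lra.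
  have [d1 [hd1 H1]] := G _ hg. have [d2 [hd2 H2]] := F _ hf.
  exists (Rmin d0 (Rmin d2 (d1 / (Cmod l + 1)))); split.
    apply Rmin_glb_lt => //. apply Rmin_glb_lt => //. apply Rdiv_lt_0_compat; lra.
  move=> h Dh hh.
  have h0 : (Cmod h < d0) by apply (Rlt_le_trans _ _ _ hh), Rmin_l.
  have hh' := Rlt_le_trans _ _ _ hh (Rmin_r _ _).
  have h2 : (Cmod h < d2) by apply (Rlt_le_trans _ _ _ hh'), Rmin_l.
  have h1 : (Cmod h < d1 / (Cmod l + 1)) by apply (Rlt_le_trans _ _ _ hh'), Rmin_r.
  have A0 := L h Dh h0. have A2 := H2 h Dh h2.
  set k := f (x + h) - f x in A0 *.
  have hk : (Cmod k < d1).
    apply: Rle_lt_trans A0 _. apply (Rmult_lt_compat_l (Cmod l + 1)) in h1; last lra.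
    replace ((Cmod l + 1) * (d1 / (Cmod l + 1)))%R with d1 in h1 by (field; lra). lra.
  have A1 := H1 k I hk.
  have -> : g (f (x + h)) = g (f x + k) by rewrite /k; f_equal; ring.
  have -> : g (f x + k) - g (f x) - m * l * h =
    (g (f x + k) - g (f x) - m * k) + m * (f (x + h) - f x - l * h) by rewrite /k; ring.
  apply: Rle_trans (Cmod_triangle _ _) _. rewrite Cmod_mult.
  have hp := Cmod_ge_0 h.
  have B1 : (e / 2 / (Cmod l + 1) * Cmod k <= e / 2 * Cmod h).
    apply (Rmult_le_compat_l (e / 2 / (Cmod l + 1))) in A0; last lra.
    replace (e / 2 / (Cmod l + 1) * ((Cmod l + 1) * Cmod h))%R with (e/2 * Cmod h)%R in A0 by (field; lra).
    lra.
  have B2 : (Cmod m * Cmod (f (x + h) - f x - l * h) <= e / 2 * Cmod h).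
    apply Rle_trans with ((Cmod m + 1) * (e / 2 / (Cmod m + 1) * Cmod h))%R.
      apply Rmult_le_compat; try lra. apply Cmod_ge_0.
    right. field. lra.
  lra.
Qed.

(** A quadratic bound on the remainder, valid on a whole disc, is the form of differentiability that
    survives summation of series. *)
Lemma cder_second (f : C -> C) (x l : C) (M d : R) :
  (0 < d) ->
  (forall h, (Cmod h < d) -> (Cmod (f (x + h) - f x - l * h) <= M * Cmod h ^ 2)) ->
  cder f x l.
Proof.
  move=> hd H e he.
  exists (Rmin d (e / (Rabs M + 1))); split.
    apply Rmin_glb_lt => //. apply Rdiv_lt_0_compat => //. have := Rabs_pos M; lra.
  move=> h _ hh. have A := H h (Rlt_le_trans _ _ _ hh (Rmin_l _ _)).
  have B := Rlt_le_trans _ _ _ hh (Rmin_r _ _).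
  have h0 := Cmod_ge_0 h. have M0 := Rabs_pos M. have M1 := Rle_abs M.
  apply (Rmult_lt_compat_l (Rabs M + 1)) in B; last lra.
  replace ((Rabs M + 1) * (e / (Rabs M + 1)))%R with e in B by (field; lra).
  apply: Rle_trans A _. nra.
Qed.

Lemma cder_sq x : cder (fun y => y * y) x (2 * x).
Proof.
  apply (cder_second _ _ _ 1 1); first lra. move=> h _.
  replace ((x + h) * (x + h) - x * x - 2 * x * h) with (h * h) by ring.
  rewrite Cmod_mult. right; ring.
Qed.

Lemma cder_scal c x : cder (fun y => c * y) x c.
Proof.
  apply (cder_second _ _ _ 1 1); first lra. move=> h _.
  replace (c * (x + h) - c * x - c * h) with (RtoC 0) by ring.
  rewrite Cmod_0. have := Cmod_ge_0 h. nra.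
Qed.

Lemma der_scal D c f x l : der D f x l -> der D (fun y => c * f y) x (c * l).
Proof. move=> F. apply (der_comp D (fun y => c * y)) => //. apply cder_scal. Qed.

Lemma der_opp D f x l : der D f x l -> der D (fun y => - f y) x (- l).
Proof.
  move=> F. apply (der_ext D (fun y => - (1) * f y) _ x (- (1) * l)); try ring.
    exists 1%R; split; [lra | move=> h _ _; ring].
  by apply der_scal.
Qed.

Lemma der_minus D f g x l m :
  der D f x l -> der D g x m -> der D (fun y => f y - g y) x (l - m).
Proof. move=> F G. by apply der_plus => //; apply der_opp. Qed.

(** Polarization: a product is a quarter of the difference of the squares of sum and difference, so
    linearity and the chain rule for the square suffice. *)
Lemma der_mult D f g x l m :
  der D f x l -> der D g x m -> der D (fun y => f y * g y) x (l * g x + f x * m).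
Proof.
  move=> F G.
  apply (der_ext D (fun y => / 4 * ((f y + g y) * (f y + g y)) - / 4 * ((f y - g y) * (f y - g y))) _ x
    (/ 4 * (2 * (f x + g x) * (l + m)) - / 4 * (2 * (f x - g x) * (l - m)))).
  - exists 1%R; split; [lra | move=> h _ _; field].
  - field.
  - field.
  - apply der_minus; apply der_scal; apply (der_comp D (fun y => y * y));
    try apply cder_sq; [by apply der_plus | by apply der_minus].
Qed.

Lemma cder_inv (x : C) : x <> 0 -> cder (fun y => / y) x (- / (x * x)).
Proof.
  move=> hx. have px := Cmod_pos _ hx.
  apply (cder_second _ _ _ (2 / Cmod x ^ 3) (Cmod x / 2)); first lra.
  move=> h hh.
  have hxh : (Cmod x / 2 <= Cmod (x + h)) by have := Cmod_add_ge x h; lra.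
  have hn : x + h <> 0 by apply Cmod_pos_neq; lra.
  replace (/ (x + h) - / x - - / (x * x) * h) with (h * h / (x * x * (x + h))) by (field; auto).
  rewrite Cmod_div; last by repeat apply Cmult_neq_0.
  rewrite !Cmod_mult.
  apply (Rmult_le_reg_r (Cmod x * Cmod x * Cmod (x + h))).
    by apply Rmult_lt_0_compat; [nra | lra].
  replace (Cmod h * Cmod h / (Cmod x * Cmod x * Cmod (x + h)) * (Cmod x * Cmod x * Cmod (x + h)))%R
    with (Cmod h * Cmod h)%R by (field; split; lra).
  replace (2 / Cmod x ^ 3 * Cmod h ^ 2 * (Cmod x * Cmod x * Cmod (x + h)))%R
   with ((Cmod h * Cmod h) * (2 * Cmod (x + h) / Cmod x))%R by (field; lra).
  have h0 := Cmod_ge_0 h.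
  have : (1 <= 2 * Cmod (x + h) / Cmod x).
    apply (Rmult_le_reg_r (Cmod x)) => //. replace (2 * Cmod (x + h) / Cmod x * Cmod x)%R with (2 * Cmod (x+h))%R by (field; lra). lra.
  nra.
Qed.

Lemma der_inv D f x l : der D f x l -> f x <> 0 -> der D (fun y => / f y) x (- l / (f x * f x)).
Proof.
  move=> F hx.
  replace (- l / (f x * f x)) with (- / (f x * f x) * l) by (field; auto).
  apply (der_comp D (fun y => / y)) => //. by apply cder_inv.
Qed.

Lemma der_div D f g x l m : der D f x l -> der D g x m -> g x <> 0 ->
  der D (fun y => f y / g y) x ((l * g x - f x * m) / (g x * g x)).
Proof.
  move=> F G hx.
  replace ((l * g x - f x * m) / (g x * g x)) with (l * / g x + f x * (- m / (g x * g x))) by (field; auto).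
  apply (der_mult D f (fun y => / g y)) => //. by apply der_inv.
Qed.

Lemma der_pow D f x l n : der D f x l ->
  der D (fun y => f y ^ n) x (INR n * f x ^ (pred n) * l).
Proof.
  move=> F. elim: n => [|n IH].
    replace (INR 0 * f x ^ (pred 0) * l) with (RtoC 0) by (rewrite /Re /=; ring). apply (der_const D 1).
  replace (INR (S n) * f x ^ (pred (S n)) * l) with (l * f x ^ n + f x * (INR n * f x ^ (pred n) * l)).
    by apply (der_mult D f (fun y => f y ^ n)).
  rewrite S_INR RtoC_plus. simpl pred. case: n IH => [|n] _; simpl; ring.
Qed.

Lemma cder_eq f x l l' : l = l' -> cder f x l -> cder f x l'.
Proof. by move=> <-. Qed.

Lemma rder_eq f x l l' : l = l' -> rder f x l -> rder f x l'.
Proof. by move=> <-. Qed.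

Lemma cder_local f g x l : (exists d, (0 < d) /\ forall y, (Cmod (y - x) < d) -> f y = g y) ->
  cder f x l -> cder g x l.
Proof.
  move=> [d [hd E]]. apply der_ext => //.
    exists d; split => // h _ hh. apply E. by replace (x + h - x) with h by ring.
  apply E. replace (x - x) with (RtoC 0) by ring. by rewrite Cmod_0.
Qed.

Lemma rder_local f g x l : (exists d, (0 < d) /\ forall y, (Rabs (y - x) < d) -> f y = g y) ->
  rder f x l -> rder g x l.
Proof.
  move=> [d [hd E]]. apply der_ext => //.
    exists d; split => // h Ih hh. apply E.
    replace (Re (x + h) - x)%R with (Re h) by (rewrite /Re /=; ring). apply: Rle_lt_trans hh. apply re_le_Cmod.
  apply E. replace (Re x - x)%R with 0%R by (rewrite /Re /=; ring). by rewrite Rabs_R0.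
Qed.

Lemma cder_contc f x l : cder f x l -> contc f x.
Proof.
  move=> F e he. have [d [hd H]] := der_lip _ _ _ _ F.
  have l0 := Cmod_ge_0 l.
  exists (Rmin d (e / (Cmod l + 1))); split.
    apply Rmin_glb_lt => //. apply Rdiv_lt_0_compat; lra.
  move=> y hy. have A := H (y - x) I (Rlt_le_trans _ _ _ hy (Rmin_l _ _)).
  replace (x + (y - x)) with y in A by ring.
  have B := Rlt_le_trans _ _ _ hy (Rmin_r _ _).
  apply (Rmult_lt_compat_l (Cmod l + 1)) in B; last lra.
  replace ((Cmod l + 1) * (e / (Cmod l + 1)))%R with e in B by (field; lra). lra.
Qed.

Lemma rder_contr f t l : rder f t l -> contr f t.
Proof.
  move=> F e he. have [d [hd H]] := der_lip _ _ _ _ F.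
  have l0 := Cmod_ge_0 l.
  exists (Rmin d (e / (Cmod l + 1))); split.
    apply Rmin_glb_lt => //. apply Rdiv_lt_0_compat; lra.
  move=> s hs.
  have E : Cmod (RtoC (s - t)) = Rabs (s - t) by apply Cmod_R.
  have A := H (RtoC (s - t)) (im_RtoC _). rewrite E in A.
  have A1 := A (Rlt_le_trans _ _ _ hs (Rmin_l _ _)).
  replace (Re (t + (s - t)%R)) with s in A1 by (rewrite /Re /=; ring).
  replace (Re t) with t in A1 by done.
  have B := Rlt_le_trans _ _ _ hs (Rmin_r _ _).
  apply (Rmult_lt_compat_l (Cmod l + 1)) in B; last lra.
  replace ((Cmod l + 1) * (e / (Cmod l + 1)))%R with e in B by (field; lra). lra.
Qed.

Lemma contc_contr_comp g w t : contc g (w t) -> contr w t -> contr (fun s => g (w s)) t.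
Proof.
  move=> G W e he. have [d [hd H]] := G e he. have [d' [hd' H']] := W d hd.
  exists d'; split => // s hs. apply H. by apply H'.
Qed.

Lemma rder_comp g w t l m : cder g (w t) m -> rder w t l -> rder (fun s => g (w s)) t (m * l).
Proof. move=> G W. by apply (der_comp _ g (fun z => w (Re z))). Qed.

Lemma rder_line (x h : C) (t : R) : rder (fun s => x + s * h) t h.
Proof.
  apply (der_ext _ (fun z => x + h * z) _ _ (0 + h * 1)); try ring.
  - exists 1%R; split; first lra. move=> k Ik _.
    suff -> : RtoC t + k = RtoC (Re (t + k)) by simpl; ring.
    apply injective_projections => //. by rewrite /= -/(Im k) Ik Rplus_0_r.
  - simpl; ring.
  - apply der_plus; [apply der_const | apply der_scal, der_id].
Qed.

Lemma filterdiff_eps (f : R -> R) (t l : R) :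
  (forall e, (0 < e) -> exists d, (0 < d) /\ forall h, (Rabs h < d) ->
    (Rabs (f (t + h)%R - f t - l * h) <= e * Rabs h)) -> is_derive f t l.
Proof.
  move=> H. apply is_derive_Reals => e he.
  have he2 : (0 < e / 2) by lra.
  have [d [hd A]] := H _ he2. exists (mkposreal d hd) => h hn hh.
  have := A h hh. have ph : (0 < Rabs h) by apply Rabs_pos_lt.
  move=> B. replace ((f (t + h) - f t) / h - l)%R with ((f (t + h) - f t - l * h) / h)%R by (field; auto).
  rewrite Rabs_div //. apply (Rmult_lt_reg_r (Rabs h)) => //.
  rewrite /Rdiv Rmult_assoc Rinv_l; last lra. nra.
Qed.

Lemma rder_Re f t l : rder f t l -> is_derive (fun s => Re (f s)) t (Re l).
Proof.
  move=> F. apply filterdiff_eps => e he. have [d [hd H]] := F e he.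
  exists d; split => // h hh.
  have := H (RtoC h) (im_RtoC h). rewrite Cmod_R => A0. have A := A0 hh.
  apply: Rle_trans A. apply: Rle_trans (re_le_Cmod _).
  right. f_equal. rewrite /Re /=. ring.
Qed.

Lemma rder_Im f t l : rder f t l -> is_derive (fun s => Im (f s)) t (Im l).
Proof.
  move=> F. apply filterdiff_eps => e he. have [d [hd H]] := F e he.
  exists d; split => // h hh.
  have := H (RtoC h) (im_RtoC h). rewrite Cmod_R => A0. have A := A0 hh.
  apply: Rle_trans A. apply: Rle_trans (im_le_Cmod _).
  right. f_equal. rewrite /Re /Im /=. ring.
Qed.

Lemma rder_of_real f t l : is_derive f t l -> rder (fun s => RtoC (f s)) t (RtoC l).
Proof.
  move=> /is_derive_Reals F e he. have [d H] := F e he.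
  exists d; split; first by apply cond_pos. move=> h Ih hh.
  have Eh : h = RtoC (Re h) by apply injective_projections.
  rewrite Eh. rewrite Eh Cmod_R in hh. rewrite Cmod_R.
  have -> : RtoC (f (Re (t + Re h))) - f (Re t) - l * RtoC (Re h) = RtoC (f (t + Re h)%R - f t - l * Re h).
    by rewrite !RtoC_minus RtoC_mult.
  rewrite Cmod_R.
  case: (Req_dec (Re h) 0) => hn.
    rewrite hn. replace (f (t + 0) - f t - l * 0)%R with 0%R by (rewrite Rplus_0_r; ring). rewrite Rabs_R0. lra.
  have A := H _ hn hh.
  replace (f (t + Re h) - f t - l * Re h)%R with (((f (t + Re h) - f t) / Re h - l) * Re h)%R by (field; auto).
  rewrite Rabs_mult. apply Rmult_le_compat_r; [apply Rabs_pos | lra].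
Qed.

Lemma zero_derive_const (f : R -> R) (a b : R) :
  (forall t, (a <= t <= b) -> is_derive f t 0%R) -> (a <= b) -> f a = f b.
Proof.
  move=> H hab.
  case: (MVT_gen f a b (fun _ => 0%R)).
  - move=> x. rewrite Rmin_left // Rmax_right // => hx. apply H; lra.
  - move=> x. rewrite Rmin_left // Rmax_right // => hx.
    apply continuity_pt_filterlim. apply: ex_derive_continuous. exists 0%R. by apply H.
  - move=> c [_ E]. lra.
Qed.

Lemma rder_zero_const f a b :
  (forall t, (a <= t <= b) -> rder f t 0) -> (a <= b) -> f a = f b.
Proof.
  move=> H hab. apply injective_projections.
  - apply (zero_derive_const (fun s => Re (f s)) a b) => // t ht. apply (rder_Re f t 0). by apply H.
  - apply (zero_derive_const (fun s => Im (f s)) a b) => // t ht. apply (rder_Im f t 0). by apply H.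
Qed.

Definition convex (D : C -> Prop) : Prop :=
  forall x y (t : R), D x -> D y -> (0 <= t <= 1) -> D (x + t * (y - x)).

Lemma cder_zero_const D f x y : convex D -> (forall z, D z -> cder f z 0) -> D x -> D y -> f x = f y.
Proof.
  move=> cv H Dx Dy.
  have := rder_zero_const (fun t => f (x + t * (y - x))) 0 1 _ Rle_0_1.
  replace (x + 0%R * (y - x)) with x by ring.
  replace (x + 1%R * (y - x)) with y by ring. apply.
  move=> t ht. apply (rder_eq _ _ (0 * (y - x))); first ring.
  apply (rder_comp f (fun t => x + t * (y - x))); last apply rder_line.
  apply H. by apply cv.
Qed.

Lemma convex_ball (x : C) (r : R) : convex (fun y => (Cmod (y - x) < r)).
Proof.
  move=> y z t hy hz ht.
  replace (y + t * (z - y) - x) with ((1 - t)%R * (y - x) + t * (z - x)) by (rewrite RtoC_minus; ring).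
  apply: Rle_lt_trans (Cmod_triangle _ _) _. rewrite !Cmod_mult !Cmod_R.
  rewrite (Rabs_pos_eq t); last lra. rewrite Rabs_pos_eq; last lra.
  case: (Req_dec t 0) => h0; first (rewrite h0; lra).
  have : (t * Cmod (z - x) < t * r) by apply Rmult_lt_compat_l; lra.
  have : ((1 - t) * Cmod (y - x) <= (1 - t) * r) by apply Rmult_le_compat_l; lra.
  lra.
Qed.

Lemma convex_upper : convex upper_half_plane.
Proof.
  move=> x y t. rewrite /upper_half_plane /= => hx hy ht.
  rewrite -/(Im x) -/(Im y). ring_simplify.
  case: (Req_dec t 0) => h0; first (rewrite h0; lra).
  move: (Im x) (Im y) hx hy => a b hx hy.
  rewrite /Im in hx hy *. nra.
Qed.

Lemma locally_C_eps (x : C) (P : C -> Prop) :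
  locally x P <-> exists d, (0 < d) /\ forall y, (Cmod (y - x) < d) -> P y.
Proof.
  split.
  - move=> [d H]. exists d; split; first by apply cond_pos. move=> y hy. apply H.
    by apply C_NormedModule_mixin_compat1.
  - move=> [d [hd H]].
    have h2 : (0 < sqrt 2) by apply sqrt_lt_R0; lra.
    have hd' : (0 < d / sqrt 2) by apply Rdiv_lt_0_compat.
    exists (mkposreal _ hd') => y hy. apply H.
    have := C_NormedModule_mixin_compat2 x y (mkposreal _ hd') hy. simpl.
    replace (sqrt 2 * (d / sqrt 2))%R with d by (field; lra). done.
Qed.

Lemma cder_is_derive f x l : cder f x l <-> @is_derive C_AbsRing C_NormedModule f x l.
Proof.
  split.
  - move=> H. split.
      apply is_linear_scal_l.
    move=> y hy e. have <- : x = y by apply (@is_filter_lim_locally_unique C_AbsRing (AbsRing_NormedModule C_AbsRing) x y).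
    have [d [hd A]] := H e (cond_pos e).
    apply/locally_C. apply locally_C_eps. exists d; split => // z hz.
    have := A (z - x) I hz. replace (x + (z - x)) with z by ring.
    have -> : @minus _ (@minus _ (f z) (f x)) (@scal _ C_NormedModule (@minus _ z x) l) = f z - f x - l * (z - x).
      rewrite /minus /plus /opp /scal /= /mult /=. ring.
    done.
  - move=> [_ H] e he.
    have := H x (fun P h => h) (mkposreal e he).
    move=> /locally_C /locally_C_eps [d [hd A]]. exists d; split => // h _ hh.
    have := A (x + h). replace (x + h - x) with h by ring. move=> B0. have B := B0 hh.
    have E : @minus _ (@minus _ (f (x + h)) (f x)) (@scal _ C_NormedModule (@minus _ (x + h) x) l) = f (x + h) - f x - l * h.
      rewrite /minus /plus /opp /scal /= /mult /=. ring.
    rewrite E in B.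
    have E2 : @minus C_AbsRing (x + h) x = h by rewrite /minus /plus /opp /=; ring.
    rewrite E2 in B. exact B.
Qed.

Lemma cder_C_derive f x l : cder f x l -> C_derive f x = l.
Proof. move=> /cder_is_derive. apply is_C_derive_unique. Qed.

Lemma cder_unique f x l m : cder f x l -> cder f x m -> l = m.
Proof. by move=> /cder_C_derive <- /cder_C_derive. Qed.

(** The supremum of the points up to which [P] holds is itself such a point by the closedness
    hypothesis, and the openness hypothesis forbids it to lie below [b]. Arguments along paths use
    this as connectedness of the interval. *)
Lemma real_induction (P : R -> Prop) (a b : R) : (a <= b) -> P a ->
  (forall t, (a <= t < b) -> (forall s, (a <= s <= t) -> P s) ->
     exists d, (0 < d) /\ forall s, (t <= s < t + d) -> (s <= b) -> P s) ->
  (forall t, (a < t <= b) -> (forall s, (a <= s < t) -> P s) -> P t) ->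
  forall t, (a <= t <= b) -> P t.
Proof.
  move=> hab Pa Hopen Hclosed.
  pose E := fun t => (a <= t <= b) /\ forall s, (a <= s <= t) -> P s.
  have Ea : E a by split; [lra | move=> s hs; replace s with a by lra].
  have bE : bound E by exists b => t [ht _]; lra.
  have [m [ub lub]] := completeness E bE (ex_intro _ a Ea).
  have am : (a <= m) by apply ub.
  have mb : (m <= b) by apply lub => t [ht _]; lra.
  have below : forall s, (a <= s < m) -> P s.
    move=> s hs. apply NNPP => nP.
    have : (m <= s).
      apply lub => t [ht Pt]. apply Rnot_lt_le => hst. apply nP, Pt. lra.
    lra.
  have Pm : P m.
    case: (Req_dec a m) => [<-//|hne]. apply Hclosed => //. lra.
  have Em : forall s, (a <= s <= m) -> P s.
    move=> s hs. case: (Req_dec s m) => [->//|hne]. apply below. lra.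
  case: (Rle_lt_or_eq_dec _ _ mb) => [hm|<-]; last by [].
  have [d [hd H]] := Hopen m (conj am hm) Em.
  exfalso.
  pose s := Rmin b (m + d / 2).
  have hs : (m < s) by apply Rmin_glb_lt; lra.
  have : (s <= m).
    apply ub. split.
      split; [lra | apply Rmin_l].
    move=> r hr. case: (Rle_lt_dec r m) => h; first by apply Em; lra.
    have h1 : (s <= b) by apply Rmin_l. have h2 : (s <= m + d/2) by apply Rmin_r.
    apply H; lra.
  lra.
Qed.

(** The function E exp (- K t) starts at zero, is nonnegative and does not increase. *)
Lemma gronwall_zero (E E' : R -> R) (a b K : R) :
  (forall t, (a < t < b) -> is_derive E t (E' t) /\ (E' t <= K * E t)) ->
  (forall t, (a <= t < b) -> continuity_pt E t) ->
  E a = 0%R -> (forall t, (a <= t < b) -> (0 <= E t)) ->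
  forall t, (a <= t < b) -> E t = 0%R.
Proof.
  move=> HD HC Ea Epos t ht.
  case: (Req_dec a t) => [<-//|hne].
  pose G := fun s => (E s * exp (- K * s))%R.
  (* The mean value theorem may return the endpoint [a], where no derivative is assumed; the default
     value 0 keeps the inequality used there. *)
  pose dG := fun s => match Rlt_dec a s, Rlt_dec s b with
    | left _, left _ => ((E' s - K * E s) * exp (- K * s))%R | _, _ => 0%R end.
  case: (MVT_gen G a t dG).
  - move=> x. rewrite Rmin_left ?Rmax_right; try lra. move=> hx.
    rewrite /dG. case: Rlt_dec => h1; last lra. case: Rlt_dec => h2; last lra.
    have [D _] := HD x (conj h1 h2).
    rewrite /G.
    have De : is_derive (fun s => exp (- K * s)) x (- K * exp (- K * x))%R.
      auto_derive => //. ring.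
    have := @is_derive_mult R_AbsRing _ _ _ _ _ D De Rmult_comm.
    rewrite /mult /plus /=. by replace ((E' x * exp (- K * x)) + E x * (- K * exp (- K * x)))%R with ((E' x - K * E x) * exp (- K * x))%R by ring.
  - move=> x. rewrite Rmin_left ?Rmax_right; try lra. move=> hx.
    apply continuity_pt_mult; first by apply HC; lra.
    apply continuity_pt_filterlim. apply: (@ex_derive_continuous R_AbsRing R_NormedModule (fun s => exp (- K * s))). by auto_derive.
  - move=> c [hc Ec]. rewrite Rmin_left ?Rmax_right in hc; try lra.
    have : (dG c <= 0).
      rewrite /dG. case: Rlt_dec => h1; last lra. case: Rlt_dec => h2; last lra.
      have [_ D] := HD c (conj h1 h2). have := exp_pos (- K * c). nra.
    move=> hG.
    have : (G t <= 0).
      have -> : G t = (G a + dG c * (t - a))%R by lra.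
      rewrite {1}/G Ea. nra.
    rewrite /G. have := exp_pos (- K * t). have := Epos t ht. nra.
Qed.

Lemma rder_const c t : rder (fun _ => c) t 0.
Proof. exact (der_const _ c (RtoC t)). Qed.

Lemma rder_plus f g t l m : rder f t l -> rder g t m -> rder (fun s => f s + g s) t (l + m).
Proof. apply (der_plus _ (fun z => f (Re z)) (fun z => g (Re z))). Qed.

Lemma rder_minus f g t l m : rder f t l -> rder g t m -> rder (fun s => f s - g s) t (l - m).
Proof. apply (der_minus _ (fun z => f (Re z)) (fun z => g (Re z))). Qed.

Lemma rder_scal c f t l : rder f t l -> rder (fun s => c * f s) t (c * l).
Proof. apply (der_scal _ c (fun z => f (Re z))). Qed.

Lemma rder_mult f g t l m : rder f t l -> rder g t m -> rder (fun s => f s * g s) t (l * g t + f t * m).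
Proof. apply (der_mult _ (fun z => f (Re z)) (fun z => g (Re z))). Qed.

Lemma rder_div f g t l m : rder f t l -> rder g t m -> g t <> 0 ->
  rder (fun s => f s / g s) t ((l * g t - f t * m) / (g t * g t)).
Proof. apply (der_div _ (fun z => f (Re z)) (fun z => g (Re z))). Qed.

Lemma rder_pow f t l n : rder f t l -> rder (fun s => f s ^ n) t (INR n * f t ^ (pred n) * l).
Proof. apply (der_pow _ (fun z => f (Re z))). Qed.

Lemma cder_comp g f x l m : cder g (f x) m -> cder f x l -> cder (fun y => g (f y)) x (m * l).
Proof. apply der_comp. Qed.

Lemma cder_const c x : cder (fun _ => c) x 0.
Proof. exact (der_const _ c x). Qed.

Lemma cder_id x : cder (fun y => y) x 1.
Proof. apply der_id. Qed.

Lemma cder_plus f g x l m : cder f x l -> cder g x m -> cder (fun y => f y + g y) x (l + m).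
Proof. apply der_plus. Qed.

Lemma cder_minus f g x l m : cder f x l -> cder g x m -> cder (fun y => f y - g y) x (l - m).
Proof. apply der_minus. Qed.

Lemma cder_mult f g x l m : cder f x l -> cder g x m -> cder (fun y => f y * g y) x (l * g x + f x * m).
Proof. apply der_mult. Qed.

Lemma cder_scalf c f x l : cder f x l -> cder (fun y => c * f y) x (c * l).
Proof. apply der_scal. Qed.

Lemma cder_div f g x l m : cder f x l -> cder g x m -> g x <> 0 ->
  cder (fun y => f y / g y) x ((l * g x - f x * m) / (g x * g x)).
Proof. apply der_div. Qed.

Lemma cder_pow f x l n : cder f x l -> cder (fun y => f y ^ n) x (INR n * f x ^ (pred n) * l).
Proof. apply der_pow. Qed.

(** * Unconditional sums over an arbitrary index type *)

Definition lsum {A : Type} (f : A -> C) (l : list A) : C :=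
  fold_right (fun a s => f a + s) 0 l.

Definition rsum {A : Type} (g : A -> R) (l : list A) : R :=
  fold_right (fun a s => (g a + s)%R) 0%R l.

Definition Rsummable {A : Type} (g : A -> R) : Prop :=
  exists B : R, forall l, NoDup l -> rsum g l <= B.

Definition summable {A : Type} (f : A -> C) : Prop := Rsummable (fun a => Cmod (f a)).

(** Convergence along the net of duplicate-free finite lists. No order on the index type enters, so
    reindexing by bijections and passing to products of index types is easy. *)
Definition has_sum {A : Type} (f : A -> C) (s : C) : Prop :=
  forall e : R, 0 < e -> exists l0, forall l, NoDup l -> incl l0 l -> Cmod (lsum f l - s) < e.

(** Total by choice; the value is meaningful only when a sum exists, which [summable] guarantees. *)
Definition tsum {A : Type} (f : A -> C) : C := epsilon (inhabits (RtoC 0)) (has_sum f).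

Definition eqd {A : Type} (x y : A) : {x = y} + {x <> y} := excluded_middle_informative (x = y).

Lemma nodup_cover {A : Type} (l0 : list A) : NoDup (nodup eqd l0) /\ incl l0 (nodup eqd l0).
Proof. split; [apply NoDup_nodup | move=> a; apply nodup_In]. Qed.

Section Lists.
Context {A : Type}.
Implicit Types (f : A -> C) (g : A -> R) (l : list A).

Lemma lsum_app f l l' : lsum f (l ++ l') = lsum f l + lsum f l'.
Proof. elim: l => [|a l IH] /=; first by ring. rewrite IH. ring. Qed.

Lemma rsum_app g l l' : rsum g (l ++ l') = (rsum g l + rsum g l')%R.
Proof. elim: l => [|a l IH] /=; first by ring. rewrite IH. ring. Qed.

Lemma lsum_plus f f' l : lsum (fun a => f a + f' a) l = lsum f l + lsum f' l.
Proof. elim: l => [|a l IH] /=; first by ring. rewrite IH. ring. Qed.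

Lemma lsum_scal c f l : lsum (fun a => c * f a) l = c * lsum f l.
Proof. elim: l => [|a l IH] /=; first by ring. rewrite IH. ring. Qed.

Lemma rsum_scal c g l : rsum (fun a => (c * g a)%R) l = (c * rsum g l)%R.
Proof. elim: l => [|a l IH] /=; first by ring. rewrite IH. ring. Qed.

Lemma rsum_plus g g' l : rsum (fun a => (g a + g' a)%R) l = (rsum g l + rsum g' l)%R.
Proof. elim: l => [|a l IH] /=; first by ring. rewrite IH. ring. Qed.

Lemma lsum_ext f f' l : (forall a, In a l -> f a = f' a) -> lsum f l = lsum f' l.
Proof.
  elim: l => [//|a l IH] H /=. rewrite IH; last by move=> b hb; apply H; right.
  by rewrite (H a) //; left.
Qed.

Lemma rsum_le g g' l : (forall a, In a l -> g a <= g' a) -> rsum g l <= rsum g' l.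
Proof.
  elim: l => [|a l IH] H /=; first by right.
  apply Rplus_le_compat; first by apply H; left. apply IH => b hb. apply H; by right.
Qed.

Lemma rsum_ge0 g l : (forall a, 0 <= g a) -> 0 <= rsum g l.
Proof. move=> H. elim: l => [|a l IH] /=; first by right. have := H a. lra. Qed.

Lemma Cmod_lsum_le f l : Cmod (lsum f l) <= rsum (fun a => Cmod (f a)) l.
Proof.
  elim: l => [|a l IH] /=; first by rewrite Cmod_0; right.
  have := Cmod_triangle (f a) (lsum f l). lra.
Qed.

Lemma rsum_RtoC g l : lsum (fun a => RtoC (g a)) l = RtoC (rsum g l).
Proof. elim: l => [//|a l IH] /=. by rewrite IH RtoC_plus. Qed.

Lemma lsum_perm f l l' : Permutation l l' -> lsum f l = lsum f l'.
Proof.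
  elim => [//|x m m' _ IH|x y m|m1 m2 m3 _ -> _ ->//] /=; first by rewrite IH. ring.
Qed.

Lemma rsum_incl g l l' : (forall a, 0 <= g a) -> NoDup l -> incl l l' -> rsum g l <= rsum g l'.
Proof.
  move=> g0. elim: l l' => [|a l IH] l' nd H /=; first by apply rsum_ge0.
  have [l1 [l2 E]] := in_split a l' (H a (or_introl eq_refl)).
  inversion nd as [|? ? na nd']; subst.
  have : rsum g l <= rsum g (l1 ++ l2).
    apply IH => // b hb. have := H b (or_intror hb). rewrite !in_app_iff /=.
    case; [by left | case; [move=> eab; by subst | by right]].
  rewrite !rsum_app /=. lra.
Qed.

Lemma lsum_split f l0 l : NoDup l0 -> NoDup l -> incl l0 l ->
  exists l1, NoDup l1 /\ (forall a, In a l1 -> In a l /\ ~ In a l0) /\ lsum f l = lsum f l0 + lsum f l1.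
Proof.
  move=> n0 n H.
  pose P := fun a => if excluded_middle_informative (In a l0) is left _ then false else true.
  exists (filter P l). split; first by apply NoDup_filter. split.
    move=> a /filter_In [h1]. rewrite /P. by case: excluded_middle_informative.
  rewrite -lsum_app. apply lsum_perm. apply NoDup_Permutation => //.
    apply NoDup_app => //; first by apply NoDup_filter.
    move=> a ha /filter_In [_]. rewrite /P. by case: excluded_middle_informative.
  move=> a. rewrite in_app_iff filter_In /P. case: excluded_middle_informative => h; split; try tauto.
  by move=> _; apply H.
Qed.

Lemma has_sum_ext f f' s : (forall a, f a = f' a) -> has_sum f s -> has_sum f' s.
Proof. move=> E. by have -> : f = f' by apply functional_extensionality. Qed.

Lemma has_sum_unique f s s' : has_sum f s -> has_sum f s' -> s = s'.
Proof.
  move=> H H'. apply Cmod_small_eq => e he.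
  have he2 : 0 < e / 2 by lra.
  have [l0 h0] := H _ he2. have [l1 h1] := H' _ he2.
  have [nd inc] := nodup_cover (l0 ++ l1).
  have A0 := h0 _ nd (fun a h => inc a (in_or_app _ _ _ (or_introl h))).
  have A1 := h1 _ nd (fun a h => inc a (in_or_app _ _ _ (or_intror h))).
  rewrite Cmod_minus_sym in A0.
  have := Cmod_dist s (lsum f (nodup eqd (l0 ++ l1))) s'. lra.
Qed.

Lemma has_sum_plus f f' s s' : has_sum f s -> has_sum f' s' -> has_sum (fun a => f a + f' a) (s + s').
Proof.
  move=> H H' e he. have he2 : 0 < e / 2 by lra.
  have [l0 h0] := H _ he2. have [l1 h1] := H' _ he2.
  exists (l0 ++ l1) => l nd inc.
  have A0 := h0 _ nd (fun a h => inc a (in_or_app _ _ _ (or_introl h))).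
  have A1 := h1 _ nd (fun a h => inc a (in_or_app _ _ _ (or_intror h))).
  rewrite lsum_plus.
  replace (lsum f l + lsum f' l - (s + s')) with ((lsum f l - s) + (lsum f' l - s')) by ring.
  have := Cmod_triangle (lsum f l - s) (lsum f' l - s'). lra.
Qed.

Lemma has_sum_scal c f s : has_sum f s -> has_sum (fun a => c * f a) (c * s).
Proof.
  move=> H e he. have c0 := Cmod_ge_0 c.
  have [|l0 h0] := H (e / (Cmod c + 1))%R; first by apply Rdiv_lt_0_compat; lra.
  exists l0 => l nd inc. have Q := h0 l nd inc.
  rewrite lsum_scal. replace (c * lsum f l - c * s) with (c * (lsum f l - s)) by ring.
  rewrite Cmod_mult. have B := Cmod_ge_0 (lsum f l - s).
  apply (Rmult_lt_compat_l (Cmod c + 1)) in Q; last lra.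
  replace ((Cmod c + 1) * (e / (Cmod c + 1)))%R with e in Q by (field; lra). move: (Cmod c) (Cmod (lsum f l - s)) c0 B Q => u v h1 h2 h3. nra.
Qed.

Lemma has_sum_minus f f' s s' : has_sum f s -> has_sum f' s' -> has_sum (fun a => f a - f' a) (s - s').
Proof.
  move=> H H'. have := has_sum_plus _ _ _ _ H (has_sum_scal (- (1)) _ _ H').
  replace (s + - (1) * s') with (s - s') by ring.
  apply has_sum_ext => a. ring.
Qed.

Lemma has_sum_zero : has_sum (fun _ : A => RtoC 0) 0.
Proof.
  move=> e he. exists nil => l _ _.
  have -> : lsum (fun _ : A => RtoC 0) l = 0 by elim: l => [//|a l IH] /=; rewrite IH; ring.
  replace (0 - 0) with (RtoC 0) by ring. by rewrite Cmod_0.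
Qed.

Lemma has_sum_Cmod_le f s B : has_sum f s -> (forall l, NoDup l -> rsum (fun a => Cmod (f a)) l <= B) -> Cmod s <= B.
Proof.
  move=> H hB. apply le_epsilon => e he.
  have [l0 h0] := H _ he. have [nd inc] := nodup_cover l0.
  have Q := h0 _ nd inc. have := hB _ nd. have := Cmod_lsum_le f (nodup eqd l0).
  rewrite Cmod_minus_sym in Q. have := Cmod_sub_ge s (lsum f (nodup eqd l0)). lra.
Qed.

Lemma has_sum_nonneg g : (forall a, 0 <= g a) -> Rsummable g -> exists s, has_sum (fun a => RtoC (g a)) s.
Proof.
  move=> g0 [B hB].
  have [|s [ub lub]] := completeness (fun r => exists l, NoDup l /\ r = rsum g l) _ (ex_intro _ 0%R (ex_intro _ nil (conj (NoDup_nil _) eq_refl))).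
    exists B => r [l [nd ->]]. by apply hB.
  exists (RtoC s) => e he.
  have [l0 [nd0 h0]] : exists l0, NoDup l0 /\ s - e < rsum g l0.
    apply NNPP => n.
    have : s <= s - e.
      apply lub => r [l [nd ->]]. apply Rnot_lt_le => h. apply n. by exists l.
    lra.
  exists l0 => l nd inc.
  rewrite rsum_RtoC -RtoC_minus Cmod_R.
  have Q := rsum_incl g l0 l g0 nd0 inc.
  have := ub _ (ex_intro _ l (conj nd eq_refl)). move=> A2.
  rewrite Rabs_left1; lra.
Qed.

Lemma Rsummable_le g g' : (forall a, g a <= g' a) -> Rsummable g' -> Rsummable g.
Proof.
  move=> H [B hB]. exists B => l nd. apply: Rle_trans (hB l nd). by apply rsum_le.
Qed.

Lemma Rsummable_scal c g : 0 <= c -> Rsummable g -> Rsummable (fun a => (c * g a)%R).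
Proof.
  move=> hc [B hB]. exists (c * B)%R => l nd. rewrite rsum_scal. apply Rmult_le_compat_l => //. by apply hB.
Qed.

Lemma Rsummable_plus g g' : Rsummable g -> Rsummable g' -> Rsummable (fun a => (g a + g' a)%R).
Proof.
  move=> [B hB] [B' hB']. exists (B + B')%R => l nd. rewrite rsum_plus.
  apply Rplus_le_compat; [by apply hB | by apply hB'].
Qed.

Lemma summable_le f g : (forall a, Cmod (f a) <= g a) -> Rsummable g -> summable f.
Proof. apply Rsummable_le. Qed.

Lemma summable_plus f f' : summable f -> summable f' -> summable (fun a => f a + f' a).
Proof.
  move=> H H'. apply (summable_le _ (fun a => (Cmod (f a) + Cmod (f' a))%R)).
    move=> a; apply Cmod_triangle. by apply Rsummable_plus.
Qed.

Lemma summable_scal c f : summable f -> summable (fun a => c * f a).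
Proof.
  move=> H. apply (summable_le _ (fun a => (Cmod c * Cmod (f a))%R)).
    move=> a; rewrite Cmod_mult; by right. apply Rsummable_scal => //. apply Cmod_ge_0.
Qed.

Lemma summable_ext f f' : (forall a, f a = f' a) -> summable f -> summable f'.
Proof. move=> E. by have -> : f = f' by apply functional_extensionality. Qed.

Lemma summable_minus f f' : summable f -> summable f' -> summable (fun a => f a - f' a).
Proof.
  move=> H H'. apply (summable_ext (fun a => f a + - (1) * f' a)); first by move=> a; ring.
  apply summable_plus => //. by apply summable_scal.
Qed.

(** A real family p dominated by |f| is the difference of the nonnegative families |p| + p and |p|,
    whose finite sums are bounded; this is applied to real and imaginary parts. *)
Lemma summable_has_sum f : summable f -> exists s, has_sum f s.
Proof.
  move=> H.
  have P : forall p : A -> R, (forall a, Rabs (p a) <= Cmod (f a)) -> exists s, has_sum (fun a => RtoC (p a)) s.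
    move=> p hp.
    have [s1 h1] : exists s, has_sum (fun a => RtoC (Rabs (p a))) s.
      apply has_sum_nonneg; first by move=> a; apply Rabs_pos. by apply: Rsummable_le H.
    have [s2 h2] : exists s, has_sum (fun a => RtoC (Rabs (p a) + p a)) s.
      apply has_sum_nonneg; first by move=> a; have := Rle_abs (- p a); rewrite Rabs_Ropp; lra.
      apply: Rsummable_le (Rsummable_scal 2 _ _ H); last lra.
      move=> a. have := hp a. have := Rle_abs (p a). simpl. lra.
    exists (s2 - s1). apply: has_sum_ext (has_sum_minus _ _ _ _ h2 h1) => a.
    rewrite RtoC_plus. ring.
  have [s1 h1] := P (fun a => Re (f a)) (fun a => re_le_Cmod _).
  have [s2 h2] := P (fun a => Im (f a)) (fun a => im_le_Cmod _).
  exists (s1 + Ci * s2). apply: has_sum_ext (has_sum_plus _ _ _ _ h1 (has_sum_scal Ci _ _ h2)) => a.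
  apply injective_projections; rewrite /= /Re /Im; ring.
Qed.

Lemma tsum_correct f : summable f -> has_sum f (tsum f).
Proof. move=> H. exact (epsilon_spec _ _ (summable_has_sum f H)). Qed.

Lemma has_sum_tsum f s : has_sum f s -> tsum f = s.
Proof.
  move=> H. apply (has_sum_unique f) => //. exact (epsilon_spec _ _ (ex_intro _ s H)).
Qed.

Lemma tsum_ext f f' : (forall a, f a = f' a) -> tsum f = tsum f'.
Proof. move=> E. by have -> : f = f' by apply functional_extensionality. Qed.

Lemma tsum_plus f f' : summable f -> summable f' -> tsum (fun a => f a + f' a) = tsum f + tsum f'.
Proof. move=> H H'. apply has_sum_tsum, has_sum_plus; by apply tsum_correct. Qed.

Lemma tsum_minus f f' : summable f -> summable f' -> tsum (fun a => f a - f' a) = tsum f - tsum f'.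
Proof. move=> H H'. apply has_sum_tsum, has_sum_minus; by apply tsum_correct. Qed.

Lemma tsum_scal c f : summable f -> tsum (fun a => c * f a) = c * tsum f.
Proof. move=> H. by apply has_sum_tsum, has_sum_scal, tsum_correct. Qed.

Lemma tsum_Cmod_le f B : summable f -> (forall l, NoDup l -> rsum (fun a => Cmod (f a)) l <= B) -> Cmod (tsum f) <= B.
Proof. move=> H. by apply has_sum_Cmod_le, tsum_correct. Qed.

Lemma Rsummable_tail g : (forall a, 0 <= g a) -> Rsummable g -> forall e, 0 < e -> exists l0, NoDup l0 /\
  forall l, NoDup l -> (forall a, In a l -> ~ In a l0) -> rsum g l < e.
Proof.
  move=> g0 [B hB] e he.
  have [|s [ub lub]] := completeness (fun r => exists l, NoDup l /\ r = rsum g l) _ (ex_intro _ 0%R (ex_intro _ nil (conj (NoDup_nil _) eq_refl))).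
    exists B => r [l [nd ->]]. by apply hB.
  have [l0 [nd0 h0]] : exists l0, NoDup l0 /\ s - e < rsum g l0.
    apply NNPP => n.
    have : s <= s - e.
      apply lub => r [l [nd ->]]. apply Rnot_lt_le => h. apply n. by exists l.
    lra.
  exists l0; split => // l nd dis.
  have : rsum g (l0 ++ l) <= s.
    apply ub. exists (l0 ++ l); split => //. apply NoDup_app => // a h1 h2. by apply (dis a).
  rewrite rsum_app. lra.
Qed.

End Lists.

Lemma lsum_map {A B : Type} (p : A -> B) (f : B -> C) l : lsum f (map p l) = lsum (fun a => f (p a)) l.
Proof. elim: l => [//|a l IH] /=. by rewrite IH. Qed.

Lemma rsum_map {A B : Type} (p : A -> B) (f : B -> R) l : rsum f (map p l) = rsum (fun a => f (p a)) l.
Proof. elim: l => [//|a l IH] /=. by rewrite IH. Qed.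

Definition inj {A B : Type} (p : A -> B) : Prop := forall x y, p x = p y -> x = y.

Lemma NoDup_map_inj {A B : Type} (p : A -> B) l : inj p -> NoDup l -> NoDup (map p l).
Proof. move=> h nd. apply NoDup_map_NoDup_ForallPairs => // x y _ _. apply h. Qed.

Lemma Rsummable_inj {A B : Type} (p : A -> B) (g : B -> R) : inj p -> Rsummable g -> Rsummable (fun a => g (p a)).
Proof.
  move=> hp [M hM]. exists M => l nd. rewrite -rsum_map. apply hM. by apply NoDup_map_inj.
Qed.

Lemma Rsummable_of_inj {A B : Type} (p : A -> B) (g : B -> R) :
  (forall b, (forall a, p a <> b) -> g b = 0%R) -> Rsummable (fun a => g (p a)) -> Rsummable g.
Proof.
  move=> h0 [M hM]. exists M => l nd.
  suff [l' [nd' [inc ->]]] : exists l', NoDup l' /\ (forall a, In a l' -> In (p a) l) /\ rsum g l = rsum (fun a => g (p a)) l' by apply hM.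
  elim: l nd => [_|b l IH nd]; first by exists nil; split; [apply NoDup_nil | split].
  inversion nd as [|? ? nb nd1]; subst. have [l' [nd' [inc E]]] := IH nd1.
  case: (classic (exists a, p a = b)) => [[a ea]|n].
  - exists (a :: l'); split.
      apply NoDup_cons => // ha. apply nb. rewrite -ea. by apply inc.
    split; first by move=> c [<-|hc]; [left | right; apply inc].
    by rewrite /= E ea.
  - exists l'; split => //. split; first by move=> c hc; right; apply inc.
    rewrite /= E h0; last by move=> a ea; apply n; exists a. ring.
Qed.

Lemma has_sum_inj {A B : Type} (p : A -> B) (f : B -> C) s : inj p ->
  (forall b, (forall a, p a <> b) -> f b = 0) -> has_sum f s -> has_sum (fun a => f (p a)) s.
Proof.
  move=> hp h0 H e he. have [l0 hl0] := H e he.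
  have [l1 h1] : exists l1, forall b, In b l0 -> (exists a, p a = b) -> exists a, In a l1 /\ p a = b.
    clear hl0. elim: l0 => [|b l0 [l1 IH]]; first by exists nil.
    case: (classic (exists a, p a = b)) => [[a ea]|n].
    - exists (a :: l1) => c [<-|hc] hx; first by exists a; split; [left|].
      have [d [hd ed]] := IH c hc hx. exists d; split => //. by right.
    - exists l1 => c [<-|hc] hx; first by []. by apply IH.
  exists l1 => l nd inc.
  pose P := fun b => if excluded_middle_informative (In b (map p l)) is left _ then false else true.
  have [nd0 inc0] := nodup_cover l0.
  have ndm := NoDup_map_inj p l hp nd.
  have := hl0 (map p l ++ filter P (nodup eqd l0)) _ _.
  have Z : lsum f (filter P (nodup eqd l0)) = 0.
    rewrite (lsum_ext _ (fun _ => RtoC 0)); last first.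
      move=> b /filter_In [/nodup_In hb]. rewrite /P. case: excluded_middle_informative => // nb _.
      apply h0 => a ea. apply nb. have [c [hc ec]] := h1 b hb (ex_intro _ a ea).
      apply in_map_iff. exists c; split => //. by apply inc.
    elim: (filter _ _) => [//|b m IH] /=. rewrite IH. ring.
  rewrite lsum_app lsum_map Z Cplus_0_r. apply.
  - apply NoDup_app => //; first by apply NoDup_filter.
    move=> b hb /filter_In [_]. rewrite /P. by case: excluded_middle_informative.
  - move=> b hb. rewrite in_app_iff filter_In /P. case: excluded_middle_informative => hm; [by left | right].
    split => //. by apply inc0.
Qed.

Lemma summable_inj {A B : Type} (p : A -> B) (f : B -> C) : inj p -> summable f -> summable (fun a => f (p a)).
Proof. move=> hp H. by apply (Rsummable_inj p (fun b => Cmod (f b))). Qed.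

Lemma summable_of_inj {A B : Type} (p : A -> B) (f : B -> C) :
  (forall b, (forall a, p a <> b) -> f b = 0) -> summable (fun a => f (p a)) -> summable f.
Proof.
  move=> h0. apply (Rsummable_of_inj p (fun b => Cmod (f b))) => b hb. rewrite h0 //. apply Cmod_0.
Qed.

Lemma tsum_inj {A B : Type} (p : A -> B) (f : B -> C) : inj p ->
  (forall b, (forall a, p a <> b) -> f b = 0) -> summable f -> tsum (fun a => f (p a)) = tsum f.
Proof. move=> hp h0 H. apply has_sum_tsum. apply has_sum_inj => //. by apply tsum_correct. Qed.

Lemma tsum_bij {A B : Type} (p : A -> B) (q : B -> A) (f : B -> C) :
  (forall a, q (p a) = a) -> (forall b, p (q b) = b) -> summable f -> tsum (fun a => f (p a)) = tsum f.
Proof.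
  move=> qp pq. apply tsum_inj.
  - move=> x y E. by rewrite -(qp x) E qp.
  - move=> b n. by case: (n (q b)).
Qed.

Lemma rsum_prod {A B : Type} (g : A * B -> R) la lb :
  rsum g (list_prod la lb) = rsum (fun a => rsum (fun b => g (a, b)) lb) la.
Proof. elim: la => [//|a la IH] /=. by rewrite rsum_app rsum_map IH. Qed.

Lemma lsum_prod {A B : Type} (g : A * B -> C) la lb :
  lsum g (list_prod la lb) = lsum (fun a => lsum (fun b => g (a, b)) lb) la.
Proof. elim: la => [//|a la IH] /=. by rewrite lsum_app lsum_map IH. Qed.

Lemma Rsummable_pair {A B : Type} (g : A * B -> R) (G : A -> R) : (forall p, 0 <= g p) ->
  (forall a l, NoDup l -> rsum (fun b => g (a, b)) l <= G a) -> Rsummable G -> Rsummable g.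
Proof.
  move=> g0 h [M hM]. exists M => l nd.
  pose la := nodup eqd (map fst l). pose lb := nodup eqd (map snd l).
  have [na ia] := nodup_cover (map fst l). have [nb ib] := nodup_cover (map snd l).
  apply Rle_trans with (rsum g (list_prod la lb)).
    apply rsum_incl => // -[a b] hp. apply in_prod.
    - apply ia. apply in_map_iff. by exists (a, b).
    - apply ib. apply in_map_iff. by exists (a, b).
  rewrite rsum_prod. apply Rle_trans with (rsum G la); last by apply hM.
  apply rsum_le => a _. by apply h.
Qed.

Lemma Rsummable_prod {A B : Type} (g : A -> R) (g' : B -> R) : (forall a, 0 <= g a) -> (forall b, 0 <= g' b) ->
  Rsummable g -> Rsummable g' -> Rsummable (fun p : A * B => (g (fst p) * g' (snd p))%R).
Proof.
  move=> g0 g0' H [M hM].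
  apply (Rsummable_pair _ (fun a => (M * g a)%R)).
  - move=> p. by apply Rmult_le_pos.
  - move=> a l nd /=. rewrite rsum_scal. have := hM l nd. have := g0 a. nra.
  - apply Rsummable_scal => //. apply (hM nil). apply NoDup_nil.
Qed.

Lemma summable_prod {A B : Type} (f : A -> C) (f' : B -> C) : summable f -> summable f' ->
  summable (fun p : A * B => f (fst p) * f' (snd p)).
Proof.
  move=> H H'. apply (summable_le _ (fun p : A * B => (Cmod (f (fst p)) * Cmod (f' (snd p)))%R)).
    move=> p. rewrite Cmod_mult. by right.
  apply (Rsummable_prod (fun a => Cmod (f a)) (fun b => Cmod (f' b))) => // a; apply Cmod_ge_0.
Qed.

Section Fubini.
Context {A B : Type}.

Lemma summable_row (f : A * B -> C) a : summable f -> summable (fun b => f (a, b)).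
Proof. move=> H. apply (summable_inj (fun b => (a, b))) => // x y E. by inversion E. Qed.

(** A finite sum of row sums is approximated by a finite sum over pairs that can be forced to
    contain the part of [l0] lying over [la]. Each further row spends half of the tolerance. *)
Lemma fubini_approx (f : A * B -> C) (g : A -> C) (l0 : list (A * B)) la : NoDup la ->
  (forall a, has_sum (fun b => f (a, b)) (g a)) -> forall e, 0 < e ->
  exists L, NoDup L /\ (forall p, In p L -> In (fst p) la) /\ (forall p, In p l0 -> In (fst p) la -> In p L) /\
    Cmod (lsum f L - lsum g la) < e.
Proof.
  move=> + Hg. elim: la => [_ e he|a la IH nd e he].
    exists nil; split; first by apply NoDup_nil. do 2 split => //.
    simpl. replace (0 - 0) with (RtoC 0) by ring. by rewrite Cmod_0.
  inversion nd as [|? ? na nd1]; subst.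
  have he2 : 0 < e / 2 by lra.
  have [L [ndL [L1 [L2 L3]]]] := IH nd1 _ he2.
  have [lr hr] := Hg a _ he2.
  pose lb := nodup eqd (lr ++ map snd l0).
  have [nb ib] := nodup_cover (lr ++ map snd l0).
  have R1 := hr lb nb (fun b h => ib b (in_or_app _ _ _ (or_introl h))).
  exists (map (fun b => (a, b)) lb ++ L); split; [|split; [|split]].
  - apply NoDup_app => //; first by apply NoDup_map_inj => // x y E; inversion E.
    move=> p /in_map_iff [b [<- _]] /L1 /=. done.
  - move=> p. rewrite in_app_iff. case; [move=> /in_map_iff [b [<- _]]; by left | move=> h; right; exact: L1].
  - move=> [a' b] hp /=. rewrite in_app_iff. case => [ea|ha]; [left; subst a' | right; by apply L2].
    apply in_map_iff. exists b; split => //. apply ib. apply in_or_app. right. apply in_map_iff. by exists (a, b).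
  - rewrite lsum_app lsum_map /=.
    replace (lsum (fun b => f (a, b)) lb + lsum f L - (g a + lsum g la)) with
     ((lsum (fun b => f (a, b)) lb - g a) + (lsum f L - lsum g la)) by ring.
    have := Cmod_triangle (lsum (fun b => f (a, b)) lb - g a) (lsum f L - lsum g la). lra.
Qed.

Lemma has_sum_fubini (f : A * B -> C) (g : A -> C) s : has_sum f s ->
  (forall a, has_sum (fun b => f (a, b)) (g a)) -> has_sum g s.
Proof.
  move=> H Hg e he. have he2 : 0 < e / 2 by lra.
  have [l0 h0] := H _ he2.
  exists (map fst l0) => la nd inc.
  have [L [ndL [L1 [L2 L3]]]] := fubini_approx f g l0 la nd Hg _ he2.
  have A1 : Cmod (lsum f L - s) < e / 2.
    apply h0 => // p hp. apply L2 => //. apply inc. apply in_map_iff. by exists p.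
  rewrite Cmod_minus_sym in L3.
  have := Cmod_dist (lsum g la) (lsum f L) s. lra.
Qed.

Lemma tsum_fubini (f : A * B -> C) : summable f -> tsum f = tsum (fun a => tsum (fun b => f (a, b))).
Proof.
  move=> H. symmetry. apply has_sum_tsum. apply (has_sum_fubini f); first by apply tsum_correct.
  move=> a. apply tsum_correct. by apply summable_row.
Qed.

End Fubini.

Lemma tsum_prod {A B : Type} (f : A -> C) (f' : B -> C) : summable f -> summable f' ->
  tsum (fun p : A * B => f (fst p) * f' (snd p)) = tsum f * tsum f'.
Proof.
  move=> H H'. rewrite tsum_fubini; last by apply summable_prod.
  simpl. rewrite (tsum_ext _ (fun a => tsum f' * f a)); last first.
    move=> a. rewrite tsum_scal //. ring.
  rewrite tsum_scal //. ring.
Qed.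

Definition pswap {A B : Type} (p : A * B) : B * A := (snd p, fst p).

Lemma summable_swap {A B : Type} (f : A * B -> C) : summable f -> summable (fun p => f (pswap p)).
Proof. apply summable_inj. by move=> [a b] [c d] [-> ->]. Qed.

Definition climit (u : nat -> C) (s : C) : Prop :=
  forall e, 0 < e -> exists N, forall n, (N <= n)%nat -> Cmod (u n - s) < e.

Lemma climit_unique u s s' : climit u s -> climit u s' -> s = s'.
Proof.
  move=> H H'. apply Cmod_small_eq => e he. have he2 : 0 < e / 2 by lra.
  have [N h] := H _ he2. have [N' h'] := H' _ he2.
  have A := h (N + N')%nat ltac:(lia). have A' := h' (N + N')%nat ltac:(lia).
  rewrite Cmod_minus_sym in A. have := Cmod_dist s (u (N + N')%nat) s'. lra.
Qed.

Lemma Clim_seq_eq u s : climit u s -> Clim_seq u = s.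
Proof.
  move=> H. rewrite /Clim_seq.
  have E1 : is_lim_seq (fun n => Re (u n)) (Re s).
    apply is_lim_seq_spec => e. have [N h] := H e (cond_pos e). exists N => n hn.
    apply: Rle_lt_trans (h n hn). apply: Rle_trans (re_le_Cmod _). right. done.
  have E2 : is_lim_seq (fun n => Im (u n)) (Im s).
    apply is_lim_seq_spec => e. have [N h] := H e (cond_pos e). exists N => n hn.
    apply: Rle_lt_trans (h n hn). apply: Rle_trans (im_le_Cmod _). right. done.
  rewrite (is_lim_seq_unique _ _ E1) (is_lim_seq_unique _ _ E2) /=. by case: s {H E1 E2}.
Qed.

Lemma climit_ext u v s : (forall n, u n = v n) -> climit u s -> climit v s.
Proof. move=> E. by have -> : u = v by apply functional_extensionality. Qed.

Lemma climit_const c : climit (fun _ => c) c.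
Proof. move=> e he. exists 0%nat => n _. replace (c - c) with (RtoC 0) by ring. by rewrite Cmod_0. Qed.

Lemma has_sum_exhaust {A : Type} (f : A -> C) s (L : nat -> list A) : has_sum f s ->
  (forall n, NoDup (L n)) -> (forall a, exists N, forall n, (N <= n)%nat -> In a (L n)) ->
  climit (fun n => lsum f (L n)) s.
Proof.
  move=> H nd ex e he. have [l0 h0] := H e he.
  have [N hN] : exists N, forall n, (N <= n)%nat -> incl l0 (L n).
    clear h0. elim: l0 => [|a l0 [N IH]]; first by exists 0%nat => n _ b [].
    have [N' h'] := ex a. exists (N + N')%nat => n hn b [<-|hb]; [apply h'; lia | apply (IH n) => //; lia].
  exists N => n hn. apply h0 => //. by apply hN.
Qed.

Lemma has_sum_climit (f : nat -> C) s : has_sum f s -> climit (fun n => lsum f (seq 0 n)) s.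
Proof.
  move=> H. apply has_sum_exhaust => //; first by move=> n; apply seq_NoDup.
  move=> a. exists (S a) => n hn. apply in_seq. lia.
Qed.

Lemma sum_n_lsum (f : nat -> C) n : sum_n f n = lsum f (seq 0 (S n)).
Proof.
  elim: n => [|n IH]. rewrite sum_O /=. ring.
  rewrite sum_Sn IH (seq_S (S n) 0) lsum_app. rewrite /plus /=. ring.
Qed.

Lemma rsum_S (g : nat -> R) n : rsum g (seq 0 (S n)) = (rsum g (seq 0 n) + g n)%R.
Proof. rewrite seq_S rsum_app /=. ring. Qed.

Lemma lsum_S (g : nat -> C) n : lsum g (seq 0 (S n)) = lsum g (seq 0 n) + g n.
Proof. rewrite seq_S lsum_app /=. ring. Qed.

Lemma Rsummable_nat (g : nat -> R) B : (forall n, 0 <= g n) -> (forall n, rsum g (seq 0 n) <= B) -> Rsummable g.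
Proof.
  move=> g0 hB. exists B => l nd.
  apply Rle_trans with (rsum g (seq 0 (S (list_max l)))); last by apply hB.
  apply rsum_incl => // a ha. apply in_seq. split; first lia. apply le_n_S.
  have := proj1 (list_max_le l (list_max l)) (le_n _). move=> /Forall_forall. by apply.
Qed.

Lemma Rsummable_Z (g : Z -> R) : (forall n, 0 <= g n) -> Rsummable (fun n : nat => g (Z.of_nat n)) ->
  Rsummable (fun n : nat => g (- Z.of_nat n)%Z) -> Rsummable g.
Proof.
  move=> g0 H1 H2.
  apply (Rsummable_le _ (fun z => ((if (0 <=? z)%Z then g z else 0) + (if (z <=? 0)%Z then g z else 0))%R)).
    move=> z. have := g0 z. case: Z.leb_spec; case: Z.leb_spec; try lra. lia.
  apply Rsummable_plus.
  - apply (Rsummable_of_inj Z.of_nat).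
      move=> b h. case: Z.leb_spec => // hb. case: (h (Z.to_nat b)). lia.
    apply: Rsummable_le H1 => n. case: Z.leb_spec => _; [by right | by apply g0].
  - apply (Rsummable_of_inj (fun n => (- Z.of_nat n)%Z)).
      move=> b h. case: Z.leb_spec => // hb. case: (h (Z.to_nat (- b))). lia.
    apply: Rsummable_le H2 => n. case: Z.leb_spec => _; [by right | by apply g0].
Qed.

Lemma Rsummable_geom r : 0 <= r < 1 -> Rsummable (fun n : nat => (r ^ n)%R).
Proof.
  move=> hr. apply (Rsummable_nat _ (/ (1 - r))); first by move=> n; apply pow_le; lra.
  move=> n. suff -> : rsum (fun n => (r ^ n)%R) (seq 0 n) = ((1 - r ^ n) / (1 - r))%R.
    have : 0 <= r ^ n by apply pow_le; lra.
    move=> h. rewrite /Rdiv. rewrite -{2}(Rmult_1_l (/ (1 - r))). apply Rmult_le_compat_r; last lra.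
    left; apply Rinv_0_lt_compat; lra.
  elim: n => [|n IH]; first by simpl; field; lra.
  rewrite rsum_S IH /=. field. lra.
Qed.

Lemma cder_tsum {A : Type} (t t' : A -> C -> C) (x : C) (d : R) (M : A -> R) : 0 < d -> Rsummable M ->
  (forall y, Cmod (y - x) < d -> summable (fun a => t a y)) -> summable (fun a => t' a x) ->
  (forall a h, Cmod h < d -> Cmod (t a (x + h) - t a x - t' a x * h) <= M a * Cmod h ^ 2) ->
  cder (fun y => tsum (fun a => t a y)) x (tsum (fun a => t' a x)).
Proof.
  move=> hd [B hB] S S' H.
  apply (cder_second _ _ _ B d hd) => h hh.
  have S0 : summable (fun a => t a x).
    apply S. replace (x - x) with (RtoC 0) by ring. by rewrite Cmod_0.
  have S1 : summable (fun a => t a (x + h)).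
    apply S. by replace (x + h - x) with h by ring.
  have <- : tsum (fun a => t a (x + h) - t a x - h * t' a x) =
     tsum (fun a => t a (x + h)) - tsum (fun a => t a x) - tsum (fun a => t' a x) * h.
    rewrite tsum_minus; [|by apply summable_minus | by apply summable_scal].
    rewrite tsum_minus // tsum_scal //. ring.
  apply tsum_Cmod_le.
    apply summable_minus; [by apply summable_minus | by apply summable_scal].
  move=> l nd. apply Rle_trans with (rsum (fun a => (Cmod h ^ 2 * M a)%R) l).
    apply rsum_le => a _. replace (h * t' a x) with (t' a x * h) by ring.
    rewrite Rmult_comm. by apply H.
  rewrite rsum_scal Rmult_comm. apply Rmult_le_compat_r; last by apply hB. apply pow_le, Cmod_ge_0.
Qed.

(** Dominated convergence: outside a finite list the majorant contributes less than e/8 to either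
    sum, and on the list only finitely many limits are involved. *)
Lemma tannery {A : Type} (f : nat -> A -> C) (f0 : A -> C) (g : A -> R) : (forall n a, Cmod (f n a) <= g a) ->
  Rsummable g -> (forall a, climit (fun n => f n a) (f0 a)) -> climit (fun n => tsum (f n)) (tsum f0).
Proof.
  move=> hf hg lim e he.
  have hf0 : forall a, Cmod (f0 a) <= g a.
    move=> a. apply le_epsilon => r hr. have [N h] := lim a r hr.
    have A1 := h N (le_n _). have := hf N a. rewrite Cmod_minus_sym in A1.
    have := Cmod_sub_ge (f0 a) (f N a). lra.
  have g0 : forall a, 0 <= g a by move=> a; apply: Rle_trans (hf0 a); apply Cmod_ge_0.
  have [l0 [nd0 h0]] := Rsummable_tail g g0 hg (e / 8)%R ltac:(lra).
  have S0 : summable f0 by apply (summable_le _ g).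
  have Sn : forall n, summable (f n) by move=> n; apply (summable_le _ g).
  have near : forall F, summable F -> (forall a, Cmod (F a) <= g a) -> Cmod (tsum F - lsum F l0) <= e / 4.
    move=> F SF hF. have [l1 h1] := tsum_correct F SF (e / 8)%R ltac:(lra).
    have [nd inc] := nodup_cover (l0 ++ l1).
    have A1 := h1 _ nd (fun a h => inc a (in_or_app _ _ _ (or_intror h))).
    have [l2 [nd2 [dis E]]] := lsum_split F l0 _ nd0 nd (fun a h => inc a (in_or_app _ _ _ (or_introl h))).
    rewrite E in A1.
    have A2 : Cmod (lsum F l2) < e / 8.
      apply: Rle_lt_trans (h0 l2 nd2 (fun a h => proj2 (dis a h))).
      apply: Rle_trans (Cmod_lsum_le _ _) _. by apply rsum_le => a _.
    replace (tsum F - lsum F l0) with (- (lsum F l0 + lsum F l2 - tsum F) + lsum F l2) by ring.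
    have := Cmod_triangle (- (lsum F l0 + lsum F l2 - tsum F)) (lsum F l2). rewrite Cmod_opp. lra.
  have [N hN] : exists N, forall n, (N <= n)%nat -> Cmod (lsum (f n) l0 - lsum f0 l0) < e / 4.
    clear h0 nd0 near. have : 0 < e / 4 by lra. move: (e / 4)%R => r.
    elim: l0 r => [|a l0 IH] r hr.
      exists 0%nat => n _ /=. replace (0 - 0) with (RtoC 0) by ring. by rewrite Cmod_0.
    have [N h] := IH (r / 2)%R ltac:(lra). have [N' h'] := lim a (r / 2)%R ltac:(lra).
    exists (N + N')%nat => n hn /=. have A1 := h n ltac:(lia). have A2 := h' n ltac:(lia).
    replace (f n a + lsum (f n) l0 - (f0 a + lsum f0 l0)) with ((f n a - f0 a) + (lsum (f n) l0 - lsum f0 l0)) by ring.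
    have := Cmod_triangle (f n a - f0 a) (lsum (f n) l0 - lsum f0 l0). lra.
  exists N => n hn.
  have A1 := near f0 S0 hf0. have A2 := near (f n) (Sn n) (hf n). have A3 := hN n hn.
  rewrite Cmod_minus_sym in A1.
  have := Cmod_dist (tsum (f n)) (lsum (f n) l0) (tsum f0).
  have := Cmod_dist (lsum (f n) l0) (lsum f0 l0) (tsum f0). lra.
Qed.

(** * Power series and exponential sums *)

(** Induction on k: the remainder of order k + 1 is (x + h) times that of order k plus k x^(k-1)
    h^2. The factor rho^(k-2) is written rho^k / rho^2 to avoid truncated subtraction. *)
Lemma pow_second_order (x h : C) (rho : R) (k : nat) : 0 < rho -> Cmod x <= rho -> Cmod (x + h) <= rho ->
  Cmod ((x + h) ^ k - x ^ k - INR k * x ^ (pred k) * h) <= (INR k ^ 2 * rho ^ k / rho ^ 2 * Cmod h ^ 2).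
Proof.
  move=> hr hx hxh.
  have r2 : 0 < rho ^ 2 by apply pow_lt.
  suff : (rho ^ 2 * Cmod ((x + h) ^ k - x ^ k - INR k * x ^ (pred k) * h) <= INR k ^ 2 * rho ^ k * Cmod h ^ 2).
    move=> H. apply (Rmult_le_reg_l (rho ^ 2)) => //.
    replace (rho ^ 2 * (INR k ^ 2 * rho ^ k / rho ^ 2 * Cmod h ^ 2))%R with (INR k ^ 2 * rho ^ k * Cmod h ^ 2)%R by (field; lra).
    exact H.
  elim: k => [|k IH].
    simpl. replace (1 - 1 - 0 * 1 * h) with (RtoC 0) by ring. rewrite Cmod_0. right; ring.
  have -> : (x + h) ^ (S k) - x ^ (S k) - INR (S k) * x ^ (pred (S k)) * h =
    (x + h) * ((x + h) ^ k - x ^ k - INR k * x ^ (pred k) * h) + INR k * x ^ (pred k) * (h * h).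
    rewrite S_INR RtoC_plus. case: k {IH} => [|k]; simpl; ring.
  have T := Cmod_triangle ((x + h) * ((x + h) ^ k - x ^ k - INR k * x ^ (pred k) * h)) (INR k * x ^ (pred k) * (h * h)).
  apply: Rle_trans (Rmult_le_compat_l _ _ _ (Rlt_le _ _ r2) T) _.
  rewrite !Cmod_mult Cmod_pow Cmod_R (Rabs_pos_eq (INR k)); last by apply pos_INR.
  set P := Cmod ((x + h) ^ k - _ - _) in IH *.
  have P0 : 0 <= P by apply Cmod_ge_0.
  have k0 := pos_INR k. have h0 := Cmod_ge_0 h. have x0 := Cmod_ge_0 x. have xh0 := Cmod_ge_0 (x + h).
  have rk : 0 <= rho ^ k by apply pow_le; lra.
  have A : (rho ^ 2 * (Cmod (x + h) * P) <= rho * (INR k ^ 2 * rho ^ k * Cmod h ^ 2)).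
    apply Rle_trans with (rho * (rho ^ 2 * P))%R.
      have : Cmod (x + h) * P <= rho * P by apply Rmult_le_compat_r. nra.
    apply Rmult_le_compat_l => //; lra.
  have B : (rho ^ 2 * (INR k * Cmod x ^ (pred k) * (Cmod h * Cmod h)) <= INR k * rho ^ (S k) * Cmod h ^ 2).
    case: k k0 {IH P P0 T rk A} => [|k] k0; first by simpl; lra.
    have : (Cmod x ^ k <= rho ^ k) by apply pow_incr.
    move=> hk. simpl pred.
    replace (INR (S k) * rho ^ (S (S k)) * Cmod h ^ 2)%R with (rho ^ 2 * (INR (S k) * rho ^ k * (Cmod h * Cmod h)))%R by (simpl; ring).
    apply Rmult_le_compat_l; first lra. apply Rmult_le_compat_r; first nra.
    by apply Rmult_le_compat_l.
  rewrite Rmult_plus_distr_l. apply: Rle_trans (Rplus_le_compat _ _ _ _ A B) _.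
  rewrite S_INR. simpl.
  have : (0 <= rho * rho ^ k * (Cmod h * Cmod h)) by apply Rmult_le_pos; [apply Rmult_le_pos; lra | nra].
  set q := (rho * rho ^ k * (Cmod h * Cmod h))%R => q0.
  replace (rho * (INR k * (INR k * 1) * rho ^ k * (Cmod h * (Cmod h * 1))) + INR k * (rho * rho ^ k) * (Cmod h * (Cmod h * 1)))%R
   with ((INR k * INR k + INR k) * q)%R by (rewrite /q; ring).
  replace ((INR k + 1) * ((INR k + 1) * 1) * (rho * rho ^ k) * (Cmod h * (Cmod h * 1)))%R with
   (((INR k * INR k + INR k) + (INR k + 1)) * q)%R by (rewrite /q; ring).
  nra.
Qed.

(** With v = sqrt (r / rho) > 1, a Bernoulli estimate gives u (k + 1) <= v^k for u = min (v - 1, 1),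
    where the bound 1 is what k = 0 demands. Squaring gives the claim with K = u^(-2). *)
Lemma poly_geom (rho r : R) : 0 < rho < r -> exists K, 0 < K /\ forall k, (INR k + 1) ^ 2 * rho ^ k <= K * r ^ k.
Proof.
  move=> [h0 h1].
  pose v := sqrt (r / rho). pose u := Rmin (v - 1) 1.
  have hs : 1 < r / rho.
    apply (Rmult_lt_reg_r rho) => //. replace (r / rho * rho)%R with r by (field; lra). lra.
  have hv : (v * v = r / rho)%R by apply sqrt_sqrt; lra.
  have v1 : 1 < v by rewrite /v -{1}sqrt_1; apply sqrt_lt_1; lra.
  have u0 : 0 < u by apply Rmin_glb_lt; lra.
  exists (/ u ^ 2)%R; split; first by apply Rinv_0_lt_compat, pow_lt.
  move=> k.
  have B : (u * (INR k + 1) <= v ^ k).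
    elim: k => [|k IH]; first by rewrite /= Rplus_0_l Rmult_1_r; apply Rmin_r.
    rewrite S_INR /=. have : u <= v - 1 by apply Rmin_l.
    have : 1 <= v ^ k by apply pow_R1_Rle; lra. nra.
  have E : (r ^ k = rho ^ k * (v ^ k) ^ 2)%R.
    have -> : r = (rho * (v * v))%R by rewrite hv; field; lra.
    rewrite !Rpow_mult_distr. simpl; ring.
  rewrite E.
  have rk : 0 < rho ^ k by apply pow_lt.
  have k0 := pos_INR k.
  have : ((u * (INR k + 1)) ^ 2 <= (v ^ k) ^ 2) by apply pow_incr; split => //; nra.
  move=> B2. apply (Rmult_le_reg_l (u ^ 2)); first by apply pow_lt.
  replace (u ^ 2 * (/ u ^ 2 * (rho ^ k * (v ^ k) ^ 2)))%R with (rho ^ k * (v ^ k) ^ 2)%R by (field; lra).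
  replace (u ^ 2 * ((INR k + 1) ^ 2 * rho ^ k))%R with (rho ^ k * (u * (INR k + 1)) ^ 2)%R by ring.
  apply Rmult_le_compat_l; lra.
Qed.

Lemma Rsummable_poly_geom (a : nat -> R) (rho r : R) : 0 < rho < r -> (forall k, 0 <= a k) ->
  Rsummable (fun k => (a k * r ^ k)%R) -> Rsummable (fun k => (a k * ((INR k + 1) ^ 2 * rho ^ k))%R).
Proof.
  move=> h a0 H. have [K [K0 hK]] := poly_geom rho r h.
  apply: Rsummable_le (Rsummable_scal K _ _ H); last lra.
  move=> k /=. have := hK k. have := a0 k. nra.
Qed.

Lemma tsum_S (f : nat -> C) : summable f -> tsum f = f 0%nat + tsum (fun n => f (S n)).
Proof.
  move=> H.
  have H' : summable (fun n => f (S n)) by apply (summable_inj S) => // x y E; inversion E.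
  apply (climit_unique (fun n => lsum f (seq 0 (S n)))).
  - move=> e he. have [N h] := has_sum_climit _ _ (tsum_correct _ H) e he. exists N => n hn. apply h. lia.
  - move=> e he. have [N h] := has_sum_climit _ _ (tsum_correct _ H') e he. exists N => n hn.
    have -> : lsum f (seq 0 (S n)) = f 0%nat + lsum (fun n => f (S n)) (seq 0 n).
      by rewrite -[seq 0 (S n)]/(0%nat :: seq 1 n) /= -seq_shift lsum_map.
    replace (f 0%nat + lsum (fun n => f (S n)) (seq 0 n) - (f 0%nat + tsum (fun n => f (S n)))) with
      (lsum (fun n => f (S n)) (seq 0 n) - tsum (fun n => f (S n))) by ring.
    by apply h.
Qed.

Definition psum (a : nat -> C) (x : C) : C := tsum (fun k => a k * x ^ k).

Lemma summable_psum (a : nat -> C) (x : C) (r : R) : Cmod x <= r -> Rsummable (fun k => (Cmod (a k) * r ^ k)%R) ->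
  summable (fun k => a k * x ^ k).
Proof.
  move=> hx. apply summable_le => k. rewrite Cmod_mult Cmod_pow.
  apply Rmult_le_compat_l; first by apply Cmod_ge_0. apply pow_incr. split => //. apply Cmod_ge_0.
Qed.

Lemma cder_psum (a : nat -> C) (x : C) (r : R) : Cmod x < r -> Rsummable (fun k => (Cmod (a k) * r ^ k)%R) ->
  cder (psum a) x (psum (fun k => INR (S k) * a (S k)) x).
Proof.
  move=> hx H. have x0 := Cmod_ge_0 x.
  pose rho := ((Cmod x + r) / 2)%R.
  have hrho : 0 < rho < r by rewrite /rho; lra.
  have H2 := Rsummable_poly_geom (fun k => Cmod (a k)) rho r hrho (fun k => Cmod_ge_0 _) H.
  have S' : summable (fun k => INR k * a k * x ^ (pred k)).
    apply: summable_le (Rsummable_scal (/ rho) _ _ H2); last by left; apply Rinv_0_lt_compat; lra.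
    move=> k /=. rewrite !Cmod_mult Cmod_pow Cmod_R Rabs_pos_eq; last by apply pos_INR.
    have k0 := pos_INR k. have a0 := Cmod_ge_0 (a k).
    have rk : 0 < rho ^ k by apply pow_lt; lra.
    have E : (INR k * Cmod x ^ (pred k) <= / rho * ((INR k + 1) * ((INR k + 1) * 1) * rho ^ k)).
      case: k k0 rk {a0} => [|k] k0 rk.
        simpl. rewrite Rmult_0_l. apply Rmult_le_pos; [left; apply Rinv_0_lt_compat; lra | lra].
      have P1 : (Cmod x ^ k <= rho ^ k) by apply pow_incr; rewrite /rho; lra.
      have P0 : (0 <= Cmod x ^ k) by apply pow_le.
      replace (/ rho * ((INR (S k) + 1) * ((INR (S k) + 1) * 1) * rho ^ S k))%R with ((INR (S k) + 1) * (INR (S k) + 1) * rho ^ k)%R by (simpl pow; field; lra).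
      simpl pred. apply Rmult_le_compat => //. nra.
    have : (0 <= INR k * Cmod x ^ (pred k)) by apply Rmult_le_pos => //; apply pow_le.
    nra.
  apply (cder_eq _ _ (tsum (fun k => INR k * a k * x ^ (pred k)))).
    rewrite tsum_S // /psum /=. rewrite !Cmult_0_l Cplus_0_l. done.
  apply (cder_tsum (fun k y => a k * y ^ k) (fun k y => INR k * a k * y ^ (pred k)) x ((r - Cmod x) / 2)
     (fun k => (/ rho ^ 2 * (Cmod (a k) * ((INR k + 1) ^ 2 * rho ^ k)))%R)) => //; first lra.
  - apply Rsummable_scal => //. left. apply Rinv_0_lt_compat, pow_lt. lra.
  - move=> y hy. apply (summable_psum a y r) => //.
    have := Cmod_dist y x 0. have := Cmod_sub_ge y x. lra.
  - move=> k h hh.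
    replace (a k * (x + h) ^ k - a k * x ^ k - INR k * a k * x ^ (pred k) * h) with
      (a k * ((x + h) ^ k - x ^ k - INR k * x ^ (pred k) * h)) by ring.
    rewrite Cmod_mult.
    have A := pow_second_order x h rho k (proj1 hrho) ltac:(rewrite /rho; lra) ltac:(rewrite /rho; have := Cmod_triangle x h; lra).
    have a0 := Cmod_ge_0 (a k). have k0 := pos_INR k. have h0 := Cmod_ge_0 h.
    have rk : 0 < rho ^ k by apply pow_lt; lra.
    apply Rle_trans with (Cmod (a k) * (INR k ^ 2 * rho ^ k / rho ^ 2 * Cmod h ^ 2))%R.
      by apply Rmult_le_compat_l.
    replace (/ rho ^ 2 * (Cmod (a k) * ((INR k + 1) ^ 2 * rho ^ k)) * Cmod h ^ 2)%R with
      (Cmod (a k) * ((INR k + 1) ^ 2 * rho ^ k / rho ^ 2 * Cmod h ^ 2))%R by (field; lra).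
    apply Rmult_le_compat_l => //. apply Rmult_le_compat_r; first by apply pow_le.
    apply Rmult_le_compat_r; first by left; apply Rinv_0_lt_compat, pow_lt; lra.
    apply Rmult_le_compat_r; first lra. nra.
Qed.

Definition expc (k : nat) : C := RtoC (/ INR (fact k)).

Lemma fact_pos k : 0 < INR (fact k).
Proof. apply lt_0_INR, lt_O_fact. Qed.

Lemma rsum_exp (x : R) l : 0 <= x -> NoDup l -> rsum (fun k => (/ INR (fact k) * x ^ k)%R) l <= exp x.
Proof.
  move=> hx nd.
  have pos : forall k, 0 <= / INR (fact k) * x ^ k.
    move=> k. apply Rmult_le_pos; last by apply pow_le. left. apply Rinv_0_lt_compat, fact_pos.
  apply Rle_trans with (rsum (fun k => (/ INR (fact k) * x ^ k)%R) (seq 0 (S (list_max l)))).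
    apply rsum_incl => // a ha. apply in_seq. split; first lia. apply le_n_S.
    have := proj1 (list_max_le l (list_max l)) (le_n _). move=> /Forall_forall. by apply.
  apply: Rle_trans (exp_ge_taylor x (list_max l) hx).
  right. elim: (list_max l) => [|n IH]; first by simpl; field.
  rewrite rsum_S IH tech5. f_equal. field. have := fact_pos (S n). lra.
Qed.

Lemma Rsummable_exp (x : R) : 0 <= x -> Rsummable (fun k => (Cmod (expc k) * x ^ k)%R).
Proof.
  move=> hx. exists (exp x) => l nd. apply: Rle_trans (rsum_exp x l hx nd). right.
  f_equal. apply functional_extensionality => k. f_equal. rewrite Cmod_R. apply Rabs_pos_eq.
  left. apply Rinv_0_lt_compat, fact_pos.
Qed.

Lemma cder_psum_exp x : cder (psum expc) x (psum expc x).
Proof.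
  have x0 := Cmod_ge_0 x.
  refine (cder_eq _ _ _ _ _ (cder_psum expc x (Cmod x + 1) ltac:(lra) (Rsummable_exp (Cmod x + 1) ltac:(lra)))).
  f_equal. apply functional_extensionality => k.
  rewrite /expc -RtoC_mult. f_equal. rewrite fact_simpl mult_INR. field.
  split; [apply INR_fact_neq_0 | by apply not_0_INR].
Qed.

Lemma psum_0 (a : nat -> C) : psum a 0 = a 0%nat.
Proof.
  apply has_sum_tsum => e he. exists [0%nat] => l nd inc.
  have [l1 [n1 [dis ->]]] := lsum_split (fun k => a k * 0 ^ k) [0%nat] l ltac:(repeat constructor; auto) nd inc.
  rewrite (lsum_ext _ (fun _ => RtoC 0) l1); last first.
    move=> k hk. have [_ nk] := dis k hk. case: k {hk} nk => [nk|k _]; first by case: nk; left.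
    simpl. ring.
  have -> : lsum (fun _ : nat => RtoC 0) l1 = 0 by elim: l1 {n1 dis} => [//|b m IH] /=; rewrite IH; ring.
  simpl. replace (a 0%nat * 1 + 0 + 0 - a 0%nat) with (RtoC 0) by ring. by rewrite Cmod_0.
Qed.

Lemma psum_exp_0 : psum expc 0 = 1.
Proof. rewrite psum_0 /expc /= Rinv_1. done. Qed.

(** The product has zero derivative in z and is compared with its value at z = 0; this takes the
    place of the Cauchy product and the binomial theorem. *)
Lemma psum_exp_shift z c : psum expc z * psum expc (c - z) = psum expc c.
Proof.
  rewrite -[RHS](Cmult_1_l). rewrite -psum_exp_0.
  rewrite -{2}(Cplus_0_r c). replace (c + 0) with (c - 0) by ring.
  apply (cder_zero_const (fun _ => True) (fun z => psum expc z * psum expc (c - z)) z 0) => //.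
  move=> w _. apply (cder_eq _ _ (psum expc w * psum expc (c - w) + psum expc w * (psum expc (c - w) * (0 - 1)))).
    ring.
  apply (der_mult _ (psum expc) (fun w => psum expc (c - w))); first by apply cder_psum_exp.
  apply (cder_comp (psum expc) (fun w => c - w)); first by apply cder_psum_exp.
  apply der_minus; [apply der_const | apply der_id].
Qed.

Lemma psum_exp_add z w : psum expc (z + w) = psum expc z * psum expc w.
Proof. rewrite -(psum_exp_shift z (z + w)). f_equal. f_equal. ring. Qed.

Lemma psum_exp_real (x : R) : psum expc x = RtoC (exp x).
Proof.
  have E : forall a b : R, (a <= b) -> psum expc (- a) * RtoC (exp a) = psum expc (- b) * RtoC (exp b).
    move=> a b hab.
    apply (rder_zero_const (fun t => psum expc (- t) * RtoC (exp t)) a b) => // t _.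
    apply (rder_eq _ _ (psum expc (- t) * (- (1)) * RtoC (exp t) + psum expc (- t) * RtoC (exp t))); first ring.
    apply (der_mult _ (fun z => psum expc (- RtoC (Re z))) (fun z => RtoC (exp (Re z)))).
    - apply (rder_comp (psum expc) (fun t => - RtoC t)); first by apply cder_psum_exp.
      apply (rder_local (fun s => 0 + s * (- (1)))); last by apply rder_line.
      exists 1%R; split; [lra | move=> y _; ring].
    - apply (rder_of_real exp t (exp t)). apply is_derive_exp.
  have N : psum expc (- x) * psum expc x = 1.
    rewrite -psum_exp_add. replace (- x + x) with (RtoC 0) by ring. apply psum_exp_0.
  have F : psum expc (- x) * RtoC (exp x) = 1.
    have E0 : psum expc (- 0) * RtoC (exp 0) = 1.
      rewrite exp_0. replace (- RtoC 0) with (RtoC 0) by ring. rewrite psum_exp_0. ring.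
    case: (Rle_lt_dec 0 x) => h; [by rewrite -(E 0%R x h) | by rewrite (E x 0%R (Rlt_le _ _ h))].
  have nz : psum expc (- x) <> 0 by move=> z; move: N; rewrite z Cmult_0_l => h; apply C1_nz.
  have : psum expc (- x) * (psum expc x - RtoC (exp x)) = 0 by rewrite Cmult_plus_distr_l N -F; ring.
  move=> h. apply Ceq_minus. apply NNPP => n. by apply (Cmult_neq_0 _ _ nz n).
Qed.

Lemma psum_exp_imag (x : R) : psum expc (Ci * x) = (cos x, sin x).
Proof.
  pose cis := fun t : R => RtoC (cos t) + Ci * RtoC (sin t).
  have dcis : forall t, rder cis t (Ci * cis t).
    move=> t. apply (rder_eq _ _ (RtoC (- sin t) + Ci * RtoC (cos t))).
      rewrite /cis RtoC_opp. have : Ci * Ci = - (1) by apply injective_projections; simpl; ring.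
      move=> ci. rewrite Cmult_plus_distr_l Cmult_assoc ci. ring.
    apply (der_plus _ (fun z => RtoC (cos (Re z))) (fun z => Ci * RtoC (sin (Re z)))).
    - apply (rder_of_real cos t (- sin t)%R). apply is_derive_cos.
    - apply (der_scal _ Ci (fun z => RtoC (sin (Re z)))). apply (rder_of_real sin t (cos t)). apply is_derive_sin.
  have -> : (cos x, sin x) = cis x by apply injective_projections; rewrite /cis /=; ring.
  have E : forall a b : R, (a <= b) -> psum expc (- (Ci * a)) * cis a = psum expc (- (Ci * b)) * cis b.
    move=> a b hab.
    apply (rder_zero_const (fun t => psum expc (- (Ci * t)) * cis t) a b) => // t _.
    apply (rder_eq _ _ (psum expc (- (Ci * t)) * (- Ci) * cis t + psum expc (- (Ci * t)) * (Ci * cis t))); first ring.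
    apply (der_mult _ (fun z => psum expc (- (Ci * RtoC (Re z)))) (fun z => cis (Re z))).
    - apply (rder_comp (psum expc) (fun t => - (Ci * RtoC t))); first by apply cder_psum_exp.
      apply (rder_local (fun s => 0 + s * (- Ci))); last by apply rder_line.
      exists 1%R; split; [lra | move=> y _; ring].
    - exact: (dcis t).
  have N : psum expc (- (Ci * x)) * psum expc (Ci * x) = 1.
    rewrite -psum_exp_add. replace (- (Ci * x) + Ci * x) with (RtoC 0) by ring. apply psum_exp_0.
  have F : psum expc (- (Ci * x)) * cis x = 1.
    have E0 : psum expc (- (Ci * 0%R)) * cis 0%R = 1.
      replace (- (Ci * 0)) with (RtoC 0) by ring. rewrite psum_exp_0 /cis cos_0 sin_0. ring.
    case: (Rle_lt_dec 0 x) => h; [by rewrite -(E 0%R x h) | by rewrite (E x 0%R (Rlt_le _ _ h))].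
  have nz : psum expc (- (Ci * x)) <> 0 by move=> z; move: N; rewrite z Cmult_0_l => h; apply C1_nz.
  have : psum expc (- (Ci * x)) * (psum expc (Ci * x) - cis x) = 0 by rewrite Cmult_plus_distr_l N -F; ring.
  move=> h. apply Ceq_minus. apply NNPP => n. by apply (Cmult_neq_0 _ _ nz n).
Qed.

(** [Cexp] is assembled from the real exponential, cosine and sine. Its identification with the
    power series yields the addition theorem and the second-order estimates on which termwise
    differentiation rests. *)
Lemma Cexp_psum (w : C) : Cexp w = psum expc w.
Proof.
  have -> : psum expc w = psum expc (RtoC (Re w) + Ci * RtoC (Im w)).
    f_equal. apply injective_projections; rewrite /= /Re /Im; ring.
  by rewrite psum_exp_add psum_exp_real psum_exp_imag.
Qed.

Lemma Cexp_add z w : Cexp (z + w) = Cexp z * Cexp w.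
Proof. rewrite !Cexp_psum. apply psum_exp_add. Qed.

Lemma Cexp_0 : Cexp 0 = 1.
Proof. rewrite Cexp_psum. apply psum_exp_0. Qed.

Lemma Cmod_cis x : Cmod (cos x, sin x) = 1%R.
Proof.
  have := Cmod2_alt (cos x, sin x). rewrite /Re /Im /=. have := sin2_cos2 x. rewrite /Rsqr.
  have := Cmod_ge_0 (cos x, sin x). nra.
Qed.

Lemma Cmod_Cexp w : Cmod (Cexp w) = exp (Re w).
Proof. rewrite /Cexp Cmod_mult Cmod_cis Cmod_R Rabs_pos_eq; [ring | left; apply exp_pos]. Qed.

Lemma Cexp_neq_0 w : Cexp w <> 0.
Proof. apply Cmod_pos_neq. rewrite Cmod_Cexp. apply exp_pos. Qed.

Lemma Cexp_pow w n : Cexp w ^ n = Cexp (INR n * w).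
Proof.
  elim: n => [|n IH]; first by rewrite /= Cmult_0_l Cexp_0.
  rewrite Cpow_S IH -Cexp_add S_INR RtoC_plus. f_equal. ring.
Qed.

Lemma Cexp_second_order w : Cmod (Cexp w - 1 - w) <= Cmod w ^ 2 * exp (Cmod w).
Proof.
  have S0 : summable (fun k => expc k * w ^ k) by apply (summable_psum expc w (Cmod w)); [right | apply Rsummable_exp, Cmod_ge_0].
  have S1 : summable (fun k => expc (S k) * w ^ (S k)).
    apply (summable_inj S (fun k => expc k * w ^ k)) => // x y E; by inversion E.
  have S2 : summable (fun k => expc (S (S k)) * w ^ (S (S k))).
    apply (summable_inj S (fun k => expc (S k) * w ^ (S k))) => // x y E; by inversion E.
  have -> : Cexp w - 1 - w = tsum (fun k => expc (S (S k)) * w ^ (S (S k))).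
    rewrite Cexp_psum /psum tsum_S // tsum_S // /expc /= Rinv_1. ring.
  apply tsum_Cmod_le => // l nd.
  apply Rle_trans with (rsum (fun k => (Cmod w ^ 2 * (/ INR (fact k) * Cmod w ^ k))%R) l).
    apply rsum_le => k _. rewrite Cmod_mult Cmod_pow Cmod_R Rabs_pos_eq; last by left; apply Rinv_0_lt_compat, fact_pos.
    have w0 := Cmod_ge_0 w.
    replace (Cmod w ^ 2 * (/ INR (fact k) * Cmod w ^ k))%R with (/ INR (fact k) * Cmod w ^ (S (S k)))%R by (simpl; ring).
    apply Rmult_le_compat_r; first by apply pow_le. apply Rinv_le_contravar; first by apply fact_pos.
    apply le_INR. apply fact_le. lia.
  rewrite rsum_scal. apply Rmult_le_compat_l; first by apply pow_le, Cmod_ge_0.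
  apply rsum_exp => //. apply Cmod_ge_0.
Qed.

(** In the majorant, the summand |lam| d in the exponent covers the displacement of the base point
    inside the disc, and (1 + |lam|)^2 covers the second-order remainder of each exponential. *)
Lemma cder_expsum {A : Type} (c lam : A -> C) (x : C) (d : R) : 0 < d ->
  Rsummable (fun a => (Cmod (c a) * (1 + Cmod (lam a)) ^ 2 * exp (Re (lam a * x) + Cmod (lam a) * d))%R) ->
  cder (fun y => tsum (fun a => c a * Cexp (lam a * y))) x (tsum (fun a => c a * lam a * Cexp (lam a * x))).
Proof.
  move=> hd H.
  have sq : forall a, 1 <= (1 + Cmod (lam a)) ^ 2 by move=> a; have := Cmod_ge_0 (lam a); nra.
  have bd : forall a h, Cmod h < d -> exp (Re (lam a * (x + h))) <= exp (Re (lam a * x) + Cmod (lam a) * d).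
    move=> a h hh. have : Re (lam a * (x + h)) <= Re (lam a * x) + Cmod (lam a) * d.
      have -> : Re (lam a * (x + h)) = (Re (lam a * x) + Re (lam a * h))%R by rewrite /Re /=; ring.
      have := re_le_Cmod (lam a * h). have := Rle_abs (Re (lam a * h)). rewrite Cmod_mult.
      have := Cmod_ge_0 (lam a). nra.
    case => [h1|->]; [by left; apply exp_increasing | by right].
  apply (cder_tsum (fun a y => c a * Cexp (lam a * y)) (fun a y => c a * lam a * Cexp (lam a * y)) x d
     (fun a => (Cmod (c a) * (1 + Cmod (lam a)) ^ 2 * exp (Re (lam a * x) + Cmod (lam a) * d))%R)) => //.
  - move=> y hy. apply: summable_le H => a. rewrite Cmod_mult Cmod_Cexp.
    have := bd a (y - x) hy. replace (x + (y - x)) with y by ring. move=> b.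
    have c0 := Cmod_ge_0 (c a). have e0 := exp_pos (Re (lam a * y)). have s := sq a.
    rewrite Rmult_assoc. apply Rmult_le_compat_l => //. nra.
  - apply: (summable_le _ _ _ H) => a. rewrite (Cmod_mult (c a * lam a)) (Cmod_mult (c a)) Cmod_Cexp.
    have := bd a 0. rewrite Cmod_0 Cplus_0_r => b0. have b := b0 hd.
    have c0 := Cmod_ge_0 (c a). have l0 := Cmod_ge_0 (lam a). have e0 := exp_pos (Re (lam a * x)).
    rewrite !Rmult_assoc. apply Rmult_le_compat_l => //. rewrite -!Rmult_assoc.
    apply Rmult_le_compat; try lra. nra.
  - move=> a h hh.
    replace (c a * Cexp (lam a * (x + h)) - c a * Cexp (lam a * x) - c a * lam a * Cexp (lam a * x) * h) with
     (c a * Cexp (lam a * x) * (Cexp (lam a * h) - 1 - lam a * h)).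
      2: { rewrite Cmult_plus_distr_l Cexp_add. ring. }
    rewrite !(Cmod_Cexp, Cmod_mult).
    have := Cexp_second_order (lam a * h). rewrite Cmod_mult => B.
    have c0 := Cmod_ge_0 (c a). have l0 := Cmod_ge_0 (lam a). have h0 := Cmod_ge_0 h.
    have e0 := exp_pos (Re (lam a * x)).
    have B2 : exp (Cmod (lam a) * Cmod h) <= exp (Cmod (lam a) * d).
      case: (Rle_lt_or_eq_dec (Cmod (lam a) * Cmod h) (Cmod (lam a) * d)) => [|h1|->]; last by right.
        apply Rmult_le_compat_l; lra.
      left. by apply exp_increasing.
    rewrite exp_plus.
    apply Rle_trans with (Cmod (c a) * exp (Re (lam a * x)) * ((Cmod (lam a) * Cmod h) ^ 2 * exp (Cmod (lam a) * d)))%R.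
      apply Rmult_le_compat_l; first nra. apply: Rle_trans B _. apply Rmult_le_compat_l => //. apply pow_le; nra.
    have e1 := exp_pos (Cmod (lam a) * d).
    set E := (Cmod (c a) * exp (Re (lam a * x)) * exp (Cmod (lam a) * d) * Cmod h ^ 2)%R.
    have E0 : 0 <= E by rewrite /E; apply Rmult_le_pos; [apply Rmult_le_pos; nra | apply pow_le].
    replace (Cmod (c a) * exp (Re (lam a * x)) * ((Cmod (lam a) * Cmod h) ^ 2 * exp (Cmod (lam a) * d)))%R with (Cmod (lam a) ^ 2 * E)%R by (rewrite /E; ring).
    replace (Cmod (c a) * (1 + Cmod (lam a)) ^ 2 * (exp (Re (lam a * x)) * exp (Cmod (lam a) * d)) * Cmod h ^ 2)%R with ((1 + Cmod (lam a)) ^ 2 * E)%R by (rewrite /E; ring).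
    apply Rmult_le_compat_r => //. nra.
Qed.

Lemma has_sum_is_pseries (a : nat -> C) (y s : C) : has_sum (fun k => a k * y ^ k) s ->
  @is_pseries C_AbsRing C_NormedModule a y s.
Proof.
  move=> H P /locally_C_eps [d [hd hP]].
  have [N hN] := has_sum_climit _ _ H d hd.
  exists N => n hn. apply hP.
  have -> : sum_n (fun k => @scal C_AbsRing C_NormedModule (@pow_n C_AbsRing y k) (a k)) n = lsum (fun k => a k * y ^ k) (seq 0 (S n)).
    rewrite -sum_n_lsum. apply sum_n_ext => k.
    have -> : @pow_n C_AbsRing y k = y ^ k by elim: k => [//|k IH] /=; rewrite IH.
    rewrite /scal /= /mult /=. ring.
  apply hN. lia.
Qed.

(** Each exponential is expanded about x, and the resulting double series converges absolutely, so
    summation over the exponents may be carried out inside the coefficient of each power. *)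
Lemma analytic_expsum {A : Type} (c lam : A -> C) (x : C) (d : R) : 0 < d ->
  Rsummable (fun a => (Cmod (c a) * exp (Re (lam a * x) + Cmod (lam a) * d))%R) ->
  analytic_at (fun y => tsum (fun a => c a * Cexp (lam a * y))) x.
Proof.
  move=> hd H.
  exists (fun k => tsum (fun a => c a * Cexp (lam a * x) * (expc k * lam a ^ k))).
  apply locally_C_eps. exists d; split => // y hy.
  apply has_sum_is_pseries.
  set h := y - x in hy *.
  pose F := fun p : A * nat => c (fst p) * Cexp (lam (fst p) * x) * (expc (snd p) * lam (fst p) ^ (snd p)) * h ^ (snd p).
  have SF : summable F.
    apply (Rsummable_pair _ (fun a => (Cmod (c a) * exp (Re (lam a * x) + Cmod (lam a) * d))%R)) => //.
      move=> p; apply Cmod_ge_0.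
    move=> a l nd. rewrite /F /=.
    rewrite exp_plus -Rmult_assoc.
    apply Rle_trans with (rsum (fun k => (Cmod (c a) * exp (Re (lam a * x)) * (/ INR (fact k) * (Cmod (lam a) * d) ^ k))%R) l).
      apply rsum_le => k _. rewrite !(Cmod_Cexp, Cmod_mult, Cmod_pow) Cmod_R Rabs_pos_eq; last by left; apply Rinv_0_lt_compat, fact_pos.
      rewrite Rmult_assoc. apply Rmult_le_compat_l.
        apply Rmult_le_pos; [apply Cmod_ge_0 | left; apply exp_pos].
      rewrite Rpow_mult_distr -Rmult_assoc. apply Rmult_le_compat_l.
        apply Rmult_le_pos; [left; apply Rinv_0_lt_compat, fact_pos | apply pow_le, Cmod_ge_0].
      apply pow_incr. split; [apply Cmod_ge_0 | lra].
    rewrite rsum_scal. apply Rmult_le_compat_l.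
      apply Rmult_le_pos; [apply Cmod_ge_0 | left; apply exp_pos].
    apply rsum_exp => //. apply Rmult_le_pos; [apply Cmod_ge_0 | lra].
  have -> : tsum (fun a => c a * Cexp (lam a * y)) = tsum F.
    rewrite tsum_fubini //. apply tsum_ext => a. rewrite /F /=.
    have -> : lam a * y = lam a * x + lam a * h by rewrite /h; ring.
    rewrite Cexp_add (Cexp_psum (lam a * h)) /psum.
    rewrite Cmult_assoc -tsum_scal.
      apply tsum_ext => k. rewrite Cpow_mult_l. ring.
    apply (summable_psum expc (lam a * h) (Cmod (lam a * h))); [by right | apply Rsummable_exp, Cmod_ge_0].
  have SF' := summable_swap _ SF.
  have -> : tsum F = tsum (fun p => F (pswap p)).
    symmetry. apply (tsum_bij pswap pswap) => //; by case.
  apply (has_sum_fubini (fun p => F (pswap p))); first by apply tsum_correct.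
  move=> k. have -> : tsum (fun a => c a * Cexp (lam a * x) * (expc k * lam a ^ k)) * h ^ k = tsum (fun a => F (pswap (k, a))).
    (* Summability of the coefficient series is obtained from that of its multiple by h^k, hence the
       separate case h^k = 0. *)
    case: (Ceq_dec (h ^ k) 0) => hk.
      rewrite hk Cmult_0_r. symmetry. apply has_sum_tsum. apply: has_sum_ext has_sum_zero => a. rewrite /F /= hk. ring.
    rewrite Cmult_comm -tsum_scal.
      apply tsum_ext => a. rewrite /F /=. ring.
    apply (summable_ext (fun a => / h ^ k * F (pswap (k, a)))).
      move=> a. rewrite /F /=. field. exact hk.
    apply summable_scal. by apply (summable_row (fun p => F (pswap p))).
  apply tsum_correct. by apply (summable_row (fun p => F (pswap p))).
Qed.

(** The polynomial factor is at most j! exp (1 + u), and completing the square bounds 1 + u - y u^2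
    + M u by 1 + (M + 2)^2 / (4 y) - u; this leaves a geometric series and accounts for [K]. *)
Lemma Rsummable_gauss (y M : R) (j : nat) : 0 < y ->
  Rsummable (fun a : Z => ((1 + Rabs (IZR a)) ^ j * exp (- y * IZR a ^ 2 + M * Rabs (IZR a)))%R).
Proof.
  move=> hy.
  pose K := (INR (fact j) * exp (1 + (M + 2) ^ 2 / (4 * y)))%R.
  have g : Rsummable (fun a : Z => exp (- Rabs (IZR a))).
    have G : Rsummable (fun n : nat => exp (- INR n)).
      apply: Rsummable_le (Rsummable_geom (exp (- 1)) _).
        move=> n. right. elim: n => [|n IH]; first by rewrite /= Ropp_0 exp_0.
        rewrite S_INR Ropp_plus_distr exp_plus IH. simpl pow. replace (exp (- (1)))%R with (exp (- 1))%R by (f_equal; lra). ring.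
      split; first by left; apply exp_pos. rewrite -exp_0. apply exp_increasing. lra.
    apply Rsummable_Z.
    - move=> n; left; apply exp_pos.
    - apply: Rsummable_le G => n. right. by rewrite -INR_IZR_INZ Rabs_pos_eq //; apply pos_INR.
    - apply: Rsummable_le G => n. right. rewrite opp_IZR -INR_IZR_INZ Rabs_Ropp Rabs_pos_eq //; apply pos_INR.
  apply: Rsummable_le (Rsummable_scal K _ _ g); last by apply Rmult_le_pos; [apply pos_INR | left; apply exp_pos].
  move=> a. rewrite -(pow2_abs (IZR a)). have u0 := Rabs_pos (IZR a). move: (Rabs (IZR a)) u0 => u u0.
  have A : ((1 + u) ^ j <= INR (fact j) * exp (1 + u)).
    have := rsum_exp (1 + u) [j] ltac:(lra) ltac:(repeat constructor; auto). simpl. rewrite Rplus_0_r => h.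
    apply (Rmult_le_reg_l (/ INR (fact j))); first by apply Rinv_0_lt_compat, fact_pos.
    rewrite -Rmult_assoc Rinv_l; last by apply INR_fact_neq_0. rewrite Rmult_1_l. exact h.
  apply Rle_trans with (INR (fact j) * exp (1 + u) * exp (- y * u ^ 2 + M * u))%R.
    apply Rmult_le_compat_r => //. left; apply exp_pos.
  have B : exp (1 + u) * exp (- y * u ^ 2 + M * u) <= exp (1 + (M + 2) ^ 2 / (4 * y)) * exp (- u).
    rewrite -!exp_plus.
    have : 1 + u + (- y * u ^ 2 + M * u) <= 1 + (M + 2) ^ 2 / (4 * y) + - u.
      apply (Rmult_le_reg_l (4 * y)); first lra.
      replace (4 * y * (1 + (M + 2) ^ 2 / (4 * y) + - u))%R with (4 * y * (1 - u) + (M + 2) ^ 2)%R by (field; lra).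
      have := pow2_ge_0 (2 * y * u - (M + 2)). simpl. nra.
    case => [h|->]; [left; by apply exp_increasing | by right].
  apply Rle_trans with (INR (fact j) * (exp (1 + (M + 2) ^ 2 / (4 * y)) * exp (- u)))%R; last by rewrite /K; right; ring.
  rewrite Rmult_assoc. apply Rmult_le_compat_l => //. by apply pos_INR.
Qed.

(** * Differential identities of an odd theta function *)

Lemma cder_transfer F G y a b : (forall z, F z = G z) -> cder F y a -> cder G y b -> a = b.
Proof.
  move=> E HF HG. apply (cder_unique G y) => //. by have <- : F = G by apply functional_extensionality.
Qed.

Ltac cder_step :=
  match goal with
  | |- cder (fun _ => ?c) _ _ => eapply cder_const
  | |- cder (fun y => y) _ _ => eapply cder_id
  | |- cder (fun y => (@?f y) + (@?g y)) _ _ => eapply (cder_plus f g)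
  | |- cder (fun y => (@?f y) - (@?g y)) _ _ => eapply (cder_minus f g)
  | |- cder (fun y => ?c * (@?g y)) _ _ => eapply (cder_scalf c g)
  | |- cder (fun y => (@?f y) * (@?g y)) _ _ => eapply (cder_mult f g)
  | |- cder (fun y => (@?f y) / (@?g y)) _ _ => eapply (cder_div f g)
  | |- cder (fun y => (@?f y) ^ ?n) _ _ => eapply (cder_pow f _ _ n)
  | |- cder (fun y => ?g (@?h y)) _ _ => eapply (cder_comp g h)
  | |- cder _ _ _ => solve [eauto]
  end.

Ltac cder_solve := lazymatch goal with |- cder ?f ?x ?l => eapply (cder_eq f x _ l); [ | repeat cder_step ] end.

Section OddTheta.
Variables (f o e : nat -> C -> C).
Hypothesis Hf : forall k x, cder (f k) x (f (S k) x).
Hypothesis Ho : forall k x, cder (o k) x (o (S k) x).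
Hypothesis He : forall k x, cder (e k) x (e (S k) x).
Hypothesis f00 : f 0 0 = 0.
Hypothesis f20 : f 2 0 = 0.
Hypothesis o10 : o 1 0 = 0.
Hypothesis e10 : e 1 0 = 0.
Hypothesis H0 : forall x y, f 0 (x + y) * f 0 (x - y) = o 0 x * e 0 y - e 0 x * o 0 y.

(** The first index is the order of the derivative. Differentiating the addition formula in y and
    setting y = 0 gives nothing in odd order, where the left side cancels. Even orders express
    bilinear forms in the derivatives of f as combinations of o(x) and e(x) with constant
    coefficients: [oddtheta_L0], [oddtheta_L2], [oddtheta_L4]. *)
Lemma oddtheta1 x y : f 1 (x + y) * f 0 (x - y) - f 0 (x + y) * f 1 (x - y) = o 0 x * e 1 y - e 0 x * o 1 y.
Proof. refine (cder_transfer _ _ y _ _ (H0 x) _ _); cder_solve; ring. Qed.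

Lemma oddtheta2 x y : f 2 (x + y) * f 0 (x - y) - 2 * (f 1 (x + y) * f 1 (x - y)) + f 0 (x + y) * f 2 (x - y)
  = o 0 x * e 2 y - e 0 x * o 2 y.
Proof. refine (cder_transfer _ _ y _ _ (oddtheta1 x) _ _); cder_solve; ring. Qed.

Lemma oddtheta3 x y : f 3 (x + y) * f 0 (x - y) - 3 * (f 2 (x + y) * f 1 (x - y)) + 3 * (f 1 (x + y) * f 2 (x - y))
  - f 0 (x + y) * f 3 (x - y) = o 0 x * e 3 y - e 0 x * o 3 y.
Proof. refine (cder_transfer _ _ y _ _ (oddtheta2 x) _ _); cder_solve; ring. Qed.

Lemma oddtheta4 x y : f 4 (x + y) * f 0 (x - y) - 4 * (f 3 (x + y) * f 1 (x - y)) + 6 * (f 2 (x + y) * f 2 (x - y))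
  - 4 * (f 1 (x + y) * f 3 (x - y)) + f 0 (x + y) * f 4 (x - y) = o 0 x * e 4 y - e 0 x * o 4 y.
Proof. refine (cder_transfer _ _ y _ _ (oddtheta3 x) _ _); cder_solve; ring. Qed.

Lemma oddtheta_L0 x : f 0 x * f 0 x = o 0 x * e 0 0 - e 0 x * o 0 0.
Proof. have := H0 x 0. by rewrite Cplus_0_r; replace (x - 0) with x by ring. Qed.

Lemma oddtheta_L2 x : 2 * (f 2 x * f 0 x) - 2 * (f 1 x * f 1 x) = o 0 x * e 2 0 - e 0 x * o 2 0.
Proof. have := oddtheta2 x 0. rewrite Cplus_0_r; replace (x - 0) with x by ring. move=> <-. ring. Qed.

Lemma oddtheta_L4 x : 2 * (f 4 x * f 0 x) - 8 * (f 3 x * f 1 x) + 6 * (f 2 x * f 2 x) = o 0 x * e 4 0 - e 0 x * o 4 0.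
Proof. have := oddtheta4 x 0. rewrite Cplus_0_r; replace (x - 0) with x by ring. move=> <-. ring. Qed.

Lemma oddtheta_L0' x : 2 * (f 0 x * f 1 x) = o 1 x * e 0 0 - e 1 x * o 0 0.
Proof. refine (cder_transfer _ _ x _ _ oddtheta_L0 _ _); cder_solve; ring. Qed.

Lemma oddtheta_L2' x : 2 * (f 3 x * f 0 x) - 2 * (f 1 x * f 2 x) = o 1 x * e 2 0 - e 1 x * o 2 0.
Proof. refine (cder_transfer _ _ x _ _ oddtheta_L2 _ _); cder_solve; ring. Qed.

Lemma oddtheta_L4' x : 2 * (f 5 x * f 0 x) - 6 * (f 4 x * f 1 x) + 4 * (f 3 x * f 2 x) = o 1 x * e 4 0 - e 1 x * o 4 0.
Proof. refine (cder_transfer _ _ x _ _ oddtheta_L4 _ _); cder_solve; ring. Qed.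

(** At y = x the factor f(x - y) vanishes, and what remains is the Wronskian of o and e. This is how
    values at the doubled argument enter. *)
Lemma oddtheta_W x : f 1 0 * f 0 (2 * x) = e 0 x * o 1 x - o 0 x * e 1 x.
Proof.
  have := oddtheta1 x x. replace (x - x) with (RtoC 0) by ring. replace (x + x) with (2 * x) by ring.
  rewrite f00 => h. replace (e 0 x * o 1 x - o 0 x * e 1 x) with (- (o 0 x * e 1 x - e 0 x * o 1 x)) by ring.
  rewrite -h. ring.
Qed.

Lemma oddtheta_W1 x : 2 * (f 1 0 * f 1 (2 * x)) = e 0 x * o 2 x - o 0 x * e 2 x.
Proof. refine (cder_transfer _ _ x _ _ oddtheta_W _ _); cder_solve; ring. Qed.

Lemma oddtheta_W2 x : 4 * (f 1 0 * f 2 (2 * x)) = e 1 x * o 2 x + e 0 x * o 3 x - o 1 x * e 2 x - o 0 x * e 3 x.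
Proof. refine (cder_transfer _ _ x _ _ oddtheta_W1 _ _); cder_solve; ring. Qed.

Lemma oddtheta_W3 x : 8 * (f 1 0 * f 3 (2 * x)) = 2 * (e 1 x * o 3 x) + e 0 x * o 4 x - 2 * (o 1 x * e 3 x) - o 0 x * e 4 x.
Proof. refine (cder_transfer _ _ x _ _ oddtheta_W2 _ _); cder_solve; ring. Qed.

(** In terms of the logarithmic derivative this reads f(x)^4 (log f)'''(x) = J^3 f(2x), the analogue
    of P'(x) = - sigma(2x) / sigma(x)^4. Since L0 and L2 are constant combinations of o and e, their
    Wronskian is the Wronskian of o and e times a constant determinant, and [oddtheta_W1] at 0
    evaluates that determinant as 2 J^2. *)
Lemma oddtheta_duplication x :
  f 0 x * (f 3 x * f 0 x ^ 2 - 3 * f 0 x * f 1 x * f 2 x + 2 * f 1 x ^ 3) = f 1 0 ^ 3 * f 0 (2 * x).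
Proof.
  have W1 := oddtheta_W1 0. replace (2 * 0) with (RtoC 0) in W1 by ring.
  have E : (2 * (f 3 x * f 0 x) - 2 * (f 1 x * f 2 x)) * (f 0 x * f 0 x) -
    (2 * (f 2 x * f 0 x) - 2 * (f 1 x * f 1 x)) * (2 * (f 0 x * f 1 x)) = 2 * (f 1 0 ^ 3 * f 0 (2 * x)).
    rewrite oddtheta_L0 oddtheta_L2 oddtheta_L0' oddtheta_L2'.
    transitivity ((e 0%nat x * o 1%nat x - o 0%nat x * e 1%nat x) * (e 0%nat 0 * o 2%nat 0 - o 0%nat 0 * e 2%nat 0)); first ring.
    rewrite -W1 -oddtheta_W. ring.
  transitivity (/ 2 * (2 * (f 1%nat 0 ^ 3 * f 0%nat (2 * x)))); last by field.
  rewrite -E. field.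
Qed.

Lemma oddtheta_dup x :
  f 0 x * (f 3 x * (f 0 x * f 0 x) - 3 * (f 0 x * (f 1 x * f 2 x)) + 2 * (f 1 x * (f 1 x * f 1 x)))
  = f 1 0 ^ 3 * f 0 (2 * x).
Proof. rewrite -oddtheta_duplication. simpl. ring. Qed.

Lemma oddtheta_dup1 x :
  f 1 x * (f 3 x * (f 0 x * f 0 x) - 3 * (f 0 x * (f 1 x * f 2 x)) + 2 * (f 1 x * (f 1 x * f 1 x)))
  + f 0 x * (f 4 x * (f 0 x * f 0 x) - f 0 x * (f 1 x * f 3 x) + 3 * (f 1 x * (f 1 x * f 2 x)) - 3 * (f 0 x * (f 2 x * f 2 x)))
  = 2 * (f 1 0 ^ 3 * f 1 (2 * x)).
Proof. refine (cder_transfer _ _ x _ _ oddtheta_dup _ _); cder_solve; ring. Qed.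

Lemma oddtheta_dup2 x :
  f 2 x * (f 3 x * (f 0 x * f 0 x) - 3 * (f 0 x * (f 1 x * f 2 x)) + 2 * (f 1 x * (f 1 x * f 1 x)))
  + 2 * (f 1 x * (f 4 x * (f 0 x * f 0 x) - f 0 x * (f 1 x * f 3 x) + 3 * (f 1 x * (f 1 x * f 2 x)) - 3 * (f 0 x * (f 2 x * f 2 x))))
  + f 0 x * (f 5 x * (f 0 x * f 0 x) + f 4 x * (f 0 x * f 1 x) + 2 * (f 1 x * (f 1 x * f 3 x)) - 7 * (f 0 x * (f 2 x * f 3 x)) + 3 * (f 1 x * (f 2 x * f 2 x)))
  = 4 * (f 1 0 ^ 3 * f 2 (2 * x)).
Proof. refine (cder_transfer _ _ x _ _ oddtheta_dup1 _ _); cder_solve; ring. Qed.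

(** The same determinant with L4 in place of L2. The constant factor is now [oddtheta_W3] at 0, in
    which o'(0) = e'(0) = 0 leaves 8 J f'''(0); this is the relation that reaches f'''(0), hence the
    tau-derivative of J. *)
Lemma oddtheta_third x :
  (2 * (f 5 x * f 0 x) - 6 * (f 4 x * f 1 x) + 4 * (f 3 x * f 2 x)) * (f 0 x * f 0 x) -
    (2 * (f 4 x * f 0 x) - 8 * (f 3 x * f 1 x) + 6 * (f 2 x * f 2 x)) * (2 * (f 0 x * f 1 x))
  = 8 * f 1 0 ^ 2 * f 3 0 * f 0 (2 * x).
Proof.
  have W3 := oddtheta_W3 0. replace (2 * 0) with (RtoC 0) in W3 by ring.
  rewrite o10 e10 in W3.
  rewrite oddtheta_L0 oddtheta_L4 oddtheta_L0' oddtheta_L4'.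
  transitivity ((e 0%nat x * o 1%nat x - o 0%nat x * e 1%nat x) * (2 * (0 * o 3%nat 0) + e 0%nat 0 * o 4%nat 0 - 2 * (0 * e 3%nat 0) - o 0%nat 0 * e 4%nat 0)); first ring.
  rewrite -W3 -oddtheta_W. ring.
Qed.

End OddTheta.

(** * Theta series *)

(** The theta series with modulus t, coefficients c and argument v; the index k is the order of the
    derivative in v. *)
Definition TH (c : Z -> C) (k : nat) (t v : C) : C :=
  tsum (fun a : Z => c a * (Ci * IZR a) ^ k * Cexp (PI * Ci * t * IZR a ^ 2 + Ci * IZR a * v)).

Definition bounded1 (c : Z -> C) : Prop := forall a, Cmod (c a) <= 1.

Lemma Re_theta_exponent (t v : C) (a : Z) :
  Re (PI * Ci * t * IZR a ^ 2 + Ci * IZR a * v) = (- (PI * Im t) * IZR a ^ 2 - IZR a * Im v)%R.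
Proof. rewrite /Re /Im /=. ring. Qed.

Lemma Cmod_iZ (a : Z) : Cmod (Ci * IZR a) = Rabs (IZR a).
Proof. rewrite Cmod_mult Cmod_Ci Cmod_R. ring. Qed.

Lemma exp_le (x y : R) : x <= y -> exp x <= exp y.
Proof. case => [h|->]; [left; by apply exp_increasing | by right]. Qed.

Lemma Rsummable_theta (t v : C) (M : R) (j : nat) : 0 < Im t ->
  Rsummable (fun a : Z => ((1 + Rabs (IZR a)) ^ j * exp (Re (PI * Ci * t * IZR a ^ 2 + Ci * IZR a * v) + M * Rabs (IZR a)))%R).
Proof.
  move=> ht.
  have hy : 0 < PI * Im t by apply Rmult_lt_0_compat => //; apply PI_RGT_0.
  apply: Rsummable_le (Rsummable_gauss (PI * Im t) (M + Rabs (Im v)) j hy) => a.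
  apply Rmult_le_compat_l; first by apply pow_le; have := Rabs_pos (IZR a); lra.
  apply exp_le. rewrite Re_theta_exponent.
  have : (- (IZR a * Im v) <= Rabs (IZR a) * Rabs (Im v)) by rewrite -Rabs_mult -Rabs_Ropp; apply Rle_abs.
  lra.
Qed.

Lemma coef_bound (c : Z -> C) (k : nat) (a : Z) : bounded1 c -> Cmod (c a * (Ci * IZR a) ^ k) <= (1 + Rabs (IZR a)) ^ k.
Proof.
  move=> hc. rewrite Cmod_mult Cmod_pow Cmod_iZ.
  have h := hc a. have h0 := Cmod_ge_0 (c a). have a0 := Rabs_pos (IZR a).
  have : (Rabs (IZR a) ^ k <= (1 + Rabs (IZR a)) ^ k) by apply pow_incr; lra.
  have : (0 <= Rabs (IZR a) ^ k) by apply pow_le. nra.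
Qed.

Lemma summable_TH (c : Z -> C) (k : nat) (t v : C) : bounded1 c -> 0 < Im t ->
  summable (fun a : Z => c a * (Ci * IZR a) ^ k * Cexp (PI * Ci * t * IZR a ^ 2 + Ci * IZR a * v)).
Proof.
  move=> hc ht. apply: summable_le (Rsummable_theta t v 0 k ht) => a.
  rewrite Cmod_mult Cmod_Cexp Rmult_0_l Rplus_0_r.
  apply Rmult_le_compat_r; [left; apply exp_pos | by apply coef_bound].
Qed.

Lemma cder_TH_v (c : Z -> C) (k : nat) (t v : C) : bounded1 c -> 0 < Im t ->
  cder (TH c k t) v (TH c (S k) t v).
Proof.
  move=> hc ht.
  have H := cder_expsum (fun a : Z => c a * (Ci * IZR a) ^ k * Cexp (PI * Ci * t * IZR a ^ 2)) (fun a => Ci * IZR a) v 1 Rlt_0_1.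
  have E : forall u, TH c k t u = tsum (fun a : Z => c a * (Ci * IZR a) ^ k * Cexp (PI * Ci * t * IZR a ^ 2) * Cexp (Ci * IZR a * u)).
    move=> u. apply tsum_ext => a. rewrite Cexp_add. ring.
  have -> : TH c k t = (fun u => tsum (fun a : Z => c a * (Ci * IZR a) ^ k * Cexp (PI * Ci * t * IZR a ^ 2) * Cexp (Ci * IZR a * u))).
    by apply functional_extensionality.
  have -> : TH c (S k) t v = tsum (fun a : Z => c a * (Ci * IZR a) ^ k * Cexp (PI * Ci * t * IZR a ^ 2) * (Ci * IZR a) * Cexp (Ci * IZR a * v)).
    apply tsum_ext => a. rewrite Cexp_add Cpow_S. ring.
  apply H. apply: Rsummable_le (Rsummable_theta t v 1 (k + 2) ht) => a.
  rewrite Cmod_mult Cmod_Cexp Cmod_iZ pow_add.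
  have -> : (Re (PI * Ci * t * IZR a ^ 2 + Ci * IZR a * v) + 1 * Rabs (IZR a))%R =
    (Re (PI * Ci * t * IZR a ^ 2) + (Re (Ci * IZR a * v) + Rabs (IZR a) * 1))%R by rewrite /Re /=; ring.
  rewrite (exp_plus (Re (PI * Ci * t * IZR a ^ 2))).
  have B := coef_bound c k a hc.
  have e1 := exp_pos (Re (PI * Ci * t * IZR a ^ 2)). have e2 := exp_pos (Re (Ci * IZR a * v) + Rabs (IZR a) * 1).
  have a0 := Rabs_pos (IZR a).
  set P := ((1 + Rabs (IZR a)) ^ 2)%R. have P0 : 0 <= P by apply pow_le; lra.
  replace (Cmod (c a * (Ci * IZR a) ^ k) * exp (Re (PI * Ci * t * IZR a ^ 2)) * P * exp (Re (Ci * IZR a * v) + Rabs (IZR a) * 1))%R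
   with (Cmod (c a * (Ci * IZR a) ^ k) * (P * (exp (Re (PI * Ci * t * IZR a ^ 2)) * exp (Re (Ci * IZR a * v) + Rabs (IZR a) * 1))))%R by ring.
  rewrite (Rmult_assoc _ P). apply Rmult_le_compat_r => //.
  apply Rmult_le_pos => //. apply Rmult_le_pos; lra.
Qed.

(** The heat equation: a derivative in t multiplies the terms by pi i a^2, that is, by - pi i (i
    a)^2. *)
Lemma cder_TH_t (c : Z -> C) (k : nat) (t v : C) : bounded1 c -> 0 < Im t ->
  cder (fun s => TH c k s v) t (- (PI * Ci) * TH c (S (S k)) t v).
Proof.
  move=> hc ht.
  have hd : 0 < Im t / 2 by lra.
  have H := cder_expsum (fun a : Z => c a * (Ci * IZR a) ^ k * Cexp (Ci * IZR a * v)) (fun a => PI * Ci * IZR a ^ 2) t (Im t / 2) hd.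
  have -> : (fun s => TH c k s v) = (fun s => tsum (fun a : Z => c a * (Ci * IZR a) ^ k * Cexp (Ci * IZR a * v) * Cexp (PI * Ci * IZR a ^ 2 * s))).
    apply functional_extensionality => s. apply tsum_ext => a.
    rewrite Cexp_add. replace (PI * Ci * s * IZR a ^ 2) with (PI * Ci * IZR a ^ 2 * s) by ring. ring.
  have ci : Ci * Ci = - (1) by apply injective_projections; simpl; ring.
  have -> : - (PI * Ci) * TH c (S (S k)) t v = tsum (fun a : Z => c a * (Ci * IZR a) ^ k * Cexp (Ci * IZR a * v) * (PI * Ci * IZR a ^ 2) * Cexp (PI * Ci * IZR a ^ 2 * t)).
    rewrite /TH -tsum_scal; last by apply summable_TH.
    apply tsum_ext => a. rewrite Cexp_add !Cpow_S.
    replace (PI * Ci * t * (IZR a * (IZR a * IZR a ^ 0))) with (PI * Ci * (IZR a * (IZR a * IZR a ^ 0)) * t) by ring.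
    transitivity (- (Ci * Ci) * PI * Ci * c a * IZR a ^ 2 * (Ci * IZR a) ^ k * Cexp (PI * Ci * (IZR a * (IZR a * IZR a ^ 0)) * t) * Cexp (Ci * IZR a * v)); first (simpl; ring).
    rewrite ci. simpl. ring.
  apply H.
  have ht2 : 0 < Im (Ci * (Im t / 2)%R) by rewrite /Im /=; rewrite /Im in hd; lra.
  have PI0 := PI_RGT_0.
  (* The disc of radius Im t / 2 costs half of the Gaussian decay, so the majorant is the theta
     majorant at the purely imaginary point i Im t / 2. *)
  apply: Rsummable_le (Rsummable_scal ((1 + PI) ^ 2) _ _ (Rsummable_theta (Ci * (Im t / 2)%R) v 0 (k + 4) ht2)); last by apply pow_le; lra.
  move=> a. rewrite Cmod_mult Cmod_Cexp.
  have -> : Cmod (PI * Ci * IZR a ^ 2) = (PI * Rabs (IZR a) ^ 2)%R.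
    rewrite Cmod_mult (Cmod_mult PI) Cmod_pow !Cmod_R Cmod_Ci (Rabs_pos_eq PI); [ring | lra].
  have -> : (Re (PI * Ci * (Ci * (Im t / 2)%R) * IZR a ^ 2 + Ci * IZR a * v) + 0 * Rabs (IZR a))%R =
    (Re (Ci * IZR a * v) + (Re (PI * Ci * IZR a ^ 2 * t) + PI * Rabs (IZR a) ^ 2 * (Im t / 2)))%R.
    rewrite pow2_abs /Re /Im /=. field.
  rewrite (exp_plus (Re (Ci * IZR a * v))) pow_add.
  have B := coef_bound c k a hc. have a0 := Rabs_pos (IZR a).
  set e1 := exp (Re (Ci * IZR a * v)). set e2 := exp (Re (PI * Ci * IZR a ^ 2 * t) + _).
  have e10 : 0 < e1 by apply exp_pos. have e20 : 0 < e2 by apply exp_pos.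
  set P := (1 + PI * Rabs (IZR a) ^ 2)%R.
  have P0 : 0 <= P by rewrite /P; have := pow2_ge_0 (Rabs (IZR a)); nra.
  have P1 : P ^ 2 <= (1 + PI) ^ 2 * (1 + Rabs (IZR a)) ^ 4.
    replace ((1 + PI) ^ 2 * (1 + Rabs (IZR a)) ^ 4)%R with (((1 + PI) * (1 + Rabs (IZR a)) ^ 2) ^ 2)%R by ring.
    apply pow_incr. split => //. rewrite /P. simpl. nra.
  replace (Cmod (c a * (Ci * IZR a) ^ k) * e1 * P ^ 2 * e2)%R with (Cmod (c a * (Ci * IZR a) ^ k) * P ^ 2 * (e1 * e2))%R by ring.
  replace ((1 + PI) ^ 2 * ((1 + Rabs (IZR a)) ^ k * (1 + Rabs (IZR a)) ^ 4 * (e1 * e2)))%R with ((1 + Rabs (IZR a)) ^ k * ((1 + PI) ^ 2 * (1 + Rabs (IZR a)) ^ 4) * (e1 * e2))%R by ring.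
  apply Rmult_le_compat_r; first nra. apply Rmult_le_compat => //; first by apply Cmod_ge_0. by apply pow_le.
Qed.

(** * The character modulo 4 and the addition formula *)

Lemma Ci2 : Ci * Ci = - (1).
Proof. apply injective_projections; simpl; ring. Qed.

Lemma Cexp_2pi_Z (n : Z) : Cexp (2 * PI * Ci * IZR n) = 1.
Proof.
  have E1 : Cexp (2 * PI * Ci) = 1.
    rewrite /Cexp.
    have -> : Re (2 * PI * Ci) = 0%R by rewrite /Re /=; ring.
    have -> : Im (2 * PI * Ci) = (2 * PI)%R by rewrite /Im /=; ring.
    rewrite exp_0 cos_2PI sin_2PI. apply injective_projections; simpl; ring.
  have N : forall m : nat, Cexp (2 * PI * Ci * INR m) = 1.
    move=> m. have := Cexp_pow (2 * PI * Ci) m. rewrite E1 Cpow_1_l Cmult_comm. by move=> <-.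
  case: (Z_le_gt_dec 0 n) => h.
  - rewrite -(Z2Nat.id n h) -INR_IZR_INZ. apply N.
  - have M := N (Z.to_nat (- n)). rewrite INR_IZR_INZ Z2Nat.id in M; last lia.
    rewrite opp_IZR RtoC_opp in M.
    have := Cexp_add (2 * PI * Ci * IZR n) (2 * PI * Ci * - IZR n).
    rewrite M. replace (2 * PI * Ci * IZR n + 2 * PI * Ci * - IZR n) with (RtoC 0) by ring.
    rewrite Cexp_0 Cmult_1_r. by move=> <-.
Qed.

Lemma Cexp_imag (x : R) : Cexp (Ci * x) = (cos x, sin x).
Proof. rewrite Cexp_psum. apply psum_exp_imag. Qed.

Lemma Cexp_pi_i : Cexp (Ci * PI) = - (1).
Proof. rewrite Cexp_imag cos_PI sin_PI. apply injective_projections; simpl; ring. Qed.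

(** The nontrivial Dirichlet character modulo 4. With these coefficients the series is 2 i times the
    sum of (-1)^n exp (pi i t (2n+1)^2) sin ((2n+1) v), the odd Jacobi theta function up to
    normalization. *)
Definition chi (a : Z) : C :=
  if (a mod 4 =? 1)%Z then RtoC 1 else if (a mod 4 =? 3)%Z then - (1) else RtoC 0.

Definition oddc (a : Z) : C := if Z.odd a then RtoC 1 else RtoC 0.
Definition evenc (a : Z) : C := if Z.odd a then RtoC 0 else RtoC 1.

Lemma Cmod_opp1 : Cmod (- (1)) = 1%R.
Proof. by rewrite Cmod_opp Cmod_1. Qed.

Lemma chi_bounded : bounded1 chi.
Proof. move=> a. rewrite /chi. case: Z.eqb => //; [|case: Z.eqb]; rewrite ?Cmod_1 ?Cmod_opp1 ?Cmod_0; lra. Qed.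

Lemma oddc_bounded : bounded1 oddc.
Proof. move=> a. rewrite /oddc. case: Z.odd; rewrite ?Cmod_1 ?Cmod_0; lra. Qed.

Lemma evenc_bounded : bounded1 evenc.
Proof. move=> a. rewrite /evenc. case: Z.odd; rewrite ?Cmod_1 ?Cmod_0; lra. Qed.

Lemma mod4_cases (a : Z) : exists p, (a = 4 * p \/ a = 4 * p + 1 \/ a = 4 * p + 2 \/ a = 4 * p + 3)%Z.
Proof. exists (a / 4)%Z. have := Z.div_mod a 4 ltac:(lia). have := Z.mod_pos_bound a 4 ltac:(lia). lia. Qed.

Lemma chi_shift (p r : Z) : chi (4 * p + r) = chi r.
Proof. rewrite /chi. replace (4 * p + r)%Z with (r + p * 4)%Z by ring. by rewrite Z_mod_plus_full. Qed.

Lemma chi_even (a : Z) : Z.odd a = false -> chi a = 0.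
Proof.
  have [p H] := mod4_cases a.
  move: H => [->|[->|[->|->]]]; rewrite ?chi_shift.
  - move=> _. have := chi_shift p 0. by rewrite Z.add_0_r => ->.
  - by rewrite Z.odd_add Z.odd_mul.
  - done.
  - by rewrite Z.odd_add Z.odd_mul.
Qed.

Lemma chi_opp (a : Z) : chi (- a) = - (1) * chi a.
Proof.
  have [p H] := mod4_cases a.
  move: H => [->|[->|[->|->]]].
  - replace (- (4 * p))%Z with (4 * (- p) + 0)%Z by ring. replace (4 * p)%Z with (4 * p + 0)%Z by ring.
    rewrite !chi_shift /chi /=. ring.
  - replace (- (4 * p + 1))%Z with (4 * (- p - 1) + 3)%Z by ring. rewrite !chi_shift /chi /=. ring.
  - replace (- (4 * p + 2))%Z with (4 * (- p - 1) + 2)%Z by ring. rewrite !chi_shift /chi /=. ring.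
  - replace (- (4 * p + 3))%Z with (4 * (- p - 1) + 1)%Z by ring. rewrite !chi_shift /chi /=. ring.
Qed.

Lemma chi_mul3 (a : Z) : chi (3 * a) = - chi a.
Proof.
  have [p H] := mod4_cases a.
  move: H => [->|[->|[->|->]]].
  - replace (3 * (4 * p))%Z with (4 * (3 * p) + 0)%Z by ring. replace (4 * p)%Z with (4 * p + 0)%Z by ring.
    rewrite !chi_shift /chi /=. ring.
  - replace (3 * (4 * p + 1))%Z with (4 * (3 * p) + 3)%Z by ring. rewrite !chi_shift /chi /=. ring.
  - replace (3 * (4 * p + 2))%Z with (4 * (3 * p + 1) + 2)%Z by ring. rewrite !chi_shift /chi /=. ring.
  - replace (3 * (4 * p + 3))%Z with (4 * (3 * p + 2) + 1)%Z by ring. rewrite !chi_shift /chi /=. ring.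
Qed.

Lemma odd4 (p r : Z) : Z.odd (4 * p + r) = Z.odd r.
Proof. by rewrite Z.odd_add Z.odd_mul. Qed.

Lemma chi_prod (a b : Z) : chi (a + b) * chi (a - b) = oddc a * evenc b - evenc a * oddc b.
Proof.
  have [p H] := mod4_cases a. have [q H'] := mod4_cases b.
  have E : forall r s, a = (4 * p + r)%Z -> b = (4 * q + s)%Z ->
    chi (r + s) * chi (r - s) = oddc r * evenc s - evenc r * oddc s ->
    chi (a + b) * chi (a - b) = oddc a * evenc b - evenc a * oddc b.
    move=> r s -> ->. replace (4 * p + r + (4 * q + s))%Z with (4 * (p + q) + (r + s))%Z by ring.
    replace (4 * p + r - (4 * q + s))%Z with (4 * (p - q) + (r - s))%Z by ring.
    by rewrite !chi_shift /oddc /evenc !odd4.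
  move: H H' => [h|[h|[h|h]]] [h'|[h'|[h'|h']]];
  [apply (E 0 0)%Z | apply (E 0 1)%Z | apply (E 0 2)%Z | apply (E 0 3)%Z |
   apply (E 1 0)%Z | apply (E 1 1)%Z | apply (E 1 2)%Z | apply (E 1 3)%Z |
   apply (E 2 0)%Z | apply (E 2 1)%Z | apply (E 2 2)%Z | apply (E 2 3)%Z |
   apply (E 3 0)%Z | apply (E 3 1)%Z | apply (E 3 2)%Z | apply (E 3 3)%Z ];
  try lia; rewrite /chi /oddc /evenc /=; ring.
Qed.

(** Reindexing a pair of summation indices as (a + b, a - b) turns the sum of their squares into 2
    a^2 + 2 b^2. A pair outside the image has entries of different parity, where the product of the
    characters vanishes; on the image [chi_prod] separates a from b. *)
Lemma theta_addition (t x y : C) : 0 < Im t ->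
  TH chi 0 t (x + y) * TH chi 0 t (x - y) =
  TH oddc 0 (2 * t) (2 * x) * TH evenc 0 (2 * t) (2 * y) - TH evenc 0 (2 * t) (2 * x) * TH oddc 0 (2 * t) (2 * y).
Proof.
  move=> ht.
  have ht2 : 0 < Im (2 * t) by rewrite /Im /=; rewrite /Im in ht; lra.
  have Sc := fun v => summable_TH chi 0 t v chi_bounded ht.
  have So := fun v => summable_TH oddc 0 (2 * t) v oddc_bounded ht2.
  have Se := fun v => summable_TH evenc 0 (2 * t) v evenc_bounded ht2.
  rewrite /TH -(tsum_prod _ _ (Sc (x + y)) (Sc (x - y))).
  rewrite -(tsum_prod _ _ (So (2 * x)) (Se (2 * y))) -(tsum_prod _ _ (Se (2 * x)) (So (2 * y))).
  rewrite -tsum_minus; [|by apply: (summable_prod _ _ (So (2 * x)) (Se (2 * y))) | by apply: (summable_prod _ _ (Se (2 * x)) (So (2 * y)))].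
  pose p := fun q : Z * Z => ((fst q + snd q)%Z, (fst q - snd q)%Z).
  rewrite -(tsum_inj p).
  - apply tsum_ext => -[a b]. rewrite /p; cbn [fst snd]. rewrite minus_IZR plus_IZR RtoC_minus RtoC_plus.
    set A := RtoC (IZR a). set B := RtoC (IZR b).
    set E1 := Cexp (PI * Ci * t * (A + B) ^ 2 + Ci * (A + B) * (x + y)).
    set E2 := Cexp (PI * Ci * t * (A - B) ^ 2 + Ci * (A - B) * (x - y)).
    have E : forall u v u' v' : C, u * (Ci * A) ^ 0 * Cexp (PI * Ci * (2 * t) * A ^ 2 + Ci * A * (2 * x)) *
       (v * (Ci * B) ^ 0 * Cexp (PI * Ci * (2 * t) * B ^ 2 + Ci * B * (2 * y))) = u * v * (E1 * E2).
      move=> u v _ _. rewrite /E1 /E2 -Cexp_add.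
      replace (PI * Ci * t * (A + B) ^ 2 + Ci * (A + B) * (x + y) + (PI * Ci * t * (A - B) ^ 2 + Ci * (A - B) * (x - y)))
       with ((PI * Ci * (2 * t) * A ^ 2 + Ci * A * (2 * x)) + (PI * Ci * (2 * t) * B ^ 2 + Ci * B * (2 * y))) by ring.
      rewrite (Cexp_add (PI * Ci * (2 * t) * A ^ 2 + Ci * A * (2 * x)) (PI * Ci * (2 * t) * B ^ 2 + Ci * B * (2 * y))). simpl. ring.
    rewrite !E //. rewrite /=. transitivity (chi (a + b) * chi (a - b) * (E1 * E2)); first (rewrite /=; ring).
    rewrite chi_prod. ring.
  - move=> [a b] [c d] E. inversion E. f_equal; lia.
  - move=> [c d] n; cbn [fst snd].
    case hc : (Z.odd c); last by rewrite (chi_even _ hc); ring.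
    case hd : (Z.odd d); last by rewrite (chi_even _ hd); ring.
    case: (n ((c + d) / 2, (c - d) / 2)%Z).
    have := Zodd_bool_iff c. have := Zodd_bool_iff d. rewrite hc hd.
    have [c' Ec] := proj1 (Z.odd_spec c) hc. have [d' Ed] := proj1 (Z.odd_spec d) hd.
    move=> _ _. rewrite /p Ec Ed; cbn [fst snd].
    replace (2 * c' + 1 + (2 * d' + 1))%Z with ((c' + d' + 1) * 2)%Z by ring.
    replace (2 * c' + 1 - (2 * d' + 1))%Z with ((c' - d') * 2)%Z by ring.
    rewrite !Z_div_mult; try lia. f_equal; ring.
  - exact: (summable_prod _ _ (Sc (x + y)) (Sc (x - y))).
Qed.

Lemma TH_opp (c : Z -> C) (s : C) (k : nat) (t v : C) : bounded1 c -> 0 < Im t ->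
  (forall a, c (- a)%Z = s * c a) -> TH c k t (- v) = s * (- (1)) ^ k * TH c k t v.
Proof.
  move=> hc ht H. rewrite /TH -tsum_scal; last by apply summable_TH.
  rewrite -(tsum_bij Z.opp Z.opp _ Z.opp_involutive Z.opp_involutive (summable_TH c k t (- v) hc ht)).
  apply tsum_ext => a. rewrite H opp_IZR RtoC_opp.
  replace (PI * Ci * t * (- IZR a) ^ 2 + Ci * - IZR a * - v) with (PI * Ci * t * IZR a ^ 2 + Ci * IZR a * v) by ring.
  replace (Ci * - IZR a) with (- (1) * (Ci * IZR a)) by ring. rewrite Cpow_mult_l. ring.
Qed.

Lemma Cexp_odd (a : Z) : Z.odd a = true -> Cexp (Ci * PI * IZR a) = - (1).
Proof.
  move=> /Z.odd_spec [n ->]. rewrite plus_IZR mult_IZR RtoC_plus RtoC_mult.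
  replace (Ci * PI * (2 * IZR n + 1)) with (2 * PI * Ci * IZR n + Ci * PI) by ring.
  by rewrite Cexp_add Cexp_2pi_Z Cexp_pi_i Cmult_1_l.
Qed.

Lemma theta_reflect (k : nat) (t v : C) : 0 < Im t -> TH chi k t (PI - v) = (- (1)) ^ k * TH chi k t v.
Proof.
  move=> ht. rewrite /TH -tsum_scal; last by apply summable_TH => //; apply chi_bounded.
  rewrite -(tsum_bij Z.opp Z.opp _ Z.opp_involutive Z.opp_involutive (summable_TH chi k t (PI - v) chi_bounded ht)).
  apply tsum_ext => a. rewrite chi_opp opp_IZR RtoC_opp.
  case ha : (Z.odd a); last by rewrite (chi_even _ ha); ring.
  replace (PI * Ci * t * (- IZR a) ^ 2 + Ci * - IZR a * (PI - v)) with
    ((PI * Ci * t * IZR a ^ 2 + Ci * IZR a * v) + Ci * PI * - IZR a) by ring.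
  have := Cexp_odd (- a)%Z. rewrite opp_IZR RtoC_opp Z.odd_opp => h. rewrite Cexp_add (h ha).
  replace (Ci * - IZR a) with (- (1) * (Ci * IZR a)) by ring. rewrite Cpow_mult_l. ring.
Qed.

Lemma self_opp_0 (x : C) : x = - x -> x = 0.
Proof. move=> h. replace x with (/ 2 * (x + x)) by field. rewrite {1}h. ring. Qed.

(** For odd a this is 2 cos (a pi / 3), so only the residues 1, 3, 5 modulo 6 have to be
    considered. *)
Lemma third_root_sum (a : Z) : Z.odd a = true ->
  Cexp (Ci * IZR a * (PI / 3)%R) + Cexp (Ci * IZR a * - (PI / 3)%R) = if (a mod 3 =? 0)%Z then - (2) else RtoC 1.
Proof.
  move=> ha.
  have [q Hq] : exists q, (a = 6 * q + 1 \/ a = 6 * q + 3 \/ a = 6 * q + 5)%Z.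
    exists (a / 6)%Z. have := Z.div_mod a 6 ltac:(lia). have := Z.mod_pos_bound a 6 ltac:(lia).
    have [b hb] := proj1 (Z.odd_spec a) ha. lia.
  have P : forall r : Z, a = (6 * q + r)%Z -> Cexp (Ci * IZR a * (PI / 3)%R) + Cexp (Ci * IZR a * - (PI / 3)%R) =
     RtoC (2 * cos (IZR r * (PI / 3))).
    move=> r ->. rewrite plus_IZR mult_IZR RtoC_plus RtoC_mult.
    replace (Ci * (6 * IZR q + IZR r) * (PI / 3)%R) with (2 * PI * Ci * IZR q + Ci * (IZR r * (PI / 3))%R).
      2: { rewrite RtoC_mult RtoC_div; last lra. field. }
    replace (Ci * (6 * IZR q + IZR r) * - (PI / 3)%R) with (2 * PI * Ci * IZR (- q) + Ci * (- (IZR r * (PI / 3)))%R).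
      2: { rewrite opp_IZR !RtoC_opp RtoC_mult RtoC_div; last lra. field. }
    rewrite !Cexp_add !Cexp_2pi_Z !Cexp_imag cos_neg sin_neg.
    apply injective_projections; simpl; ring.
  have M : forall r k : Z, a = (6 * q + r)%Z -> (a mod 3 = r mod 3)%Z.
    move=> r _ ->. replace (6 * q + r)%Z with (r + (2 * q) * 3)%Z by ring. by rewrite Z_mod_plus_full.
  move: Hq => [h|[h|h]]; rewrite (P _ h) (M _ 0%Z h) /=.
  - rewrite Rmult_1_l cos_PI3. f_equal. field.
  - replace (3 * (PI / 3))%R with PI by field. rewrite cos_PI -RtoC_opp. f_equal. ring.
  - replace (5 * (PI / 3))%R with (- (PI / 3) + 2 * INR 1 * PI)%R by (simpl; field).
    rewrite cos_period cos_neg cos_PI3. f_equal. field.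
Qed.

(** The origin of the eta quotient with 9 tau: adding the equal values at pi/3 and - pi/3 weights
    the terms by 1, or by - 2 when 3 divides a. The multiples a = 3b carry the factor 3 chi(3) = - 3
    and the modulus 9t, which yields the coefficient 9. *)
Lemma theta_third (t : C) : 0 < Im t ->
  TH chi 1 t (PI / 3)%R = / 2 * (TH chi 1 t 0 + 9 * TH chi 1 (9 * t) 0).
Proof.
  move=> ht.
  have ht9 : 0 < Im (9 * t) by rewrite /Im /=; rewrite /Im in ht; lra.
  have S := fun v => summable_TH chi 1 t v chi_bounded ht.
  pose h := fun a : Z => if (a mod 3 =? 0)%Z then chi a * (Ci * IZR a) ^ 1 * Cexp (PI * Ci * t * IZR a ^ 2 + Ci * IZR a * 0) else RtoC 0.
  have Sh : summable h.
    apply: summable_le (S 0) => a. rewrite /h. case: Z.eqb; first by right. rewrite Cmod_0. apply Cmod_ge_0.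
  have E1 : TH chi 1 t (PI / 3)%R + TH chi 1 t (- (PI / 3)%R) = TH chi 1 t 0 - 3 * tsum h.
    rewrite /TH -tsum_plus // -tsum_scal // -tsum_minus //; last by apply summable_scal.
    apply tsum_ext => a. rewrite /h.
    case ha : (Z.odd a).
    - have T := third_root_sum a ha. rewrite !Cexp_add.
      set E := Cexp (PI * Ci * t * IZR a ^ 2).
      transitivity (chi a * (Ci * IZR a) ^ 1 * E * (Cexp (Ci * IZR a * (PI / 3)%R) + Cexp (Ci * IZR a * - (PI / 3)%R))); first ring.
      rewrite T Cmult_0_r Cexp_0. case: Z.eqb; ring.
    - rewrite (chi_even _ ha). case: Z.eqb; ring.
  have E2 : TH chi 1 t (- (PI / 3)%R) = TH chi 1 t (PI / 3)%R.
    rewrite (TH_opp chi (- (1)) 1 t _ chi_bounded ht chi_opp). ring.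
  have E3 : tsum h = - (3) * TH chi 1 (9 * t) 0.
    rewrite -(tsum_inj (fun b => (3 * b)%Z) h).
    - rewrite /TH -tsum_scal; last by apply summable_TH => //; apply chi_bounded.
      apply tsum_ext => b. rewrite /h.
      have -> : ((3 * b) mod 3 =? 0)%Z = true by rewrite Z.mul_comm Z_mod_mult.
      rewrite chi_mul3 mult_IZR RtoC_mult.
      replace (PI * Ci * t * (3 * IZR b) ^ 2 + Ci * (3 * IZR b) * 0) with
        (PI * Ci * (9 * t) * IZR b ^ 2 + Ci * IZR b * 0) by ring. ring.
    - move=> x y E. lia.
    - move=> b n. rewrite /h. case: Z.eqb_spec => // hb. case: (n (b / 3)%Z).
      have := Z.div_mod b 3 ltac:(lia). lia.
    - exact Sh.
  rewrite E2 E3 in E1.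
  replace (TH chi 1 t (PI / 3)%R) with (/ 2 * (TH chi 1 t (PI / 3)%R + TH chi 1 t (PI / 3)%R)) by field.
  rewrite E1. ring.
Qed.

(** * Theta relations at the third-torsion point *)

Section ThirdTorsion.
Variable t : C.
Hypothesis ht : 0 < Im t.

Let f (k : nat) (v : C) := TH chi k t v.
Let V := RtoC (PI / 3).

Lemma Im_2t : 0 < Im (2 * t).
Proof. have := ht. rewrite /Im /=. lra. Qed.

Lemma cder_TH_2 (c : Z -> C) (k : nat) (x : C) : bounded1 c ->
  cder (fun v => 2 ^ k * TH c k (2 * t) (2 * v)) x (2 ^ (S k) * TH c (S k) (2 * t) (2 * x)).
Proof.
  move=> hc. apply (cder_eq _ _ (2 ^ k * (TH c (S k) (2 * t) (2 * x) * 2))); first (simpl; ring).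
  apply cder_scalf. apply (cder_comp (TH c k (2 * t)) (fun v => 2 * v)); last by apply cder_scal.
  apply cder_TH_v => //. apply Im_2t.
Qed.

Lemma theta_even_0 (k : nat) : Nat.even k = true -> TH chi k t 0 = 0.
Proof.
  move=> hk. apply self_opp_0.
  have := TH_opp chi (- (1)) k t 0 chi_bounded ht chi_opp.
  replace (- RtoC 0) with (RtoC 0) by ring. move=> {1}->.
  move: hk => /Nat.even_spec [m ->]. rewrite Cpow_mult_r. replace ((- (1)) ^ 2) with (RtoC 1) by (simpl; ring). rewrite Cpow_1_l. ring.
Qed.

Lemma even_series_odd_0 (c : Z -> C) : bounded1 c -> (forall a, c (- a)%Z = 1 * c a) -> 2 ^ 1 * TH c 1 (2 * t) (2 * 0) = 0.
Proof.
  move=> hc h. replace (2 * 0) with (RtoC 0) by ring.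
  suff -> : TH c 1 (2 * t) 0 = 0 by ring.
  apply self_opp_0. have := TH_opp c 1 1 (2 * t) 0 hc Im_2t h.
  replace (- RtoC 0) with (RtoC 0) by ring. move=> {1}->. simpl. ring.
Qed.

Lemma oddc_opp a : oddc (- a) = 1 * oddc a.
Proof. rewrite /oddc Z.odd_opp. ring. Qed.

Lemma evenc_opp a : evenc (- a) = 1 * evenc a.
Proof. rewrite /evenc Z.odd_opp. ring. Qed.

Lemma theta_addition' (x y : C) : f 0 (x + y) * f 0 (x - y) =
  2 ^ 0 * TH oddc 0 (2 * t) (2 * x) * (2 ^ 0 * TH evenc 0 (2 * t) (2 * y)) -
  2 ^ 0 * TH evenc 0 (2 * t) (2 * x) * (2 ^ 0 * TH oddc 0 (2 * t) (2 * y)).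
Proof. rewrite /f theta_addition //. simpl. ring. Qed.

Lemma V_double : 2 * V = PI - V.
Proof. rewrite /V RtoC_div; last lra. field. Qed.

(** The doubled point is the reflection of the point itself, so values at 2V are again values at V
    up to sign, and the duplication identities close up. *)
Lemma theta_V_double (k : nat) : f k (2 * V) = (- (1)) ^ k * f k V.
Proof. rewrite V_double. by apply theta_reflect. Qed.

Let o (k : nat) (v : C) := 2 ^ k * TH oddc k (2 * t) (2 * v).
Let e (k : nat) (v : C) := 2 ^ k * TH evenc k (2 * t) (2 * v).

Lemma theta_dup_V : f 0 V * (f 3 V * (f 0 V * f 0 V) - 3 * (f 0 V * (f 1 V * f 2 V)) + 2 * (f 1 V * (f 1 V * f 1 V)))
  = f 1 0 ^ 3 * f 0 V.
Proof.
  have := oddtheta_dup f o e (fun k x => cder_TH_v chi k t x chi_bounded ht) (fun k x => cder_TH_2 oddc k x oddc_bounded)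
    (fun k x => cder_TH_2 evenc k x evenc_bounded) (theta_even_0 0 eq_refl) theta_addition' V.
  move=> ->. rewrite theta_V_double. simpl. ring.
Qed.

Lemma theta_dup1_V : f 1 V * (f 3 V * (f 0 V * f 0 V) - 3 * (f 0 V * (f 1 V * f 2 V)) + 2 * (f 1 V * (f 1 V * f 1 V)))
  + f 0 V * (f 4 V * (f 0 V * f 0 V) - f 0 V * (f 1 V * f 3 V) + 3 * (f 1 V * (f 1 V * f 2 V)) - 3 * (f 0 V * (f 2 V * f 2 V)))
  = - (2) * (f 1 0 ^ 3 * f 1 V).
Proof.
  have := oddtheta_dup1 f o e (fun k x => cder_TH_v chi k t x chi_bounded ht) (fun k x => cder_TH_2 oddc k x oddc_bounded)
    (fun k x => cder_TH_2 evenc k x evenc_bounded) (theta_even_0 0 eq_refl) theta_addition' V.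
  move=> ->. rewrite theta_V_double. simpl. ring.
Qed.

Lemma theta_dup2_V : f 2 V * (f 3 V * (f 0 V * f 0 V) - 3 * (f 0 V * (f 1 V * f 2 V)) + 2 * (f 1 V * (f 1 V * f 1 V)))
  + 2 * (f 1 V * (f 4 V * (f 0 V * f 0 V) - f 0 V * (f 1 V * f 3 V) + 3 * (f 1 V * (f 1 V * f 2 V)) - 3 * (f 0 V * (f 2 V * f 2 V))))
  + f 0 V * (f 5 V * (f 0 V * f 0 V) + f 4 V * (f 0 V * f 1 V) + 2 * (f 1 V * (f 1 V * f 3 V)) - 7 * (f 0 V * (f 2 V * f 3 V)) + 3 * (f 1 V * (f 2 V * f 2 V)))
  = 4 * (f 1 0 ^ 3 * f 2 V).
Proof.
  have := oddtheta_dup2 f o e (fun k x => cder_TH_v chi k t x chi_bounded ht) (fun k x => cder_TH_2 oddc k x oddc_bounded)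
    (fun k x => cder_TH_2 evenc k x evenc_bounded) (theta_even_0 0 eq_refl) theta_addition' V.
  move=> ->. rewrite theta_V_double. simpl. ring.
Qed.

Lemma theta_third_V :
  (2 * (f 5 V * f 0 V) - 6 * (f 4 V * f 1 V) + 4 * (f 3 V * f 2 V)) * (f 0 V * f 0 V) -
    (2 * (f 4 V * f 0 V) - 8 * (f 3 V * f 1 V) + 6 * (f 2 V * f 2 V)) * (2 * (f 0 V * f 1 V))
  = 8 * f 1 0 ^ 2 * f 3 0 * f 0 V.
Proof.
  have := oddtheta_third f o e (fun k x => cder_TH_v chi k t x chi_bounded ht) (fun k x => cder_TH_2 oddc k x oddc_bounded)
    (fun k x => cder_TH_2 evenc k x evenc_bounded) (theta_even_0 0 eq_refl)
    (even_series_odd_0 oddc oddc_bounded oddc_opp) (even_series_odd_0 evenc evenc_bounded evenc_opp) theta_addition' V.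
  move=> ->. rewrite theta_V_double. simpl. ring.
Qed.

End ThirdTorsion.

Lemma Cmult_cancel_l (a b c : C) : a <> 0 -> a * b = a * c -> b = c.
Proof.
  move=> ha h. apply Ceq_minus. apply NNPP => n. apply (Cmult_neq_0 _ _ ha n).
  replace (a * (b - c)) with (a * b - a * c) by ring. rewrite h. ring.
Qed.

(** Elimination, with f_k = f^(k)(pi/3), J = f'(0) and p = f'''(0). After division by f0 the
    duplication formula gives f3, its first derivative f4 and its second f5; the remaining relation
    then determines p. *)
Lemma third_torsion_algebra (f0 f1 f2 f3 f4 f5 J p : C) : f0 <> 0 -> J <> 0 ->
  f0 * (f3 * (f0 * f0) - 3 * (f0 * (f1 * f2)) + 2 * (f1 * (f1 * f1))) = J ^ 3 * f0 ->
  f1 * (f3 * (f0 * f0) - 3 * (f0 * (f1 * f2)) + 2 * (f1 * (f1 * f1)))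
  + f0 * (f4 * (f0 * f0) - f0 * (f1 * f3) + 3 * (f1 * (f1 * f2)) - 3 * (f0 * (f2 * f2))) = - (2) * (J ^ 3 * f1) ->
  f2 * (f3 * (f0 * f0) - 3 * (f0 * (f1 * f2)) + 2 * (f1 * (f1 * f1)))
  + 2 * (f1 * (f4 * (f0 * f0) - f0 * (f1 * f3) + 3 * (f1 * (f1 * f2)) - 3 * (f0 * (f2 * f2))))
  + f0 * (f5 * (f0 * f0) + f4 * (f0 * f1) + 2 * (f1 * (f1 * f3)) - 7 * (f0 * (f2 * f3)) + 3 * (f1 * (f2 * f2))) = 4 * (J ^ 3 * f2) ->
  (2 * (f5 * f0) - 6 * (f4 * f1) + 4 * (f3 * f2)) * (f0 * f0) -
    (2 * (f4 * f0) - 8 * (f3 * f1) + 6 * (f2 * f2)) * (2 * (f0 * f1)) = 8 * J ^ 2 * p * f0 ->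
  f3 = (J ^ 3 + 3 * f0 * f1 * f2 - 2 * f1 ^ 3) / f0 ^ 2 /\
  f4 = (- (3) * J ^ 3 * f1 / f0 + f0 * f1 * f3 - 3 * f1 ^ 2 * f2 + 3 * f0 * f2 ^ 2) / f0 ^ 2 /\
  p = J * (6 * f1 ^ 2 + 3 * f0 * f2) / f0 ^ 2.
Proof.
  move=> h0 hJ H1 H2 H3 H4.
  have N : f3 * (f0 * f0) - 3 * (f0 * (f1 * f2)) + 2 * (f1 * (f1 * f1)) = J ^ 3.
    apply (Cmult_cancel_l f0) => //. rewrite H1. ring.
  rewrite N in H2 H3.
  have N' : f4 * (f0 * f0) - f0 * (f1 * f3) + 3 * (f1 * (f1 * f2)) - 3 * (f0 * (f2 * f2)) = - (3) * J ^ 3 * f1 / f0.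
    apply (Cmult_cancel_l f0) => //. replace (f0 * (- (3) * J ^ 3 * f1 / f0)) with (- (2) * (J ^ 3 * f1) - f1 * J ^ 3) by (field; auto).
    rewrite -H2. ring.
  rewrite N' in H3.
  have E3 : f3 = (J ^ 3 + 3 * f0 * f1 * f2 - 2 * f1 ^ 3) / f0 ^ 2.
    rewrite -N. field. auto.
  have E4 : f4 = (- (3) * J ^ 3 * f1 / f0 + f0 * f1 * f3 - 3 * f1 ^ 2 * f2 + 3 * f0 * f2 ^ 2) / f0 ^ 2.
    rewrite -N'. field. auto.
  split => //. split => //.
  (* The fifth derivative is needed only to be eliminated from the relation containing p. *)
  have E5 : f5 = ((4 * (J ^ 3 * f2) - f2 * J ^ 3 - 2 * (f1 * (- (3) * J ^ 3 * f1 / f0))) / f0 - f4 * (f0 * f1) - 2 * (f1 * (f1 * f3)) + 7 * (f0 * (f2 * f3)) - 3 * (f1 * (f2 * f2))) / f0 ^ 2.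
    rewrite -H3. field. auto.
  apply (Cmult_cancel_l (8 * J ^ 2 * f0)).
    repeat apply Cmult_neq_0 => //; [apply RtoC_neq; lra | by apply C1_nz].
  replace (8 * J ^ 2 * f0 * p) with (8 * J ^ 2 * p * f0) by ring. rewrite -H4 E5 E4 E3. field. auto.
Qed.

Lemma theta_third_torsion (t : C) : 0 < Im t -> TH chi 0 t (PI / 3)%R <> 0 -> TH chi 1 t 0 <> 0 ->
  let f0 := TH chi 0 t (PI / 3)%R in let f1 := TH chi 1 t (PI / 3)%R in let f2 := TH chi 2 t (PI / 3)%R in
  let f3 := TH chi 3 t (PI / 3)%R in let f4 := TH chi 4 t (PI / 3)%R in let J := TH chi 1 t 0 in
  f3 = (J ^ 3 + 3 * f0 * f1 * f2 - 2 * f1 ^ 3) / f0 ^ 2 /\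
  f4 = (- (3) * J ^ 3 * f1 / f0 + f0 * f1 * f3 - 3 * f1 ^ 2 * f2 + 3 * f0 * f2 ^ 2) / f0 ^ 2 /\
  TH chi 3 t 0 = J * (6 * f1 ^ 2 + 3 * f0 * f2) / f0 ^ 2.
Proof.
  move=> ht h0 hJ. apply (third_torsion_algebra _ _ _ _ _ (TH chi 5 t (PI / 3)%R)) => //.
  - by apply theta_dup_V.
  - by apply theta_dup1_V.
  - by apply theta_dup2_V.
  - by apply theta_third_V.
Qed.

(** * Infinite products and the Jacobi identity *)

Definition qp (q : C) (n : nat) : C := Cprod (fun k => 1 - q ^ k) n.
Definition qinf (q : C) : C := Clim_seq (qp q).

Fixpoint rp (r : R) (n : nat) : R :=
  match n with O => 1%R | S m => (rp r m * (1 - r ^ (S m)))%R end.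

Lemma pow_lt_1 (r : R) (n : nat) : 0 <= r < 1 -> (n <> 0)%nat -> 0 <= r ^ n < 1.
Proof.
  move=> hr hn. split; first by apply pow_le; lra.
  case: n hn => [//|n] _. simpl.
  have : r ^ n <= 1 by rewrite -(pow1 n); apply pow_incr; lra.
  have : 0 <= r ^ n by apply pow_le; lra. nra.
Qed.

Lemma rp_pos r n : 0 <= r < 1 -> 0 < rp r n.
Proof.
  move=> hr. elim: n => [|n IH]; first by simpl; lra.
  apply Rmult_lt_0_compat => //. have := pow_lt_1 r (S n) hr ltac:(lia). lra.
Qed.

(** From an index K on with r^(K+1) / (1 - r) <= 1/2, the remaining factors multiply to at least one
    minus the sum of the r^i, hence to at least 1/2; the products themselves decrease. *)
Lemma rp_lower (r : R) : 0 <= r < 1 -> exists m, 0 < m /\ forall n, m <= rp r n.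
Proof.
  move=> hr.
  have [K hK] : exists K, r ^ (S K) / (1 - r) <= 1 / 2.
    have [N hN] := pow_lt_1_zero r ltac:(rewrite Rabs_pos_eq; lra) ((1 - r) / 2) ltac:(lra).
    exists N. have := hN (S N) ltac:(lia). rewrite Rabs_pos_eq; last by apply pow_le; lra.
    move=> h. apply (Rmult_le_reg_r (1 - r)); first lra.
    replace (r ^ S N / (1 - r) * (1 - r))%R with (r ^ S N)%R by (field; lra). lra.
  have P : forall j, (rp r K * (1 - r ^ (S K) * (1 - r ^ j) / (1 - r)) <= rp r (K + j)).
    elim => [|j IH].
      rewrite Nat.add_0_r /=. right. field. lra.
    rewrite Nat.add_succ_r /=.
    have q0 := rp_pos r K hr. have q1 := rp_pos r (K + j) hr.
    have a0 : (0 <= r ^ j) by apply pow_le; lra. have b0 : (0 <= r ^ K) by apply pow_le; lra.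
    have qd : rp r (K + j) <= rp r K.
      elim: j {IH q1 a0} => [|j IH]; first by rewrite Nat.add_0_r; right.
      rewrite Nat.add_succ_r /=. have := pow_lt_1 r (S (K + j)) hr ltac:(lia). simpl.
      have := rp_pos r (K + j) hr. nra.
    rewrite pow_add.
    replace (1 - r * r ^ K * (1 - r * r ^ j) / (1 - r))%R with ((1 - r ^ S K * (1 - r ^ j) / (1 - r)) - r * (r ^ K * r ^ j))%R by (simpl; field; lra).
    have c0 : (0 <= r * (r ^ K * r ^ j)) by apply Rmult_le_pos; [lra | apply Rmult_le_pos].
    nra.
  exists (rp r K / 2)%R. have q0 := rp_pos r K hr. split; first lra.
  move=> n. case: (le_lt_dec K n) => h.
  - have := P (n - K)%nat. replace (K + (n - K))%nat with n by lia.
    have a0 := pow_lt_1 r (n - K) hr. have a1 : 0 <= r ^ (n - K) by apply pow_le; lra.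
    have b0 : 0 <= r ^ S K / (1 - r) by apply Rdiv_le_0_compat; [apply pow_le; lra | lra].
    replace (r ^ S K * (1 - r ^ (n - K)) / (1 - r))%R with (r ^ S K / (1 - r) * (1 - r ^ (n - K)))%R by (field; lra).
    have : (r ^ S K / (1 - r) * (1 - r ^ (n - K)) <= 1 / 2) by nra.
    nra.
  - have D : forall j, rp r (n + j) <= rp r n.
      elim => [|j IH]; first by rewrite Nat.add_0_r; right.
      rewrite Nat.add_succ_r /=. have := pow_lt_1 r (S (n + j)) hr ltac:(lia). simpl.
      have := rp_pos r (n + j) hr. nra.
    have := D (K - n)%nat. replace (n + (K - n))%nat with K by lia. lra.
Qed.

Lemma qp_S q n : qp q (S n) = qp q n * (1 - q ^ (S n)).
Proof. done. Qed.

(** The lower bound compares factor by factor with [rp]; the upper bound follows from (1 + x)(1 - x)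
    <= 1, which keeps |qp q n| rp |q| n below 1. *)
Lemma qp_bounds q : Cmod q < 1 -> exists m, 0 < m /\ forall n, m <= Cmod (qp q n) <= / m.
Proof.
  move=> hq. have q0 := Cmod_ge_0 q.
  have [m [m0 hm]] := rp_lower (Cmod q) (conj q0 hq).
  exists m; split => // n.
  have A : rp (Cmod q) n <= Cmod (qp q n).
    elim: n => [|n IH]; first by rewrite /qp /= Cmod_1; right.
    rewrite qp_S Cmod_mult. simpl rp.
    have := Cmod_sub_ge 1 (q ^ S n). rewrite Cmod_1 Cmod_pow => h.
    have := pow_lt_1 (Cmod q) (S n) (conj q0 hq) ltac:(lia). simpl in h |- *.
    have := rp_pos (Cmod q) n (conj q0 hq) => r0 hx. apply Rmult_le_compat; lra.
  have B : Cmod (qp q n) * rp (Cmod q) n <= 1.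
    elim: n {A} => [|n IH]; first by rewrite /qp /= Cmod_1; lra.
    rewrite qp_S Cmod_mult. simpl rp.
    have := Cmod_sub_le 1 (q ^ S n). rewrite Cmod_1 Cmod_pow => h.
    have := pow_lt_1 (Cmod q) (S n) (conj q0 hq) ltac:(lia). simpl in h |- *.
    set x := (Cmod q * Cmod q ^ n)%R in h *. move=> hx.
    have p0 := rp_pos (Cmod q) n (conj q0 hq). have c0 := Cmod_ge_0 (qp q n). have d0 := Cmod_ge_0 (1 - q * q ^ n).
    have e1 : (Cmod (1 - q * q ^ n) * (1 - x) <= 1) by nra.
    replace (Cmod (qp q n) * Cmod (1 - q * q ^ n) * (rp (Cmod q) n * (1 - x)))%R with
      ((Cmod (qp q n) * rp (Cmod q) n) * (Cmod (1 - q * q ^ n) * (1 - x)))%R by ring.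
    have a0 : 0 <= Cmod (qp q n) * rp (Cmod q) n by nra.
    have b0 : (0 <= Cmod (1 - q * q ^ n) * (1 - x))%R by nra.
    move: (Cmod (qp q n) * rp (Cmod q) n)%R (Cmod (1 - q * q ^ n) * (1 - x))%R IH a0 e1 b0 => u v. nra.
  split; first by have := hm n; lra.
  apply (Rmult_le_reg_r m) => //. rewrite Rinv_l; last lra.
  have := hm n. have := Cmod_ge_0 (qp q n). nra.
Qed.

Lemma qp_neq_0 q n : Cmod q < 1 -> qp q n <> 0.
Proof. move=> hq. have [m [m0 hm]] := qp_bounds q hq. apply Cmod_pos_neq. have := hm n. lra. Qed.

Lemma climit_qp q : Cmod q < 1 -> climit (qp q) (qinf q).
Proof.
  move=> hq. have q0 := Cmod_ge_0 q. have [m [m0 hm]] := qp_bounds q hq.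
  have S : summable (fun n => qp q (S n) - qp q n).
    apply: summable_le (Rsummable_scal (/ m) _ _ (Rsummable_geom (Cmod q) (conj q0 hq))); last by left; apply Rinv_0_lt_compat.
    move=> n. rewrite qp_S. replace (qp q n * (1 - q ^ S n) - qp q n) with (- (qp q n * (q * q ^ n))) by (simpl; ring).
    rewrite Cmod_opp !Cmod_mult Cmod_pow.
    have h := hm n. have p0 : 0 <= Cmod q ^ n by apply pow_le.
    apply Rmult_le_compat; try lra; nra.
  have L : climit (qp q) (1 + tsum (fun n => qp q (Datatypes.S n) - qp q n)).
    move=> e he. have [N hN] := has_sum_climit _ _ (tsum_correct _ S) e he. exists N => n hn.
    have E : lsum (fun n => qp q (Datatypes.S n) - qp q n) (seq 0 n) = qp q n - 1.
      elim: n {hn} => [|n IH]; first by rewrite /qp /=; ring.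
      rewrite lsum_S IH. ring.
    have := hN n hn. rewrite E.
    by replace (qp q n - 1 - tsum (fun n => qp q (Datatypes.S n) - qp q n)) with
      (qp q n - (1 + tsum (fun n => qp q (Datatypes.S n) - qp q n))) by ring.
  have -> : qinf q = 1 + tsum (fun n => qp q (Datatypes.S n) - qp q n) by apply Clim_seq_eq.
  exact L.
Qed.

Lemma climit_Cmod_ge u s m : climit u s -> (forall n, m <= Cmod (u n)) -> m <= Cmod s.
Proof.
  move=> L h. apply le_epsilon => e he. have [N hN] := L e he.
  have := hN N (le_n _). have := h N. have := Cmod_sub_ge (u N) s. lra.
Qed.

Lemma climit_Cmod_le u s c m : climit u s -> (forall n, Cmod (u n - c) <= m) -> Cmod (s - c) <= m.
Proof.
  move=> L h. apply le_epsilon => e he. have [N hN] := L e he.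
  have := hN N (le_n _). have := h N. rewrite (Cmod_minus_sym (u N) s). have := Cmod_dist s (u N) c. lra.
Qed.

Lemma qinf_neq_0 q : Cmod q < 1 -> qinf q <> 0.
Proof.
  move=> hq. have [m [m0 hm]] := qp_bounds q hq. apply Cmod_pos_neq.
  have := climit_Cmod_ge _ _ m (climit_qp q hq) (fun n => proj1 (hm n)). lra.
Qed.

Lemma qinf_near_1 q : Cmod q <= 1 / 100 -> Cmod (qinf q - 1) <= 2 * Cmod q.
Proof.
  move=> hq. have q0 := Cmod_ge_0 q.
  apply (climit_Cmod_le (qp q)); first by apply climit_qp; lra.
  have P : forall n, Cmod (qp q n - 1) <= 3 / 2 * Cmod q * (1 - Cmod q ^ n).
    elim => [|n IH].
      rewrite /qp /=. replace (1 - 1) with (RtoC 0) by ring. rewrite Cmod_0. lra.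
    rewrite qp_S.
    replace (qp q n * (1 - q ^ S n) - 1) with ((qp q n - 1) - (qp q n - 1) * q ^ S n - q ^ S n) by ring.
    have p0 : 0 <= Cmod q ^ n <= 1.
      split; first by apply pow_le. rewrite -(pow1 n). apply pow_incr; lra.
    have T1 := Cmod_sub_le (qp q n - 1 - (qp q n - 1) * q ^ S n) (q ^ S n).
    have T2 := Cmod_sub_le (qp q n - 1) ((qp q n - 1) * q ^ S n).
    rewrite Cmod_mult in T2. rewrite Cmod_pow in T1 T2. simpl in *.
    set x := (Cmod q ^ n)%R in IH p0 T1 T2 *. set D := Cmod (qp q n - 1) in IH T2.
    have D0 : 0 <= D by apply Cmod_ge_0.
    have D1 : D <= 2 / 100 by nra.

    have x1 : 0 <= Cmod q * x by nra.
    have : D * (Cmod q * x) <= 2 / 100 * (Cmod q * x) by apply Rmult_le_compat_r.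
    have : (Cmod q * x * (99 / 100) <= Cmod q * x * (1 - Cmod q))%R by apply Rmult_le_compat_l; lra.
    lra.
  move=> n. apply: Rle_trans (P n) _.
  have p0 : 0 <= Cmod q ^ n <= 1.
    split; first by apply pow_le. rewrite -(pow1 n). apply pow_incr; lra.
  nra.
Qed.

(** * A finite form of the Jacobi triple product *)

Fixpoint tri (n : nat) : nat := match n with O => O | S m => (tri m + S m)%nat end.

Section FiniteJacobi.
Variables (q y : C).
Hypothesis hq : Cmod q < 1.

(** Consecutive Dirichlet kernels: for y = x + 1/x the n-th is the sum of x^j over |j| <= n. Stated
    in y, the triple product has the factors 1 - y q^k + q^(2k) and needs no x. *)
Fixpoint cheb (n : nat) : C * C :=
  match n with O => (RtoC 1, y + 1) | S m => (snd (cheb m), y * snd (cheb m) - fst (cheb m)) end.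

Definition ch (n : nat) : C := fst (cheb n).

Lemma ch_SS n : ch (S (S n)) = y * ch (S n) - ch n.
Proof. done. Qed.

(** The coefficient (-1)^n q^(n(n+1)/2) of the infinite identity times the Gaussian binomial
    coefficient of 2N + 1 over N - n. *)
Definition jac (N n : nat) : C :=
  if (n <=? N)%nat then (- (1)) ^ n * q ^ tri n * qp q (2 * N + 1) / (qp q (N - n) * qp q (N + n + 1)) else RtoC 0.

(** The shifted coefficient a(n-1) with the convention a(-1) = - a(0), which encodes y ch(0) = ch(1)
    - ch(0). Thus [jpred a n + a (S n)] is the coefficient of ch(n) after multiplication by y. *)
Definition jpred (a : nat -> C) (n : nat) : C := match n with O => - a 0%nat | S m => a m end.

Lemma ch_boundary (a : nat -> C) M :
  y * lsum (fun n => a n * ch n) (seq 0 (S M)) - lsum (fun n => (jpred a n + a (S n)) * ch n) (seq 0 (S M)) =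
  a M * ch (S M) - a (S M) * ch M.
Proof.
  elim: M => [|M IH]; first by rewrite /= /ch /=; ring.
  rewrite (lsum_S (fun n => a n * ch n)) (lsum_S (fun n => (jpred a n + a (S n)) * ch n)).
  transitivity ((y * lsum (fun n => a n * ch n) (seq 0 (S M)) - lsum (fun n => (jpred a n + a (S n)) * ch n) (seq 0 (S M)))
    + y * (a (S M) * ch (S M)) - (jpred a (S M) + a (S (S M))) * ch (S M)); first ring.
  rewrite IH ch_SS. simpl jpred. ring.
Qed.

(** The coefficients follow multiplication of the product by 1 - y q^(N+1) + q^(2N+2). Writing N = n
    + m avoids truncated subtraction; the equations J1 to J4 bring the four terms to related
    denominators, leaving a polynomial identity in q^m and q^(2n+m+1). *)
Lemma jac_step_mid (n m : nat) :
  jac (S (n + m)) n = (1 + q ^ (2 * (n + m) + 2)) * jac (n + m) n - q ^ (n + m + 1) * (jpred (jac (n + m)) n + jac (n + m) (S n)).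
Proof.
  have Q : forall k, qp q k <> 0 by move=> k; apply qp_neq_0.
  have Q1 : forall k, 1 - q ^ (S k) <> 0.
    move=> k h. apply (Q (S k)). rewrite qp_S h. ring.
  have J1 : jac (S (n + m)) n = (- (1)) ^ n * q ^ tri n * qp q (2 * (n + m) + 1) * (1 - q * (q ^ m * q ^ (n + n + m + 1))) * (1 - q * (q * (q ^ m * q ^ (n + n + m + 1))))
    / (qp q m * (1 - q * q ^ m) * (qp q (n + n + m + 1) * (1 - q * q ^ (n + n + m + 1)))).
    rewrite /jac. have -> : (n <=? S (n + m))%nat = true by apply Nat.leb_le; lia.
    replace (S (n + m) - n)%nat with (S m) by lia. replace (S (n + m) + n + 1)%nat with (S (n + n + m + 1)) by lia.
    replace (2 * S (n + m) + 1)%nat with (S (S (2 * (n + m) + 1))) by lia.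
    rewrite !qp_S -Cpow_add_r. replace (m + (n + n + m + 1))%nat with (2 * (n + m) + 1)%nat by lia. simpl Cpow. field. 
    repeat split; try apply Q; apply Q1.
  have J2 : jac (n + m) n = (- (1)) ^ n * q ^ tri n * qp q (2 * (n + m) + 1) / (qp q m * qp q (n + n + m + 1)).
    rewrite /jac. have -> : (n <=? n + m)%nat = true by apply Nat.leb_le; lia.
    replace (n + m - n)%nat with m by lia. by replace (n + m + n + 1)%nat with (n + n + m + 1)%nat by lia.
  have J3 : q ^ (n + m + 1) * jpred (jac (n + m)) n = - (q * q ^ m) * ((- (1)) ^ n * q ^ tri n * qp q (2 * (n + m) + 1) * (1 - q ^ (n + n + m + 1))) / (qp q m * (1 - q * q ^ m) * qp q (n + n + m + 1)).
    case: n {J1 J2} => [|n].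
      rewrite /jpred /jac. cbn [Nat.leb tri Nat.add]. replace (m - 0)%nat with m by lia. replace (m + 0 + 1)%nat with (S m) by lia.
      replace (m + 1)%nat with (S m) by lia. rewrite !Cpow_S. field. repeat split; try apply Q; apply (Q1 m).
    change (jpred (jac (S n + m)) (S n)) with (jac (S n + m) n).
    rewrite /jac. have -> : (n <=? S n + m)%nat = true by apply Nat.leb_le; lia.
    replace (S n + m - n)%nat with (S m) by lia. replace (S n + m + n + 1)%nat with (n + n + m + 2)%nat by lia.
    replace (S n + S n + m + 1)%nat with (S (n + n + m + 2)) by lia.
    have E2 : q ^ (S n + m + 1) = q * q ^ m * q ^ (S n) by rewrite -Cpow_S -Cpow_add_r; f_equal; lia.
    rewrite (qp_S q m) (qp_S q (n + n + m + 2)) E2. simpl tri. rewrite (Cpow_add_r q (tri n) (S n)). rewrite (Cpow_S (- (1)) n). simpl (q ^ S m).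
    have := Q1 (n + n + m + 2)%nat. set X := 1 - q ^ S (n + n + m + 2). move=> hX.
    field. repeat split; try apply Q; try done; apply (Q1 m).
  have J4 : q ^ (n + m + 1) * jac (n + m) (S n) = - (q * q ^ (n + n + m + 1)) * ((- (1)) ^ n * q ^ tri n * qp q (2 * (n + m) + 1) * (1 - q ^ m)) / (qp q m * (qp q (n + n + m + 1) * (1 - q * q ^ (n + n + m + 1)))).
    case: m {J1 J2 J3} => [|m].
      rewrite /jac. have -> : (S n <=? n + 0)%nat = false by apply Nat.leb_gt; lia. simpl (q ^ 0). field.
      repeat split; try apply Q; apply (Q1 (n + n + 0 + 1)%nat).
    rewrite /jac. have -> : (S n <=? n + S m)%nat = true by apply Nat.leb_le; lia.
    replace (n + S m - S n)%nat with m by lia. replace (n + S m + S n + 1)%nat with (S (n + n + S m + 1)) by lia.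
    have E2 : q ^ (n + S m + 1) * q ^ (S n) = q * q ^ (n + n + S m + 1) by rewrite -Cpow_S -Cpow_add_r; f_equal; lia.
    rewrite (qp_S q m) (qp_S q (n + n + S m + 1)). simpl tri. rewrite (Cpow_add_r q (tri n) (S n)) (Cpow_S (- (1)) n).
    transitivity (- (q ^ (n + S m + 1) * q ^ S n) * ((- (1)) ^ n * q ^ tri n * qp q (2 * (n + S m) + 1) * (1 - q ^ S m)) / (qp q m * (1 - q ^ S m) * (qp q (n + n + S m + 1) * (1 - q * q ^ (n + n + S m + 1))))).
      rewrite (Cpow_S q (n + n + S m + 1)). field. repeat split; try apply Q; first apply (Q1 (n + n + S m + 1)%nat); apply (Q1 m).
    by rewrite E2.
  rewrite Cmult_plus_distr_l J1 J2 J3 J4.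
  have -> : q ^ (2 * (n + m) + 2) = q * (q ^ m * q ^ (n + n + m + 1)).
    rewrite -Cpow_add_r -Cpow_S. f_equal. lia.
  field. repeat split; try apply Q; first [exact (Q1 m) | exact (Q1 (n + n + m + 1)%nat)].
Qed.

Lemma jac_step (N n : nat) :
  jac (S N) n = (1 + q ^ (2 * N + 2)) * jac N n - q ^ (N + 1) * (jpred (jac N) n + jac N (S n)).
Proof.
  case: (le_lt_dec n N) => h.
    replace N with (n + (N - n))%nat by lia. apply jac_step_mid.
  have Q : forall k, qp q k <> 0 by move=> k; apply qp_neq_0.
  have Z : forall k, (N < k)%nat -> jac N k = 0.
    move=> k hk. rewrite /jac. by have -> : (k <=? N)%nat = false by apply Nat.leb_gt.
  rewrite (Z n h) (Z (S n)); last lia.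
  case: n h => [|n] h; first lia. simpl jpred.
  (* Beyond the old range a nonzero contribution arises only for the new top index N + 1. *)
  case: (Nat.eq_dec n N) => [->|hn].
  - rewrite /jac !Nat.leb_refl. rewrite !Nat.sub_diag.
    replace (S N + S N + 1)%nat with (2 * S N + 1)%nat by lia. replace (N + N + 1)%nat with (2 * N + 1)%nat by lia.
    change (tri (S N)) with (tri N + S N)%nat. have -> : qp q 0 = 1 by done.
    rewrite (Cpow_add_r q (tri N) (S N)) (Cpow_S (- (1)) N). replace (N + 1)%nat with (S N) by lia.
    field. split; apply Q.
  - rewrite (Z n); last lia. rewrite /jac. have -> : (S n <=? S N)%nat = false by apply Nat.leb_gt; lia. ring.
Qed.

Definition jprod (N : nat) : C := Cprod (fun k => 1 - y * q ^ k + q ^ (2 * k)) N.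

Lemma jac_finite N : forall M, (N < M)%nat -> jprod N = lsum (fun n => jac N n * ch n) (seq 0 M).
Proof.
  elim: N => [|N IH] M hM.
    case: M hM => [|M] hM; first lia.
    elim: M {hM} => [|M IH].
      have E : jac 0 0 = 1.
        rewrite /jac. cbn [Nat.leb Nat.sub Nat.add Nat.mul tri]. change (qp q 0) with (RtoC 1). simpl (_ ^ 0). field.
        by apply qp_neq_0.
      cbn [seq lsum fold_right]. rewrite E /jprod /ch /=. ring.
    rewrite lsum_S -IH /jac /=. ring.
  case: M hM => [|M] hM; first lia.
  have E := ch_boundary (jac N) M.
  have Z : forall k, (N < k)%nat -> jac N k = 0.
    move=> k hk. rewrite /jac. by have -> : (k <=? N)%nat = false by apply Nat.leb_gt.
  rewrite (Z M) in E; last lia. rewrite (Z (S M)) in E; last lia.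
  rewrite (lsum_ext _ (fun n => (1 + q ^ (2 * N + 2)) * (jac N n * ch n) + - (q ^ (N + 1)) * ((jpred (jac N) n + jac N (S n)) * ch n))); last first.
    move=> n _. rewrite jac_step. ring.
  rewrite lsum_plus !lsum_scal. change (jprod (S N)) with (jprod N * (1 - y * q ^ S N + q ^ (2 * S N))). rewrite (IH (S M)); last lia.
  have -> : lsum (fun n => (jpred (jac N) n + jac N (S n)) * ch n) (seq 0 (S M)) = y * lsum (fun n => jac N n * ch n) (seq 0 (S M)).
    apply Ceq_minus. rewrite -[RHS]Copp_0. replace (RtoC 0) with (0 * ch (S M) - 0 * ch M) by ring. rewrite -E. ring.
  replace (q ^ (2 * N + 2)) with (q ^ (N + 1) * q ^ (N + 1)) by (rewrite -Cpow_add_r; f_equal; lia).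
  replace (N + 1)%nat with (S N) by lia.
  replace (q ^ (2 * S N)) with (q ^ S N * q ^ S N) by (rewrite -Cpow_add_r; f_equal; lia). ring.
Qed.

End FiniteJacobi.

Lemma climit_mult u v a b : climit u a -> climit v b -> climit (fun n => u n * v n) (a * b).
Proof.
  move=> U V e he. have a0 := Cmod_ge_0 a. have b0 := Cmod_ge_0 b.
  have h1 : 0 < Rmin 1 (e / (2 * (Cmod a + Cmod b + 1))) by apply Rmin_glb_lt; [lra | apply Rdiv_lt_0_compat; lra].
  have [N hN] := U _ h1. have [N' hN'] := V _ h1.
  exists (N + N')%nat => n hn.
  have A := hN n ltac:(lia). have B := hN' n ltac:(lia).
  have A1 := Rlt_le_trans _ _ _ A (Rmin_l _ _). have A2 := Rlt_le_trans _ _ _ A (Rmin_r _ _).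
  have B2 := Rlt_le_trans _ _ _ B (Rmin_r _ _).
  replace (u n * v n - a * b) with ((u n - a) * (v n - b) + a * (v n - b) + b * (u n - a)) by ring.
  have T1 := Cmod_triangle ((u n - a) * (v n - b) + a * (v n - b)) (b * (u n - a)).
  have T2 := Cmod_triangle ((u n - a) * (v n - b)) (a * (v n - b)).
  rewrite !Cmod_mult in T1 T2.
  set r := (e / (2 * (Cmod a + Cmod b + 1)))%R in A2 B2.
  have r0 : 0 < r by apply Rdiv_lt_0_compat; lra.
  have E : ((Cmod a + Cmod b + 1) * r = e / 2)%R by rewrite /r; field; lra.
  have x0 := Cmod_ge_0 (u n - a). have y0 := Cmod_ge_0 (v n - b).
  have : Cmod (u n - a) * Cmod (v n - b) <= 1 * r by apply Rmult_le_compat; lra.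
  have : Cmod a * Cmod (v n - b) <= Cmod a * r by apply Rmult_le_compat_l; lra.
  have : Cmod b * Cmod (u n - a) <= Cmod b * r by apply Rmult_le_compat_l; lra.
  lra.
Qed.

Lemma climit_inv u (a : C) : a <> 0 -> climit u a -> climit (fun n => / u n) (/ a).
Proof.
  move=> ha U e he.
  have [d [hd H]] := cder_contc _ _ _ (cder_inv a ha) e he.
  have [N hN] := U d hd. exists N => n hn. by apply H, hN.
Qed.

Lemma climit_sub u a (p : nat -> nat) : (forall N, exists M, forall n, (M <= n)%nat -> (N <= p n)%nat) ->
  climit u a -> climit (fun n => u (p n)) a.
Proof.
  move=> hp U e he. have [N hN] := U e he. have [M hM] := hp N. exists M => n hn. by apply hN, hM.
Qed.

Lemma climit_eventually u v a : (exists N, forall n, (N <= n)%nat -> u n = v n) -> climit u a -> climit v a.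
Proof.
  move=> [M hM] U e he. have [N hN] := U e he. exists (M + N)%nat => n hn. rewrite -hM; last lia. apply hN. lia.
Qed.

Lemma tsum_finite (f : nat -> C) M : (forall n, (M <= n)%nat -> f n = 0) -> tsum f = lsum f (seq 0 M).
Proof.
  move=> h. apply has_sum_tsum => e he. exists (seq 0 M) => l nd inc.
  have [l1 [n1 [dis ->]]] := lsum_split f (seq 0 M) l (seq_NoDup _ _) nd inc.
  rewrite (lsum_ext f (fun _ => RtoC 0) l1); last first.
    move=> k hk. have [_ nk] := dis k hk. apply h. apply Nat.nlt_ge => hlt. apply nk. apply in_seq. lia.
  have -> : lsum (fun _ : nat => RtoC 0) l1 = 0 by elim: l1 {n1 dis} => [//|b m IH] /=; rewrite IH; ring.
  replace (lsum f (seq 0 M) + 0 - lsum f (seq 0 M)) with (RtoC 0) by ring. by rewrite Cmod_0.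
Qed.

Lemma tri_ge n : (n <= tri n)%nat.
Proof. elim: n => [//|n IH] /=. lia. Qed.

Lemma Rsummable_linear_geom r : 0 <= r < 1 -> Rsummable (fun n => ((2 * INR n + 1) * r ^ n)%R).
Proof.
  move=> hr.
  have [K [K0 hK]] := poly_geom ((r + 1) / 2) ((r + 3) / 4) ltac:(lra).
  apply: Rsummable_le (Rsummable_scal K _ _ (Rsummable_geom ((r + 3) / 4) ltac:(lra))); last lra.
  move=> n. apply: Rle_trans (hK n). have n0 := pos_INR n.
  apply Rmult_le_compat; [lra | apply pow_le; lra | nra | apply pow_incr; lra].
Qed.

(** For fixed n the Gaussian binomial coefficients tend to 1 / qinf q. They are bounded uniformly in
    N and n, and the linear bound on the kernels makes the terms dominated, so the limit may be
    taken termwise. *)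
Lemma jac_limit (q y : C) : Cmod q < 1 -> (forall n, Cmod (ch y n) <= 2 * INR n + 1) ->
  climit (jprod q y) (tsum (fun n => (- (1)) ^ n * q ^ tri n * ch y n) / qinf q).
Proof.
  move=> hq hch. have q0 := Cmod_ge_0 q. have [m [m0 hm]] := qp_bounds q hq.
  have qi := qinf_neq_0 q hq.
  have c1 : forall n, Cmod ((- (1)) ^ n) = 1%R by move=> n; rewrite Cmod_pow Cmod_opp1 pow1.
  have pw : forall n, Cmod q ^ tri n <= Cmod q ^ n.
    move=> n. replace (tri n) with (n + (tri n - n))%nat by (have := tri_ge n; lia). rewrite pow_add.
    have : 0 <= Cmod q ^ n by apply pow_le.
    have : Cmod q ^ (tri n - n) <= 1 by rewrite -(pow1 (tri n - n)); apply pow_incr; lra.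
    nra.
  have SS : summable (fun n => (- (1)) ^ n * q ^ tri n * ch y n).
    apply: summable_le (Rsummable_linear_geom (Cmod q) (conj q0 hq)) => n.
    rewrite Cmod_mult Cmod_mult c1 Cmod_pow Rmult_1_l Rmult_comm. 
    apply Rmult_le_compat => //; [apply Cmod_ge_0 | by apply pow_le].
  have -> : tsum (fun n => (- (1)) ^ n * q ^ tri n * ch y n) / qinf q = tsum (fun n => / qinf q * ((- (1)) ^ n * q ^ tri n * ch y n)).
    rewrite tsum_scal // /Cdiv. ring.
  apply (climit_ext (fun N => tsum (fun n => jac q N n * ch y n))).
    move=> N. rewrite (tsum_finite _ (S N)).
      by rewrite -(jac_finite q y hq N (S N)).
    move=> n hn. rewrite /jac. have -> : (n <=? N)%nat = false by apply Nat.leb_gt. ring.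
  apply (tannery _ _ (fun n => (/ m ^ 3 * ((2 * INR n + 1) * Cmod q ^ n))%R)).
  - move=> N n. rewrite /jac. case: Nat.leb; last first.
      rewrite Cmult_0_l Cmod_0. apply Rmult_le_pos; first by left; apply Rinv_0_lt_compat, pow_lt.
      apply Rmult_le_pos; [have := pos_INR n; lra | by apply pow_le].
    have D : qp q (N - n) * qp q (N + n + 1) <> 0 by apply Cmult_neq_0; apply qp_neq_0.
    rewrite Cmod_mult Cmod_div // !Cmod_mult c1 Cmod_pow Rmult_1_l.
    have h1 := hm (2 * N + 1)%nat. have h2 := hm (N - n)%nat. have h3 := hm (N + n + 1)%nat.
    have hd : / (Cmod (qp q (N - n)) * Cmod (qp q (N + n + 1))) <= / (m * m).
      apply Rinv_le_contravar; first nra. apply Rmult_le_compat; lra.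
    replace (/ m ^ 3 * ((2 * INR n + 1) * Cmod q ^ n))%R with (Cmod q ^ n * / m * / (m * m) * (2 * INR n + 1))%R by (field; lra).
    have i0 : 0 < / m by apply Rinv_0_lt_compat.
    have p0 : 0 <= Cmod q ^ tri n by apply pow_le.
    have d0 : 0 < / (Cmod (qp q (N - n)) * Cmod (qp q (N + n + 1))) by apply Rinv_0_lt_compat; nra.
    have g0 := Cmod_ge_0 (qp q (2 * N + 1)).
    have A0 : 0 <= Cmod q ^ tri n * Cmod (qp q (2 * N + 1)) by apply Rmult_le_pos.
    have A1 : Cmod q ^ tri n * Cmod (qp q (2 * N + 1)) <= Cmod q ^ n * / m.
      apply Rmult_le_compat => //. lra.
    apply Rmult_le_compat => //; [apply Rmult_le_pos => //; lra | apply Cmod_ge_0 |].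
    apply Rmult_le_compat => //. lra.
  - apply Rsummable_scal; first by left; apply Rinv_0_lt_compat, pow_lt. by apply Rsummable_linear_geom.
  - move=> n.
    apply (climit_eventually (fun N => (- (1)) ^ n * q ^ tri n * ch y n * (qp q (2 * N + 1) * (/ qp q (N - n) * / qp q (N + n + 1))))).
      exists n => N hN. rewrite /jac. have -> : (n <=? N)%nat = true by apply Nat.leb_le.
      field. split; by apply qp_neq_0.
    have -> : / qinf q * ((- (1)) ^ n * q ^ tri n * ch y n) = (- (1)) ^ n * q ^ tri n * ch y n * (qinf q * (/ qinf q * / qinf q)) by field.
    have L := climit_qp q hq.
    apply climit_mult; first by apply climit_const. apply climit_mult.
      apply (climit_sub (qp q) _ (fun N => (2 * N + 1)%nat)) => //. move=> M. exists M => k. lia.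
    apply climit_mult.
      apply climit_inv => //. apply (climit_sub (qp q) _ (fun N => (N - n)%nat)) => //. move=> M. exists (M + n)%nat => k. lia.
    apply climit_inv => //. apply (climit_sub (qp q) _ (fun N => (N + n + 1)%nat)) => //. move=> M. exists M => k. lia.
Qed.

Lemma ch_2 n : ch 2 n = 2 * INR n + 1.
Proof.
  suff : ch 2 n = 2 * INR n + 1 /\ ch 2 (S n) = 2 * INR (S n) + 1 by case.
  elim: n => [|n [IH1 IH2]]; first by rewrite /ch /=; split; ring.
  split => //. rewrite ch_SS IH1 IH2 !S_INR !RtoC_plus. ring.
Qed.

(** The case y = 2, that is x = 1: the kernel is 2n + 1 and each factor is the square (1 -
    q^k)^2. *)
Lemma Jacobi_cube (q : C) : Cmod q < 1 -> tsum (fun n => (- (1)) ^ n * q ^ tri n * (2 * INR n + 1)) = qinf q ^ 3.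
Proof.
  move=> hq. have qi := qinf_neq_0 q hq.
  have L := jac_limit q 2 hq.
  have B : forall n, Cmod (ch 2 n) <= 2 * INR n + 1.
    move=> n. rewrite ch_2 -RtoC_mult -RtoC_plus Cmod_R Rabs_pos_eq; [by right | have := pos_INR n; lra].
  have L2 : climit (jprod q 2) (qinf q * qinf q).
    apply (climit_ext (fun N => qp q N * qp q N)); last by apply climit_mult; apply climit_qp.
    elim => [|N IH]; first by rewrite /qp /jprod /=; ring.
    change (jprod q 2 (S N)) with (jprod q 2 N * (1 - 2 * q ^ S N + q ^ (2 * S N))). rewrite -IH qp_S.
    replace (q ^ (2 * S N)) with (q ^ S N * q ^ S N) by (rewrite -Cpow_add_r; f_equal; lia). ring.
  have E := climit_unique _ _ _ (L B) L2.
  rewrite (tsum_ext _ (fun n => (- (1)) ^ n * q ^ tri n * ch 2 n)); last by move=> n; rewrite ch_2.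
  transitivity (tsum (fun n => (- (1)) ^ n * q ^ tri n * ch 2 n) / qinf q * qinf q); first by field.
  rewrite E. simpl. ring.
Qed.

(** The case y = - 1, that is x a primitive cube root of unity: the kernel runs periodically through
    1, 0, - 1, and 1 + q^k + q^(2k) is the quotient of 1 - q^(3k) by 1 - q^k. *)
Lemma Euler_pentagonal (q : C) : Cmod q < 1 -> tsum (fun n => (- (1)) ^ n * q ^ tri n * ch (- (1)) n) = qinf (q ^ 3).
Proof.
  move=> hq. have qi := qinf_neq_0 q hq. have q0 := Cmod_ge_0 q.
  have hq3 : Cmod (q ^ 3) < 1 by rewrite Cmod_pow; apply (pow_lt_1 _ 3) => //; lia.
  have P : forall n, (ch (- (1)) (3 * n) = 1 /\ ch (- (1)) (S (3 * n)) = 0) /\ ch (- (1)) (S (S (3 * n))) = - (1).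
    elim => [|n [[I1 I2] I3]]; first by rewrite /ch /=; (split; [split|]); ring.
    replace (3 * S n)%nat with (S (S (S (3 * n)))) by lia.
    have E1 : ch (- (1)) (S (S (S (3 * n)))) = 1 by rewrite ch_SS I3 I2; ring.
    have E2 : ch (- (1)) (S (S (S (S (3 * n))))) = 0 by rewrite ch_SS E1 I3; ring.
    split => //. rewrite ch_SS E1 E2. ring.
  have B : forall n, Cmod (ch (- (1)) n) <= 2 * INR n + 1.
    move=> n. have n0 := pos_INR n.
    suff : Cmod (ch (- (1)) n) <= 1 by lra.
    have [[I1 I2] I3] := P (n / 3)%nat. have := Nat.div_mod n 3 ltac:(lia). have := Nat.mod_upper_bound n 3 ltac:(lia).
    move=> h1 h2. 
    have : (n = 3 * (n / 3) \/ n = S (3 * (n / 3)) \/ n = S (S (3 * (n / 3))))%nat by lia.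
    move=> [->|[->|->]]; rewrite ?I1 ?I2 ?I3 ?Cmod_1 ?Cmod_0 ?Cmod_opp1; lra.
  have L2 : climit (jprod q (- (1))) (qinf (q ^ 3) * / qinf q).
    apply (climit_ext (fun N => qp (q ^ 3) N * / qp q N)).
      move=> N. have qn := qp_neq_0 q N hq.
      suff -> : qp (q ^ 3) N = jprod q (- (1)) N * qp q N by field.
      elim: N {qn} => [|N IH]; first by rewrite /qp /jprod /=; ring.
      change (jprod q (- (1)) (S N)) with (jprod q (- (1)) N * (1 - - (1) * q ^ S N + q ^ (2 * S N))). rewrite !qp_S IH.
      replace (q ^ (2 * S N)) with (q ^ S N * q ^ S N) by (rewrite -Cpow_add_r; f_equal; lia).
      replace ((q ^ 3) ^ S N) with (q ^ S N * q ^ S N * q ^ S N) by (rewrite -!Cpow_add_r -Cpow_mult_r; f_equal; lia). ring.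
    apply climit_mult; first by apply climit_qp. apply climit_inv => //. by apply climit_qp.
  have E := climit_unique _ _ _ (jac_limit q (- (1)) hq B) L2.
  transitivity (tsum (fun n => (- (1)) ^ n * q ^ tri n * ch (- (1)) n) / qinf q * qinf q); first by field.
  rewrite E. field. auto.
Qed.

(** * Theta values as infinite products *)

Lemma tsum_odd_Z (f : Z -> C) : summable f -> (forall a, Z.odd a = false -> f a = 0) ->
  tsum f = tsum (fun n : nat => f (2 * Z.of_nat n + 1)%Z + f (- (2 * Z.of_nat n + 1))%Z).
Proof.
  move=> S h0.
  pose f1 := fun a => if (0 <=? a)%Z then f a else RtoC 0. pose f2 := fun a => if (0 <=? a)%Z then RtoC 0 else f a.
  have S1 : summable f1.
    apply: summable_le S => a. rewrite /f1. case: Z.leb; first by right. rewrite Cmod_0. apply Cmod_ge_0.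
  have S2 : summable f2.
    apply: summable_le S => a. rewrite /f2. case: Z.leb; last by right. rewrite Cmod_0. apply Cmod_ge_0.
  have i1 : inj (fun n : nat => (2 * Z.of_nat n + 1)%Z) by move=> x y E; lia.
  have i2 : inj (fun n : nat => (- (2 * Z.of_nat n + 1))%Z) by move=> x y E; lia.
  have T1 := summable_inj _ _ i1 S1. have T2 := summable_inj _ _ i2 S2.
  transitivity (tsum f1 + tsum f2).
    rewrite -tsum_plus //. apply tsum_ext => a. rewrite /f1 /f2. case: Z.leb; ring.
  rewrite -(tsum_inj _ f1 i1) // -?(tsum_inj _ f2 i2) // -?tsum_plus //.
  - apply tsum_ext => n. rewrite /f1 /f2. case: Z.leb_spec; case: Z.leb_spec; try lia. done.
  - move=> b n. rewrite /f2. case: Z.leb_spec => // hb. apply h0. case hb' : (Z.odd b) => //.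
    have [c hc] := proj1 (Z.odd_spec b) hb'. case: (n (Z.to_nat (- c - 1))). lia.
  - move=> b n. rewrite /f1. case: Z.leb_spec => // hb. apply h0. case hb' : (Z.odd b) => //.
    have [c hc] := proj1 (Z.odd_spec b) hb'. case: (n (Z.to_nat c)). lia.
Qed.

Lemma chi_odd (n : nat) : chi (2 * Z.of_nat n + 1) = (- (1)) ^ n.
Proof.
  have [m Hm] : exists m, (n = 2 * m \/ n = 2 * m + 1)%nat by exists (n / 2)%nat; have := Nat.div_mod n 2 ltac:(lia); have := Nat.mod_upper_bound n 2 ltac:(lia); lia.
  have E : ((- (1)) ^ 2)%C = 1 by simpl; ring.
  case: Hm => ->.
  - replace (2 * Z.of_nat (2 * m) + 1)%Z with (4 * Z.of_nat m + 1)%Z by lia.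
    by rewrite chi_shift Cpow_mult_r E Cpow_1_l.
  - replace (2 * Z.of_nat (2 * m + 1) + 1)%Z with (4 * Z.of_nat m + 3)%Z by lia.
    rewrite chi_shift Cpow_add_r Cpow_mult_r E Cpow_1_l /chi /=. ring.
Qed.

Lemma tri_square (n : nat) : ((2 * INR n + 1) ^ 2 = 8 * INR (tri n) + 1)%R.
Proof. elim: n => [|n IH]; first by simpl; ring. rewrite S_INR. simpl tri. rewrite plus_INR S_INR. lra. Qed.

Lemma theta_exponent (t : C) (n : nat) :
  Cexp (PI * Ci * t * (2 * INR n + 1) ^ 2) = Cexp (PI * Ci * t) * Cexp (8 * PI * Ci * t) ^ tri n.
Proof.
  rewrite Cexp_pow -Cexp_add. f_equal.
  have -> : (2 * INR n + 1) ^ 2 = 8 * INR (tri n) + 1.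
    by rewrite -RtoC_mult -RtoC_plus -RtoC_pow tri_square RtoC_plus RtoC_mult.
  ring.
Qed.

Lemma IZR_odd (n : nat) : IZR (2 * Z.of_nat n + 1) = (2 * INR n + 1)%R.
Proof. by rewrite plus_IZR mult_IZR -INR_IZR_INZ. Qed.

Lemma theta_nat (k : nat) (t v : C) : 0 < Im t ->
  TH chi k t v = Cexp (PI * Ci * t) * tsum (fun n => (- (1)) ^ n * Cexp (8 * PI * Ci * t) ^ tri n *
    ((Ci * (2 * INR n + 1)) ^ k * Cexp (Ci * (2 * INR n + 1) * v) - (- (Ci * (2 * INR n + 1))) ^ k * Cexp (- (Ci * (2 * INR n + 1) * v)))).
Proof.
  move=> ht. have S := summable_TH chi k t v chi_bounded ht.
  have i1 : inj (fun n : nat => (2 * Z.of_nat n + 1)%Z) by move=> x y E; lia.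
  have i2 : inj (fun n : nat => (- (2 * Z.of_nat n + 1))%Z) by move=> x y E; lia.
  have T := summable_plus _ _ (summable_inj _ _ i1 S) (summable_inj _ _ i2 S).
  have E : forall n : nat, chi (2 * Z.of_nat n + 1) * (Ci * IZR (2 * Z.of_nat n + 1)) ^ k * Cexp (PI * Ci * t * IZR (2 * Z.of_nat n + 1) ^ 2 + Ci * IZR (2 * Z.of_nat n + 1) * v) +
     chi (- (2 * Z.of_nat n + 1)) * (Ci * IZR (- (2 * Z.of_nat n + 1))) ^ k * Cexp (PI * Ci * t * IZR (- (2 * Z.of_nat n + 1)) ^ 2 + Ci * IZR (- (2 * Z.of_nat n + 1)) * v) =
     Cexp (PI * Ci * t) * ((- (1)) ^ n * Cexp (8 * PI * Ci * t) ^ tri n *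
    ((Ci * (2 * INR n + 1)) ^ k * Cexp (Ci * (2 * INR n + 1) * v) - (- (Ci * (2 * INR n + 1))) ^ k * Cexp (- (Ci * (2 * INR n + 1) * v)))).
    move=> n. rewrite chi_opp chi_odd opp_IZR IZR_odd RtoC_opp RtoC_plus RtoC_mult !Cexp_add.
    set A := 2 * INR n + 1. replace ((- A) ^ 2) with (A ^ 2) by ring. rewrite /A theta_exponent -/A.
    replace (Ci * - A) with (- (Ci * A)) by ring. replace (- (Ci * A) * v) with (- (Ci * A * v)) by ring. ring.
  have nz := Cexp_neq_0 (PI * Ci * t).
  rewrite {1}/TH tsum_odd_Z //; last by move=> a ha; rewrite (chi_even _ ha); ring.
  rewrite (tsum_ext _ _ E) tsum_scal //.
  apply (summable_ext (fun n => / Cexp (PI * Ci * t) * (Cexp (PI * Ci * t) * ((- (1)) ^ n * Cexp (8 * PI * Ci * t) ^ tri n *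
    ((Ci * (2 * INR n + 1)) ^ k * Cexp (Ci * (2 * INR n + 1) * v) - (- (Ci * (2 * INR n + 1))) ^ k * Cexp (- (Ci * (2 * INR n + 1) * v))))))).
    move=> n. by field.
  apply summable_scal. by apply (summable_ext _ _ E).
Qed.

Lemma Cmod_nome_lt (c : R) (t : C) : 0 < c -> 0 < Im t -> Cmod (Cexp (c * PI * Ci * t)) < 1.
Proof.
  move=> hc ht. rewrite Cmod_Cexp -exp_0. apply exp_increasing.
  have -> : Re (c * PI * Ci * t) = (- (c * PI * Im t))%R by rewrite /Re /Im /=; ring.
  have := Rmult_lt_0_compat _ _ (Rmult_lt_0_compat _ _ hc PI_RGT_0) ht. lra.
Qed.

(** For t = tau/4 this is 2 i eta(tau)^3. The product also shows that the value does not vanish. *)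
Lemma theta_prime_0 (t : C) : 0 < Im t ->
  TH chi 1 t 0 = 2 * Ci * Cexp (PI * Ci * t) * qinf (Cexp (8 * PI * Ci * t)) ^ 3.
Proof.
  move=> ht. have hq := Cmod_nome_lt 8 t ltac:(lra) ht.
  rewrite theta_nat // -Jacobi_cube //.
  rewrite (tsum_ext _ (fun n => 2 * Ci * ((- (1)) ^ n * Cexp (8 * PI * Ci * t) ^ tri n * (2 * INR n + 1)))); last first.
    move=> n. rewrite Cmult_0_r Copp_0 Cexp_0. simpl. ring.
  rewrite tsum_scal; first ring.
  apply: summable_le (Rsummable_linear_geom (Cmod (Cexp (8 * PI * Ci * t))) (conj (Cmod_ge_0 _) hq)) => n.
  have q0 := Cmod_ge_0 (Cexp (8 * PI * Ci * t)).
  rewrite Cmod_mult Cmod_mult !Cmod_pow Cmod_opp1 pow1 -(RtoC_mult 2 (INR n)) -RtoC_plus Cmod_R Rabs_pos_eq; last by have := pos_INR n; lra.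
  rewrite Rmult_1_l Rmult_comm. apply Rmult_le_compat_l; first by have := pos_INR n; lra.
  replace (tri n) with (n + (tri n - n))%nat by (have := tri_ge n; lia). rewrite pow_add.
  have : 0 <= Cmod (Cexp (8 * PI * Ci * t)) ^ n by apply pow_le.
  have : Cmod (Cexp (8 * PI * Ci * t)) ^ (tri n - n) <= 1 by rewrite -(pow1 (tri n - n)); apply pow_incr; lra.
  nra.
Qed.

(** Both sides satisfy u(n+2) = - u(n+1) - u(n), because 2 cos (2 pi / 3) = - 1, and they agree for
    n = 0 and n = 1. *)
Lemma ch_sin (n : nat) : RtoC (sin ((2 * INR n + 1) * (PI / 3))) = (sqrt 3 / 2)%R * ch (- (1)) n.
Proof.
  suff : RtoC (sin ((2 * INR n + 1) * (PI / 3))) = (sqrt 3 / 2)%R * ch (- (1)) n /\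
     RtoC (sin ((2 * INR (S n) + 1) * (PI / 3))) = (sqrt 3 / 2)%R * ch (- (1)) (S n) by case.
  elim: n => [|n [IH1 IH2]].
    split.
    - replace ((2 * INR 0 + 1) * (PI / 3))%R with (PI / 3)%R by (simpl; field).
      rewrite sin_PI3 /ch /=. ring.
    - replace ((2 * INR 1 + 1) * (PI / 3))%R with PI by (simpl; field).
      rewrite sin_PI /ch /=. ring.
  split => //. rewrite ch_SS.
  have E : (sin ((2 * INR (S (S n)) + 1) * (PI / 3)) = - sin ((2 * INR (S n) + 1) * (PI / 3)) - sin ((2 * INR n + 1) * (PI / 3)))%R.
    rewrite !S_INR. set u := ((2 * (INR n + 1) + 1) * (PI / 3))%R.
    replace ((2 * (INR n + 1 + 1) + 1) * (PI / 3))%R with (u + 2 * (PI / 3))%R by (rewrite /u; field).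
    replace ((2 * INR n + 1) * (PI / 3))%R with (u - 2 * (PI / 3))%R by (rewrite /u; field).
    rewrite sin_plus sin_minus cos_2PI3. field.
  rewrite E RtoC_minus RtoC_opp IH1 IH2. ring.
Qed.

(** For t = tau/4 this is i sqrt 3 eta(3 tau), which has no zeros on the half-plane. *)
Lemma theta_third_value (t : C) : 0 < Im t ->
  TH chi 0 t (PI / 3)%R = Ci * sqrt 3 * Cexp (PI * Ci * t) * qinf (Cexp (8 * PI * Ci * t) ^ 3).
Proof.
  move=> ht. have hq := Cmod_nome_lt 8 t ltac:(lra) ht.
  rewrite theta_nat // -Euler_pentagonal //.
  have E : forall n, (- (1)) ^ n * Cexp (8 * PI * Ci * t) ^ tri n *
    ((Ci * (2 * INR n + 1)) ^ 0 * Cexp (Ci * (2 * INR n + 1) * (PI / 3)%R) - (- (Ci * (2 * INR n + 1))) ^ 0 * Cexp (- (Ci * (2 * INR n + 1) * (PI / 3)%R)))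
    = Ci * sqrt 3 * ((- (1)) ^ n * Cexp (8 * PI * Ci * t) ^ tri n * ch (- (1)) n).
    move=> n.
    replace (Ci * (2 * INR n + 1) * (PI / 3)%R) with (Ci * ((2 * INR n + 1) * (PI / 3))%R) by (rewrite RtoC_mult RtoC_plus RtoC_mult; ring).
    replace (- (Ci * ((2 * INR n + 1) * (PI / 3))%R)) with (Ci * (- ((2 * INR n + 1) * (PI / 3)))%R) by (rewrite RtoC_opp; ring).
    rewrite !Cexp_imag cos_neg sin_neg.
    have D : forall a b : R, (a, b) - (a, (- b)%R) = 2 * Ci * RtoC b by move=> a b; apply injective_projections; simpl; ring.
    simpl. rewrite !Cmult_1_l D ch_sin RtoC_div; last lra. field.
  have s3 : RtoC (sqrt 3) <> 0 by apply RtoC_neq; have := sqrt_lt_R0 3; lra.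
  have cn : Ci * sqrt 3 <> 0 by apply Cmult_neq_0 => //; apply Ci_nz.
  rewrite (tsum_ext _ _ E).
  case: (classic (summable (fun n => (- (1)) ^ n * Cexp (8 * PI * Ci * t) ^ tri n * ch (- (1)) n))) => [S|nS].
    rewrite tsum_scal //. ring.
  exfalso. apply nS.
  apply: summable_le (Rsummable_linear_geom (Cmod (Cexp (8 * PI * Ci * t))) (conj (Cmod_ge_0 _) hq)) => n.
  have q0 := Cmod_ge_0 (Cexp (8 * PI * Ci * t)).
  rewrite Cmod_mult Cmod_mult !Cmod_pow Cmod_opp1 pow1.
  have C1 : Cmod (ch (- (1)) n) <= 2 * INR n + 1.
    have := ch_sin n => /(f_equal Cmod). rewrite Cmod_mult !Cmod_R => h.
    have := SIN_bound ((2 * INR n + 1) * (PI / 3)) => hb.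
    have : Rabs (sin ((2 * INR n + 1) * (PI / 3))) <= 1 by apply Rabs_le; lra.
    have s1 : 1 < sqrt 3 by rewrite -sqrt_1; apply sqrt_lt_1; lra.
    rewrite h Rabs_pos_eq; last lra. have := Cmod_ge_0 (ch (- (1)) n). 
    case: n {h hb} => [|n]; first by rewrite /ch /= Cmod_1; lra.
    have := pos_INR n. rewrite S_INR. nra.
  rewrite Rmult_1_l Rmult_comm. apply Rmult_le_compat => //; [by apply Cmod_ge_0 | by apply pow_le |].
  replace (tri n) with (n + (tri n - n))%nat by (have := tri_ge n; lia). rewrite pow_add.
  have : 0 <= Cmod (Cexp (8 * PI * Ci * t)) ^ n by apply pow_le.
  have : Cmod (Cexp (8 * PI * Ci * t)) ^ (tri n - n) <= 1 by rewrite -(pow1 (tri n - n)); apply pow_incr; lra.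
  nra.
Qed.

Lemma theta_prime_0_neq (t : C) : 0 < Im t -> TH chi 1 t 0 <> 0.
Proof.
  move=> ht. have hq := Cmod_nome_lt 8 t ltac:(lra) ht. rewrite theta_prime_0 //.
  apply Cmult_neq_0; last by apply Cpow_nz, qinf_neq_0.
  apply Cmult_neq_0; last by apply Cexp_neq_0.
  apply Cmult_neq_0; [apply RtoC_neq; lra | apply Ci_nz].
Qed.

Lemma theta_third_neq (t : C) : 0 < Im t -> TH chi 0 t (PI / 3)%R <> 0.
Proof.
  move=> ht. have hq := Cmod_nome_lt 8 t ltac:(lra) ht. rewrite theta_third_value //.
  have s1 : 0 < sqrt 3 by apply sqrt_lt_R0; lra.
  apply Cmult_neq_0; first (apply Cmult_neq_0; last by apply Cexp_neq_0).
    apply Cmult_neq_0; [apply Ci_nz | apply RtoC_neq; lra].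
  apply qinf_neq_0. rewrite Cmod_pow. apply (pow_lt_1 _ 3); last lia. split => //. apply Cmod_ge_0.
Qed.

(** * The eta quotient *)

Lemma eta_qinf (tau : C) : eta tau = Cexp (PI * Ci / 12 * tau) * qinf (Cexp (2 * PI * Ci * tau)).
Proof.
  rewrite /eta /qinf. f_equal. f_equal. apply functional_extensionality => n. rewrite /qp. f_equal.
  apply functional_extensionality => k. rewrite Cexp_pow. do 2 f_equal. ring.
Qed.

Lemma eta_cube_ratio (tau : C) : 0 < Im tau ->
  eta (9 * tau) ^ 3 / eta tau ^ 3 = Cexp (2 * PI * Ci * tau) * (qinf (Cexp (2 * PI * Ci * tau) ^ 9) / qinf (Cexp (2 * PI * Ci * tau))) ^ 3.
Proof.
  move=> ht. have hq := Cmod_nome_lt 2 tau ltac:(lra) ht. have qi := qinf_neq_0 _ hq.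
  rewrite !eta_qinf (Cpow_mult_l (Cexp (PI * Ci / 12 * (9 * tau)))) (Cpow_mult_l (Cexp (PI * Ci / 12 * tau))) !Cexp_pow.
  have -> : Cexp (INR 3 * (PI * Ci / 12 * (9 * tau))) = Cexp (2 * PI * Ci * tau) * Cexp (INR 3 * (PI * Ci / 12 * tau)).
    rewrite -Cexp_add. f_equal. have -> : INR 3 = 3%R by simpl; lra. field.
  have -> : Cexp (INR 9 * (2 * PI * Ci * tau)) = Cexp (2 * PI * Ci * (9 * tau)).
    f_equal. have -> : INR 9 = 9%R by simpl; lra. ring.
  field. split => //. apply Cexp_neq_0.
Qed.

Lemma zfun_theta (tau : C) : 0 < Im tau ->
  zfun tau = 2 * TH chi 1 (tau / 4) (PI / 3)%R / TH chi 1 (tau / 4) 0.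
Proof.
  move=> ht.
  have h4 : / 4 = RtoC (/ 4) by rewrite RtoC_inv //; lra.
  have ht4 : 0 < Im (tau / 4).
    have -> : tau / 4 = RtoC (/ 4) * tau by rewrite -h4; field.
    rewrite /Im /=; rewrite /Im in ht; lra.
  have ht9 : 0 < Im (9 * (tau / 4)) by move: ht4; rewrite /Im /=; lra.
  have hq := Cmod_nome_lt 2 tau ltac:(lra) ht. have qi := qinf_neq_0 _ hq.
  rewrite theta_third // !theta_prime_0 // /zfun eta_cube_ratio //.
  have -> : 8 * PI * Ci * (tau / 4) = 2 * PI * Ci * tau by field.
  have -> : Cexp (8 * PI * Ci * (9 * (tau / 4))) = Cexp (2 * PI * Ci * tau) ^ 9.
    rewrite Cexp_pow. f_equal. have -> : INR 9 = 9%R by simpl; lra. field.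
  have -> : Cexp (PI * Ci * (9 * (tau / 4))) = Cexp (2 * PI * Ci * tau) * Cexp (PI * Ci * (tau / 4)).
    rewrite -Cexp_add. f_equal. field.
  have e1 := Cexp_neq_0 (PI * Ci * (tau / 4)). have ci := Ci_nz.
  field. auto.
Qed.

Lemma exists_small_zfun : exists tau0 : C, upper_half_plane tau0 /\ Cmod (zfun tau0) < 1.
Proof.
  (* The real part 1/2 makes q negative, so that 1 + 9 q (...) falls just below 1; the large
     imaginary part makes q so small that the remaining factor is close to 1. *)
  exists (1 / 2, 100)%R. have ht : 0 < Im (1 / 2, 100)%R by simpl; lra.
  split => //.
  rewrite /zfun eta_cube_ratio //.
  set q := Cexp _. set e := exp (- (200 * PI)).
  have Eq : q = - RtoC e.
    rewrite /q.
    have -> : 2 * PI * Ci * (1 / 2, 100)%R = Ci * PI + RtoC (- (200 * PI)) by apply injective_projections; simpl; field.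
    rewrite Cexp_add Cexp_pi_i Cexp_psum psum_exp_real -/e. ring.
  have e0 : 0 < e by apply exp_pos.
  have e1 : e <= 1 / 100.
    rewrite /e exp_Ropp.
    have := exp_ineq1_le (200 * PI). have := PI2_1. move=> h1 h2.
    have : 100 <= exp (200 * PI) by lra. move=> h3.
    apply (Rmult_le_reg_r (exp (200 * PI))); first lra. rewrite Rinv_l; lra.
  have Mq : Cmod q = e by rewrite Eq Cmod_opp Cmod_R Rabs_pos_eq; lra.
  have M9 : Cmod (q ^ 9) <= 1 / 100 /\ Cmod (q ^ 9) <= e.
    rewrite Cmod_pow Mq. have : e ^ 9 <= e * 1 ^ 8.
      change (e ^ 9)%R with (e * e ^ 8)%R. apply Rmult_le_compat_l; first lra. apply pow_incr. lra.
    rewrite pow1. lra.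
  have N1 := qinf_near_1 q ltac:(lra). have N9 := qinf_near_1 (q ^ 9) (proj1 M9).
  set a := qinf q in N1 *. set b := qinf (q ^ 9) in N9 *.
  have A : 98 / 100 <= Cmod a.
    have := Cmod_sub_ge 1 (1 - a). rewrite Cmod_1 (Cmod_minus_sym 1 a). replace (1 - (1 - a)) with a by ring. lra.
  have an : a <> 0 by apply Cmod_pos_neq; lra.
  have F : Cmod ((b / a) - 1) <= 5 / 100.
    replace (b / a - 1) with (((b - 1) - (a - 1)) / a) by (field; auto).
    rewrite Cmod_div //. apply (Rmult_le_reg_r (Cmod a)); first lra.
    replace (Cmod (b - 1 - (a - 1)) / Cmod a * Cmod a)%R with (Cmod (b - 1 - (a - 1))) by (field; lra).
    have := Cmod_sub_le (b - 1) (a - 1). lra.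
  set c := b / a in F *.
  have G : Cmod (c ^ 3 - 1) <= 2 / 10.
    replace (c ^ 3 - 1) with ((c - 1) * ((c - 1) * (c - 1) + 3 * (c - 1) + 3)) by ring.
    rewrite Cmod_mult.
    have T1 := Cmod_triangle ((c - 1) * (c - 1) + 3 * (c - 1)) 3.
    have T2 := Cmod_triangle ((c - 1) * (c - 1)) (3 * (c - 1)).
    rewrite !Cmod_mult !Cmod_R !(Rabs_pos_eq 3) in T1 T2; try lra.
    have c0 := Cmod_ge_0 (c - 1). have d0 := Cmod_ge_0 ((c - 1) * (c - 1) + 3 * (c - 1) + 3). nra.
  rewrite Eq. replace (9 * (- RtoC e * c ^ 3) + 1) with (RtoC (1 - 9 * e) + - RtoC (9 * e) * (c ^ 3 - 1)).
    2: { rewrite RtoC_minus RtoC_mult. ring. }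
  apply: Rle_lt_trans (Cmod_triangle _ _) _. rewrite Cmod_mult Cmod_opp !Cmod_R !Rabs_pos_eq; try lra. nra.
Qed.

(** * The modular function and its differential equation *)

Definition th (k : nat) (tau : C) : C := TH chi k (tau / 4) (PI / 3)%R.
Definition thJ (tau : C) : C := TH chi 1 (tau / 4) 0.
Definition zt (tau : C) : C := 2 * th 1 tau / thJ tau.

Lemma Im_div4 (tau : C) : upper_half_plane tau -> 0 < Im (tau / 4).
Proof.
  move=> ht. have -> : tau / 4 = RtoC (/ 4) * tau by rewrite RtoC_inv; [field | lra].
  move: ht. rewrite /upper_half_plane /Im /=. lra.
Qed.

Lemma upper_open (x : C) : upper_half_plane x -> exists d, 0 < d /\ forall y, Cmod (y - x) < d -> upper_half_plane y.
Proof.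
  move=> hx. exists (Im x); split => // y hy.
  have := im_le_Cmod (y - x). have -> : Im (y - x) = (Im y - Im x)%R by rewrite /Im /=; ring.
  have := Rle_abs (- (Im y - Im x)). rewrite Rabs_Ropp /upper_half_plane. lra.
Qed.

Lemma cder_div4 (tau : C) : cder (fun s => s / 4) tau (/ 4).
Proof.
  apply (cder_eq _ _ (1 * / 4 + tau * 0)); first ring.
  apply (cder_mult (fun s => s) (fun _ => / 4)); [apply cder_id | apply cder_const].
Qed.

Lemma cder_th (k : nat) (tau : C) : upper_half_plane tau -> cder (th k) tau (- (PI * Ci / 4) * th (S (S k)) tau).
Proof.
  move=> /Im_div4 h. apply (cder_eq _ _ (- (PI * Ci) * th (S (S k)) tau * / 4)); first field.
  apply (cder_comp (fun s => TH chi k s (PI / 3)%R) (fun s => s / 4)); last by apply cder_div4.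
  apply cder_TH_t => //. apply chi_bounded.
Qed.

Lemma cder_thJ (tau : C) : upper_half_plane tau -> cder thJ tau (- (PI * Ci / 4) * TH chi 3 (tau / 4) 0).
Proof.
  move=> /Im_div4 h. apply (cder_eq _ _ (- (PI * Ci) * TH chi 3 (tau / 4) 0 * / 4)); first field.
  apply (cder_comp (fun s => TH chi 1 s 0) (fun s => s / 4)); last by apply cder_div4.
  apply cder_TH_t => //. apply chi_bounded.
Qed.

Lemma th0_neq tau : upper_half_plane tau -> th 0 tau <> 0.
Proof. move=> /Im_div4. apply theta_third_neq. Qed.

Lemma thJ_neq tau : upper_half_plane tau -> thJ tau <> 0.
Proof. move=> /Im_div4. apply theta_prime_0_neq. Qed.

(** The heat equation brings in f'''(pi/3) and f'''(0). After substitution of the third-torsion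
    relations the second derivative cancels, and J^3 - (2 f')^3 remains, which is J^3 (1 - z^3). *)
Lemma cder_zt tau : upper_half_plane tau ->
  cder zt tau (PI * Ci / 2 * (thJ tau / th 0 tau) ^ 2 * (zt tau ^ 3 - 1)).
Proof.
  move=> h. have n0 := th0_neq _ h. have nJ := thJ_neq _ h.
  have [E3 [_ EJ]] := theta_third_torsion (tau / 4) (Im_div4 _ h) n0 nJ.
  refine (cder_eq _ _ _ _ _ (cder_div (fun s => 2 * th 1 s) thJ tau _ _ (cder_scalf 2 (th 1) _ _ (cder_th 1 tau h)) (cder_thJ tau h) nJ)).
  rewrite EJ /th E3 /zt -/(th 0 tau) -/(th 1 tau) -/(th 2 tau) -/(thJ tau).
  move: (th 0 tau) (th 1 tau) (th 2 tau) (thJ tau) n0 nJ => f0 f1 f2 J n0 nJ.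
  field. auto.
Qed.

(** The product of z^3 - 1 and (J / th0^3)^4 has zero derivative on the convex half-plane; its value
    at i serves as kappa. *)
Lemma zt_cube : exists kappa : C, forall tau, upper_half_plane tau -> zt tau ^ 3 - 1 = kappa * (th 0 tau ^ 12 / thJ tau ^ 4).
Proof.
  pose W := fun s => thJ s / th 0 s ^ 3.
  pose K := fun s => (zt s ^ 3 - 1) * W s ^ 4.
  have i3 : INR 3 = 3%R by simpl; lra. have i4 : INR 4 = 4%R by simpl; lra.
  have hi : upper_half_plane Ci by rewrite /upper_half_plane /=; lra.
  have const : forall tau, upper_half_plane tau -> K tau = K Ci.
    move=> tau ht. apply (cder_zero_const upper_half_plane) => //; first by apply convex_upper.
    move=> s h. have n0 := th0_neq _ h. have nJ := thJ_neq _ h.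
    have [E3 [_ EJ]] := theta_third_torsion (s / 4) (Im_div4 _ h) n0 nJ.
    have n3 : th 0 s ^ 3 <> 0 by apply Cpow_nz.
    have dW := cder_div thJ (fun s => th 0 s ^ 3) s _ _ (cder_thJ s h) (cder_pow (th 0) s _ 3 (cder_th 0 s h)) n3.
    have dK := cder_mult (fun s => zt s ^ 3 - 1) (fun s => W s ^ 4) s _ _
      (cder_minus (fun s => zt s ^ 3) (fun _ => 1) s _ _ (cder_pow zt s _ 3 (cder_zt s h)) (cder_const 1 s)) (cder_pow W s _ 4 dW).
    apply: (cder_eq _ _ _ _ _ dK).
    rewrite EJ i3 i4 /W /zt -/(th 0 s) -/(th 1 s) -/(th 2 s) -/(thJ s). simpl pred.
    move: (th 0 s) (th 1 s) (th 2 s) (thJ s) n0 nJ => f0 f1 f2 J n0' nJ'.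
    field. auto.
  exists (K Ci) => tau h. rewrite -(const tau h) /K /W.
  have n0 := th0_neq _ h. have nJ := thJ_neq _ h. move: (zt tau ^ 3 - 1) => x. field. auto.
Qed.

Lemma zfun_zt tau : upper_half_plane tau -> zfun tau = zt tau.
Proof. move=> h. rewrite zfun_theta //. Qed.

(** If kappa were 0, then z^3 would be identically 1, whereas |z| < 1 at some point. *)
Lemma zt_kappa : exists kappa : C, kappa <> 0 /\ forall tau, upper_half_plane tau -> zt tau ^ 3 - 1 = kappa * (th 0 tau ^ 12 / thJ tau ^ 4).
Proof.
  have [kappa H] := zt_cube. exists kappa; split => // k0.
  have [tau0 [h hz]] := exists_small_zfun.
  have E := H tau0 h. rewrite k0 Cmult_0_l -zfun_zt // in E.
  have E1 : zfun tau0 ^ 3 = 1 by replace (zfun tau0 ^ 3) with (zfun tau0 ^ 3 - 1 + 1) by ring; rewrite E; ring.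
  have : Cmod (zfun tau0) ^ 3 < 1 by apply (pow_lt_1 _ 3); [split; [apply Cmod_ge_0 | done] | lia].
  rewrite -Cmod_pow E1 Cmod_1. lra.
Qed.

Lemma zt_cube_neq tau : upper_half_plane tau -> zt tau ^ 3 - 1 <> 0.
Proof.
  move=> h. have [kappa [k0 H]] := zt_kappa. rewrite H //.
  have n0 := th0_neq _ h. have nJ := thJ_neq _ h.
  apply Cmult_neq_0 => //. move=> E. apply (Cpow_nz _ 12 n0).
  replace (th 0 tau ^ 12) with (th 0 tau ^ 12 / thJ tau ^ 4 * thJ tau ^ 4) by (field; auto). rewrite E. ring.
Qed.

Lemma cder_C_derive_upper F G x l : (forall y, upper_half_plane y -> cder F y (G y)) -> upper_half_plane x ->
  cder G x l -> cder (C_derive F) x l.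
Proof.
  move=> H hx. apply cder_local. have [d [hd h]] := upper_open x hx. exists d; split => // y hy.
  symmetry. apply cder_C_derive. by apply H, h.
Qed.

(** The first coordinate of the doubled point on the curve Y^2 = 4 X^3 - 4. *)
Definition dup_X (X : C) : C := X * (X ^ 3 + 8) / (4 * (X ^ 3 - 1)).

(** The first three derivatives of g are c times polynomials in theta derivatives by the heat
    equation. The constant enters the bracket only through c^2, which the last hypothesis supplies;
    the result is therefore insensitive to the sign of g. *)
Lemma schwarz_third (g : C -> C) (c tau : C) : c <> 0 ->
  (forall s, upper_half_plane s -> cder g s (c * th 0 s ^ 4)) -> upper_half_plane tau ->
  4 * (zt tau ^ 3 - 1) * (c * th 0 tau ^ 4) ^ 2 = (PI * Ci / 2 * (thJ tau / th 0 tau) ^ 2 * (zt tau ^ 3 - 1)) ^ 2 ->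
  schwarz_bracket g tau = - (2) * dup_X (zt tau).
Proof.
  move=> c0 Hg h Hc.
  have n0 := th0_neq _ h. have nJ := thJ_neq _ h. have nz := zt_cube_neq _ h.
  have i3 : INR 3 = 3%R by simpl; lra. have i4 : INR 4 = 4%R by simpl; lra.
  have d2 : forall s, upper_half_plane s -> cder (fun s => c * th 0 s ^ 4) s (- (PI * Ci) * c * (th 0 s ^ 3 * th 2 s)).
    move=> s hs. apply: (cder_eq _ _ _ _ _ (cder_scalf c (fun s => th 0 s ^ 4) s _ (cder_pow (th 0) s _ 4 (cder_th 0 s hs)))).
    rewrite i4. simpl pred. field.
  have d3 := cder_scalf (- (PI * Ci) * c) (fun s => th 0 s ^ 3 * th 2 s) tau _ (cder_mult (fun s => th 0 s ^ 3) (th 2) tau _ _ (cder_pow (th 0) tau _ 3 (cder_th 0 tau h)) (cder_th 2 tau h)).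
  have e2 : forall s, upper_half_plane s -> cder (C_derive g) s (- (PI * Ci) * c * (th 0 s ^ 3 * th 2 s)).
    move=> s hs. apply (cder_C_derive_upper _ (fun s => c * th 0 s ^ 4)) => //. by apply d2.
  have e3 := cder_C_derive_upper _ _ _ _ e2 h d3.
  rewrite /schwarz_bracket (cder_C_derive _ _ _ (Hg tau h)) (cder_C_derive _ _ _ (e2 tau h)) (cder_C_derive _ _ _ e3).
  have [E3 [E4 EJ]] := theta_third_torsion (tau / 4) (Im_div4 _ h) n0 nJ.
  rewrite i3. simpl pred. rewrite /th E4 E3. rewrite -/(th 0 tau) -/(th 1 tau) -/(th 2 tau) -/(thJ tau).
  have Ez : th 1 tau = zt tau * thJ tau / 2 by rewrite /zt; field; auto.
  rewrite Ez.
  rewrite -/(th 0 tau) in Hc.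
  move: (th 0 tau) (th 2 tau) (thJ tau) (zt tau) n0 nJ nz Hc => f0 f2 J z n0 nJ nz Hc.
  have ci := Ci2.
  have pi0 : RtoC PI <> 0 by apply RtoC_neq; have := PI_RGT_0; lra.
  have Hc2 : c ^ 2 = - (PI ^ 2 * J ^ 4 * (z ^ 3 - 1)) / (16 * f0 ^ 12).
    apply (Cmult_cancel_l (4 * (z ^ 3 - 1) * f0 ^ 8)).
      apply Cmult_neq_0; last by apply Cpow_nz. apply Cmult_neq_0 => //. apply RtoC_neq; lra.
    transitivity (4 * (z ^ 3 - 1) * (c * f0 ^ 4) ^ 2); first ring.
    rewrite Hc. transitivity (PI ^ 2 * (Ci * Ci) * J ^ 4 * (z ^ 3 - 1) ^ 2 / (4 * f0 ^ 4)); first by field.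
    rewrite ci. field. auto.
  (* Here the second theta derivative has dropped out; what remains is rational in z, J, f0 and
     c^2. *)
  transitivity ((PI * Ci * (PI * Ci)) * (z * J / 2 * (J ^ 3 + (z * J / 2) ^ 3)) / (- (2) * c ^ 2 * f0 ^ 12)).
    2: { rewrite Hc2. replace (PI * Ci * (PI * Ci)) with (PI ^ 2 * (Ci * Ci)) by ring. rewrite ci /dup_X. field. auto. }
  field. auto.
Qed.

(** * A primitive of the fourth power of the theta constant *)

(* Expanding [th 0 tau ^ 4] over quadruples of integers makes its termwise primitive a single exponential series. *)
Definition quad : Type := ((Z * Z) * (Z * Z))%type.

Definition qc1 (a : Z) : C := chi a * Cexp (Ci * IZR a * (PI / 3)%R).
Definition qcoef (p : quad) : C := qc1 (fst (fst p)) * qc1 (snd (fst p)) * (qc1 (fst (snd p)) * qc1 (snd (snd p))).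
Definition qnorm (p : quad) : R := (IZR (fst (fst p)) ^ 2 + IZR (snd (fst p)) ^ 2 + (IZR (fst (snd p)) ^ 2 + IZR (snd (snd p)) ^ 2))%R.
Definition qlam (p : quad) : C := PI * Ci / 4 * qnorm p.

Definition prim (tau : C) : C := tsum (fun p : quad => qcoef p / qlam p * Cexp (qlam p * tau)).

Lemma th0_quad tau : upper_half_plane tau ->
  th 0 tau ^ 4 = tsum (fun p : quad => qcoef p * Cexp (qlam p * tau)).
Proof.
  move=> /Im_div4 h. have S := summable_TH chi 0 (tau / 4) (PI / 3)%R chi_bounded h.
  transitivity ((th 0 tau * th 0 tau) * (th 0 tau * th 0 tau)); first ring.
  rewrite /th /TH -(tsum_prod _ _ S S).
  have S2 := summable_prod _ _ S S. rewrite -(tsum_prod _ _ S2 S2).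
  apply tsum_ext => -[[a b] [c d]]. rewrite /qcoef /qlam /qnorm; cbn [fst snd].
  rewrite !Cexp_add /qc1.
  have -> : PI * Ci / 4 * (IZR a ^ 2 + IZR b ^ 2 + (IZR c ^ 2 + IZR d ^ 2))%R * tau =
     (PI * Ci * (tau / 4) * IZR a ^ 2 + PI * Ci * (tau / 4) * IZR b ^ 2) + (PI * Ci * (tau / 4) * IZR c ^ 2 + PI * Ci * (tau / 4) * IZR d ^ 2).
    rewrite !RtoC_plus !RtoC_pow. field.
  rewrite !Cexp_add. simpl. ring.
Qed.

Lemma Cmod_cis_arg (a : Z) : Cmod (Cexp (Ci * IZR a * (PI / 3)%R)) = 1%R.
Proof. rewrite -Cmult_assoc -RtoC_mult Cexp_imag. apply Cmod_cis. Qed.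

Lemma Cmod_qc1 a : Cmod (qc1 a) <= 1.
Proof. rewrite /qc1 Cmod_mult Cmod_cis_arg Rmult_1_r. apply chi_bounded. Qed.

Lemma qc1_even a : Z.odd a = false -> qc1 a = 0.
Proof. move=> h. rewrite /qc1 (chi_even _ h). ring. Qed.

Lemma qcoef_le p : Cmod (qcoef p) <= 1.
Proof.
  case: p => -[a b] [c d]. rewrite /qcoef; cbn [fst snd]. rewrite (Cmod_mult (qc1 a * qc1 b)) (Cmod_mult (qc1 a)) (Cmod_mult (qc1 c)).
  have := Cmod_qc1 a. have := Cmod_qc1 b. have := Cmod_qc1 c. have := Cmod_qc1 d.
  have := Cmod_ge_0 (qc1 a). have := Cmod_ge_0 (qc1 b). have := Cmod_ge_0 (qc1 c). have := Cmod_ge_0 (qc1 d).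
  move: (Cmod (qc1 a)) (Cmod (qc1 b)) (Cmod (qc1 c)) (Cmod (qc1 d)) => u v w x h1 h2 h3 h4 h5 h6 h7 h8.
  have M : forall r s, 0 <= r -> 0 <= s -> r <= 1 -> s <= 1 -> 0 <= r * s <= 1 by move=> r s; nra.
  have h9 := M u v h4 h3 h8 h7. have h10 := M w x h2 h1 h6 h5. apply M; lra.
Qed.

Lemma IZR_odd_sq a : Z.odd a = true -> 1 <= IZR a ^ 2.
Proof.
  move=> h. have : (1 <= a * a)%Z by have [b hb] := proj1 (Z.odd_spec a) h; nia.
  move=> /IZR_le. rewrite mult_IZR. simpl. lra.
Qed.

(** The termwise primitive divides by [qlam], which vanishes at the zero quadruple. The character
    vanishes on even integers, so a nonzero coefficient forces norm at least 1 and no such division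
    matters. *)
Lemma qcoef_cases p : qcoef p = 0 \/ 1 <= qnorm p.
Proof.
  case: p => -[a b] [c d]. rewrite /qcoef /qnorm; cbn [fst snd].
  case ha : (Z.odd a); last by left; rewrite (qc1_even _ ha); ring.
  right. have := IZR_odd_sq a ha. have := pow2_ge_0 (IZR b). have := pow2_ge_0 (IZR c). have := pow2_ge_0 (IZR d). lra.
Qed.

Lemma Cmod_qlam p : Cmod (qlam p) = (PI / 4 * qnorm p)%R.
Proof.
  have P := PI_RGT_0.
  have n0 : 0 <= qnorm p.
    rewrite /qnorm. have := pow2_ge_0 (IZR (fst (fst p))). have := pow2_ge_0 (IZR (snd (fst p))).
    have := pow2_ge_0 (IZR (fst (snd p))). have := pow2_ge_0 (IZR (snd (snd p))). lra.
  rewrite /qlam Cmod_mult /Cdiv !Cmod_mult Cmod_Ci Cmod_inv; last by apply RtoC_neq; lra.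
  rewrite !Cmod_R !Rabs_pos_eq; try lra.
Qed.

Lemma qprim_coef_le p : Cmod (qcoef p / qlam p) <= 4.
Proof.
  have P := PI_RGT_0. have P2 := PI2_1.
  case: (qcoef_cases p) => h.
    rewrite h /Cdiv Cmult_0_l Cmod_0. lra.
  have L := Cmod_qlam p. have c := qcoef_le p.
  have l0 : 0 < Cmod (qlam p) by rewrite L; nra.
  have ln : qlam p <> 0 by apply Cmod_pos_neq.
  rewrite Cmod_div //. apply (Rmult_le_reg_r (Cmod (qlam p))) => //.
  replace (Cmod (qcoef p) / Cmod (qlam p) * Cmod (qlam p))%R with (Cmod (qcoef p)) by (field; lra).
  rewrite L. nra.
Qed.

(** The displacement Im tau / 2 lowers the decay rate from pi/4 to pi/8, and the majorant factors
    into four one-dimensional Gaussian sums because 1 plus a sum of nonnegative terms is at most the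
    product of the individual 1 + term. *)
Lemma Rsummable_quad (tau : C) : upper_half_plane tau ->
  Rsummable (fun p : quad => ((1 + Cmod (qlam p)) ^ 2 * exp (Re (qlam p * tau) + Cmod (qlam p) * (Im tau / 2)))%R).
Proof.
  move=> ht. rewrite /upper_half_plane in ht. have P := PI_RGT_0.
  have hy : 0 < PI / 8 * Im tau by nra.
  pose G := fun a : Z => ((1 + PI) ^ 2 * ((1 + Rabs (IZR a)) ^ 4 * exp (- (PI / 8 * Im tau) * IZR a ^ 2 + 0 * Rabs (IZR a))))%R.
  have SG : Rsummable G by apply Rsummable_scal; [apply pow_le; lra | apply Rsummable_gauss].
  have G0 : forall a, 0 <= G a.
    move=> a. have := Rabs_pos (IZR a) => h. apply Rmult_le_pos; first by apply pow_le; lra.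
    apply Rmult_le_pos; [apply pow_le; lra | left; apply exp_pos].
  have SG2 := Rsummable_prod G G G0 G0 SG SG.
  have G20 : forall p : Z * Z, 0 <= G (fst p) * G (snd p) by move=> p; apply Rmult_le_pos.
  apply: Rsummable_le (Rsummable_prod _ _ G20 G20 SG2 SG2) => -[[a b] [c d]]; cbn [fst snd].
  have E : (Re (qlam (a, b, (c, d)) * tau) + Cmod (qlam (a, b, (c, d))) * (Im tau / 2))%R =
    ((- (PI / 8 * Im tau) * IZR a ^ 2 + 0 * Rabs (IZR a)) + (- (PI / 8 * Im tau) * IZR b ^ 2 + 0 * Rabs (IZR b)) +
     ((- (PI / 8 * Im tau) * IZR c ^ 2 + 0 * Rabs (IZR c)) + (- (PI / 8 * Im tau) * IZR d ^ 2 + 0 * Rabs (IZR d))))%R.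
    rewrite Cmod_qlam. have -> : Re (qlam (a, b, (c, d)) * tau) = (- (PI / 4 * qnorm (a, b, (c, d)) * Im tau))%R.
      rewrite /qlam. set n := qnorm _. rewrite /Re /Im /=. field.
    rewrite /qnorm; cbn [fst snd]. field.
  rewrite E Cmod_qlam /qnorm; cbn [fst snd]. rewrite /G. clear E.
  move: (- (PI / 8 * Im tau) * IZR a ^ 2 + 0 * Rabs (IZR a))%R (- (PI / 8 * Im tau) * IZR b ^ 2 + 0 * Rabs (IZR b))%R
    (- (PI / 8 * Im tau) * IZR c ^ 2 + 0 * Rabs (IZR c))%R (- (PI / 8 * Im tau) * IZR d ^ 2 + 0 * Rabs (IZR d))%R => xa xb xc xd.
  rewrite !exp_plus.
  set ea := exp xa. set eb := exp xb. set ec := exp xc. set ed := exp xd.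
  have hE : 0 < ea * eb * (ec * ed) by repeat apply Rmult_lt_0_compat; apply exp_pos.
  have A : forall x : Z, 1 + PI / 4 * IZR x ^ 2 <= (1 + PI) * (1 + Rabs (IZR x)) ^ 2 /\ 1 <= 1 + PI / 4 * IZR x ^ 2.
    move=> x. rewrite -(pow2_abs (IZR x)). have := Rabs_pos (IZR x). move: (Rabs (IZR x)) => u u0. simpl. split; nra.
  have [a1 a2] := A a. have [b1 b2] := A b. have [c1 c2] := A c. have [d1 d2] := A d.
  replace ((1 + PI) ^ 2 * ((1 + Rabs (IZR a)) ^ 4 * ea) * ((1 + PI) ^ 2 * ((1 + Rabs (IZR b)) ^ 4 * eb)) *
   ((1 + PI) ^ 2 * ((1 + Rabs (IZR c)) ^ 4 * ec) * ((1 + PI) ^ 2 * ((1 + Rabs (IZR d)) ^ 4 * ed))))%R with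
   ((((1 + PI) * (1 + Rabs (IZR a)) ^ 2) * ((1 + PI) * (1 + Rabs (IZR b)) ^ 2) * (((1 + PI) * (1 + Rabs (IZR c)) ^ 2) * ((1 + PI) * (1 + Rabs (IZR d)) ^ 2))) ^ 2 * (ea * eb * (ec * ed)))%R by ring.
  apply Rmult_le_compat_r; first lra. apply pow_incr.
  have q := fun x => pow2_ge_0 (IZR x). have qa := q a. have qb := q b. have qc := q c. have qd := q d.
  split; first nra.
  move: ((1 + PI) * (1 + Rabs (IZR a)) ^ 2)%R ((1 + PI) * (1 + Rabs (IZR b)) ^ 2)%R ((1 + PI) * (1 + Rabs (IZR c)) ^ 2)%R ((1 + PI) * (1 + Rabs (IZR d)) ^ 2)%R a1 b1 c1 d1 => A1 B1 C1 D1 a1 b1 c1 d1.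
  have ab : (1 + PI / 4 * (IZR a ^ 2 + IZR b ^ 2) <= A1 * B1).
    apply Rle_trans with ((1 + PI / 4 * IZR a ^ 2) * (1 + PI / 4 * IZR b ^ 2))%R; last by apply Rmult_le_compat; lra.
    have : 0 <= (PI / 4 * IZR a ^ 2) * (PI / 4 * IZR b ^ 2) by apply Rmult_le_pos; lra. lra.
  have cd : (1 + PI / 4 * (IZR c ^ 2 + IZR d ^ 2) <= C1 * D1).
    apply Rle_trans with ((1 + PI / 4 * IZR c ^ 2) * (1 + PI / 4 * IZR d ^ 2))%R; last by apply Rmult_le_compat; lra.
    have : 0 <= (PI / 4 * IZR c ^ 2) * (PI / 4 * IZR d ^ 2) by apply Rmult_le_pos; lra. lra.
  apply Rle_trans with ((1 + PI / 4 * (IZR a ^ 2 + IZR b ^ 2)) * (1 + PI / 4 * (IZR c ^ 2 + IZR d ^ 2)))%R.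
    have : 0 <= (PI / 4 * (IZR a ^ 2 + IZR b ^ 2)) * (PI / 4 * (IZR c ^ 2 + IZR d ^ 2)) by apply Rmult_le_pos; lra. lra.
  apply Rmult_le_compat; lra.
Qed.

Lemma cder_prim tau : upper_half_plane tau -> cder prim tau (th 0 tau ^ 4).
Proof.
  move=> ht. have P := PI_RGT_0. rewrite th0_quad //.
  have -> : tsum (fun p => qcoef p * Cexp (qlam p * tau)) = tsum (fun p => qcoef p / qlam p * qlam p * Cexp (qlam p * tau)).
    apply tsum_ext => p. case: (qcoef_cases p) => h.
      rewrite h /Cdiv. ring.
    have ln : qlam p <> 0 by apply Cmod_pos_neq; rewrite Cmod_qlam; nra.
    field. exact ln.
  apply (cder_expsum (fun p => qcoef p / qlam p) qlam tau (Im tau / 2)).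
    move: ht. rewrite /upper_half_plane. lra.
  apply: Rsummable_le (Rsummable_scal 4 _ _ (Rsummable_quad tau ht)); last lra.
  move=> p. rewrite Rmult_assoc. apply Rmult_le_compat_r; last by apply qprim_coef_le.
  apply Rmult_le_pos; [apply pow_le; have := Cmod_ge_0 (qlam p); lra | left; apply exp_pos].
Qed.

Lemma analytic_prim tau : upper_half_plane tau -> analytic_at prim tau.
Proof.
  move=> ht. apply (analytic_expsum (fun p => qcoef p / qlam p) qlam tau (Im tau / 2)).
    move: ht. rewrite /upper_half_plane. lra.
  apply: Rsummable_le (Rsummable_scal 4 _ _ (Rsummable_quad tau ht)); last lra.
  move=> p.
  have e := exp_pos (Re (qlam p * tau) + Cmod (qlam p) * (Im tau / 2)).
  have l0 := Cmod_ge_0 (qlam p). have q0 := Cmod_ge_0 (qcoef p / qlam p). have q4 := qprim_coef_le p.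
  set E := exp _ in e *. apply Rmult_le_compat => //; first lra.
  have : 1 <= (1 + Cmod (qlam p)) ^ 2 by simpl; nra. nra.
Qed.

Lemma analytic_affine (A B : C) (f : C -> C) (x : C) : analytic_at f x -> analytic_at (fun s => A + B * f s) x.
Proof.
  move=> [a /locally_C_eps [d [hd H]]].
  pose c := fun k : nat => match k with O => A | _ => RtoC 0 end.
  exists (fun k => @plus C_NormedModule (c k) (@scal C_AbsRing C_NormedModule B (a k))).
  apply locally_C_eps. exists d; split => // y hy.
  have h1 : @is_pseries C_AbsRing C_NormedModule c (y - x) A.
    apply has_sum_is_pseries.
    have -> : (fun k => c k * (y - x) ^ k) = (fun k => c k * 0 ^ k).
      apply functional_extensionality => -[|k]; [done | rewrite /c /=; ring].
    have S : summable (fun k => c k * 0 ^ k).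
      apply (summable_of_inj (fun _ : unit => 0%nat)).
        move=> [|k] h; [by case: (h tt) | rewrite /=; ring].
      exists (Cmod (c 0%nat * 0 ^ 0)) => m nd. have A0 := Cmod_ge_0 (c 0%nat * 0 ^ 0).
      case: m nd => [|[] [|[] m]] nd; [exact A0 | rewrite /rsum; cbn [fold_right]; lra |].
      inversion nd as [|? ? h]. exfalso. apply h. by left.
    have := tsum_correct _ S. by rewrite -/(psum c 0) psum_0.
  exact (is_pseries_plus _ _ _ _ _ h1 (is_pseries_scal B a (y - x) (f y) (Cmult_comm _ _) (H y hy))).
Qed.

(** * The elliptic integral as a hypergeometric series *)

(** The binomial coefficients of (1 - x)^(-1/2). *)
Definition bcoef (n : nat) : C := rising (1 / 2) n / INR (fact n).
Definition hcoef (n : nat) : C := rising (1 / 2) n * rising (1 / 3) n / (rising (4 / 3) n * INR (fact n)).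

Lemma INR_S_neq (n : nat) : RtoC (INR (S n)) <> 0.
Proof. apply RtoC_neq. by apply not_0_INR. Qed.

Lemma fact_neq (n : nat) : RtoC (INR (fact n)) <> 0.
Proof. apply RtoC_neq. apply INR_fact_neq_0. Qed.

Lemma bcoef_S (n : nat) : INR (S n) * bcoef (S n) = (1 / 2 + INR n) * bcoef n.
Proof.
  have h1 := INR_S_neq n. have h2 := fact_neq n.
  rewrite /bcoef fact_simpl mult_INR RtoC_mult. cbn [rising]. field. auto.
Qed.

Lemma three_n_1 (n : nat) : 3 * INR n + 1 <> 0.
Proof. rewrite -RtoC_mult -RtoC_plus. apply RtoC_neq. have := pos_INR n. lra. Qed.

Lemma rising_43 (n : nat) : rising (4 / 3) n <> 0 /\ rising (1 / 3) n * (3 * INR n + 1) = rising (4 / 3) n.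
Proof.
  elim: n => [|n [IH1 IH2]]; first by split; [apply C1_nz | simpl; ring].
  cbn [rising].
  have E : 4 / 3 + INR n = (3 * INR (S n) + 1) / 3 by rewrite S_INR RtoC_plus; field.
  split.
  - apply Cmult_neq_0 => //. rewrite E. move=> h. apply (three_n_1 (S n)).
    replace (3 * INR (S n) + 1) with (3 * ((3 * INR (S n) + 1) / 3)) by field. rewrite h. ring.
  - rewrite E -IH2. field.
Qed.

(** Since (1/3)_n / (4/3)_n = 1 / (3n + 1), differentiating y F(y^3) termwise cancels this
    denominator and leaves the binomial series in y^3. *)
Lemma hcoef_bcoef (n : nat) : (3 * INR n + 1) * hcoef n = bcoef n.
Proof.
  have [h1 h2] := rising_43 n. have h3 := fact_neq n. have h4 := three_n_1 n.
  rewrite /hcoef /bcoef. transitivity (rising (1 / 2) n * (rising (1 / 3) n * (3 * INR n + 1)) / (rising (4 / 3) n * INR (fact n))).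
    field. auto.
  rewrite h2. field. auto.
Qed.

Lemma Cmod_bcoef (n : nat) : Cmod (bcoef n) <= 1.
Proof.
  elim: n => [|n IH].
    rewrite /bcoef /=. replace (1 / 1) with (RtoC 1) by field. rewrite Cmod_1. lra.
  have := bcoef_S n => /(f_equal Cmod). rewrite (Cmod_mult (INR (S n))) (Cmod_mult (1 / 2 + INR n)) Cmod_R Rabs_pos_eq; last by apply pos_INR.
  have -> : 1 / 2 + INR n = RtoC (1 / 2 + INR n) by rewrite RtoC_plus RtoC_div //; lra.
  rewrite Cmod_R Rabs_pos_eq; last by have := pos_INR n; lra.
  rewrite S_INR => h. have n0 := pos_INR n.
  apply (Rmult_le_reg_l (INR n + 1)); first lra. rewrite h.
  apply Rle_trans with ((1 / 2 + INR n) * 1)%R; last lra. apply Rmult_le_compat_l; [lra|]. exact IH.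
Qed.

Lemma Cmod_hcoef (n : nat) : Cmod (hcoef n) <= 1.
Proof.
  have := Cmod_bcoef n. rewrite -hcoef_bcoef (Cmod_mult (3 * INR n + 1)) -RtoC_mult -RtoC_plus Cmod_R Rabs_pos_eq; last by have := pos_INR n; lra.
  have := pos_INR n. have := Cmod_ge_0 (hcoef n). nra.
Qed.

Lemma Rsummable_bounded_coef (a : nat -> C) (r : R) : 0 <= r < 1 -> (forall n, Cmod (a n) <= 1) -> Rsummable (fun n => (Cmod (a n) * r ^ n)%R).
Proof.
  move=> hr ha. apply: Rsummable_le (Rsummable_geom r hr) => n.
  have : 0 <= r ^ n by apply pow_le; lra. have := ha n. nra.
Qed.

Lemma psum_bounded_summable (a : nat -> C) (x : C) : Cmod x < 1 -> (forall n, Cmod (a n) <= 1) -> summable (fun n => a n * x ^ n).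
Proof.
  move=> hx ha. apply (summable_psum a x (Cmod x)); first by right.
  apply Rsummable_bounded_coef => //. split => //. apply Cmod_ge_0.
Qed.

Definition psum' (a : nat -> C) : C -> C := psum (fun k => INR (S k) * a (S k)).

Lemma cder_psum_bounded (a : nat -> C) (x : C) : Cmod x < 1 -> (forall n, Cmod (a n) <= 1) -> cder (psum a) x (psum' a x).
Proof.
  move=> hx ha. have x0 := Cmod_ge_0 x. apply (cder_psum a x ((Cmod x + 1) / 2)); first lra.
  apply Rsummable_bounded_coef => //. lra.
Qed.

Lemma summable_psum' (a : nat -> C) (x : C) : Cmod x < 1 -> (forall n, Cmod (a n) <= 1) ->
  summable (fun k => INR (S k) * a (S k) * x ^ k).
Proof.
  move=> hx ha. have x0 := Cmod_ge_0 x.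
  apply: summable_le (Rsummable_scal 2 _ _ (Rsummable_linear_geom (Cmod x) (conj x0 hx))); last lra.
  move=> n. rewrite !Cmod_mult Cmod_pow Cmod_R Rabs_pos_eq; last by apply pos_INR.
  rewrite S_INR. have := ha (S n). have := Cmod_ge_0 (a (S n)). have n0 := pos_INR n.
  have p0 : 0 <= Cmod x ^ n by apply pow_le. move=> h1 h2. rewrite -Rmult_assoc.
  apply Rmult_le_compat_r => //. nra.
Qed.

Lemma psum'_shift (a : nat -> C) (x : C) : Cmod x < 1 -> (forall n, Cmod (a n) <= 1) ->
  x * psum' a x = tsum (fun k => INR k * a k * x ^ k) /\ summable (fun k => INR k * a k * x ^ k).
Proof.
  move=> hx ha. have S' := summable_psum' a x hx ha.
  have SS : summable (fun k => INR k * a k * x ^ k).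
    have S2 := summable_scal x _ S'.
    apply (summable_of_inj S).
      move=> [|b] h; first by simpl; ring. by case: (h b).
    apply: (summable_ext _ _ _ S2) => k. cbn [Cpow]. ring.
  split => //. rewrite tsum_S // /psum' /psum -tsum_scal //.
  cbn [INR]. rewrite !Cmult_0_l Cplus_0_l. apply tsum_ext => k. cbn [Cpow]. ring.
Qed.

Definition Bf : C -> C := psum bcoef.
(** The elliptic integral of dt / sqrt (1 - t^3) from 0 to y, on the unit disc. *)
Definition Zf (y : C) : C := y * psum hcoef (y ^ 3).

Lemma Bf_ode (x : C) : Cmod x < 1 -> (1 - x) * psum' bcoef x = / 2 * Bf x.
Proof.
  move=> hx. have [E S] := psum'_shift bcoef x hx Cmod_bcoef.
  have Sb := psum_bounded_summable bcoef x hx Cmod_bcoef.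
  have : psum' bcoef x = / 2 * Bf x + x * psum' bcoef x.
    rewrite E /Bf /psum -tsum_scal // -tsum_plus //; last by apply summable_scal.
    rewrite /psum' /psum. apply tsum_ext => k. rewrite bcoef_S. field.
  move=> h. transitivity (psum' bcoef x - x * psum' bcoef x); first ring. rewrite {1}h. ring.
Qed.

Lemma Bf_0 : Bf 0 = 1.
Proof. rewrite /Bf psum_0 /bcoef /=. field. Qed.

(** The coefficient recursion gives (1 - x) B' = B / 2, so B^2 (1 - x) is constant. Thus [Bf] is a
    branch of the inverse square root on the disc without any choice of argument. *)
Lemma Bf_sq (x : C) : Cmod x < 1 -> Bf x * Bf x * (1 - x) = 1.
Proof.
  move=> hx.
  transitivity (Bf 0 * Bf 0 * (1 - 0)); last by rewrite Bf_0; ring.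
  apply (cder_zero_const (fun y => Cmod (y - 0) < 1) (fun x => Bf x * Bf x * (1 - x))).
  - apply convex_ball.
  - move=> y hy. have hy' : Cmod y < 1 by replace y with (y - 0) by ring.
    have D := cder_psum_bounded bcoef y hy' Cmod_bcoef. have O := Bf_ode y hy'.
    apply (cder_eq _ _ ((psum' bcoef y * Bf y + Bf y * psum' bcoef y) * (1 - y) + Bf y * Bf y * (0 - 1))).
      transitivity (2 * Bf y * ((1 - y) * psum' bcoef y) - Bf y * Bf y); first ring. rewrite O. field.
    apply (cder_mult (fun x => Bf x * Bf x) (fun x => 1 - x)); first by apply cder_mult.
    apply cder_minus; [apply cder_const | apply cder_id].
  - by replace (x - 0) with x by ring.
  - replace (0 - 0) with (RtoC 0) by ring. rewrite Cmod_0. lra.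
Qed.

Lemma Bf_neq (x : C) : Cmod x < 1 -> Bf x <> 0.
Proof. move=> /Bf_sq h h0. move: h. rewrite h0 !Cmult_0_l => h. by apply C1_nz. Qed.

Lemma cder_Bf (x : C) : Cmod x < 1 -> cder Bf x (Bf x ^ 3 / 2).
Proof.
  move=> hx. have D := cder_psum_bounded bcoef x hx Cmod_bcoef. have O := Bf_ode x hx. have Q := Bf_sq x hx.
  apply: (cder_eq _ _ _ _ _ D).
  transitivity (psum' bcoef x * (Bf x * Bf x * (1 - x))); first by rewrite Q; ring.
  transitivity (Bf x * Bf x * ((1 - x) * psum' bcoef x)); first ring. rewrite O. field.
Qed.

Lemma Cmod_cube_lt (y : C) : Cmod y < 1 -> Cmod (y ^ 3) < 1.
Proof. move=> h. rewrite Cmod_pow. apply (pow_lt_1 _ 3); [split; [apply Cmod_ge_0 | done] | lia]. Qed.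

Lemma cder_Zf (y : C) : Cmod y < 1 -> cder Zf y (Bf (y ^ 3)).
Proof.
  move=> hy. have hx := Cmod_cube_lt y hy. set x := y ^ 3 in hx.
  have i3 : INR 3 = 3%R by simpl; lra.
  have D := cder_psum_bounded hcoef x hx Cmod_hcoef.
  have [E S] := psum'_shift hcoef x hx Cmod_hcoef.
  have Sh := psum_bounded_summable hcoef x hx Cmod_hcoef.
  have Eq : Bf x = psum hcoef x + 3 * (x * psum' hcoef x).
    rewrite E /psum -tsum_scal // -tsum_plus //; last by apply summable_scal.
    rewrite /Bf /psum. apply tsum_ext => k. rewrite -hcoef_bcoef. ring.
  apply (cder_eq _ _ (1 * psum hcoef (y ^ 3) + y * (psum' hcoef x * (INR 3 * y ^ (pred 3) * 1)))).
    rewrite -/x Eq i3 /x. simpl pred. ring.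
  apply (cder_mult (fun y => y) (fun y => psum hcoef (y ^ 3))); first by apply cder_id.
  apply (cder_comp (psum hcoef) (fun y => y ^ 3)) => //. apply (cder_pow (fun y => y)). apply cder_id.
Qed.

Lemma hyp2F1_psum (x : C) : Cmod x < 1 -> hyp2F1 (1 / 2) (1 / 3) (4 / 3) x = psum hcoef x.
Proof.
  move=> hx. rewrite /hyp2F1 /Cseries. apply Clim_seq_eq.
  have S := tsum_correct _ (psum_bounded_summable hcoef x hx Cmod_hcoef).
  move=> e he. have [N hN] := has_sum_climit _ _ S e he. exists N => n hn.
  rewrite sum_n_lsum. apply hN. lia.
Qed.

Lemma u_series_Zf (tau : C) : Cmod (zfun tau) < 1 -> u_series tau = u_o + Ci / 2 * Zf (zfun tau).
Proof. move=> h. rewrite /u_series hyp2F1_psum; last by apply Cmod_cube_lt. rewrite /Zf. ring. Qed.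

(** * The Weierstrass function of a lattice *)

Definition zp (p : Z * Z) : bool := ((fst p =? 0) && (snd p =? 0))%Z%bool.
Definition Zn (p : Z * Z) : R := (1 + Rabs (IZR (fst p)) + Rabs (IZR (snd p)))%R.

Lemma zp_spec p : zp p = true <-> p = (0, 0)%Z.
Proof.
  case: p => a b. rewrite /zp /=. split.
  - move=> /andb_prop [/Z.eqb_eq -> /Z.eqb_eq ->]. done.
  - by move=> [-> ->].
Qed.

Lemma Zn_ge_1 p : 1 <= Zn p.
Proof. rewrite /Zn. have := Rabs_pos (IZR (fst p)). have := Rabs_pos (IZR (snd p)). lra. Qed.

Lemma Zn_star p : zp p = false -> Zn p <= 2 * (Rabs (IZR (fst p)) + Rabs (IZR (snd p))).
Proof.
  case: p => a b h. rewrite /Zn; cbn [fst snd].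
  suff : 1 <= Rabs (IZR a) + Rabs (IZR b) by lra.
  rewrite -!abs_IZR -plus_IZR. apply IZR_le.
  have : ~ (a = 0 /\ b = 0)%Z by move=> [h1 h2]; move: h; rewrite h1 h2. lia.
Qed.

(** The terms are dominated by the telescoping differences 2 / sqrt (n) - 2 / sqrt (n + 1), which
    explains the bound 3 - 2 / sqrt (n + 1). *)
Lemma Rsummable_32 : Rsummable (fun n : nat => (/ ((INR n + 1) * sqrt (INR n + 1)))%R).
Proof.
  apply (Rsummable_nat _ 3).
    move=> n. left. apply Rinv_0_lt_compat. have := pos_INR n => h. apply Rmult_lt_0_compat; [lra | apply sqrt_lt_R0; lra].
  suff P : forall n, rsum (fun n : nat => (/ ((INR n + 1) * sqrt (INR n + 1)))%R) (seq 0 (S n)) <= 3 - 2 / sqrt (INR n + 1).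
    move=> [|n]; first by simpl; lra. apply: Rle_trans (P n) _.
    have : 0 < sqrt (INR n + 1) by apply sqrt_lt_R0; have := pos_INR n; lra.
    move=> h. have := Rdiv_lt_0_compat 2 _ Rlt_0_2 h. lra.
  elim => [|n IH].
    rewrite /rsum /=. rewrite Rplus_0_l sqrt_1. lra.
  rewrite rsum_S. apply: Rle_trans (Rplus_le_compat_r _ _ _ IH) _.
  rewrite S_INR. have n0 := pos_INR n.
  set u := sqrt (INR n + 1). set v := sqrt (INR n + 1 + 1).
  have u0 : 0 < u by apply sqrt_lt_R0; lra.
  have uv : u < v by apply sqrt_lt_1; lra.
  have v2 : (v * v = INR n + 1 + 1)%R by apply sqrt_sqrt; lra.
  have u2 : (u * u = INR n + 1)%R by apply sqrt_sqrt; lra.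
  have : / ((INR n + 1 + 1) * v) <= 2 / u - 2 / v.
    replace (2 / u - 2 / v)%R with (2 * (v * v - u * u) / (u * v * (u + v)))%R by (field; lra).
    rewrite v2 u2. replace (2 * (INR n + 1 + 1 - (INR n + 1)))%R with 2%R by ring. rewrite -v2.
    apply (Rmult_le_reg_r (v * v * v * (u * v * (u + v)))); first by repeat apply Rmult_lt_0_compat; lra.
    replace (/ (v * v * v) * (v * v * v * (u * v * (u + v))))%R with (u * v * (u + v))%R by (field; lra).
    replace (2 / (u * v * (u + v)) * (v * v * v * (u * v * (u + v))))%R with (2 * (v * v * v))%R by (field; lra).
    have : u * v <= v * v by nra. have : u + v <= 2 * v by lra. nra.
  lra.
Qed.

Definition zw (a : Z) : R := (/ ((Rabs (IZR a) + 1) * sqrt (Rabs (IZR a) + 1)))%R.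

Lemma zw_pos a : 0 < zw a.
Proof.
  apply Rinv_0_lt_compat. have h := Rabs_pos (IZR a). apply Rmult_lt_0_compat; [lra | apply sqrt_lt_R0; lra].
Qed.

Lemma Rsummable_zw : Rsummable zw.
Proof.
  apply Rsummable_Z; first by move=> n; left; apply zw_pos.
  - apply: Rsummable_le Rsummable_32 => n. rewrite /zw -INR_IZR_INZ Rabs_pos_eq; [by right | by apply pos_INR].
  - apply: Rsummable_le Rsummable_32 => n. rewrite /zw opp_IZR -INR_IZR_INZ Rabs_Ropp Rabs_pos_eq; [by right | by apply pos_INR].
Qed.

(** From (1 + u)(1 + v) <= (1 + u + v)^2 the cube of the norm dominates ((1 + u)(1 + v))^(3/2), so
    the double sum is bounded by a product of two convergent sums. *)
Lemma Rsummable_Zn3 : Rsummable (fun p => (/ Zn p ^ 3)%R).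
Proof.
  have S := Rsummable_prod zw zw (fun a => Rlt_le _ _ (zw_pos a)) (fun a => Rlt_le _ _ (zw_pos a)) Rsummable_zw Rsummable_zw.
  apply: Rsummable_le S => -[a b]. rewrite /zw /Zn; cbn [fst snd].
  have a0 := Rabs_pos (IZR a). have b0 := Rabs_pos (IZR b).
  set u := Rabs (IZR a) in a0 *. set v := Rabs (IZR b) in b0 *.
  have su : 0 < sqrt (u + 1) by apply sqrt_lt_R0; lra. have sv : 0 < sqrt (v + 1) by apply sqrt_lt_R0; lra.
  have E1 : (sqrt (u + 1) * sqrt (u + 1) = u + 1)%R by apply sqrt_sqrt; lra.
  have E2 : (sqrt (v + 1) * sqrt (v + 1) = v + 1)%R by apply sqrt_sqrt; lra.
  rewrite -Rinv_mult. apply Rinv_le_contravar; first by repeat apply Rmult_lt_0_compat; lra.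
  have A : sqrt (u + 1) * sqrt (v + 1) <= 1 + u + v.
    have := Rle_0_sqr (sqrt (u + 1) - sqrt (v + 1)). rewrite /Rsqr. nra.
  have B : (u + 1) * (v + 1) <= (1 + u + v) ^ 2 by simpl; nra.
  replace ((u + 1) * sqrt (u + 1) * ((v + 1) * sqrt (v + 1)))%R with (((u + 1) * (v + 1)) * (sqrt (u + 1) * sqrt (v + 1)))%R by ring.
  replace ((1 + u + v) ^ 3)%R with ((1 + u + v) ^ 2 * (1 + u + v))%R by (simpl; ring).
  apply Rmult_le_compat => //; nra.
Qed.

(** The second-order estimate for powers is applied at 1/u, with the increment 1/(u + h) - 1/u; the
    last summand of the bound accounts for replacing this increment by - h / u^2. *)
Lemma inv_pow_second_order (u h : C) (k : nat) : u <> 0 -> Cmod h <= Cmod u / 2 ->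
  Cmod (/ (u + h) ^ k - / u ^ k + INR k * h / u ^ (S k)) <= (INR k ^ 2 * 2 ^ k + 2 * INR k) * Cmod h ^ 2 / Cmod u ^ (k + 2).
Proof.
  move=> hu hh. have pu := Cmod_pos _ hu.
  have hv : Cmod u / 2 <= Cmod (u + h) by have := Cmod_add_ge u h; lra.
  have hn : u + h <> 0 by apply Cmod_pos_neq; lra.
  have nk : u ^ k <> 0 by apply Cpow_nz. have nk' : (u + h) ^ k <> 0 by apply Cpow_nz.
  set eta := - h / (u * (u + h)).
  have E1 : / u + eta = / (u + h) by rewrite /eta; field; auto.
  have Mx : Cmod (/ u) = (/ Cmod u)%R by apply Cmod_inv.
  have Me : Cmod eta <= 2 * Cmod h / Cmod u ^ 2.
    rewrite /eta Cmod_div; last by apply Cmult_neq_0. rewrite Cmod_opp Cmod_mult.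
    apply (Rmult_le_reg_r (Cmod u * Cmod (u + h))); first nra.
    replace (Cmod h / (Cmod u * Cmod (u + h)) * (Cmod u * Cmod (u + h)))%R with (Cmod h) by (field; lra).
    replace (2 * Cmod h / Cmod u ^ 2 * (Cmod u * Cmod (u + h)))%R with (Cmod h * (2 * Cmod (u + h) / Cmod u))%R by (field; lra).
    have : 1 <= 2 * Cmod (u + h) / Cmod u.
      apply (Rmult_le_reg_r (Cmod u)) => //. replace (2 * Cmod (u + h) / Cmod u * Cmod u)%R with (2 * Cmod (u + h))%R by (field; lra). lra.
    have := Cmod_ge_0 h. nra.
  have rho0 : 0 < 2 / Cmod u by apply Rdiv_lt_0_compat; lra.
  have Q := pow_second_order (/ u) eta (2 / Cmod u) k rho0.
  rewrite E1 Mx in Q.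
  have Q1 := Q ltac:(have := Rinv_0_lt_compat _ pu; rewrite /Rdiv; lra) _.
  have h2 : Cmod (/ (u + h)) <= 2 / Cmod u.
    rewrite Cmod_inv //. replace (2 / Cmod u)%R with (/ (Cmod u / 2))%R by (field; lra). apply Rinv_le_contravar; lra.
  have Q2 := Q1 h2.
  have -> : / (u + h) ^ k - / u ^ k + INR k * h / u ^ S k =
    ((/ (u + h)) ^ k - (/ u) ^ k - INR k * (/ u) ^ (pred k) * eta) + INR k * (/ u) ^ (pred k) * (h * h / (u * u * (u + h))).
    rewrite !Cpow_inv //. case: k {Q Q1 Q2 nk nk'} => [|k]; rewrite /eta; cbn [pred Cpow INR]; first by field; auto.
    have nk : u ^ k <> 0 by apply Cpow_nz. have nk' : (u + h) ^ k <> 0 by apply Cpow_nz.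
    field. auto.
  apply: Rle_trans (Cmod_triangle _ _) _.
  have k0 := pos_INR k. have h0 := Cmod_ge_0 h.
  have u2 : 0 < Cmod u ^ (k + 2) by apply pow_lt.
  have A : Cmod ((/ (u + h)) ^ k - (/ u) ^ k - INR k * (/ u) ^ (pred k) * eta) <= INR k ^ 2 * 2 ^ k * Cmod h ^ 2 / Cmod u ^ (k + 2).
    apply: Rle_trans Q2 _.
    have q0 : 0 <= INR k ^ 2 * (2 / Cmod u) ^ k / (2 / Cmod u) ^ 2.
      apply Rmult_le_pos; last by left; apply Rinv_0_lt_compat, pow_lt. apply Rmult_le_pos; [by apply pow_le | apply pow_le; lra].
    apply Rle_trans with (INR k ^ 2 * (2 / Cmod u) ^ k / (2 / Cmod u) ^ 2 * (2 * Cmod h / Cmod u ^ 2) ^ 2)%R.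
      apply Rmult_le_compat_l => //. apply pow_incr. split => //. apply Cmod_ge_0.
    right. rewrite /Rdiv Rpow_mult_distr pow_inv pow_add. have := pow_lt _ k pu. move=> h3. field. lra.
  have B : Cmod (INR k * (/ u) ^ (pred k) * (h * h / (u * u * (u + h)))) <= 2 * INR k * Cmod h ^ 2 / Cmod u ^ (k + 2).
    rewrite Cmod_mult (Cmod_mult (INR k)) Cmod_pow Mx Cmod_R (Rabs_pos_eq (INR k)) //.
    rewrite Cmod_div; last by repeat apply Cmult_neq_0. rewrite !Cmod_mult pow_inv.
    have u1 : 0 < Cmod u ^ (pred k) by apply pow_lt.
    apply Rle_trans with (INR k * / Cmod u ^ (pred k) * (2 * Cmod h ^ 2 / Cmod u ^ 3))%R.
      apply Rmult_le_compat_l; first by apply Rmult_le_pos => //; left; apply Rinv_0_lt_compat.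
      apply (Rmult_le_reg_r (Cmod u * Cmod u * Cmod (u + h))); first by repeat apply Rmult_lt_0_compat; lra.
      replace (Cmod h * Cmod h / (Cmod u * Cmod u * Cmod (u + h)) * (Cmod u * Cmod u * Cmod (u + h)))%R with (Cmod h * Cmod h)%R by (field; lra).
      replace (2 * Cmod h ^ 2 / Cmod u ^ 3 * (Cmod u * Cmod u * Cmod (u + h)))%R with ((Cmod h * Cmod h) * (2 * Cmod (u + h) / Cmod u))%R by (field; lra).
      have : 1 <= 2 * Cmod (u + h) / Cmod u.
        apply (Rmult_le_reg_r (Cmod u)) => //. replace (2 * Cmod (u + h) / Cmod u * Cmod u)%R with (2 * Cmod (u + h))%R by (field; lra). lra.
      nra.
    right. case: k {Q Q1 Q2 k0 nk nk' A u1} u2 => [|k] u2; first by simpl; field; lra.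
    cbn [pred]. replace (S k + 2)%nat with (k + 3)%nat by lia. rewrite pow_add. have := pow_lt _ k pu. move=> h3. field. lra.
  apply: Rle_trans (Rplus_le_compat _ _ _ _ A B) _. right. field. lra.
Qed.

Section Lattice.
Variable w : C * C.
Hypothesis hw : Im (snd w * Cconj (fst w)) <> 0%R.

Definition lam (p : Z * Z) : C := lattice_point w (fst p) (snd p).

(** Multiplying a lattice point by a conjugate period and taking imaginary parts isolates one
    coordinate times the area D of the fundamental parallelogram. *)
Lemma lam_lower : exists c, 0 < c /\ forall p, c * (Rabs (IZR (fst p)) + Rabs (IZR (snd p))) <= Cmod (lam p).
Proof.
  set D := Rabs (Im (snd w * Cconj (fst w))).
  have D0 : 0 < D by apply Rabs_pos_lt.
  set W := (Cmod (fst w) + Cmod (snd w))%R.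
  have a0 := Cmod_ge_0 (fst w). have b0 := Cmod_ge_0 (snd w).
  have W0 : 0 < W.
    case: (Rle_lt_or_eq_dec 0 W); [rewrite /W; lra | done |] => E.
    have E1 : fst w = 0 by apply Cmod_eq_0; rewrite /W in E; lra.
    case: hw. by rewrite E1 /Im /=; ring.
  exists (D / W)%R; split; first by apply Rdiv_lt_0_compat.
  move=> [m n]; cbn [fst snd]. set l := lam (m, n).
  have E1 : (Rabs (IZR n) * D <= Cmod l * Cmod (fst w)).
    rewrite -Rabs_mult -(Cmod_conj (fst w)) -Cmod_mult. apply: Rle_trans (im_le_Cmod _). right. f_equal.
    rewrite /l /lam /lattice_point /Im /=. ring.
  have E2 : (Rabs (IZR m) * D <= Cmod l * Cmod (snd w)).
    rewrite -Rabs_mult -(Cmod_conj (snd w)) -Cmod_mult. apply: Rle_trans (im_le_Cmod _). right. rewrite -Rabs_Ropp. f_equal.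
    rewrite /l /lam /lattice_point /Im /=. ring.
  apply (Rmult_le_reg_r W) => //.
  replace (D / W * (Rabs (IZR m) + Rabs (IZR n)) * W)%R with (Rabs (IZR m) * D + Rabs (IZR n) * D)%R by (field; lra).
  rewrite /W. lra.
Qed.

Definition off_star (x : C) : Prop := forall p, zp p = false -> x <> lam p.

Lemma finite_lower (f : Z * Z -> R) (l : list (Z * Z)) : (forall p, In p l -> 0 < f p) -> exists c, 0 < c /\ forall p, In p l -> c <= f p.
Proof.
  elim: l => [|p l IH] H; first by exists 1%R; split; [lra|].
  have [c [c0 hc]] := IH (fun q hq => H q (or_intror hq)).
  exists (Rmin c (f p)); split; first by apply Rmin_glb_lt => //; apply H; left.
  move=> q [<-|hq]; first by apply Rmin_r. apply: Rle_trans (Rmin_l _ _) _. by apply hc.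
Qed.

(** Lattice points of large index are far from x by [lam_lower]; the finitely many others have
    positive distance. The result is one lower bound, proportional to the index norm, that is stable
    under small moves of x. *)
Lemma off_star_lower x : off_star x -> exists c, 0 < c /\ forall p, zp p = false -> c * Zn p <= Cmod (x - lam p).
Proof.
  move=> hx. have [c0 [c00 h0]] := lam_lower.
  have x0 := Cmod_ge_0 x.
  have [N hN] : exists N : Z, (4 * Cmod x / c0 <= IZR N).
    exists (up (4 * Cmod x / c0)). have [h _] := archimed (4 * Cmod x / c0). lra.
  pose zs := map (fun i => (Z.of_nat i - N)%Z) (seq 0 (Z.to_nat (2 * N + 1))).
  pose L := filter (fun p => negb (zp p)) (list_prod zs zs).
  have [c1 [c10 h1]] : exists c, 0 < c /\ forall p, In p L -> c <= (Cmod (x - lam p) / Zn p)%R.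
    apply finite_lower => p /filter_In [_ hp]. apply Rdiv_lt_0_compat; last by have := Zn_ge_1 p; lra.
    apply Cmod_pos. apply Cminus_eq_contra. apply hx. by case: (zp p) hp.
  exists (Rmin c1 (c0 / 4)); split; first by apply Rmin_glb_lt; lra.
  move=> p hp. have z1 := Zn_ge_1 p. have z2 := Zn_star p hp.
  case: (Rle_lt_dec (4 * Cmod x) (c0 * Zn p)) => hc.
  - apply Rle_trans with (c0 / 4 * Zn p)%R; first by apply Rmult_le_compat_r; [lra | apply Rmin_r].
    rewrite Cmod_minus_sym. have := Cmod_sub_ge (lam p) x. have := h0 p. nra.
  - apply Rle_trans with (c1 * Zn p)%R; first by apply Rmult_le_compat_r; [lra | apply Rmin_l].
    have : c1 <= Cmod (x - lam p) / Zn p.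
      apply h1. apply filter_In. split; last by rewrite hp.
      have zb : Zn p < IZR N.
        apply: Rlt_le_trans hN. apply (Rmult_lt_reg_l c0) => //. by replace (c0 * (4 * Cmod x / c0))%R with (4 * Cmod x)%R by (field; lra).
      have P : forall a, Rabs (IZR a) < IZR N -> In a zs.
        move=> a. rewrite -abs_IZR => /lt_IZR ha. apply in_map_iff. exists (Z.to_nat (a + N)). split; first lia.
        apply in_seq. lia.
      case: p {hp z1 z2 hc} zb => a b. rewrite /Zn; cbn [fst snd] => zb.
      have u0 := Rabs_pos (IZR a). have v0 := Rabs_pos (IZR b).
      apply in_prod; apply P; lra.
    move=> h. apply (Rmult_le_compat_r (Zn p)) in h; last lra.
    by replace (Cmod (x - lam p) / Zn p * Zn p)%R with (Cmod (x - lam p)) in h by (field; lra).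
Qed.

Lemma off_star_0 : off_star 0.
Proof.
  move=> p hp E. have [c [c0 h]] := lam_lower. have := h p. rewrite -E Cmod_0. have := Zn_star p hp. have := Zn_ge_1 p. nra.
Qed.

Lemma lam_lower_star : exists c, 0 < c /\ forall p, zp p = false -> c * Zn p <= Cmod (lam p).
Proof.
  have [c [c0 h]] := off_star_lower 0 off_star_0. exists c; split => // p hp.
  have := h p hp. by rewrite Cmod_minus_sym; replace (lam p - 0) with (lam p) by ring.
Qed.

Lemma lam_neq p : zp p = false -> lam p <> 0.
Proof. move=> hp E. by apply (off_star_0 p hp). Qed.

Lemma off_star_near x c : (forall p, zp p = false -> c * Zn p <= Cmod (x - lam p)) -> 0 < c ->
  forall y, Cmod (y - x) < c / 2 -> forall p, zp p = false -> c / 2 * Zn p <= Cmod (y - lam p).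
Proof.
  move=> H c0 y hy p hp. have := H p hp. have := Zn_ge_1 p. have := Cmod_dist x y (lam p).
  rewrite Cmod_minus_sym in hy. nra.
Qed.

Lemma lower_off_star y c : 0 < c -> (forall p, zp p = false -> c * Zn p <= Cmod (y - lam p)) -> off_star y.
Proof.
  move=> c0 H p hp E. have := H p hp. have := Zn_ge_1 p.
  rewrite E. replace (lam p - lam p) with (RtoC 0) by ring. rewrite Cmod_0. nra.
Qed.

Definition star (f : Z * Z -> C) (p : Z * Z) : C := if zp p then RtoC 0 else f p.

(** Weights are carried so that the same differentiation rule covers the derivatives of P, with
    weight 1, and the remainder of its expansion at 0, with weights lambda^(-j). *)
Definition latsum (c : Z * Z -> C) (k : nat) (x : C) : C := tsum (star (fun p => c p * / (x - lam p) ^ k)).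

Definition lat_admissible (c : Z * Z -> C) (k : nat) : Prop := Rsummable (fun p => (Cmod (c p) * / Zn p ^ k)%R).

Lemma star_bound (c : Z * Z -> C) (k : nat) (y : C) (d : R) : 0 < d -> (forall p, zp p = false -> d * Zn p <= Cmod (y - lam p)) ->
  forall p, zp p = false -> Cmod (/ (y - lam p) ^ k) <= / d ^ k * / Zn p ^ k.
Proof.
  move=> d0 H p hp. have h := H p hp. have z1 := Zn_ge_1 p.
  have n : y - lam p <> 0 by apply Cmod_pos_neq; nra.
  rewrite Cmod_inv; last by apply Cpow_nz. rewrite Cmod_pow -Rinv_mult -Rpow_mult_distr.
  apply Rinv_le_contravar; first by apply pow_lt; nra. apply pow_incr. split => //. nra.
Qed.

Lemma summable_latsum c k x : lat_admissible c k -> off_star x -> summable (star (fun p => c p * / (x - lam p) ^ k)).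
Proof.
  move=> hc /off_star_lower [d [d0 H]].
  have id : 0 < / d ^ k by apply Rinv_0_lt_compat, pow_lt.
  apply: summable_le (Rsummable_scal (/ d ^ k) _ _ hc); last lra.
  move=> p. rewrite /star. have z1 := Zn_ge_1 p. have iz : 0 < / Zn p ^ k by apply Rinv_0_lt_compat, pow_lt; lra.
  have c0 := Cmod_ge_0 (c p).
  case hp : (zp p); first by rewrite Cmod_0; apply Rmult_le_pos; [lra | nra].
  rewrite Cmod_mult. have := star_bound c k x d d0 H p hp. nra.
Qed.

Lemma lat_admissible_S c k : lat_admissible c k -> lat_admissible c (S k).
Proof.
  apply Rsummable_le => p. apply Rmult_le_compat_l; first by apply Cmod_ge_0.
  have z1 := Zn_ge_1 p. apply Rinv_le_contravar; first by apply pow_lt; lra. simpl.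
  have : 0 < Zn p ^ k by apply pow_lt; lra. nra.
Qed.

(** Only the increments of the terms are prescribed, so a term may differ from c / (y - lambda)^k by
    a constant depending on p. This admits the convergence correction - 1 / lambda^2 of the
    Weierstrass series. *)
Lemma cder_star_sum (t : Z * Z -> C -> C) (c : Z * Z -> C) (k : nat) (x : C) : off_star x -> lat_admissible c (k + 2) ->
  (forall y, off_star y -> summable (star (fun p => t p y))) -> lat_admissible c (S k) ->
  (forall p y h, t p (y + h) - t p y = c p * / (y + h - lam p) ^ k - c p * / (y - lam p) ^ k) ->
  cder (fun y => tsum (star (fun p => t p y))) x (- INR k * latsum c (S k) x).
Proof.
  move=> hx hc St hc' Ht. have [d [d0 H]] := off_star_lower x hx.
  have near := off_star_near x d H d0.
  have k0 := pos_INR k.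
  have S' := summable_latsum c (S k) x hc' hx.
  have -> : - INR k * latsum c (S k) x = tsum (fun p => - INR k * star (fun p => c p * / (x - lam p) ^ (S k)) p).
    by rewrite tsum_scal.
  set K := (INR k ^ 2 * 2 ^ k + 2 * INR k)%R.
  have K0 : 0 <= K by rewrite /K; have := pow_lt 2 k Rlt_0_2; have := pow2_ge_0 (INR k); nra.
  have id : 0 < / d ^ (k + 2) by apply Rinv_0_lt_compat, pow_lt.
  apply (cder_tsum (fun p y => star (fun p => t p y) p) (fun p y => - INR k * star (fun p => c p * / (y - lam p) ^ (S k)) p) x (d / 2)
    (fun p => (K * / d ^ (k + 2) * (Cmod (c p) * / Zn p ^ (k + 2)))%R)); first lra.
  - apply Rsummable_scal => //. nra.
  - move=> y hy. apply St. apply (lower_off_star y (d / 2)); first lra. by apply near.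
  - by apply summable_scal.
  - move=> p h hh. rewrite /star. have z1 := Zn_ge_1 p.
    have iz : 0 < / Zn p ^ (k + 2) by apply Rinv_0_lt_compat, pow_lt; lra.
    have c0 := Cmod_ge_0 (c p). have h0 := pow2_ge_0 (Cmod h).
    case hp : (zp p).
      replace (0 - 0 - - INR k * 0 * h) with (RtoC 0) by ring. rewrite Cmod_0.
      apply Rmult_le_pos => //. apply Rmult_le_pos; nra.
    have n : x - lam p <> 0 by apply Cmod_pos_neq; have := H p hp; nra.
    replace (t p (x + h) - t p x - - INR k * (c p * / (x - lam p) ^ S k) * h) with
      (c p * (/ (x - lam p + h) ^ k - / (x - lam p) ^ k + INR k * h / (x - lam p) ^ (S k))).
      2: { rewrite Ht. replace (x - lam p + h) with (x + h - lam p) by ring. rewrite /Cdiv. ring. }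
    rewrite Cmod_mult.
    have B := inv_pow_second_order (x - lam p) h k n ltac:(have := H p hp; nra). rewrite -/K in B.
    have B2 := star_bound c (k + 2) x d d0 H p hp. rewrite Cmod_inv in B2; last by apply Cpow_nz. rewrite Cmod_pow in B2.
    apply Rle_trans with (Cmod (c p) * (K * Cmod h ^ 2 * (/ d ^ (k + 2) * / Zn p ^ (k + 2))))%R; last by right; ring.
    apply Rmult_le_compat_l => //. apply: Rle_trans B _. apply Rmult_le_compat_l => //. nra.
Qed.

Lemma cder_latsum c k x : lat_admissible c k -> off_star x -> cder (latsum c k) x (- INR k * latsum c (S k) x).
Proof.
  move=> hc hx. apply (cder_star_sum (fun p y => c p * / (y - lam p) ^ k)) => //.
  - replace (k + 2)%nat with (S (S k)) by lia. by do 2 apply lat_admissible_S.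
  - move=> y hy. by apply summable_latsum.
  - by apply lat_admissible_S.
Qed.

Definition one_coef (p : Z * Z) : C := 1.

Lemma admissible_one k : (3 <= k)%nat -> lat_admissible one_coef k.
Proof.
  move=> hk. have -> : k = ((k - 3) + 3)%nat by lia.
  elim: (k - 3)%nat => [|j IH]; last by apply lat_admissible_S.
  apply: Rsummable_le Rsummable_Zn3 => p. rewrite /one_coef Cmod_1 Rmult_1_l. by right.
Qed.

Definition wpterm (x : C) (p : Z * Z) : C := 1 / (x - lam p) ^ 2 - 1 / lam p ^ 2.
Definition wpR (x : C) : C := tsum (star (wpterm x)).

(** The combined term equals x (2 lambda - x) / ((x - lambda)^2 lambda^2), which decays like the
    inverse cube of the index norm. *)
Lemma summable_wpR x : off_star x -> summable (star (wpterm x)).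
Proof.
  move=> hx. have [d [d0 H]] := off_star_lower x hx. have [e [e0 E]] := lam_lower_star.
  have x0 := Cmod_ge_0 x.
  set K := (Cmod x * (2 + Cmod x / e) * / d ^ 2 * / e)%R.
  have K0 : 0 <= K.
    have : 0 <= Cmod x / e by apply Rdiv_le_0_compat.
    move=> h. have := Rinv_0_lt_compat _ (pow_lt _ 2 d0). have := Rinv_0_lt_compat _ e0. move=> h1 h2.
    repeat apply Rmult_le_pos; lra.
  apply: summable_le (Rsummable_scal K _ K0 Rsummable_Zn3) => p. rewrite /star.
  have z1 := Zn_ge_1 p.
  case hp : (zp p).
    rewrite Cmod_0. apply Rmult_le_pos => //. left. apply Rinv_0_lt_compat, pow_lt. lra.
  have h1 := H p hp. have h2 := E p hp.
  have n1 : x - lam p <> 0 by apply Cmod_pos_neq; nra. have n2 : lam p <> 0 by apply lam_neq.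
  rewrite /wpterm. replace (1 / (x - lam p) ^ 2 - 1 / lam p ^ 2) with (x * (2 * lam p - x) / ((x - lam p) ^ 2 * lam p ^ 2)) by (field; auto).
  rewrite Cmod_div; last by apply Cmult_neq_0; apply Cpow_nz.
  rewrite Cmod_mult (Cmod_mult ((x - lam p) ^ 2)) !Cmod_pow.
  have A : Cmod (2 * lam p - x) <= (2 + Cmod x / e) * Cmod (lam p).
    apply: Rle_trans (Cmod_sub_le _ _) _. rewrite Cmod_mult Cmod_R Rabs_pos_eq; last lra.
    have : Cmod x <= Cmod x / e * Cmod (lam p).
      replace (Cmod x) with (Cmod x / e * e)%R at 1 by (field; lra). apply Rmult_le_compat_l; last nra. by apply Rdiv_le_0_compat.
    lra.
  have l0 : 0 < Cmod (lam p) by nra. have y0 : 0 < Cmod (x - lam p) by nra.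
  apply Rle_trans with (Cmod x * ((2 + Cmod x / e) * Cmod (lam p)) / (Cmod (x - lam p) ^ 2 * Cmod (lam p) ^ 2))%R.
    apply Rmult_le_compat_r; last by apply Rmult_le_compat_l.
    left. apply Rinv_0_lt_compat. apply Rmult_lt_0_compat; by apply pow_lt.
  replace (Cmod x * ((2 + Cmod x / e) * Cmod (lam p)) / (Cmod (x - lam p) ^ 2 * Cmod (lam p) ^ 2))%R with
    (Cmod x * (2 + Cmod x / e) * (/ Cmod (x - lam p) ^ 2 * / Cmod (lam p)))%R by (field; lra).
  replace (K * / Zn p ^ 3)%R with (Cmod x * (2 + Cmod x / e) * (/ (d * Zn p) ^ 2 * / (e * Zn p)))%R by (rewrite /K; field; lra).
  apply Rmult_le_compat_l.
    apply Rmult_le_pos => //. have : 0 <= Cmod x / e by apply Rdiv_le_0_compat. lra.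
  apply Rmult_le_compat; try by (left; apply Rinv_0_lt_compat; try apply pow_lt; nra).
  - apply Rinv_le_contravar; first by apply pow_lt; nra. apply pow_incr; nra.
  - apply Rinv_le_contravar; nra.
Qed.

Lemma cder_wpR x : off_star x -> cder wpR x (- (2) * latsum one_coef 3 x).
Proof.
  move=> hx. have i2 : RtoC (INR 2) = 2 by f_equal; simpl; lra. rewrite -i2.
  apply (cder_star_sum (fun p y => wpterm y p) one_coef 2) => //; try by apply admissible_one; lia.
  - move=> y hy. by apply summable_wpR.
  - move=> p y h. rewrite /wpterm /one_coef /Cdiv. ring.
Qed.

Definition wpf (x : C) : C := 1 / x ^ 2 + wpR x.
Definition wpf1 (x : C) : C := - (2) / x ^ 3 - 2 * latsum one_coef 3 x.
Definition wpf2 (x : C) : C := 6 / x ^ 4 + 6 * latsum one_coef 4 x.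
Definition wpf3 (x : C) : C := - (24) / x ^ 5 - 24 * latsum one_coef 5 x.

Definition off (x : C) : Prop := ~ in_lattice w x.

Lemma in_lattice_lam x : in_lattice w x <-> exists p, x = lam p.
Proof. split; [move=> [m [n ->]]; by exists (m, n) | move=> [[m n] ->]; by exists m, n]. Qed.

Lemma lam_0 : lam (0, 0)%Z = 0.
Proof. rewrite /lam /lattice_point /=. ring. Qed.

Lemma off_iff x : off x <-> x <> 0 /\ off_star x.
Proof.
  split.
  - move=> h. split; first by move=> E; apply h; apply in_lattice_lam; exists (0, 0)%Z; rewrite lam_0.
    move=> p _ E. apply h. apply in_lattice_lam. by exists p.
  - move=> [h0 h] /in_lattice_lam [p E]. case hp : (zp p); last by apply (h p hp).
    move: hp => /zp_spec hp. apply h0. by rewrite E hp lam_0.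
Qed.

Lemma off_open x : off x -> exists d, 0 < d /\ forall y, Cmod (y - x) < d -> off y.
Proof.
  move=> /off_iff [h0 h]. have [d [d0 H]] := off_star_lower x h.
  have px := Cmod_pos _ h0.
  exists (Rmin (d / 2) (Cmod x)); split; first by apply Rmin_glb_lt; lra.
  move=> y hy. apply off_iff. split.
  - move=> E. have := Rlt_le_trans _ _ _ hy (Rmin_r _ _). rewrite E Cmod_minus_sym. replace (x - 0) with x by ring. lra.
  - apply (lower_off_star y (d / 2)); first lra. apply (off_star_near x d) => //. apply: Rlt_le_trans hy (Rmin_l _ _).
Qed.

Lemma cder_inv_pow (c : C) (k : nat) (x : C) : x <> 0 -> cder (fun y => c / y ^ k) x (- INR k * c / x ^ (S k)).
Proof.
  move=> hx. have nk : x ^ k <> 0 by apply Cpow_nz.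
  refine (cder_eq _ _ _ _ _ (cder_div (fun _ => c) (fun y => y ^ k) x _ _ (cder_const c x) (cder_pow (fun y => y) x _ k (cder_id x)) nk)).
  case: k nk => [|k] nk; first by simpl; field.
  have nk' : x ^ k <> 0 by apply Cpow_nz. cbn [pred Cpow]. field. auto.
Qed.

Lemma cder_wpf x : off x -> cder wpf x (wpf1 x).
Proof.
  move=> /off_iff [h0 h]. apply (cder_eq _ _ (- INR 2 * 1 / x ^ 3 + - (2) * latsum one_coef 3 x)).
    have -> : INR 2 = 2%R by simpl; lra. rewrite /wpf1 /Cdiv. ring.
  apply cder_plus; [by apply (cder_inv_pow 1 2) | by apply cder_wpR].
Qed.

Lemma cder_wpf1 x : off x -> cder wpf1 x (wpf2 x).
Proof.
  move=> /off_iff [h0 h]. apply (cder_eq _ _ (- INR 3 * - (2) / x ^ 4 - 2 * (- INR 3 * latsum one_coef 4 x))).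
    have -> : INR 3 = 3%R by simpl; lra. rewrite /wpf2 /Cdiv. ring.
  apply cder_minus; [by apply (cder_inv_pow (- (2)) 3) | apply cder_scalf; apply cder_latsum => //; apply admissible_one; lia].
Qed.

Lemma cder_wpf2 x : off x -> cder wpf2 x (wpf3 x).
Proof.
  move=> /off_iff [h0 h]. apply (cder_eq _ _ (- INR 4 * 6 / x ^ 5 + 6 * (- INR 4 * latsum one_coef 5 x))).
    have -> : INR 4 = 4%R by simpl; lra. rewrite /wpf3 /Cdiv. ring.
  apply cder_plus; [by apply (cder_inv_pow 6 4) | apply cder_scalf; apply cder_latsum => //; apply admissible_one; lia].
Qed.

Lemma cder_wpf3 x : off x -> cder wpf3 x (120 / x ^ 6 + 120 * latsum one_coef 6 x).
Proof.
  move=> /off_iff [h0 h]. apply (cder_eq _ _ (- INR 5 * - (24) / x ^ 6 - 24 * (- INR 5 * latsum one_coef 6 x))).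
    have -> : INR 5 = 5%R by simpl; lra. rewrite /Cdiv. ring.
  apply cder_minus; [by apply (cder_inv_pow (- (24)) 5) | apply cder_scalf; apply cder_latsum => //; apply admissible_one; lia].
Qed.

Lemma NoDup_list_prod {A B : Type} (l : list A) (m : list B) : NoDup l -> NoDup m -> NoDup (list_prod l m).
Proof.
  move=> + hm. elim: l => [_|a l IH nd] /=; first by apply NoDup_nil.
  inversion nd as [|? ? na nl]; subst. apply NoDup_app; [by apply NoDup_map_inj => // x y E; inversion E | by apply IH |].
  move=> p /in_map_iff [b [<- _]] /in_prod_iff [h _]. done.
Qed.

Definition boxz (N : nat) : list Z := map (fun i => (Z.of_nat i - Z.of_nat N)%Z) (seq 0 (S (2 * N))).

Lemma square_sum_lsum (f : Z -> Z -> C) N : square_sum f N = lsum (fun p => f (fst p) (snd p)) (list_prod (boxz N) (boxz N)).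
Proof.
  rewrite /square_sum sum_n_lsum lsum_prod /boxz lsum_map. apply lsum_ext => i _.
  by rewrite sum_n_lsum lsum_map.
Qed.

Lemma square_sum_climit (f : Z -> Z -> C) s : has_sum (fun p : Z * Z => f (fst p) (snd p)) s -> climit (square_sum f) s.
Proof.
  move=> H. apply (climit_ext (fun N => lsum (fun p => f (fst p) (snd p)) (list_prod (boxz N) (boxz N)))).
    move=> N. by rewrite square_sum_lsum.
  apply has_sum_exhaust => //.
  - move=> N. apply NoDup_list_prod; apply NoDup_map_inj; try apply seq_NoDup; move=> x y E; lia.
  - move=> [a b]. exists (Z.to_nat (Z.abs a) + Z.to_nat (Z.abs b))%nat => N hN.
    have P : forall c, (Z.to_nat (Z.abs c) <= N)%nat -> In c (boxz N).
      move=> c hc. apply in_map_iff. exists (Z.to_nat (c + Z.of_nat N)). split; first lia. apply in_seq. lia.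
    apply in_prod; apply P; lia.
Qed.

Lemma lattice_wp_wpf x : off_star x -> lattice_wp w x = wpf x.
Proof.
  move=> hx. rewrite /lattice_wp /wpf. f_equal. apply Clim_seq_eq. apply square_sum_climit.
  apply: has_sum_ext (tsum_correct _ (summable_wpR x hx)) => -[m n]. done.
Qed.

End Lattice.

(** * Parity, periodicity and behaviour at the poles *)

Section LatticeSymmetry.
Variable w : C * C.
Hypothesis hw : Im (snd w * Cconj (fst w)) <> 0%R.

Definition padd (p e : Z * Z) : Z * Z := ((fst p + fst e)%Z, (snd p + snd e)%Z).
Definition popp (p : Z * Z) : Z * Z := ((- fst p)%Z, (- snd p)%Z).

Lemma lam_padd p e : lam w (padd p e) = lam w p + lam w e.
Proof. rewrite /lam /lattice_point /padd; cbn [fst snd]. rewrite !plus_IZR !RtoC_plus. ring. Qed.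

Lemma lam_popp p : lam w (popp p) = - lam w p.
Proof. rewrite /lam /lattice_point /popp; cbn [fst snd]. rewrite !opp_IZR !RtoC_opp. ring. Qed.

Lemma padd_popp p e : padd (padd p e) (popp e) = p.
Proof. case: p e => a b [c d]. rewrite /padd /popp; cbn [fst snd]. f_equal; lia. Qed.

Lemma padd_popp' p e : padd (padd p (popp e)) e = p.
Proof. case: p e => a b [c d]. rewrite /padd /popp; cbn [fst snd]. f_equal; lia. Qed.

Lemma popp_popp p : popp (popp p) = p.
Proof. case: p => a b. rewrite /popp; cbn [fst snd]. f_equal; lia. Qed.

(** With the correction set to 0 at the origin, the principal part 1 / x^2 becomes the term of index
    0, and P is a sum over the whole index group, which translations and reflection permute. *)
Definition il2 (p : Z * Z) : C := if zp p then RtoC 0 else 1 / lam w p ^ 2.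
Definition fullterm (x : C) (p : Z * Z) : C := 1 / (x - lam w p) ^ 2 - il2 p.

Lemma has_sum_delta (c : C) : has_sum (fun p => if zp p then c else RtoC 0) c.
Proof.
  move=> e he. exists [(0, 0)%Z] => l nd inc.
  have [l1 [n1 [dis ->]]] := lsum_split (fun p => if zp p then c else RtoC 0) [(0, 0)%Z] l ltac:(repeat constructor; auto) nd inc.
  rewrite (lsum_ext _ (fun _ => RtoC 0) l1); last first.
    move=> k hk. have [_ nk] := dis k hk. case hz : (zp k) => //. case: nk. left. symmetry. by apply zp_spec.
  have -> : lsum (fun _ : Z * Z => RtoC 0) l1 = 0 by elim: l1 {n1 dis} => [//|b m IH] /=; rewrite IH; ring.
  rewrite /=. replace (c + 0 + 0 - c) with (RtoC 0) by ring. by rewrite Cmod_0.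
Qed.

Lemma summable_delta (c : C) : summable (fun p => if zp p then c else RtoC 0).
Proof.
  exists (Cmod c) => l nd. have c0 := Cmod_ge_0 c.
  apply Rle_trans with (rsum (fun p => Cmod (if zp p then c else RtoC 0)) ((0, 0)%Z :: filter (fun p => negb (zp p)) l)).
    apply rsum_incl => // [a|a ha]; first by apply Cmod_ge_0.
    case hz : (zp a); [left; symmetry; by apply zp_spec | right; apply filter_In; by rewrite hz].
  rewrite /rsum; cbn [fold_right]. rewrite {1}/zp /=. 
  have : rsum (fun p => Cmod (if zp p then c else RtoC 0)) (filter (fun p => negb (zp p)) l) <= 0.
    elim: l {nd} => [|a l IH] /=; first by right. case hz : (zp a) => //=. rewrite hz Cmod_0. lra.
  rewrite /rsum. lra.
Qed.

Lemma fullterm_split x p : fullterm x p = star (wpterm w x) p + (if zp p then 1 / x ^ 2 else RtoC 0).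
Proof.
  rewrite /fullterm /star /wpterm /il2. case hz : (zp p); last by ring.
  move: hz => /zp_spec ->. rewrite lam_0. replace (x - 0) with x by ring. ring.
Qed.

Lemma summable_fullterm x : off w x -> summable (fullterm x).
Proof.
  move=> /(off_iff w) [h0 h]. apply: (summable_ext _ _ (fun p => eq_sym (fullterm_split x p))).
  apply summable_plus; [by apply summable_wpR | apply summable_delta].
Qed.

Lemma wpf_full x : off w x -> wpf w x = tsum (fullterm x).
Proof.
  move=> /(off_iff w) [h0 h]. rewrite (tsum_ext _ _ (fullterm_split x)) tsum_plus; [|by apply summable_wpR | apply summable_delta].
  rewrite (has_sum_tsum _ _ (has_sum_delta (1 / x ^ 2))) /wpf /wpR. ring.
Qed.

Lemma off_padd x e : off w x -> off w (x + lam w e).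
Proof.
  move=> h /(in_lattice_lam w) [p E]. apply h. apply (in_lattice_lam w). exists (padd p (popp e)).
  rewrite lam_padd lam_popp -E. ring.
Qed.

Lemma off_opp x : off w x -> off w (- x).
Proof.
  move=> h /(in_lattice_lam w) [p E]. apply h. apply (in_lattice_lam w). exists (popp p).
  rewrite lam_popp -E. ring.
Qed.

Lemma zp_popp p : zp (popp p) = zp p.
Proof.
  case h : (zp p).
    move: h => /zp_spec ->. done.
  case h' : (zp (popp p)) => //. move: h' => /zp_spec E. rewrite -h -(popp_popp p) E. done.
Qed.

Lemma il2_popp p : il2 (popp p) = il2 p.
Proof.
  rewrite /il2 zp_popp lam_popp. case: (zp p) => //. f_equal. ring.
Qed.

Lemma wpf_opp x : off w x -> wpf w (- x) = wpf w x.
Proof.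
  move=> h. have h' := off_opp x h. rewrite !wpf_full //.
  rewrite -(tsum_bij popp popp _ popp_popp popp_popp (summable_fullterm _ h')).
  apply tsum_ext => p. rewrite /fullterm il2_popp lam_popp.
  by replace ((- x - - lam w p) ^ 2) with ((x - lam w p) ^ 2) by ring.
Qed.

(* The difference is a constant series, and p -> - (p + e) turns it into its opposite. *)
Lemma wpf_padd x e : off w x -> wpf w (x + lam w e) = wpf w x.
Proof.
  move=> h. have h' := off_padd x e h. have S := summable_fullterm x h. have S' := summable_fullterm _ h'.
  have bij1 : forall p, padd (padd p e) (popp e) = p by move=> p; apply padd_popp.
  have bij2 : forall p, padd (padd p (popp e)) e = p by move=> p; apply padd_popp'.
  have i1 : inj (fun p => padd p e) by move=> p q E; rewrite -(bij1 p) E bij1.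
  have Se := summable_inj _ _ i1 S'.
  have E : wpf w (x + lam w e) - wpf w x = tsum (fun p => il2 p - il2 (padd p e)).
    rewrite !wpf_full // -(tsum_bij (fun p => padd p e) (fun p => padd p (popp e)) _ bij1 bij2 S') -tsum_minus //.
    apply tsum_ext => p. rewrite /fullterm lam_padd.
    replace (x + lam w e - (lam w p + lam w e)) with (x - lam w p) by ring. ring.
  have Sk : summable (fun p => il2 p - il2 (padd p e)).
    apply: summable_ext (summable_minus _ _ Se S) => p. rewrite /fullterm lam_padd.
    replace (x + lam w e - (lam w p + lam w e)) with (x - lam w p) by ring. ring.
  have r1 : forall p, popp (padd (popp (padd p e)) e) = p.
    move=> [a b]. case: e {h' S' bij1 bij2 i1 Se E Sk} => c d. rewrite /padd /popp; cbn [fst snd]. f_equal; lia.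
  have r2 : forall p, popp (padd (popp (padd p e)) e) = p by exact r1.
  have K : tsum (fun p => il2 p - il2 (padd p e)) = - (1) * tsum (fun p => il2 p - il2 (padd p e)).
    rewrite -{1}(tsum_bij (fun p => popp (padd p e)) (fun p => popp (padd p e)) _ r1 r1 Sk).
    rewrite -tsum_scal //. apply tsum_ext => p. rewrite il2_popp.
    have -> : padd (popp (padd p e)) e = popp p by rewrite -[LHS]popp_popp r1.
    rewrite il2_popp. ring.
  apply Ceq_minus. rewrite E.
  replace (tsum (fun p => il2 p - il2 (padd p e))) with (/ 2 * (tsum (fun p => il2 p - il2 (padd p e)) + tsum (fun p => il2 p - il2 (padd p e)))) by field.
  rewrite {1}K. ring.
Qed.

Lemma wpf1_opp x : off w x -> wpf1 w (- x) = - wpf1 w x.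
Proof.
  move=> h. have h' := off_opp x h.
  have D1 : cder (fun y => wpf w (- y)) x (wpf1 w (- x) * - (1)).
    apply (cder_comp (wpf w) (fun y => - y)); first by apply cder_wpf. by apply der_opp, der_id.
  have D2 : cder (fun y => wpf w (- y)) x (wpf1 w x).
    have [d [d0 H]] := off_open w hw x h.
    apply: cder_local (cder_wpf w hw x h). exists d; split => // y hy. symmetry. by apply wpf_opp, H.
  rewrite -(cder_unique _ _ _ _ D1 D2). ring.
Qed.

Lemma wpf1_padd x e : off w x -> wpf1 w (x + lam w e) = wpf1 w x.
Proof.
  move=> h. have h' := off_padd x e h.
  have D1 : cder (fun y => wpf w (y + lam w e)) x (wpf1 w (x + lam w e) * (1 + 0)).
    apply (cder_comp (wpf w) (fun y => y + lam w e)); first by apply cder_wpf. by apply cder_plus; [apply cder_id | apply cder_const].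
  have D2 : cder (fun y => wpf w (y + lam w e)) x (wpf1 w x).
    have [d [d0 H]] := off_open w hw x h.
    apply: cder_local (cder_wpf w hw x h). exists d; split => // y hy. symmetry. by apply wpf_padd, H.
  rewrite -(cder_unique _ _ _ _ D1 D2). ring.
Qed.

Lemma contc_bounded (f : C -> C) x : contc f x -> exists d K, 0 < d /\ 0 < K /\ forall y, Cmod (y - x) < d -> Cmod (f y) <= K.
Proof.
  move=> H. have [d [d0 h]] := H 1%R Rlt_0_1. exists d, (Cmod (f x) + 1)%R.
  split => //. split; first by have := Cmod_ge_0 (f x); lra.
  move=> y hy. have := h y hy. have := Cmod_sub_ge (f y) (f x). lra.
Qed.

Lemma wpf_bounded_parts : exists d K, 0 < d /\ 0 < K /\ forall x, Cmod x < d ->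
  off_star w x /\ Cmod (wpR w x) <= K /\ Cmod (latsum w one_coef 3 x) <= K.
Proof.
  have h0 := off_star_0 w hw.
  have [d1 [K1 [d10 [K10 H1]]]] := contc_bounded _ _ (cder_contc _ _ _ (cder_wpR w hw 0 h0)).
  have [d2 [K2 [d20 [K20 H2]]]] := contc_bounded _ _ (cder_contc _ _ _ (cder_latsum w hw one_coef 3 0 (admissible_one 3 (le_n _)) h0)).
  have [c [c0 hc]] := off_star_lower w hw 0 h0.
  exists (Rmin (Rmin d1 d2) (c / 2)), (K1 + K2)%R.
  split; first by repeat apply Rmin_glb_lt => //; lra. split; first lra.
  move=> x hx. have hx' : Cmod (x - 0) < Rmin (Rmin d1 d2) (c / 2) by replace (x - 0) with x by ring.
  have a := Rlt_le_trans _ _ _ hx' (Rmin_l _ _). have a1 := Rlt_le_trans _ _ _ a (Rmin_l _ _).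
  have a2 := Rlt_le_trans _ _ _ a (Rmin_r _ _). have a3 := Rlt_le_trans _ _ _ hx' (Rmin_r _ _).
  split; last by have := H1 x a1; have := H2 x a2; lra.
  apply (lower_off_star w x (c / 2)); first lra. by apply (off_star_near w 0 c).
Qed.

Lemma wpf_blowup_0 M : exists d, 0 < d /\ forall x : C, x <> 0 -> Cmod x < d -> M < Cmod (wpf w x).
Proof.
  have [d [K [d0 [K0 H]]]] := wpf_bounded_parts.
  set L := (Rabs M + K + 1)%R. have L1 : 1 <= L by rewrite /L; have := Rabs_pos M; lra.
  exists (Rmin d (/ L)); split; first by apply Rmin_glb_lt => //; apply Rinv_0_lt_compat; lra.
  move=> x hx hd. have [_ [h _]] := H x (Rlt_le_trans _ _ _ hd (Rmin_l _ _)).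
  have h2 := Rlt_le_trans _ _ _ hd (Rmin_r _ _). have px := Cmod_pos _ hx.
  rewrite /wpf. have := Cmod_add_ge (1 / x ^ 2) (wpR w x).
  have -> : Cmod (1 / x ^ 2) = (/ Cmod x ^ 2)%R by rewrite Cmod_div ?Cmod_1 ?Cmod_pow; [rewrite /Rdiv Rmult_1_l | apply Cpow_nz].
  have h3 : L < / Cmod x.
    rewrite -(Rinv_inv L). apply Rinv_lt_contravar => //. apply Rmult_lt_0_compat => //. apply Rinv_0_lt_compat. lra.
  have : L <= / Cmod x ^ 2.
    rewrite -pow_inv. simpl. nra.
  have := Rle_abs M. rewrite /L. lra.
Qed.

Lemma wpf_blowup l M : in_lattice w l -> exists d, 0 < d /\ forall x, off w x -> Cmod (x - l) < d -> M < Cmod (wpf w x).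
Proof.
  move=> /(in_lattice_lam w) [p ->]. have [d [d0 H]] := wpf_blowup_0 M.
  exists d; split => // x hx hd.
  have E : x = (x - lam w p) + lam w p by ring.
  have h' : off w (x - lam w p).
    have := off_padd x (popp p) hx. by rewrite lam_popp.
  rewrite E wpf_padd //. apply H => //. by have [h0 _] := proj1 (off_iff w _) h'.
Qed.

(** Near 0, P and P' behave like x^(-2) and - 2 x^(-3), so the two quotients behave like x and
    x^3. *)
Lemma wpf_chart_0 e : 0 < e -> exists d, 0 < d /\ forall x : C, x <> 0 -> Cmod x < d ->
  off w x /\ wpf1 w x <> 0 /\ Cmod (- (2) * wpf w x / wpf1 w x) < e /\ Cmod (- (2) / wpf1 w x) < e.
Proof.
  move=> he. have [d [K [d0 [K0 H]]]] := wpf_bounded_parts.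
  set D := Rmin (Rmin d 1) (Rmin (/ (4 * (K + 1))) (e / 8)).
  have D0 : 0 < D.
    repeat apply Rmin_glb_lt => //; try lra. apply Rinv_0_lt_compat. lra.
  exists D; split => // x hx hd.
  have a := Rlt_le_trans _ _ _ hd (Rmin_l _ _). have b := Rlt_le_trans _ _ _ hd (Rmin_r _ _).
  have a1 := Rlt_le_trans _ _ _ a (Rmin_l _ _). have a2 := Rlt_le_trans _ _ _ a (Rmin_r _ _).
  have b1 := Rlt_le_trans _ _ _ b (Rmin_l _ _). have b2 := Rlt_le_trans _ _ _ b (Rmin_r _ _).
  have [ho [hR hL]] := H x a1. have px := Cmod_pos _ hx.
  split; first by apply (off_iff w).
  have xK : Cmod x * K <= 1 / 4.
    apply (Rmult_lt_compat_r (4 * (K + 1))) in b1; last lra. rewrite Rinv_l in b1; last lra. nra.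
  have E1 : wpf w x = (1 + x ^ 2 * wpR w x) / x ^ 2 by rewrite /wpf; field.
  have E2 : wpf1 w x = - (2 + 2 * (x ^ 3 * latsum w one_coef 3 x)) / x ^ 3 by rewrite /wpf1; field.
  have B1 : Cmod (1 + x ^ 2 * wpR w x) <= 2.
    apply: Rle_trans (Cmod_triangle _ _) _. rewrite Cmod_1 Cmod_mult Cmod_pow. simpl.
    have := Cmod_ge_0 (wpR w x). move=> r0.
    have : (Cmod x * Cmod (wpR w x) <= 1 / 4) by apply Rle_trans with (Cmod x * K)%R => //; apply Rmult_le_compat_l; lra.
    move=> h. have : Cmod x * (Cmod x * Cmod (wpR w x)) <= 1 * (1 / 4) by apply Rmult_le_compat; nra. nra.
  have B2 : 1 <= Cmod (2 + 2 * (x ^ 3 * latsum w one_coef 3 x)).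
    have := Cmod_add_ge 2 (2 * (x ^ 3 * latsum w one_coef 3 x)). rewrite (Cmod_mult 2) (Cmod_mult (x ^ 3)) Cmod_pow !Cmod_R !(Rabs_pos_eq 2); last lra.
    have := Cmod_ge_0 (latsum w one_coef 3 x). set L := Cmod (latsum w one_coef 3 x) in hL *. move=> r0. simpl.
    have h : (Cmod x * L <= 1 / 4) by apply Rle_trans with (Cmod x * K)%R => //; apply Rmult_le_compat_l; lra.
    have : Cmod x * Cmod x <= 1 by nra. move=> h2.
    have : (Cmod x * Cmod x) * (Cmod x * L) <= 1 * (1 / 4) by apply Rmult_le_compat; nra. nra.
  set U := 1 + x ^ 2 * wpR w x in E1 B1. set V := 2 + 2 * (x ^ 3 * latsum w one_coef 3 x) in E2 B2.
  have nV : V <> 0 by apply Cmod_pos_neq; lra.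
  have n3 : x ^ 3 <> 0 by apply Cpow_nz.
  split.
    rewrite E2. move=> h. apply nV. replace V with (- (- V / x ^ 3 * x ^ 3)) by (field; auto). rewrite h. ring.
  have F1 : - (2) * wpf w x / wpf1 w x = 2 * x * U / V by rewrite E1 E2; field; auto.
  have F2 : - (2) / wpf1 w x = 2 * x ^ 3 / V by rewrite E2; field; auto.
  have iV : / Cmod V <= 1 by rewrite -Rinv_1; apply Rinv_le_contravar; lra.
  have iV0 : 0 < / Cmod V by apply Rinv_0_lt_compat; lra.
  rewrite F1 F2 !Cmod_div // (Cmod_mult (2 * x)) (Cmod_mult 2) (Cmod_mult 2) Cmod_pow !Cmod_R !(Rabs_pos_eq 2); last lra.
  have u0 := Cmod_ge_0 U.
  split.
  - apply Rle_lt_trans with (2 * Cmod x * 2 * 1)%R; last lra.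
    apply Rmult_le_compat; try nra. 
  - have h1 : Cmod x * Cmod x <= 1 by nra. have h : Cmod x ^ 3 <= Cmod x by simpl; nra.
    have h0 : 0 <= Cmod x ^ 3 by apply pow_le; lra.
    apply Rle_lt_trans with (2 * Cmod x * 1)%R; last lra.
    apply Rmult_le_compat; nra.
Qed.

End LatticeSymmetry.

(** * Elliptic functions without poles are constant *)

Lemma list_argmax {A : Type} (f : A -> R) (l : list A) : l <> [] -> exists a, In a l /\ forall b, In b l -> f b <= f a.
Proof.
  elim: l => [//|a l IH] _. case: l IH => [|b l] IH.
    exists a. split; [by left | move=> c [<-|[]]; lra].
  have [c [hc H]] := IH ltac:(done).
  case: (Rle_lt_dec (f a) (f c)) => h.
  - exists c. split; [by right | move=> x [<-|hx] //; by apply H].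
  - exists a. split; [by left | move=> x [<-|hx]; first lra; have := H x hx; lra].
Qed.

(** Without a maximum, every point of the plane has a neighbourhood on which v, restricted to K,
    stays below its value at some point of K. Finitely many such neighbourhoods cover K, and the
    best of the corresponding points would have to lie below another one. *)
Lemma closed_attains_max (K : C -> Prop) (v : C -> R) (M : R) (z0 : C) : K z0 ->
  (forall z, K z -> Rabs (Re z) <= M /\ Rabs (Im z) <= M) ->
  (forall z, ~ K z -> exists d, 0 < d /\ forall y, Cmod (y - z) < d -> ~ K y) ->
  (forall z, K z -> forall e, 0 < e -> exists d, 0 < d /\ forall y, K y -> Cmod (y - z) < d -> v y < v z + e) ->
  exists z, K z /\ forall y, K y -> v y <= v z.
Proof.
  move=> K0 bd cl us. apply NNPP => H.
  have H1 : forall z, exists p : posreal * C, K (snd p) /\ (forall y, K y -> Cmod (y - z) < fst p -> v y < v (snd p)).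
    move=> z. case: (classic (K z)) => hz.
    - have [s [Ks hs]] : exists s, K s /\ v z < v s.
        apply NNPP => N. apply H. exists z; split => // y hy. apply Rnot_lt_le => h. apply N. by exists y.
      have [d [d0 hd]] := us z hz (v s - v z)%R ltac:(lra).
      exists (mkposreal d d0, s); split => // y hy hyz. have := hd y hy hyz. cbn [fst snd]. lra.
    - have [d [d0 hd]] := cl z hz. exists (mkposreal d d0, z0); split => // y hy hyz. by have := hd y hyz.
  pose g z := proj1_sig (constructive_indefinite_description _ (H1 z)).
  have gP z : K (snd (g z)) /\ (forall y, K y -> Cmod (y - z) < fst (g z) -> v y < v (snd (g z))).
    exact (proj2_sig (constructive_indefinite_description _ (H1 z))).
  pose pt (t : R * (R * unit)) : C := (fst t, fst (snd t)).
  (* The covering is by squares, so each coordinate gets half of the radius in order to bound the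
     modulus. *)
  have half z : 0 < fst (g z) / 2 by have := cond_pos (fst (g z)); lra.
  apply (compactness_list 2 (- M, (- M, tt))%R (M, (M, tt)) (fun t => mkposreal _ (half (pt t)))).
  move=> [l hl].
  have cov : forall y, K y -> exists t, In t l /\ v y < v (snd (g (pt t))).
    move=> y hy. have [b1 b2] := bd y hy. move: b1 b2 => /Rabs_le_between b1 /Rabs_le_between b2.
    have [[t1 [t2 u]] [It [_ [c1 [c2 _]]]]] := hl (Re y, (Im y, tt)) ltac:(simpl; rewrite -/(Re y) -/(Im y); tauto).
    exists (t1, (t2, u)); split => //. apply (proj2 (gP _)) => //.
    apply: Rle_lt_trans (Cmod_le_re_im _) _. cbn [pt fst snd] in c1, c2 |- *.
    rewrite /Re /Im /=. rewrite /Re /Im in c1 c2.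
    rewrite /pt /= in c1 c2. rewrite /pt /=. 
    replace (fst y + - t1)%R with (fst y - t1)%R by ring. replace (snd y + - t2)%R with (snd y - t2)%R by ring. lra.
  have ln : l <> [] by have [t [It _]] := cov z0 K0; move=> E; rewrite E in It.
  have [t [It Ht]] := list_argmax (fun t => v (snd (g (pt t)))) l ln.
  have [s [Is Hs]] := cov (snd (g (pt t))) (proj1 (gP _)).
  have := Ht s Is. lra.
Qed.

Lemma second_derivative_max (p p1 : R -> R) (l d : R) : 0 < d -> (forall t, Rabs t < d -> is_derive p t (p1 t)) ->
  is_derive p1 0 l -> (forall t, Rabs t < d -> p t <= p 0) -> l <= 0.
Proof.
  move=> d0 D D1 mx. apply Rnot_lt_le => l0.
  have ab0 : Rabs 0 < d by rewrite Rabs_R0.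
  have p10 : p1 0 = 0%R.
    have D0 : derivable_pt_lim p 0 (p1 0) by apply is_derive_Reals, D.
    apply NNPP => n. have [e he] := D0 (Rabs (p1 0) / 2)%R ltac:(have := Rabs_pos_lt _ n; lra).
    have e0 := cond_pos e. set h := (Rmin e d / 2)%R.
    have h0 : 0 < h by rewrite /h; have := Rmin_glb_lt _ _ _ e0 d0; lra.
    have he' : h < e by rewrite /h; have := Rmin_l e d; rewrite /h in h0; lra.
    have hd : h < d by rewrite /h; have := Rmin_r e d; rewrite /h in h0; lra.
    case: (Rlt_le_dec 0 (p1 0)) => s.
    - have := he h ltac:(lra) ltac:(by rewrite Rabs_pos_eq; lra). rewrite (Rabs_pos_eq (p1 0)); last lra.
      have := mx h ltac:(rewrite Rabs_pos_eq; lra). rewrite Rplus_0_l => m /Rabs_def2 [_ q].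
      have : (p h - p 0) / h <= 0 by apply Rmult_le_0_r; [lra | left; by apply Rinv_0_lt_compat]. lra.
    - have := he (- h)%R ltac:(lra) ltac:(by rewrite Rabs_Ropp Rabs_pos_eq; lra). rewrite (Rabs_left (p1 0)); last lra.
      have := mx (- h)%R ltac:(rewrite Rabs_Ropp Rabs_pos_eq; lra). rewrite Rplus_0_l => m /Rabs_def2 [q _].
      have : 0 <= ((p (- h)%R - p 0) / - h)%R.
        replace ((p (- h)%R - p 0) / - h)%R with ((p 0 - p (- h)%R) / h)%R by (field; lra). apply Rdiv_le_0_compat; lra.
      lra.
  move: D1 => /is_derive_Reals D1. have [e he] := D1 (l / 2)%R ltac:(lra). have e0 := cond_pos e.
  have pos : forall h, 0 < h -> h < e -> 0 < p1 h.
    move=> h h0 h1. have := he h ltac:(lra) ltac:(rewrite Rabs_pos_eq; lra). rewrite Rplus_0_l p10 => /Rabs_def2 [_ q].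
    have : 0 < (p1 h - 0) / h by lra. move=> q2. apply (Rmult_lt_compat_r h) in q2 => //.
    replace ((p1 h - 0) / h * h)%R with (p1 h) in q2 by (field; lra). lra.
  set h := (Rmin e d / 2)%R.
  have h0 : 0 < h by rewrite /h; have := Rmin_glb_lt _ _ _ e0 d0; lra.
  have he' : h < e by rewrite /h; have := Rmin_l e d; rewrite /h in h0; lra.
  have hd : h < d by rewrite /h; have := Rmin_r e d; rewrite /h in h0; lra.
  case: (MVT_cor2 p p1 0 h h0).
    move=> c hc. apply is_derive_Reals, D. rewrite Rabs_pos_eq; lra.
  move=> c [E [c0 ch]]. have := pos c c0 ltac:(lra). have := mx h ltac:(rewrite Rabs_pos_eq; lra). nra.
Qed.

(* The barrier [ln |z|^2 - |z|^-2] is strictly superharmonic and tends to infinity. *)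
Definition barrier (z : C) : R := (ln (Re z ^ 2 + Im z ^ 2) - / (Re z ^ 2 + Im z ^ 2))%R.

Lemma barrier_line (a b h k : R) : 0 < a ^ 2 + b ^ 2 -> exists d, 0 < d /\ exists B1,
  (forall t, Rabs t < d -> is_derive (fun t : R => barrier ((a, b) + t * (h, k))) t (B1 t : R)) /\
  is_derive B1 0 ((2 * (h ^ 2 + k ^ 2) * (a ^ 2 + b ^ 2) - 4 * (a * h + b * k) ^ 2) / (a ^ 2 + b ^ 2) ^ 2
     + 2 * (h ^ 2 + k ^ 2) / (a ^ 2 + b ^ 2) ^ 2 - 8 * (a * h + b * k) ^ 2 / (a ^ 2 + b ^ 2) ^ 3)%R.
Proof.
  move=> q0.
  pose q t := ((a + t * h) ^ 2 + (b + t * k) ^ 2)%R. pose q' t := (2 * h * (a + t * h) + 2 * k * (b + t * k))%R.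
  have E (t : R) : barrier ((a, b) + t * (h, k)) = (ln (q t) - / q t)%R.
    rewrite /barrier /q /Re /Im /=. do 2 f_equal; ring.
  have Cq : continuous q 0 by apply: (@ex_derive_continuous R_AbsRing R_NormedModule q); rewrite /q; auto_derive.
  have q00 : q 0%R = (a ^ 2 + b ^ 2)%R by rewrite /q; ring.
  have [d hd] := proj1 (filterlim_locally _ _) Cq (mkposreal _ q0).
  exists d; split; first by apply cond_pos.
  have pos (t : R) : Rabs t < d -> 0 < q t.
    move=> ht. have := hd t. rewrite /ball /= /AbsRing_ball /abs /minus /plus /opp /= q00.
    replace (t + - 0)%R with t by ring. move=> /(_ ht) /Rabs_def2. lra.
  exists (fun t => (q' t / q t + q' t / q t ^ 2)%R). split.
  - move=> t /pos ht. apply (is_derive_ext (fun t => (ln (q t) - / q t)%R)) => [s|]; first by rewrite E.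
    rewrite /q /q' in ht *. auto_derive; first by repeat split; lra. field. lra.
  - have := pos 0%R ltac:(rewrite Rabs_R0; apply cond_pos). rewrite /q /q' => hq.
    auto_derive; last by (replace (a + 0 * h)%R with a by ring); (replace (b + 0 * k)%R with b by ring); field; lra.
    simpl in hq. move: hq. set s := (_ + _)%R. move=> hq. repeat split; apply Rgt_not_eq; nra.
Qed.

Lemma Re_minus (x y : C) : Re (x - y) = (Re x - Re y)%R.
Proof. by []. Qed.

Lemma barrier_cont (z : C) : z <> 0 -> forall e, 0 < e -> exists d, 0 < d /\ forall y, Cmod (y - z) < d -> Rabs (barrier y - barrier z) < e.
Proof.
  move=> hz e he. have pz := Cmod_pos _ hz.
  pose g s := (ln (s ^ 2) - / s ^ 2)%R.
  have Cg : continuous g (Cmod z).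
    apply: (@ex_derive_continuous R_AbsRing R_NormedModule g). rewrite /g. auto_derive.
    have : 0 < Cmod z ^ 2 by apply pow_lt. simpl => h. repeat split => //; lra.
  have [d hd] := proj1 (filterlim_locally _ _) Cg (mkposreal e he).
  exists d; split; first by apply cond_pos. move=> y hy.
  rewrite /barrier -!Cmod2_alt. apply (hd (Cmod y)).
  rewrite /ball /= /AbsRing_ball /abs /minus /plus /opp /=.
  apply: Rle_lt_trans hy. apply Rabs_le.
  have := Cmod_sub_ge y z. have := Cmod_sub_ge z y. rewrite (Cmod_minus_sym z). lra.
Qed.

Section EllipticLiouville.
Variable w : C * C.
Hypothesis hw : Im (snd w * Cconj (fst w)) <> 0%R.
Variables (f f1 f2 : C -> C) (c : C) (C0 : R).
Hypothesis f_der : forall x, off w x -> cder f x (f1 x).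
Hypothesis f1_der : forall x, off w x -> cder f1 x (f2 x).
Hypothesis f_per : forall x p, off w x -> f (x + lam w p) = f x.
Hypothesis f_lim : forall e, 0 < e -> exists d, 0 < d /\ forall x, off w x -> Cmod x < d -> Cmod (f x - c) < e.
Hypothesis fundamental : forall z : C, exists p, Cmod (z + lam w p) <= C0.

(** If the harmonic function u = Re (a f) exceeded its limit at the lattice points, then u minus a
    small multiple of the barrier would attain a maximum: near the lattice u is too low, and far
    away the barrier is too large. At the maximum the second derivatives in two orthogonal
    directions have nonpositive sum, whereas superharmonicity of the barrier makes this sum
    positive. *)
Lemma elliptic_le (a : C) z1 : off w z1 -> Re (a * f z1) <= Re (a * c).
Proof.
  move=> hz1. apply Rnot_lt_le => lt. pose u z := Re (a * f z).
  set e := ((u z1 - Re (a * c)) / 2)%R. have e0 : 0 < e by rewrite /e /u; lra.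
  have ue : Re (a * c) + e <= u z1 by rewrite /e /u; lra.
  have uc x : off w x -> forall e, 0 < e -> exists d, 0 < d /\ forall y, Cmod (y - x) < d -> off w y /\ Rabs (u y - u x) < e.
    move=> hx e' he'. have D := cder_scalf a f x _ (f_der x hx).
    have [d [d0 H]] := cder_contc _ _ _ D e' he'. have [d' [d0' H']] := off_open w hw x hx.
    exists (Rmin d d'); split; first by apply Rmin_glb_lt.
    move=> y hy. split; first by apply H'; apply: Rlt_le_trans hy (Rmin_r _ _).
    apply: Rle_lt_trans (H y (Rlt_le_trans _ _ _ hy (Rmin_l _ _))).
    rewrite /u. apply: Rle_trans (re_le_Cmod _). by right.
  have ulim : exists r, 0 < r /\ forall x l, off w x -> in_lattice w l -> Cmod (x - l) < r -> u x < Re (a * c) + e.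
    have [d [d0 H]] := f_lim (e / (Cmod a + 1))%R ltac:(apply Rdiv_lt_0_compat => //; have := Cmod_ge_0 a; lra).
    exists d; split => // x l hx /(in_lattice_lam w) [p ->] hd.
    have h' : off w (x - lam w p) by have := off_padd w x (popp p) hx; rewrite lam_popp.
    have Ex : f x = f (x - lam w p) by rewrite -(f_per (x - lam w p) p) //; f_equal; ring.
    have := H _ h' hd. rewrite -Ex => h. have a0 := Cmod_ge_0 a.
    have : Cmod (a * f x - a * c) < e.
      replace (a * f x - a * c) with (a * (f x - c)) by ring. rewrite Cmod_mult.
      apply Rle_lt_trans with (Cmod a * (e / (Cmod a + 1)))%R; first by apply Rmult_le_compat_l; lra.
      apply (Rmult_lt_reg_r (Cmod a + 1)); first lra. replace (Cmod a * (e / (Cmod a + 1)) * (Cmod a + 1))%R with (Cmod a * e)%R by (field; lra). nra.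
    move=> h2. have := Rle_lt_trans _ _ _ (re_le_Cmod _) h2. move=> /Rabs_def2 [h3 _].
    move: h3. rewrite Re_minus /u. lra.
  have [r [r0 Hr]] := ulim.
  pose K (R0 : R) z := off w z /\ Re (a * c) + e <= u z /\ Cmod z <= R0.
  have K_bd R0 z : K R0 z -> Rabs (Re z) <= R0 /\ Rabs (Im z) <= R0.
    move=> [_ [_ h]]. split; apply: Rle_trans h; [apply re_le_Cmod | apply im_le_Cmod].
  have K_cl R0 z : ~ K R0 z -> exists d, 0 < d /\ forall y, Cmod (y - z) < d -> ~ K R0 y.
    move=> nK. case: (classic (in_lattice w z)) => hz.
      exists r; split => // y hy [h1 [h2 _]]. have := Hr y z h1 hz hy. lra.
    case: (Rle_lt_dec (Cmod z) R0) => h; last first.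
      exists (Cmod z - R0)%R; split; first lra. move=> y hy [_ [_ h3]].
      have := Cmod_sub_ge z y. rewrite Cmod_minus_sym. lra.
    case: (Rle_lt_dec (Re (a * c) + e) (u z)) => h2; first by case: nK.
    have [d [d0 Hd]] := uc z hz (Re (a * c) + e - u z)%R ltac:(lra).
    exists d; split => // y hy [_ [h3 _]]. have [_ /Rabs_def2 q] := Hd y hy. lra.
  have [U HU] : exists U, forall z, off w z -> u z <= U.
    have [p1 hp1] := fundamental z1.
    have uper x p : off w x -> u (x + lam w p) = u x by move=> h; rewrite /u f_per.
    have K1 : K C0 (z1 + lam w p1).
      split; first by apply off_padd. split => //. by rewrite uper.
    have [z [[hz _] mx]] := closed_attains_max (K C0) u C0 _ K1 (K_bd C0) (K_cl C0)
      ltac:(by move=> x [hx _] e' he'; have [d [d0 Hd]] := uc x hx e' he'; exists d; split => // y _ hy; have [_ /Rabs_def2 q] := Hd y hy; lra).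
    exists (Rmax (u z) (Re (a * c) + e)) => x hx.
    case: (Rle_lt_dec (Re (a * c) + e) (u x)) => h; last by apply: Rle_trans (Rmax_r _ _); lra.
    apply: Rle_trans (Rmax_l _ _). have [p hp] := fundamental x. rewrite -(uper x p) //. apply mx.
    split; first by apply off_padd. by rewrite uper.
  have q0 z : off w z -> 0 < Re z ^ 2 + Im z ^ 2.
    move=> /(off_iff w) [h _]. rewrite -Cmod2_alt. apply pow_lt. by apply Cmod_pos.
  have Bmono r1 z : 0 < r1 -> r1 <= Cmod z -> ln (r1 ^ 2) - / r1 ^ 2 <= barrier z.
    move=> h1 h2. rewrite /barrier -Cmod2_alt.
    have p1 : 0 < r1 ^ 2 by apply pow_lt. have p2 : r1 ^ 2 <= Cmod z ^ 2 by apply pow_incr; lra.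
    have : ln (r1 ^ 2) <= ln (Cmod z ^ 2) by apply ln_le. have : / Cmod z ^ 2 <= / r1 ^ 2 by apply Rinv_le_contravar. lra.
  set b0 := (ln (r ^ 2) - / r ^ 2)%R.
  (* [b0] bounds the barrier from below at distance r from 0. The choice of [ep] makes the change of
     barrier between [z1] and the maximum cost at most e/2, so that u at the maximum still exceeds
     the level. *)
  set D := (Rmax 1 (barrier z1 - b0))%R. have D0 : 1 <= D by apply Rmax_l. have D1 : barrier z1 - b0 <= D by apply Rmax_r.
  set ep := (e / (2 * D))%R. have ep0 : 0 < ep by apply Rdiv_lt_0_compat; lra.
  have epD : (ep * D = e / 2)%R by rewrite /ep; field; lra.
  pose v z := (u z - ep * barrier z)%R.
  have [R0 [R1 HR]] : exists R0, Cmod z1 < R0 /\ forall z, R0 <= Cmod z -> U - ep * barrier z < v z1.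
    set T := ((U - v z1) / ep + 2)%R.
    exists (Rmax (Cmod z1 + 1) (Rmax 1 (exp T))). split; first by apply: Rlt_le_trans (Rmax_l _ _); lra.
    move=> z hz. have h1 := Rle_trans _ _ _ (Rmax_r _ _) hz. have h2 := Rle_trans _ _ _ (Rmax_l _ _) h1.
    have h3 := Rle_trans _ _ _ (Rmax_r _ _) h1.
    have h4 := Bmono (Rmax 1 (exp T)) z ltac:(apply: Rlt_le_trans (Rmax_l _ _); lra) h1.
    set X := Rmax 1 (exp T) in h4 h1. have X1 : 1 <= X by apply Rmax_l. have XT : exp T <= X by apply Rmax_r.
    have h5 : T <= ln (X ^ 2).
      rewrite -(ln_exp T). apply ln_le; first by apply exp_pos. simpl. nra.
    have h6 : / X ^ 2 <= 1 by rewrite -Rinv_1; apply Rinv_le_contravar; [lra | simpl; nra].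
    have h7 : T - 1 <= barrier z by lra.
    have : ep * (T - 1) <= ep * barrier z by apply Rmult_le_compat_l; lra.
    have : (ep * (T - 1) = U - v z1 + ep)%R by rewrite /T; field; lra. lra.
  have vc z : off w z -> forall e, 0 < e -> exists d, 0 < d /\ forall y, Cmod (y - z) < d -> v y < v z + e.
    move=> hz e' he'. have [d [d0 H]] := uc z hz (e' / 2)%R ltac:(lra).
    have [d' [d0' H']] := barrier_cont z (proj1 (proj1 (off_iff w z) hz)) (e' / 2 / ep)%R ltac:(apply Rdiv_lt_0_compat; lra).
    exists (Rmin d d'); split; first by apply Rmin_glb_lt.
    move=> y hy. have [_ /Rabs_def2 [q1 _]] := H y (Rlt_le_trans _ _ _ hy (Rmin_l _ _)).
    have /Rabs_def2 [_ q2] := H' y (Rlt_le_trans _ _ _ hy (Rmin_r _ _)).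
    apply (Rmult_lt_compat_l ep) in q2 => //. replace (ep * - (e' / 2 / ep))%R with (- (e' / 2))%R in q2 by (field; lra).
    rewrite /v. lra.
  have Kz1 : K R0 z1 by split => //; split => //; lra.
  have [z [[hz [hu hm]] mx]] := closed_attains_max (K R0) v R0 _ Kz1 (K_bd R0) (K_cl R0)
      ltac:(by move=> x [hx _] e' he'; have [d [d0 Hd]] := vc x hx e' he'; exists d; split => // y _ hy; apply Hd).
  have mz1 := mx z1 Kz1.
  (* This and the next two facts place the maximum in the interior of the compact set, where second
     derivatives along all directions may be used. *)
  have zR : Cmod z < R0.
    apply Rnot_le_lt => h. have := HR z h. have := HU z hz. rewrite {1}/v in mz1. rewrite /v in mz1 *. lra.
  have zr : r <= Cmod z.
    apply Rnot_lt_le => h. have := Hr z 0 hz ltac:(apply (in_lattice_lam w); exists (0, 0)%Z; by rewrite lam_0) ltac:(by replace (z - 0) with z by ring). lra.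
  have hu' : Re (a * c) + e < u z.
    apply Rnot_le_lt => h. have := Bmono r z r0 zr. rewrite -/b0 => hb.
    have : ep * (barrier z1 - b0) <= e / 2 by rewrite -epD; apply Rmult_le_compat_l; lra.
    have : ep * b0 <= ep * barrier z by apply Rmult_le_compat_l; lra.
    rewrite /v in mz1. rewrite /e in h *. lra.
  have [d1 [d10 H1]] := uc z hz (u z - Re (a * c) - e)%R ltac:(lra).
  have q := q0 z hz.
  set d := Rmin d1 (R0 - Cmod z). have d0 : 0 < d by apply Rmin_glb_lt; lra.
  have near y : Cmod (y - z) < d -> K R0 y.
    move=> hy. have [h1 /Rabs_def2 [_ h2]] := H1 y (Rlt_le_trans _ _ _ hy (Rmin_l _ _)).
    have h3 := Rlt_le_trans _ _ _ hy (Rmin_r _ _). split => //. split; first lra.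
    have := Cmod_sub_ge y z. lra.
  have line h k : (h ^ 2 + k ^ 2 = 1)%R ->
    Re (a * (f2 z * (h, k) * (h, k))) - ep * ((2 * (h ^ 2 + k ^ 2) * (Re z ^ 2 + Im z ^ 2) - 4 * (Re z * h + Im z * k) ^ 2) / (Re z ^ 2 + Im z ^ 2) ^ 2
     + 2 * (h ^ 2 + k ^ 2) / (Re z ^ 2 + Im z ^ 2) ^ 2 - 8 * (Re z * h + Im z * k) ^ 2 / (Re z ^ 2 + Im z ^ 2) ^ 3) <= 0.
    move=> hk. have [dB [dB0 [B1 [HB1 HB2]]]] := barrier_line (Re z) (Im z) h k q.
    have Ez : (Re z, Im z) = z by case: (z). rewrite Ez in HB1.
    have Chk : Cmod (h, k) = 1%R by rewrite /Cmod; cbn [fst snd]; rewrite hk sqrt_1.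
    have dist (t : R) : Cmod (z + t * (h, k) - z) = Rabs t.
      replace (z + t * (h, k) - z) with (t * (h, k)) by ring. by rewrite Cmod_mult Chk Cmod_R Rmult_1_r.
    have L1 (t : R) : Rabs t < d -> rder (fun t => a * f (z + t * (h, k))) t (a * (f1 (z + t * (h, k)) * (h, k))).
      move=> ht. apply rder_scal. apply (rder_comp f (fun t => z + t * (h, k))); last by apply rder_line.
      apply f_der. by have [h' _] := near (z + t * (h, k)) ltac:(by rewrite dist).
    have L2 : rder (fun t => a * (f1 (z + t * (h, k)) * (h, k))) 0 (a * (f2 z * (h, k) * (h, k))).
      apply rder_scal. apply (rder_eq _ _ (f2 z * (h, k) * (h, k) + f1 (z + 0%R * (h, k)) * 0)); first ring.
      apply (rder_mult (fun t => f1 (z + t * (h, k))) (fun _ => (h, k))); last by apply rder_const.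
      apply (rder_comp f1 (fun t => z + t * (h, k))); last by apply rder_line.
      replace (z + 0%R * (h, k)) with z by ring. by apply f1_der.
    apply (second_derivative_max (fun t : R => v (z + t * (h, k))) (fun t : R => (Re (a * (f1 (z + t * (h, k)) * (h, k))) - ep * B1 t)%R) _ (Rmin d dB)).
    - by apply Rmin_glb_lt.
    - move=> t ht. have t1 := Rlt_le_trans _ _ _ ht (Rmin_l _ _). have t2 := Rlt_le_trans _ _ _ ht (Rmin_r _ _).
      apply: (@is_derive_minus R_AbsRing R_NormedModule). exact (rder_Re _ _ _ (L1 t t1)).
      by apply (is_derive_scal (fun s : R => barrier (z + s * (h, k))) t ep); apply HB1.
    - apply: (@is_derive_minus R_AbsRing R_NormedModule). exact (rder_Re _ _ _ L2).
      by apply (is_derive_scal B1 0%R ep).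
    - move=> t ht. have t1 := Rlt_le_trans _ _ _ ht (Rmin_l _ _).
      replace (z + 0%R * (h, k)) with z by ring. apply mx. apply near. by rewrite dist.
  have := line 1%R 0%R ltac:(simpl; ring). have := line 0%R 1%R ltac:(simpl; ring).
  set Q := (Re z ^ 2 + Im z ^ 2)%R in q *. move=> l1 l2.
  (* The directions 1 and i multiply the second derivative by 1 and - 1: harmonicity of the real
     part. *)
  have E1 : (Re (a * (f2 z * (1, 0)%R * (1, 0)%R)) + Re (a * (f2 z * (0, 1)%R * (0, 1)%R)) = 0)%R.
    rewrite /Re /=. ring.
  match type of l1 with _ - ep * ?b <= 0 => set b1 := b in l1 end.
  match type of l2 with _ - ep * ?b <= 0 => set b2 := b in l2 end.
  (* The Laplacian of the barrier: the logarithm is harmonic, and - |z|^(-2) contributes - 4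
     |z|^(-4). *)
  have E2 : (b1 + b2 = - 4 / Q ^ 2)%R by rewrite /b1 /b2 /Q; field; rewrite -/Q; lra.
  have E3 : (ep * b1 + ep * b2 = - (ep * (4 / Q ^ 2)))%R by rewrite -Rmult_plus_distr_l E2 /Rdiv; ring.
  have : 0 < ep * (4 / Q ^ 2) by apply Rmult_lt_0_compat => //; apply Rdiv_lt_0_compat; [lra | by apply pow_lt].
  lra.
Qed.

(** The multipliers 1, - 1, i, - i bound the real and imaginary parts of f from both sides. *)
Lemma elliptic_constant z : off w z -> f z = c.
Proof.
  move=> hz. have h1 := elliptic_le 1 z hz. have h2 := elliptic_le (- (1)) z hz.
  have h3 := elliptic_le Ci z hz. have h4 := elliptic_le (- Ci) z hz.
  move: h1 h2 h3 h4. rewrite /Re /Ci /= => h1 h2 h3 h4.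
  apply injective_projections; lra.
Qed.
End EllipticLiouville.

Lemma lattice_fundamental (w : C * C) : Im (snd w * Cconj (fst w)) <> 0%R -> exists C0, forall z : C, exists p, Cmod (z + lam w p) <= C0.
Proof.
  move=> hw. exists (Cmod (fst w) + Cmod (snd w))%R => z.
  set D := Im (snd w * Cconj (fst w)) in hw. set a := (- Im (z * Cconj (snd w)) / D)%R. set b := (Im (z * Cconj (fst w)) / D)%R.
  exists ((- Int_part a)%Z, (- Int_part b)%Z). rewrite /lam /lattice_point; cbn [fst snd].
  have Ez : z = a * fst w + b * snd w.
    rewrite /a /b. move: hw. rewrite /D. case: (w) => [[p q] [r s]]. case: (z) => u v. rewrite /Im /= => hw.
    apply injective_projections; simpl; field; lra.
  have -> : z + (IZR (- Int_part a) * fst w + IZR (- Int_part b) * snd w) = frac_part a * fst w + frac_part b * snd w.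
    rewrite /frac_part !opp_IZR !RtoC_opp (RtoC_minus a) (RtoC_minus b). rewrite {1}Ez. ring.
  apply: Rle_trans (Cmod_triangle _ _) _. rewrite (Cmod_mult (frac_part a)) (Cmod_mult (frac_part b)) !Cmod_R.
  have [a1 a2] := base_fp a. have [b1 b2] := base_fp b. have r0 := Cmod_ge_0 (fst w). have r1 := Cmod_ge_0 (snd w).
  rewrite !Rabs_pos_eq; try lra. nra.
Qed.

(** * The hexagonal lattice *)

Lemma Cexp_surj (z : C) : z <> 0 -> exists y, Cexp y = z.
Proof.
  move=> hz. have pz := Cmod_pos _ hz. set x := (Re z / Cmod z)%R.
  have hx : -1 <= x <= 1.
    have := re_le_Cmod z => /Rabs_le_between [h1 h2]. split; apply (Rmult_le_reg_r (Cmod z)) => //;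
      replace (x * Cmod z)%R with (Re z) by (rewrite /x; field; lra); lra.
  have E1 : (Cmod z * x = Re z)%R by rewrite /x; field; lra.
  have E2 : (Cmod z * sqrt (1 - x²) = Rabs (Im z))%R.
    rewrite -{1}(sqrt_pow2 (Cmod z)); last lra. rewrite -sqrt_mult; [|by apply pow2_ge_0 | rewrite /Rsqr; nra].
    have -> : (Cmod z ^ 2 * (1 - x²) = (Im z)²)%R.
      have := Cmod2_alt z. rewrite -E1 /Rsqr => h. nra.
    apply sqrt_Rsqr_abs.
  case: (Rle_lt_dec 0 (Im z)) => s.
  - exists (ln (Cmod z), acos x). rewrite /Cexp /Re /Im /=. rewrite exp_ln // cos_acos // sin_acos // -/(Re z).
    rewrite Rabs_pos_eq // in E2. apply injective_projections; rewrite /= -/(Re z) -/(Im z); lra.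
  - exists (ln (Cmod z), (- acos x)%R). rewrite /Cexp /Re /Im /=. rewrite exp_ln // cos_neg sin_neg cos_acos // sin_acos //.
    rewrite Rabs_left // in E2. apply injective_projections; rewrite /= -/(Re z) -/(Im z); lra.
Qed.

Definition rho : C := ((1 / 2)%R, (sqrt 3 / 2)%R).

Lemma rho_sq : rho * rho = rho - 1.
Proof.
  have h : (sqrt 3 * sqrt 3 = 3)%R by apply sqrt_sqrt; lra.
  apply injective_projections; rewrite /=; nra.
Qed.

Lemma rho_pow_neq : rho ^ 3 <> 1 /\ rho ^ 4 <> 1 /\ rho ^ 5 <> 1.
Proof.
  have h3 : rho ^ 3 = - (1).
    simpl. rewrite Cmult_1_r rho_sq. replace (rho * (rho - 1)) with (rho * rho - rho) by ring. rewrite rho_sq. ring.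
  have h0 : 0 < sqrt 3 by apply sqrt_lt_R0; lra.
  split; [|split].
  - rewrite h3 => /(f_equal Re). rewrite /Re /=. lra.
  - replace (rho ^ 4) with (rho ^ 3 * rho) by (simpl; ring). rewrite h3 => /(f_equal Re). rewrite /Re /=. lra.
  - replace (rho ^ 5) with (rho ^ 3 * (rho * rho)) by (simpl; ring). rewrite h3 rho_sq => /(f_equal Im). rewrite /Im /=. lra.
Qed.

(** * Expansion at the origin and the differential equation *)

Section LatticePowers.
Variable w : C * C.
Hypothesis hw : Im (snd w * Cconj (fst w)) <> 0%R.

Definition lampow (j : nat) : Z * Z -> C := star (fun p => / lam w p ^ j).

Lemma lampow_bound j : exists K, 0 <= K /\ forall p, Cmod (lampow j p) <= K * / Zn p ^ j.
Proof.
  have [e [e0 E]] := lam_lower_star w hw. have i0 : 0 < / e ^ j by apply Rinv_0_lt_compat, pow_lt.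
  exists (/ e ^ j)%R; split; first lra. move=> p. have z1 := Zn_ge_1 p. rewrite /lampow /star. case hp : (zp p).
    rewrite Cmod_0. apply Rmult_le_pos; first lra. left. apply Rinv_0_lt_compat, pow_lt. lra.
  have h := E p hp. rewrite Cmod_inv; last by apply Cpow_nz, (lam_neq w hw). rewrite Cmod_pow -Rinv_mult -Rpow_mult_distr.
  apply Rinv_le_contravar; first by apply pow_lt; nra. apply pow_incr. nra.
Qed.

Lemma Zn_pow_le p n : (3 <= n)%nat -> / Zn p ^ n <= / Zn p ^ 3.
Proof.
  move=> hn. have z1 := Zn_ge_1 p. apply Rinv_le_contravar; first by apply pow_lt; lra. apply Rle_pow => //.
Qed.

Lemma lampow_admissible j k : (3 <= j + k)%nat -> lat_admissible (lampow j) k.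
Proof.
  move=> h. have [K [K0 HK]] := lampow_bound j. apply: Rsummable_le (Rsummable_scal K _ K0 Rsummable_Zn3) => p.
  have z1 := Zn_ge_1 p. have := Zn_pow_le p _ h. rewrite pow_add Rinv_mult => h2.
  have i0 : 0 < / Zn p ^ k by apply Rinv_0_lt_compat, pow_lt; lra.
  apply Rle_trans with (K * / Zn p ^ j * / Zn p ^ k)%R; first by apply Rmult_le_compat_r; [lra | apply HK].
  rewrite Rmult_assoc. by apply Rmult_le_compat_l.
Qed.

Lemma lampow_summable j : (3 <= j)%nat -> summable (lampow j).
Proof.
  move=> h. have [K [K0 HK]] := lampow_bound j. apply: summable_le (Rsummable_scal K _ K0 Rsummable_Zn3) => p.
  apply: Rle_trans (HK p) _. apply Rmult_le_compat_l => //. by apply Zn_pow_le.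
Qed.

(** Expanding 1 / (x - lambda)^2 - 1 / lambda^2 up to x^3 leaves exactly x^4 (lambda^(-4) (x -
    lambda)^(-2) - 4 lambda^(-5) (x - lambda)^(-1)). When the sums of the inverse powers 3, 4, 5
    vanish, P(x) = x^(-2) + x^4 wr(x) in closed form. *)
Definition wr (x : C) : C := latsum w (lampow 4) 2 x - 4 * latsum w (lampow 5) 1 x.
Definition wr1 (x : C) : C := - (2) * latsum w (lampow 4) 3 x + 4 * latsum w (lampow 5) 2 x.
Definition wr2 (x : C) : C := 6 * latsum w (lampow 4) 4 x - 8 * latsum w (lampow 5) 3 x.

Lemma cder_wr x : off_star w x -> cder wr x (wr1 x).
Proof.
  move=> h. apply (cder_eq _ _ (- INR 2 * latsum w (lampow 4) 3 x - 4 * (- INR 1 * latsum w (lampow 5) 2 x))).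
    have -> : INR 2 = 2%R by simpl; lra. rewrite /wr1 /=. ring.
  apply (cder_minus (latsum w (lampow 4) 2) (fun y => 4 * latsum w (lampow 5) 1 y)); last apply (cder_scalf 4 (latsum w (lampow 5) 1)); apply cder_latsum => //; apply lampow_admissible; lia.
Qed.

Lemma cder_wr1 x : off_star w x -> cder wr1 x (wr2 x).
Proof.
  move=> h. apply (cder_eq _ _ (- (2) * (- INR 3 * latsum w (lampow 4) 4 x) + 4 * (- INR 2 * latsum w (lampow 5) 3 x))).
    have -> : INR 2 = 2%R by simpl; lra. have -> : INR 3 = 3%R by simpl; lra. rewrite /wr2 /=. ring.
  apply (cder_plus (fun y => - (2) * latsum w (lampow 4) 3 y) (fun y => 4 * latsum w (lampow 5) 2 y)); [apply (cder_scalf (- (2)) (latsum w (lampow 4) 3)) | apply (cder_scalf 4 (latsum w (lampow 5) 2))]; apply cder_latsum => //; apply lampow_admissible; lia.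
Qed.

Lemma wr_0 : wr 0 = 5 * tsum (lampow 6).
Proof.
  have h0 := off_star_0 w hw.
  rewrite /wr /latsum.
  rewrite (tsum_ext _ (fun p => 1 * lampow 6 p)); last first.
    move=> p. rewrite /lampow /star. case hp : (zp p); first by ring. have n := lam_neq w hw p hp. replace (0 - lam w p) with (- lam w p) by ring. by field.
  rewrite (tsum_ext (star (fun p => lampow 5 p * / (0 - lam w p) ^ 1)) (fun p => - (1) * lampow 6 p)); last first.
    move=> p. rewrite /lampow /star. case hp : (zp p); first by ring. have n := lam_neq w hw p hp. replace (0 - lam w p) with (- lam w p) by ring. by field.
  have S6 := lampow_summable 6 ltac:(lia). rewrite !tsum_scal //. ring.
Qed.

Hypothesis odd_sums : tsum (lampow 3) = 0 /\ tsum (lampow 4) = 0 /\ tsum (lampow 5) = 0.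

Lemma wpR_wr x : off_star w x -> wpR w x = x ^ 4 * wr x.
Proof.
  move=> hx. have [t3 [t4 t5]] := odd_sums.
  have s3 := lampow_summable 3 ltac:(lia). have s4 := lampow_summable 4 ltac:(lia). have s5 := lampow_summable 5 ltac:(lia).
  have sa := summable_latsum w hw _ _ x (lampow_admissible 4 2 ltac:(lia)) hx.
  have sb := summable_latsum w hw _ _ x (lampow_admissible 5 1 ltac:(lia)) hx.
  set fa := star _ in sa. set fb := star _ in sb.
  have s34 : summable (fun p => 2 * x * lampow 3 p + 3 * x ^ 2 * lampow 4 p) by apply summable_plus; by apply summable_scal.
  have s345 : summable (fun p => 2 * x * lampow 3 p + 3 * x ^ 2 * lampow 4 p + 4 * x ^ 3 * lampow 5 p) by apply summable_plus => //; by apply summable_scal.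
  have sab : summable (fun p => fa p - 4 * fb p) by apply summable_minus => //; by apply summable_scal.
  rewrite /wpR (tsum_ext _ (fun p => (2 * x * lampow 3 p + 3 * x ^ 2 * lampow 4 p + 4 * x ^ 3 * lampow 5 p) + x ^ 4 * (fa p - 4 * fb p))).
    rewrite tsum_plus //; last by apply summable_scal. rewrite tsum_scal //. rewrite tsum_minus //; last by apply summable_scal.
    rewrite tsum_scal // tsum_plus //; last by apply summable_scal. rewrite tsum_plus //; [|by apply summable_scal| by apply summable_scal].
    rewrite !tsum_scal // t3 t4 t5 /wr /latsum -/fa -/fb. ring.
  move=> p. rewrite /fa /fb /lampow /star /wpterm. case hp : (zp p); first by ring.
  have n := lam_neq w hw p hp. have n2 : x - lam w p <> 0 by apply Cminus_eq_contra, hx. field. auto.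
Qed.

Lemma wpR1_wr x : off_star w x -> - (2) * latsum w one_coef 3 x = 4 * x ^ 3 * wr x + x ^ 4 * wr1 x.
Proof.
  move=> hx. have D1 := cder_wpR w hw x hx. have [d [d0 H]] := off_star_lower w hw x hx.
  apply (cder_unique _ _ _ _ D1).
  apply (cder_local (fun y => y ^ 4 * wr y)).
    exists (d / 2)%R; split; first lra. move=> y hy. symmetry. apply wpR_wr.
    apply (lower_off_star w y (d / 2)); first lra. by apply (off_star_near w x d).
  have E := cder_mult (fun y => y ^ 4) wr x _ _ (cder_pow (fun y => y) x 1 4 (cder_id x)) (cder_wr x hx).
  apply: cder_eq E. have -> : INR 4 = 4%R by simpl; lra. cbn [pred]. ring.
Qed.

Definition invf (x : C) : C := wpf1 w x ^ 2 - 4 * wpf w x ^ 3.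
Definition invf1 (x : C) : C := 2 * wpf1 w x * wpf2 w x - 12 * wpf w x ^ 2 * wpf1 w x.
Definition invf2 (x : C) : C := 2 * (wpf2 w x ^ 2 + wpf1 w x * wpf3 w x) - 12 * (2 * wpf w x * wpf1 w x ^ 2 + wpf w x ^ 2 * wpf2 w x).

Lemma cder_invf x : off w x -> cder invf x (invf1 x).
Proof.
  move=> h. have D0 := cder_wpf w hw x h. have D1 := cder_wpf1 w hw x h.
  have E := cder_minus _ _ _ _ _ (cder_pow _ _ _ 2 D1) (cder_scalf 4 _ _ _ (cder_pow _ _ _ 3 D0)).
  apply: cder_eq E. rewrite /invf1. have -> : INR 2 = 2%R by simpl; lra. have -> : INR 3 = 3%R by simpl; lra. cbn [pred]. ring.
Qed.

Lemma cder_invf1 x : off w x -> cder invf1 x (invf2 x).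
Proof.
  move=> h. have D0 := cder_wpf w hw x h. have D1 := cder_wpf1 w hw x h. have D2 := cder_wpf2 w hw x h.
  have E := cder_minus _ _ _ _ _ (cder_mult _ _ _ _ _ (cder_scalf 2 _ _ _ D1) D2)
    (cder_mult _ _ _ _ _ (cder_scalf 12 _ _ _ (cder_pow _ _ _ 2 D0)) D1).
  apply: cder_eq E. rewrite /invf2. have -> : INR 2 = 2%R by simpl; lra. cbn [pred]. ring.
Qed.

(** P'^2 - 4 P^3 after insertion of the expansion: the terms in x^(-6) cancel, and everything left
    is regular at 0. The value there is - 28 wr(0) = - 140 times the sum of the inverse sixth
    powers. *)
Definition invg (x : C) : C := - (28) * wr x - 4 * (x * wr1 x) + (4 * (x ^ 3 * wr x) + x ^ 4 * wr1 x) ^ 2 - 12 * (x ^ 6 * wr x ^ 2) - 4 * (x ^ 12 * wr x ^ 3).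

Lemma invf_invg x : off w x -> invf x = invg x.
Proof.
  move=> /(off_iff w) [h0 h]. rewrite /invf /invg /wpf /wpf1 (wpR_wr x h).
  replace (- (2) / x ^ 3 - 2 * latsum w one_coef 3 x) with (- (2) / x ^ 3 + - (2) * latsum w one_coef 3 x) by ring.
  rewrite (wpR1_wr x h). field. done.
Qed.

Lemma invg_contc : contc invg 0.
Proof.
  have h0 := off_star_0 w hw. have D := cder_wr 0 h0. have D1 := cder_wr1 0 h0. have I := cder_id 0.
  have P n := cder_pow (fun y => y) 0 1 n I.
  apply: cder_contc. rewrite /invg.
  apply (cder_minus (fun x => - (28) * wr x - 4 * (x * wr1 x) + (4 * (x ^ 3 * wr x) + x ^ 4 * wr1 x) ^ 2 - 12 * (x ^ 6 * wr x ^ 2)) (fun x => 4 * (x ^ 12 * wr x ^ 3))).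
  - apply (cder_minus (fun x => - (28) * wr x - 4 * (x * wr1 x) + (4 * (x ^ 3 * wr x) + x ^ 4 * wr1 x) ^ 2) (fun x => 12 * (x ^ 6 * wr x ^ 2))).
    + apply (cder_plus (fun x => - (28) * wr x - 4 * (x * wr1 x)) (fun x => (4 * (x ^ 3 * wr x) + x ^ 4 * wr1 x) ^ 2)).
      * exact (cder_minus _ _ _ _ _ (cder_scalf (- (28)) _ _ _ D) (cder_scalf 4 _ _ _ (cder_mult _ _ _ _ _ I D1))).
      * exact (cder_pow _ _ _ 2 (cder_plus _ _ _ _ _ (cder_scalf 4 _ _ _ (cder_mult _ _ _ _ _ (P 3%nat) D)) (cder_mult _ _ _ _ _ (P 4%nat) D1))).
    + exact (cder_scalf 12 _ _ _ (cder_mult _ _ _ _ _ (P 6%nat) (cder_pow _ _ _ 2 D))).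
  - exact (cder_scalf 4 _ _ _ (cder_mult _ _ _ _ _ (P 12%nat) (cder_pow _ _ _ 3 D))).
Qed.

Hypothesis fundamental : exists C0, forall z : C, exists p, Cmod (z + lam w p) <= C0.

Lemma weierstrass_equation x : off w x -> wpf1 w x ^ 2 = 4 * wpf w x ^ 3 - 140 * tsum (lampow 6).
Proof.
  move=> hx. have [C0 fd] := fundamental.
  have E : invf x = - (140) * tsum (lampow 6).
    apply (elliptic_constant w hw invf invf1 invf2 _ C0) => //.
    - by apply cder_invf.
    - by apply cder_invf1.
    - move=> y p hy. by rewrite /invf wpf_padd // wpf1_padd.
    - move=> e he. have [d [d0 H]] := invg_contc e he. exists d; split => // y hy hd.
      rewrite invf_invg //. replace (- (140) * tsum (lampow 6)) with (invg 0); first by apply H; replace (y - 0) with y by ring.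
      rewrite /invg wr_0. simpl. ring.
  rewrite /invf in E. replace (wpf1 w x ^ 2) with (wpf1 w x ^ 2 - 4 * wpf w x ^ 3 + 4 * wpf w x ^ 3) by ring. rewrite E. ring.
Qed.

End LatticePowers.

(** * The rotation of the hexagonal lattice and the choice of its scale *)

Definition hexw (mu : C) : C * C := (mu, mu * rho).

Lemma hexw_nondegenerate (mu : C) : mu <> 0 -> Im (snd (hexw mu) * Cconj (fst (hexw mu))) <> 0%R.
Proof.
  move=> h. have h0 : 0 < sqrt 3 by apply sqrt_lt_R0; lra.
  have p : 0 < Cmod mu ^ 2 by apply pow_lt; apply Cmod_pos.
  have -> : Im (snd (hexw mu) * Cconj (fst (hexw mu))) = (Cmod mu ^ 2 * (sqrt 3 / 2))%R.
    rewrite Cmod2_alt /hexw /rho /Im /Re /=. field.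
  apply Rgt_not_eq, Rmult_lt_0_compat; lra.
Qed.

Lemma lam_hexw mu p : lam (hexw mu) p = mu * (IZR (fst p) + IZR (snd p) * rho).
Proof. rewrite /lam /lattice_point /hexw; cbn [fst snd]. ring. Qed.

(** Multiplication by rho in coordinates: rho (a + b rho) = - b + (a + b) rho. *)
Definition hexrot (p : Z * Z) : Z * Z := ((- snd p)%Z, (fst p + snd p)%Z).
Definition hexrot' (p : Z * Z) : Z * Z := ((fst p + snd p)%Z, (- fst p)%Z).

Lemma hexrot_K p : hexrot' (hexrot p) = p.
Proof. case: p => a b. rewrite /hexrot /hexrot' /=. f_equal; lia. Qed.

Lemma hexrot'_K p : hexrot (hexrot' p) = p.
Proof. case: p => a b. rewrite /hexrot /hexrot' /=. f_equal; lia. Qed.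

Lemma lam_hexrot mu p : lam (hexw mu) (hexrot p) = rho * lam (hexw mu) p.
Proof.
  rewrite !lam_hexw /hexrot; cbn [fst snd]. rewrite opp_IZR plus_IZR RtoC_opp RtoC_plus.
  replace (rho * (mu * (IZR (fst p) + IZR (snd p) * rho))) with (mu * (IZR (fst p) * rho + IZR (snd p) * (rho * rho))) by ring.
  rewrite rho_sq. ring.
Qed.

Lemma zp_hexrot p : zp (hexrot p) = zp p.
Proof.
  case: p => a b. rewrite /zp /hexrot /=.
  case: (Z.eqb_spec a 0) => [->|h]; case: (Z.eqb_spec b 0) => [->|h'] //=.
  - case: (Z.eqb_spec (- b) 0) => //. lia.
  - case: (Z.eqb_spec (a + 0) 0) => //. lia.
  - case: (Z.eqb_spec (- b) 0) => //. lia.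
Qed.

Lemma rho_neq : rho <> 0.
Proof. move=> /(f_equal Re). rewrite /Re /=. lra. Qed.

(** Reindexing by the rotation multiplies the sum by rho^(-j), which differs from 1. *)
Lemma hexw_sum_zero (mu : C) j : mu <> 0 -> (3 <= j)%nat -> rho ^ j <> 1 -> tsum (lampow (hexw mu) j) = 0.
Proof.
  move=> hmu hj hr. have hw := hexw_nondegenerate mu hmu. have s := lampow_summable _ hw j hj.
  have nr : rho ^ j <> 0 by apply Cpow_nz, rho_neq.
  have E : tsum (lampow (hexw mu) j) = / rho ^ j * tsum (lampow (hexw mu) j).
    rewrite -tsum_scal // -{1}(tsum_bij hexrot hexrot' _ hexrot_K hexrot'_K s). apply tsum_ext => p.
    rewrite /lampow /star zp_hexrot. case hp : (zp p); first by ring.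
    rewrite lam_hexrot Cpow_mult_l. field. split => //. apply Cpow_nz. by apply (lam_neq _ hw).
  have E2 : (rho ^ j - 1) * tsum (lampow (hexw mu) j) = 0.
    rewrite {1}E. replace ((rho ^ j - 1) * (/ rho ^ j * tsum (lampow (hexw mu) j))) with
      (tsum (lampow (hexw mu) j) - / rho ^ j * tsum (lampow (hexw mu) j)) by (field; done). rewrite -E. ring.
  case: (classic (tsum (lampow (hexw mu) j) = 0)) => // n. exfalso. have := Cmult_neq_0 _ _ (Cminus_eq_contra _ _ hr) n. done.
Qed.

Lemma hexw_equation (mu : C) x : mu <> 0 -> off (hexw mu) x ->
  wpf1 (hexw mu) x ^ 2 = 4 * wpf (hexw mu) x ^ 3 - 140 * tsum (lampow (hexw mu) 6).
Proof.
  move=> hmu hx. have [r3 [r4 r5]] := rho_pow_neq.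
  apply weierstrass_equation => //; [by apply hexw_nondegenerate | by repeat split; apply hexw_sum_zero => //; lia | by apply lattice_fundamental, hexw_nondegenerate].
Qed.

Lemma hexw_scale (mu : C)  : mu <> 0 -> tsum (lampow (hexw mu) 6) = / mu ^ 6 * tsum (lampow (hexw 1) 6).
Proof.
  move=> hmu. have h1 : RtoC 1 <> 0 by apply RtoC_neq; lra. have hw := hexw_nondegenerate 1 h1.
  rewrite -tsum_scal; last by apply lampow_summable => //; lia.
  apply tsum_ext => p. rewrite /lampow /star. case hp : (zp p); first by ring.
  have n := lam_neq _ hw p hp. move: n. rewrite !lam_hexw => n.
  have n2 : IZR (fst p) + IZR (snd p) * rho <> 0 by move=> E; apply n; rewrite E; ring.
  field. auto.
Qed.

(* If the invariant vanished, then P'^2 = 4 P^3 and P'(1/2) = 0 would force P to vanish along (0, 1/2]. *)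
Lemma hexw_sum6_neq : tsum (lampow (hexw 1) 6) <> 0.
Proof.
  move=> T0. have h1 : RtoC 1 <> 0 by apply RtoC_neq; lra. set w := hexw 1. have hw : Im (snd w * Cconj (fst w)) <> 0%R := hexw_nondegenerate 1 h1.
  have eqn x : off w x -> wpf1 w x ^ 2 = 4 * wpf w x ^ 3 by move=> hx; rewrite (hexw_equation 1 x h1 hx) T0 -/w; ring.
  have seg (x : R) : 0 < x <= 1 / 2 -> off w x.
    move=> hx /(in_lattice_lam w) [p]. rewrite lam_hexw => E. have h0 : 0 < sqrt 3 by apply sqrt_lt_R0; lra.
    have := f_equal Im E. rewrite /rho /Im /= => e2. have n0 : IZR (snd p) = 0%R by nra.
    have := f_equal Re E. rewrite /rho /Re /= n0 => e1.
    have e3 : x = IZR (fst p) by lra. rewrite e3 in hx. have [q1 q2] := hx.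
    have := lt_IZR 0 _ q1. have : IZR (fst p) < 1 by lra. move=> /lt_IZR. lia.
  have hhalf : off w (1 / 2)%R by apply seg; lra.
  have l1 : lam w (1, 0)%Z = 1 by rewrite lam_hexw /=; ring.
  (* P' is odd and has period 1, so it vanishes at the half period. *)
  have P1 : wpf1 w (1 / 2)%R = 0.
    have e1 := wpf1_opp w hw _ hhalf. have e2 := wpf1_padd w hw _ (1, 0)%Z (off_opp w _ hhalf).
    rewrite l1 in e2. replace (- (1 / 2)%R + 1) with (RtoC (1 / 2)%R) in e2.
      2: { apply injective_projections; rewrite /=; lra. }
    rewrite e1 in e2. have : wpf1 w (1 / 2)%R + wpf1 w (1 / 2)%R = 0 by rewrite {1}e2; ring.
    move=> h. replace (wpf1 w (1 / 2)%R) with (/ 2 * (wpf1 w (1 / 2)%R + wpf1 w (1 / 2)%R)) by field. rewrite h. ring.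
  have P0 : wpf w (1 / 2)%R = 0.
    apply NNPP => n. have := eqn _ hhalf. rewrite P1 => h. have := Cpow_nz _ 3 n => n3. apply n3.
    replace (wpf w (1 / 2)%R ^ 3) with (/ 4 * (4 * wpf w (1 / 2)%R ^ 3)) by (simpl; field). rewrite -h. simpl. ring.
  have [d [d0 Hd]] := wpf_blowup_0 w hw 1.
  set dl := Rmin d (1 / 2). have dl0 : 0 < dl by apply Rmin_glb_lt; lra. have dl1 : dl <= d by apply Rmin_l. have dl2 : dl <= 1 / 2 by apply Rmin_r.
  (* The argument moves from 1/2 towards 0 and stops before the pole; at dl/2, which is still
     reached, |P| exceeds 1. *)
  set b := (1 / 2 - dl / 4)%R.
  pose g (t : R) := wpf w (1 / 2 - t)%R. pose g1 (t : R) := - wpf1 w (1 / 2 - t)%R.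
  have hoff (t : R) : 0 <= t <= b -> off w (1 / 2 - t)%R by move=> ht; apply seg; rewrite /b in ht; lra.
  have Dg (t : R) : 0 <= t <= b -> rder g t (g1 t).
    move=> ht. rewrite /g. apply (rder_eq _ _ (wpf1 w (1 / 2 - t)%R * (0 - 1))); first by rewrite /g1; ring.
    apply (rder_comp (wpf w) (fun t => RtoC (1 / 2 - t)%R)); first by apply cder_wpf => //; apply hoff.
    apply (rder_eq _ _ (RtoC (0 - 1)%R)); first by rewrite RtoC_minus. apply (rder_of_real (fun t => (1 / 2 - t)%R)). auto_derive => //. ring.
  have Cg (t : R) : 0 <= t <= b -> continuity_pt (fun t => Cmod (g t)) t.
    move=> ht e he. have [dd [dd0 H]] := rder_contr _ _ _ (Dg t ht) e he. exists dd; split => // x [_ hx].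
    rewrite /dist /= /R_dist in hx *. apply: Rle_lt_trans (H x hx). apply Rabs_le.
    have := Cmod_sub_ge (g x) (g t). have := Cmod_sub_ge (g t) (g x). rewrite (Cmod_minus_sym (g t)). lra.
  have b0 : 0 < b by rewrite /b; lra.
  have [m [Hm mb]] := continuity_ab_maj (fun t => Cmod (g t)) 0 b ltac:(lra) Cg.
  (* With |P'| = 2 |P|^(3/2) the derivative of |P|^2 is at most 4 |P|^2 |P|^(1/2), and |P| is
     bounded on the compact segment. *)
  set K := (4 * sqrt (Cmod (g m)))%R.
  have Z := gronwall_zero (fun t => (Re (g t) ^ 2 + Im (g t) ^ 2)%R) (fun t => (2 * Re (g t) * Re (g1 t) + 2 * Im (g t) * Im (g1 t))%R) 0 b K.
  have Z1 : (Re (g (1 / 2 - dl / 2)%R) ^ 2 + Im (g (1 / 2 - dl / 2)%R) ^ 2 = 0)%R.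
    apply Z; last by rewrite /b; lra.
    - move=> t ht. have D := Dg t ltac:(lra). have Dr := rder_Re _ _ _ D. have Di := rder_Im _ _ _ D. split.
        have := @is_derive_plus R_AbsRing R_NormedModule _ _ _ _ _ (is_derive_pow _ 2 _ _ Dr) (is_derive_pow _ 2 _ _ Di).
        move=> H. set r := (2 * Re (g t) * Re (g1 t) + 2 * Im (g t) * Im (g1 t))%R. match type of H with is_derive _ _ ?l => replace r with l end; first exact H.
        rewrite /r /plus /=. ring.
      have hm := Hm t ltac:(lra). have g0 := Cmod_ge_0 (g t).
      have Eg : (Cmod (g1 t) ^ 2 = 4 * Cmod (g t) ^ 3)%R.
        rewrite -!Cmod_pow /g1 /g. replace ((- wpf1 w (1 / 2 - t)%R) ^ 2) with (wpf1 w (1 / 2 - t)%R ^ 2) by ring.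
        rewrite eqn; last by apply hoff; lra. rewrite (Cmod_mult 4) Cmod_R Rabs_pos_eq //. lra.
      have Eg1 : (Cmod (g1 t) = 2 * Cmod (g t) * sqrt (Cmod (g t)))%R.
        have s0 := sqrt_pos (Cmod (g t)). have ss := sqrt_sqrt _ g0.
        apply Rsqr_inj; [by apply Cmod_ge_0 | by repeat apply Rmult_le_pos; lra |]. rewrite /Rsqr. simpl in Eg.
        replace (2 * Cmod (g t) * sqrt (Cmod (g t)) * (2 * Cmod (g t) * sqrt (Cmod (g t))))%R with (4 * Cmod (g t) * Cmod (g t) * (sqrt (Cmod (g t)) * sqrt (Cmod (g t))))%R by ring.
        rewrite ss. lra.
      have I : 2 * Re (g t) * Re (g1 t) + 2 * Im (g t) * Im (g1 t) <= 2 * (Cmod (g t) * Cmod (g1 t)).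
        rewrite -(Cmod_conj (g t)) -Cmod_mult. have := Rle_trans _ _ _ (Rle_abs _) (re_le_Cmod (Cconj (g t) * g1 t)).
        rewrite {1}/Re /Cconj /= -/(Re (g t)) -/(Im (g t)) -/(Re (g1 t)) -/(Im (g1 t)). lra.
      apply: Rle_trans I _. rewrite -Cmod2_alt Eg1 /K.
      have : sqrt (Cmod (g t)) <= sqrt (Cmod (g m)) by apply sqrt_le_1_alt.
      move=> h. have : Cmod (g t) * Cmod (g t) * sqrt (Cmod (g t)) <= Cmod (g t) * Cmod (g t) * sqrt (Cmod (g m)) by apply Rmult_le_compat_l => //; nra.
      simpl. lra.
    - move=> t ht. have D := Dg t ltac:(lra). apply continuity_pt_filterlim.
      apply: (@ex_derive_continuous R_AbsRing R_NormedModule (fun t => (Re (g t) ^ 2 + Im (g t) ^ 2)%R)).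
      eexists. exact (@is_derive_plus R_AbsRing R_NormedModule _ _ _ _ _ (is_derive_pow _ 2 _ _ (rder_Re _ _ _ D)) (is_derive_pow _ 2 _ _ (rder_Im _ _ _ D))).
    - have -> : g 0%R = 0 by rewrite /g Rminus_0_r P0. rewrite /Re /Im /=. ring.
    - move=> t _. rewrite -Cmod2_alt. apply pow2_ge_0.
  rewrite -Cmod2_alt /g in Z1. replace (1 / 2 - (1 / 2 - dl / 2))%R with (dl / 2)%R in Z1 by ring.
  have := Hd (dl / 2)%R ltac:(apply RtoC_neq; lra) ltac:(rewrite Cmod_R Rabs_pos_eq; lra).
  move=> h. have : 0 < Cmod (wpf w (dl / 2)%R) ^ 2 by apply pow_lt; lra. lra.
Qed.

Lemma period_basis_exists : exists w, is_period_basis 0 4 w.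
Proof.
  have n6 := hexw_sum6_neq. set T := tsum (lampow (hexw 1) 6) in n6.
  have h35 : 35 * T <> 0 by apply Cmult_neq_0 => //; apply RtoC_neq; lra.
  have [y Ey] := Cexp_surj _ h35.
  (* Scaling by mu divides the sixth-power sum by mu^6, and 140 T / mu^6 = 4 requires mu^6 = 35 T;
     the logarithm y provides the root. *)
  set mu := Cexp (y / 6). have hmu : mu <> 0 by apply Cexp_neq_0.
  have E6 : mu ^ 6 = 35 * T.
    rewrite -Ey /mu. replace y with (y / 6 + y / 6 + y / 6 + y / 6 + y / 6 + y / 6) at 2 by field. rewrite !Cexp_add. ring.
  have hw := hexw_nondegenerate mu hmu.
  exists (hexw mu). split => // x hx.
  have D : C_derive (lattice_wp (hexw mu)) x = wpf1 (hexw mu) x.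
    apply cder_C_derive. apply: cder_local (cder_wpf _ hw x hx).
    have [d [d0 H]] := off_open _ hw x hx. exists d; split => // z hz. symmetry. apply lattice_wp_wpf => //.
    by have [_ h] := proj1 (off_iff _ z) (H z hz).
  rewrite D lattice_wp_wpf //; last by have [_ h] := proj1 (off_iff _ x) hx.
  rewrite hexw_equation // hexw_scale // E6 -/T. field. done.
Qed.

(** The basis selected by choice. The hexagonal example only shows that the choice is sound; from
    here on, linear independence and the differential equation are all that is known of [W]. *)
Definition W : C * C := wp_periods 0 4.

Lemma W_basis : is_period_basis 0 4 W.
Proof. exact (epsilon_spec _ _ period_basis_exists). Qed.

Lemma hW : Im (snd W * Cconj (fst W)) <> 0%R.
Proof. exact (proj1 W_basis). Qed.

Lemma wp_wpf x : off W x -> wp x 0 4 = wpf W x.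
Proof. move=> hx. rewrite /wp -/W. apply lattice_wp_wpf; [exact hW | exact (proj2 (proj1 (off_iff W x) hx))]. Qed.

Lemma W_equation x : off W x -> wpf1 W x ^ 2 = 4 * wpf W x ^ 3 - 4.
Proof.
  move=> hx. have := proj2 W_basis x hx.
  have -> : C_derive (lattice_wp W) x = wpf1 W x.
    apply cder_C_derive. apply: cder_local (cder_wpf _ hW x hx).
    have [d [d0 H]] := off_open _ hW x hx. exists d; split => // z hz. symmetry. apply lattice_wp_wpf; first exact hW.
    by have [_ h] := proj1 (off_iff _ z) (H z hz).
  rewrite lattice_wp_wpf; [|exact hW| exact (proj2 (proj1 (off_iff W x) hx))]. move=> ->. ring.
Qed.

(** * Solutions of the Weierstrass equation along paths *)

Lemma contr_left_eq (f g : R -> C) (a t : R) : a < t -> contr f t -> contr g t -> (forall s, a <= s < t -> f s = g s) -> f t = g t.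
Proof.
  move=> hat Cf Cg E. apply Cmod_small_eq => e he.
  have [d [d0 H]] := Cf (e / 2)%R ltac:(lra). have [d' [d0' H']] := Cg (e / 2)%R ltac:(lra).
  set m := Rmin (Rmin d d') (t - a). have m0 : 0 < m by repeat apply Rmin_glb_lt; lra.
  have m1 : m <= Rmin d d' by apply Rmin_l. have m2 : m <= t - a by apply Rmin_r.
  have m3 := Rle_trans _ _ _ m1 (Rmin_l _ _). have m4 := Rle_trans _ _ _ m1 (Rmin_r _ _).
  set s := (t - m / 2)%R. have hs : a <= s < t by rewrite /s; lra.
  have b : Rabs (s - t) < m by rewrite /s Rabs_left; lra.
  have h1 := H s ltac:(lra). have h2 := H' s ltac:(lra). rewrite (E s hs) Cmod_minus_sym in h1.
  have := Cmod_dist (f t) (g s) (g t). lra.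
Qed.

Lemma contr_minus (f h : R -> C) t : contr f t -> contr h t -> contr (fun s => f s - h s) t.
Proof.
  move=> Hf Hh e he. have [p [p0 Hp]] := Hf (e / 2)%R ltac:(lra). have [p' [p0' Hp']] := Hh (e / 2)%R ltac:(lra).
  exists (Rmin p p'); split; first by apply Rmin_glb_lt. move=> z hz.
  have u1 := Hp z (Rlt_le_trans _ _ _ hz (Rmin_l _ _)). have u2 := Hp' z (Rlt_le_trans _ _ _ hz (Rmin_r _ _)).
  replace (f z - h z - (f t - h t)) with ((f z - f t) - (h z - h t)) by ring.
  have := Cmod_sub_le (f z - f t) (h z - h t). lra.
Qed.

Lemma contr_bounded (f : R -> C) t : contr f t -> exists d K, 0 < d /\ 0 < K /\ forall s, Rabs (s - t) < d -> Cmod (f s) <= K.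
Proof.
  move=> H. have [d [d0 h]] := H 1%R Rlt_0_1. exists d, (Cmod (f t) + 1)%R.
  split => //. split; first by have := Cmod_ge_0 (f t); lra.
  move=> y hy. have := h y hy. have := Cmod_sub_ge (f y) (f t). lra.
Qed.

Definition energy (U V : R -> C) (t : R) : R := (Cmod (U t) ^ 2 + Cmod (V t) ^ 2)%R.

Lemma energy_cont U V t : contr U t -> contr V t -> continuity_pt (energy U V) t.
Proof.
  move=> HU HV.
  have Q f : contr f t -> continuity_pt (fun s => (Cmod (f s) ^ 2)%R) t.
    move=> Hf. have c1 : continuity_pt (fun s => Cmod (f s)) t.
      move=> e he. have [dd [dd0 H]] := Hf e he. exists dd; split => // x [_ hx].
      rewrite /dist /= /R_dist in hx *. apply: Rle_lt_trans (H x hx). apply Rabs_le.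
      have := Cmod_sub_ge (f x) (f t). have := Cmod_sub_ge (f t) (f x). rewrite (Cmod_minus_sym (f t)). lra.
    have := continuity_pt_mult _ _ _ c1 c1. apply: continuity_pt_ext => s. rewrite /mult_fct. ring.
  by apply continuity_pt_plus; apply Q.
Qed.

(* Gronwall for |U|^2 + |V|^2. *)
Lemma linear_system_zero (U V p q : R -> C) (a b K : R) :
  (forall t, a < t < b -> rder U t (p t * V t)) -> (forall t, a < t < b -> rder V t (q t * U t)) ->
  (forall t, a < t < b -> Cmod (p t) <= K /\ Cmod (q t) <= K) ->
  (forall t, a <= t < b -> contr U t /\ contr V t) -> U a = 0 -> V a = 0 ->
  forall t, a <= t < b -> U t = 0 /\ V t = 0.
Proof.
  move=> HU HV HK HC U0 V0 t ht.
  have hb (u v : C) : Re u * Re v + Im u * Im v <= Cmod u * Cmod v.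
    rewrite -(Cmod_conj u) -Cmod_mult. have := Rle_trans _ _ _ (Rle_abs _) (re_le_Cmod (Cconj u * v)).
    rewrite {1}/Re /Cconj /= -/(Re u) -/(Im u) -/(Re v) -/(Im v). lra.
  have Z : energy U V t = 0%R.
    apply (gronwall_zero (energy U V) (fun t => (2 * (Re (U t) * Re (p t * V t) + Im (U t) * Im (p t * V t)) + 2 * (Re (V t) * Re (q t * U t) + Im (V t) * Im (q t * U t)))%R) a b (2 * K)) => //.
    - move=> s hs. split.
        have D f f1 : rder f s f1 -> is_derive (fun s => (Cmod (f s) ^ 2)%R) s (2 * (Re (f s) * Re f1 + Im (f s) * Im f1))%R.
          move=> Df. apply (is_derive_ext (fun s => (Re (f s) ^ 2 + Im (f s) ^ 2)%R)); first by move=> r; rewrite Cmod2_alt.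
          have := @is_derive_plus R_AbsRing R_NormedModule _ _ _ _ _ (is_derive_pow _ 2 _ _ (rder_Re _ _ _ Df)) (is_derive_pow _ 2 _ _ (rder_Im _ _ _ Df)).
          move=> H. match type of H with is_derive _ _ ?l => replace (2 * (Re (f s) * Re f1 + Im (f s) * Im f1))%R with l end; first exact H.
          rewrite /plus /=. ring.
        exact (@is_derive_plus R_AbsRing R_NormedModule _ _ _ _ _ (D _ _ (HU s hs)) (D _ _ (HV s hs))).
      have [k1 k2] := HK s hs. have h1 := hb (U s) (p s * V s). have h2 := hb (V s) (q s * U s).
      rewrite Cmod_mult in h1. rewrite Cmod_mult in h2. rewrite /energy.
      have u0 := Cmod_ge_0 (U s). have v0 := Cmod_ge_0 (V s). have uv : 0 <= Cmod (U s) * Cmod (V s) by apply Rmult_le_pos.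
      have q1 : Cmod (p s) * (Cmod (U s) * Cmod (V s)) <= K * (Cmod (U s) * Cmod (V s)) by apply Rmult_le_compat_r.
      have q2 : Cmod (q s) * (Cmod (U s) * Cmod (V s)) <= K * (Cmod (U s) * Cmod (V s)) by apply Rmult_le_compat_r.
      have K0 : 0 <= K by apply: Rle_trans k1; apply Cmod_ge_0.
      have : K * (2 * (Cmod (U s) * Cmod (V s))) <= K * (Cmod (U s) ^ 2 + Cmod (V s) ^ 2).
        apply Rmult_le_compat_l => //. have := pow2_ge_0 (Cmod (U s) - Cmod (V s)). simpl. lra.
      lra.
    - move=> s hs. have [cu cv] := HC s hs. by apply energy_cont.
    - rewrite /energy U0 V0 Cmod_0. ring.
    - move=> s _. rewrite /energy. have := pow2_ge_0 (Cmod (U s)). have := pow2_ge_0 (Cmod (V s)). lra.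
  have u0 := pow2_ge_0 (Cmod (U t)). have v0 := pow2_ge_0 (Cmod (V t)). rewrite /energy in Z.
  split; apply Cmod_eq_0; apply NNPP => n.
  - have := pow_lt (Cmod (U t)) 2 ltac:(have := Cmod_ge_0 (U t); lra). lra.
  - have := pow_lt (Cmod (V t)) 2 ltac:(have := Cmod_ge_0 (V t); lra). lra.
Qed.

Section Propagation.
Variable w : C * C.
Hypothesis hw : Im (snd w * Cconj (fst w)) <> 0%R.
Hypothesis eqn : forall x, off w x -> wpf1 w x ^ 2 = 4 * wpf w x ^ 3 - 4.

Lemma wpf2_padd x e : off w x -> wpf2 w (x + lam w e) = wpf2 w x.
Proof.
  move=> h. have h' := off_padd w x e h.
  have D1 : cder (fun y => wpf1 w (y + lam w e)) x (wpf2 w (x + lam w e) * (1 + 0)).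
    apply (cder_comp (wpf1 w) (fun y => y + lam w e)); first by apply cder_wpf1. by apply cder_plus; [apply cder_id | apply cder_const].
  have D2 : cder (fun y => wpf1 w (y + lam w e)) x (wpf2 w x).
    have [d [d0 H]] := off_open w hw x h.
    apply: cder_local (cder_wpf1 w hw x h). exists d; split => // y hy. symmetry. by apply wpf1_padd, H.
  rewrite -(cder_unique _ _ _ _ D1 D2). ring.
Qed.

Lemma wpf2_generic x : off w x -> wpf1 w x <> 0 -> wpf2 w x = 6 * wpf w x ^ 2.
Proof.
  move=> hx n. have D0 := cder_wpf w hw x hx. have D1 := cder_wpf1 w hw x hx.
  have E1 := cder_pow _ _ _ 2 D1. have E2 := cder_minus _ _ _ _ _ (cder_scalf 4 _ _ _ (cder_pow _ _ _ 3 D0)) (cder_const 4 x).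
  have E3 : cder (fun y => wpf1 w y ^ 2) x (4 * (INR 3 * wpf w x ^ (pred 3) * wpf1 w x) - 0).
    apply: cder_local E2. have [d [d0 H]] := off_open w hw x hx. exists d; split => // y hy. by rewrite eqn //; apply H.
  have := cder_unique _ _ _ _ E1 E3. have -> : INR 2 = 2%R by simpl; lra. have -> : INR 3 = 3%R by simpl; lra. cbn [pred].
  move=> E. apply Ceq_minus. have E4 : 2 * wpf1 w x * (wpf2 w x - 6 * wpf w x ^ 2) = 0.
    replace (2 * wpf1 w x * (wpf2 w x - 6 * wpf w x ^ 2)) with (2 * wpf1 w x ^ 1 * wpf2 w x - 12 * wpf w x ^ 2 * wpf1 w x) by ring.
    rewrite E. ring.
  apply NNPP => n2. have := Cmult_neq_0 (2 * wpf1 w x) _ (Cmult_neq_0 2 _ ltac:(apply RtoC_neq; lra) n) n2. done.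
Qed.

(* At zeros of P' the equation does not determine P''; but P'' - 6 P^2 is elliptic and vanishes near 0. *)
Lemma wpf2_eq x : off w x -> wpf2 w x = 6 * wpf w x ^ 2.
Proof.
  move=> hx. have [C0 fd] := lattice_fundamental w hw.
  apply Ceq_minus.
  have : wpf2 w x - 6 * wpf w x ^ 2 = 0; last done.
  apply (elliptic_constant w hw (fun x => wpf2 w x - 6 * wpf w x ^ 2) (fun x => wpf3 w x - 12 * wpf w x * wpf1 w x)
    (fun x => 120 / x ^ 6 + 120 * latsum w one_coef 6 x - (12 * wpf1 w x * wpf1 w x + 12 * wpf w x * wpf2 w x)) 0 C0) => //.
  - move=> y h. have D0 := cder_wpf w hw y h. have D2 := cder_wpf2 w hw y h.
    have E := cder_minus _ _ _ _ _ D2 (cder_scalf 6 _ _ _ (cder_pow _ _ _ 2 D0)).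
    apply: cder_eq E. have -> : INR 2 = 2%R by simpl; lra. cbn [pred]. ring.
  - move=> y h. have D0 := cder_wpf w hw y h. have D1 := cder_wpf1 w hw y h. have D3 := cder_wpf3 w hw y h.
    exact (cder_minus _ _ _ _ _ D3 (cder_mult _ _ _ _ _ (cder_scalf 12 _ _ _ D0) D1)).
  - move=> y p hy. by rewrite wpf2_padd // wpf_padd.
  - move=> e he. have [d [d0 H]] := wpf_chart_0 w hw 1 Rlt_0_1. exists d; split => // y hy hd.
    have [_ [n _]] := H y (proj1 (proj1 (off_iff w y) hy)) hd.
    rewrite wpf2_generic //. replace (6 * wpf w y ^ 2 - 6 * wpf w y ^ 2 - 0) with (RtoC 0) by ring. by rewrite Cmod_0.
Qed.

(** Along a path, (P(g), P'(g)) and (X, Y) solve the same system, so their difference solves a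
    homogeneous linear one and stays zero. The path cannot reach a lattice point: P(g) would be
    unbounded just before, while X is continuous there. *)
Lemma propagate (g X Y k : R -> C) (a b : R) : a <= b ->
  (forall t, a <= t < b -> rder g t (k t) /\ rder X t (k t * Y t) /\ rder Y t (k t * (6 * X t ^ 2)) /\ contr k t) ->
  contr g b -> contr X b -> contr Y b ->
  off w (g a) -> wpf w (g a) = X a -> wpf1 w (g a) = Y a ->
  forall t, a <= t <= b -> off w (g t) /\ wpf w (g t) = X t /\ wpf1 w (g t) = Y t.
Proof.
  move=> hab HD cg cX cY o1 o2 o3.
  have CC t : a <= t <= b -> contr g t /\ contr X t /\ contr Y t.
    move=> ht. case: (Req_dec t b) => [->|n] //. have [D1 [D2 [D3 _]]] := HD t ltac:(lra).
    repeat split; eapply rder_contr; eauto.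
  have Pc x : off w x -> contc (wpf w) x by move=> h; apply: cder_contc (cder_wpf w hw x h).
  have P1c x : off w x -> contc (wpf1 w) x by move=> h; apply: cder_contc (cder_wpf1 w hw x h).
  apply (real_induction (fun t => off w (g t) /\ wpf w (g t) = X t /\ wpf1 w (g t) = Y t)) => //.
  - move=> t ht Hs. have [q1 [q2 q3]] := Hs t ltac:(lra).
    have [gt [Xt Yt]] := CC t ltac:(lra). have [_ [_ [_ kt]]] := HD t ht.
    have [d1 [d10 H1]] := off_open w hw _ q1. have [d2 [d20 H2]] := gt d1 d10.
    have [d3 [K3 [d30 [K30 H3]]]] := contr_bounded _ _ kt.
    have [d4 [K4 [d40 [K40 H4]]]] := contr_bounded _ _ Xt.
    have [d5 [K5 [d50 [K50 H5]]]] := contr_bounded _ _ (contc_contr_comp _ _ _ (Pc _ q1) gt).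
    set d := Rmin (Rmin (Rmin d2 d3) (Rmin d4 d5)) (b - t).
    have d0 : 0 < d by repeat apply Rmin_glb_lt; lra.
    have e1 : d <= Rmin (Rmin d2 d3) (Rmin d4 d5) by apply Rmin_l.
    have e2 := Rle_trans _ _ _ e1 (Rmin_l _ _). have e3 := Rle_trans _ _ _ e1 (Rmin_r _ _). have e4 : d <= b - t by apply Rmin_r.
    have e5 := Rle_trans _ _ _ e2 (Rmin_l _ _). have e6 := Rle_trans _ _ _ e2 (Rmin_r _ _).
    have e7 := Rle_trans _ _ _ e3 (Rmin_l _ _). have e8 := Rle_trans _ _ _ e3 (Rmin_r _ _).
    have noff s : t <= s < t + d -> off w (g s).
      move=> hs. apply H1, H2. rewrite Rabs_pos_eq; lra.
    exists d; split => // s hs hsb. split; first by apply noff.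
    (* The factorization P^2 - X^2 = (P + X)(P - X) makes the system for the differences linear,
       with coefficients bounded by the local bounds on k, P(g) and X. *)
    set K := (K3 * (1 + 6 * (K5 + K4)))%R.
    have := linear_system_zero (fun s => wpf w (g s) - X s) (fun s => wpf1 w (g s) - Y s) k (fun s => k s * (6 * (wpf w (g s) + X s))) t (t + d) K.
    move=> L. have [L1 L2] : wpf w (g s) - X s = 0 /\ wpf1 w (g s) - Y s = 0.
      apply L => //.
      + move=> r hr. have [D1 [D2 [D3 _]]] := HD r ltac:(lra). have o := noff r ltac:(lra).
        apply (rder_eq _ _ (wpf1 w (g r) * k r - k r * Y r)); first ring.
        apply rder_minus => //. apply (rder_comp (wpf w) g) => //. by apply cder_wpf.
      + move=> r hr. have [D1 [D2 [D3 _]]] := HD r ltac:(lra). have o := noff r ltac:(lra).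
        apply (rder_eq _ _ (wpf2 w (g r) * k r - k r * (6 * X r ^ 2))); first by rewrite wpf2_eq //; ring.
        apply rder_minus => //. apply (rder_comp (wpf1 w) g) => //. by apply cder_wpf1.
      + move=> r hr. have a1 := H3 r ltac:(rewrite Rabs_pos_eq; lra). have a2 := H4 r ltac:(rewrite Rabs_pos_eq; lra).
        have a3 := H5 r ltac:(rewrite Rabs_pos_eq; lra). rewrite /K.
        have k0 := Cmod_ge_0 (k r). split; first nra.
        rewrite (Cmod_mult (k r)) (Cmod_mult 6) Cmod_R Rabs_pos_eq; last lra.
        have := Cmod_triangle (wpf w (g r)) (X r) => a4. have a5 := Cmod_ge_0 (wpf w (g r) + X r).
        apply Rmult_le_compat => //; lra.
      + move=> r hr. have o := noff r hr. have [gr [Xr Yr]] := CC r ltac:(lra).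
        split; apply contr_minus => //; by [apply (contc_contr_comp (wpf w)); [apply Pc|] | apply (contc_contr_comp (wpf1 w)); [apply P1c|]].
      + rewrite q2. ring.
      + rewrite q3. ring.
    split; by apply Ceq_minus.
  - move=> t ht Hs. have [gt [Xt Yt]] := CC t ltac:(lra).
    have ot : off w (g t).
      move=> hl. have [d [d0 H]] := wpf_blowup w hw (g t) (Cmod (X t) + 1) hl.
      have [d1 [d10 H1]] := gt d d0. have [d2 [d20 H2]] := Xt 1%R Rlt_0_1.
      set m := Rmin (Rmin d1 d2) (t - a). have m0 : 0 < m by repeat apply Rmin_glb_lt; lra.
      have m1 : m <= Rmin d1 d2 by apply Rmin_l. have m2 : m <= t - a by apply Rmin_r.
      have m3 := Rle_trans _ _ _ m1 (Rmin_l _ _). have m4 := Rle_trans _ _ _ m1 (Rmin_r _ _).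
      have [s1 [s2 _]] := Hs (t - m / 2)%R ltac:(lra).
      have bb : Rabs (t - m / 2 - t) < m by rewrite Rabs_left; lra.
      have h1 := H _ s1 (H1 (t - m / 2)%R ltac:(lra)). have h2 := H2 (t - m / 2)%R ltac:(lra).
      rewrite s2 in h1. have := Cmod_sub_ge (X (t - m / 2)%R) (X t). lra.
    split => //. split.
    + apply (contr_left_eq (fun s => wpf w (g s)) X a t) => //; [lra | by apply contc_contr_comp; [apply Pc|] |].
      move=> s hs. by have [_ [h _]] := Hs s hs.
    + apply (contr_left_eq (fun s => wpf1 w (g s)) Y a t) => //; [lra | by apply contc_contr_comp; [apply P1c|] |].
      move=> s hs. by have [_ [_ h]] := Hs s hs.
Qed.

(* In the coordinates -2 P / P', -2 / P' the pole becomes the regular point (0, 0). *)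
Lemma cder_chart x : off w x -> wpf1 w x <> 0 ->
  cder (fun x => - (2) * wpf w x / wpf1 w x) x (1 + 3 * (- (2) / wpf1 w x) ^ 2) /\
  cder (fun x => - (2) / wpf1 w x) x (3 * (- (2) * wpf w x / wpf1 w x) ^ 2).
Proof.
  move=> hx n. have D0 := cder_wpf w hw x hx. have D1 := cder_wpf1 w hw x hx. rewrite wpf2_eq // in D1. split.
  - have E := cder_div _ _ _ _ _ (cder_scalf (- (2)) _ _ _ D0) D1 n. apply: cder_eq E.
    have e := eqn x hx. replace (- (2) * wpf w x * (6 * wpf w x ^ 2)) with (- (3) * (4 * wpf w x ^ 3 - 4) - 12) by ring.
    rewrite -e. field. done.
  - have E := cder_div _ _ _ _ _ (cder_const (- (2)) x) D1 n. apply: cder_eq E. field. done.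
Qed.

(** In the chart at the pole both pairs satisfy the regular system Z' = k (1 + 3 V^2), V' = 3 k Z^2
    with zero initial values, so they coincide for small t. The condition g(t) <> 0 keeps the path
    inside the domain of the quotients after the start. *)
Lemma start_at_pole (g Z V k : R -> C) (b K : R) : 0 < b -> g 0%R = 0 -> Z 0%R = 0 -> V 0%R = 0 ->
  contr g 0 -> contr Z 0 -> contr V 0 ->
  (forall t, 0 < t < b -> g t <> 0 /\ Cmod (k t) <= K /\ rder g t (k t) /\
     rder Z t (k t * (1 + 3 * V t ^ 2)) /\ rder V t (k t * (3 * Z t ^ 2))) ->
  exists d, 0 < d /\ forall t, 0 < t < d -> off w (g t) /\ - (2) * wpf w (g t) / wpf1 w (g t) = Z t /\ - (2) / wpf1 w (g t) = V t /\ wpf1 w (g t) <> 0.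
Proof.
  move=> b0 g0 Z0 V0 cg cZ cV HD.
  (* Setting both chart functions to 0 at the pole makes them continuous there, which is what the
     comparison needs at its initial point. *)
  pose zf (x : C) : C := if excluded_middle_informative (x = 0) is left _ then RtoC 0 else - (2) * wpf w x / wpf1 w x.
  pose vf (x : C) : C := if excluded_middle_informative (x = 0) is left _ then RtoC 0 else - (2) / wpf1 w x.
  have zfE (x : C) : x <> 0 -> zf x = - (2) * wpf w x / wpf1 w x by move=> n; rewrite /zf; case: excluded_middle_informative.
  have vfE (x : C) : x <> 0 -> vf x = - (2) / wpf1 w x by move=> n; rewrite /vf; case: excluded_middle_informative.
  have zf0 : zf 0 = 0 by rewrite /zf; case: excluded_middle_informative.
  have vf0 : vf 0 = 0 by rewrite /vf; case: excluded_middle_informative.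
  have [d1 [d10 H1]] := wpf_chart_0 w hw 1 Rlt_0_1.
  have small (x : C) : Cmod x < d1 -> Cmod (zf x) <= 1 /\ Cmod (vf x) <= 1.
    move=> hx. case: (classic (x = 0)) => [->|n]; first by rewrite zf0 vf0 Cmod_0; lra.
    have [_ [_ [h1 h2]]] := H1 x n hx. rewrite zfE // vfE //. lra.
  have cz : contc zf 0.
    move=> e he. have [d [d0 H]] := wpf_chart_0 w hw e he. exists d; split => // y hy. replace (y - 0) with y in hy by ring.
    rewrite zf0. replace (zf y - 0) with (zf y) by ring.
    case: (classic (y = 0)) => [->|n]; first by rewrite zf0 Cmod_0. have [_ [_ [h1 h2]]] := H y n hy. by rewrite zfE.
  have cv : contc vf 0.
    move=> e he. have [d [d0 H]] := wpf_chart_0 w hw e he. exists d; split => // y hy. replace (y - 0) with y in hy by ring.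
    rewrite vf0. replace (vf y - 0) with (vf y) by ring.
    case: (classic (y = 0)) => [->|n]; first by rewrite vf0 Cmod_0. have [_ [_ [h1 h2]]] := H y n hy. by rewrite vfE.
  have [d2 [d20 H2]] := cg d1 d10. have [d3 [d30 H3]] := cZ 1%R Rlt_0_1. have [d4 [d40 H4]] := cV 1%R Rlt_0_1.
  set d := Rmin (Rmin b d2) (Rmin d3 d4). have d0 : 0 < d by repeat apply Rmin_glb_lt; lra.
  have e1 : d <= Rmin b d2 by apply Rmin_l. have e2 : d <= Rmin d3 d4 by apply Rmin_r.
  have e3 := Rle_trans _ _ _ e1 (Rmin_l _ _). have e4 := Rle_trans _ _ _ e1 (Rmin_r _ _).
  have e5 := Rle_trans _ _ _ e2 (Rmin_l _ _). have e6 := Rle_trans _ _ _ e2 (Rmin_r _ _).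
  have gs t : 0 < t < d -> Cmod (g t) < d1.
    move=> ht. have := H2 t ltac:(rewrite Rminus_0_r Rabs_pos_eq; lra). rewrite g0. by replace (g t - 0) with (g t) by ring.
  exists d; split => // t ht.
  have [n [kK _]] := HD t ltac:(lra). have [o [n1 _]] := H1 _ n (gs t ht).
  split => //. rewrite -zfE // -vfE //.
  have L := linear_system_zero (fun s => vf (g s) - V s) (fun s => zf (g s) - Z s) (fun s => k s * (3 * (zf (g s) + Z s))) (fun s => k s * (3 * (vf (g s) + V s))) 0 d (K * 6).
  have CD s : 0 < s < d -> rder (fun s => vf (g s)) s (k s * (3 * zf (g s) ^ 2)) /\ rder (fun s => zf (g s)) s (k s * (1 + 3 * vf (g s) ^ 2)).
    move=> hs. have [ns [_ [Dg _]]] := HD s ltac:(lra). have [os [ns1 _]] := H1 _ ns (gs s hs).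
    have [c1 c2] := cder_chart _ os ns1.
    have nb : exists dd, 0 < dd /\ forall y, Cmod (y - g s) < dd -> y <> 0.
      exists (Cmod (g s)); split; first by apply Cmod_pos. move=> y hy E. rewrite E Cmod_minus_sym in hy. replace (g s - 0) with (g s) in hy by ring. lra.
    have [dd [dd0 Hdd]] := nb. rewrite zfE // vfE //. split.
    - rewrite Cmult_comm. apply (rder_comp vf g) => //. apply: cder_local c2. exists dd; split => // y hy. by rewrite vfE //; apply Hdd.
    - rewrite Cmult_comm. apply (rder_comp zf g) => //. apply: cder_local c1. exists dd; split => // y hy. by rewrite zfE //; apply Hdd.
  have sZ s : 0 < s < d -> Cmod (Z s) <= 1 /\ Cmod (V s) <= 1.
    move=> hs. have h3 := H3 s ltac:(rewrite Rminus_0_r Rabs_pos_eq; lra). have h4 := H4 s ltac:(rewrite Rminus_0_r Rabs_pos_eq; lra).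
    rewrite Z0 in h3. rewrite V0 in h4. replace (Z s - 0) with (Z s) in h3 by ring. replace (V s - 0) with (V s) in h4 by ring. lra.
  have [L1 L2] : vf (g t) - V t = 0 /\ zf (g t) - Z t = 0.
    apply L; last lra.
    + move=> s hs. have [c1 c2] := CD s hs. have [_ [_ [_ [D1 D2]]]] := HD s ltac:(lra).
      apply (rder_eq _ _ (k s * (3 * zf (g s) ^ 2) - k s * (3 * Z s ^ 2))); first ring. by apply rder_minus.
    + move=> s hs. have [c1 c2] := CD s hs. have [_ [_ [_ [D1 D2]]]] := HD s ltac:(lra).
      apply (rder_eq _ _ (k s * (1 + 3 * vf (g s) ^ 2) - k s * (1 + 3 * V s ^ 2))); first ring. by apply rder_minus.
    + move=> s hs. have [_ [ks _]] := HD s ltac:(lra). have [s1 s2] := small _ (gs s hs). have [s3 s4] := sZ s hs.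
      have t1 := Cmod_triangle (zf (g s)) (Z s). have t2 := Cmod_triangle (vf (g s)) (V s). have k0 := Cmod_ge_0 (k s).
      rewrite !(Cmod_mult (k s)) !(Cmod_mult 3) Cmod_R Rabs_pos_eq; last lra.
      split; apply Rmult_le_compat => //; try lra; apply Rmult_le_pos; try lra; apply Cmod_ge_0.
    + move=> s hs. case: (Req_dec s 0) => [->|ns].
        split; apply contr_minus => //; [apply (contc_contr_comp vf) | apply (contc_contr_comp zf)] => //; by rewrite g0.
      have [c1 c2] := CD s ltac:(lra). have [_ [_ [_ [D1 D2]]]] := HD s ltac:(lra).
      split; apply contr_minus; eapply rder_contr; eauto.
    + rewrite g0 vf0 V0. ring.
    + rewrite g0 zf0 Z0. ring.
  split; [by apply Ceq_minus | by split; [apply Ceq_minus|]].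
Qed.

End Propagation.

(** * The Beta integral *)

Section BetaIntegral.
Local Open Scope R_scope.

Lemma is_derive_RInt_interval (f : R -> R) (a b c x : R) : (forall y, a < y < b -> continuous f y) -> a < c < b -> a < x < b ->
  is_derive (RInt f c) x (f x).
Proof.
  move=> H hc hx. apply (is_derive_RInt f _ c); last by apply H.
  have h : 0 < Rmin (x - a) (b - x) by apply Rmin_glb_lt; lra.
  exists (mkposreal _ h) => y. rewrite /ball /= /AbsRing_ball /abs /minus /plus /opp /= => hy.
  have h1 : Rabs (y + - x) < x - a by apply: Rlt_le_trans hy (Rmin_l _ _).
  have h2 : Rabs (y + - x) < b - x by apply: Rlt_le_trans hy (Rmin_r _ _).
  move: h1 h2 => /Rabs_def2 h1 /Rabs_def2 h2.
  apply (@RInt_correct R_CompleteNormedModule). apply (@ex_RInt_continuous R_CompleteNormedModule) => z hz. apply H.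
  split; [apply: Rlt_le_trans (proj1 hz); apply Rmin_glb_lt; lra | apply: Rle_lt_trans (proj2 hz) _; apply Rmax_lub_lt; lra].
Qed.

(* The cube root of 1 - x^6; the case distinction is needed because [Rpower 0 y] is 1. *)
Definition cr (x : R) : R := match Rle_dec (1 - x ^ 6) 0 with left _ => 0 | right _ => Rpower (1 - x ^ 6) (1 / 3) end.

Lemma pow6_lt x : -1 < x < 1 -> 0 < 1 - x ^ 6.
Proof. move=> h. have h2 : x * x < 1 by nra. have h0 : 0 <= x * x by nra. have h4 : (x * x) * (x * x) < 1 by nra. simpl. nra. Qed.

Lemma cr_E x : -1 < x < 1 -> cr x = Rpower (1 - x ^ 6) (1 / 3).
Proof. move=> /pow6_lt h. rewrite /cr. case: Rle_dec => // h2. lra. Qed.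

Lemma cr_pos x : -1 < x < 1 -> 0 < cr x.
Proof. move=> h. rewrite cr_E //. apply exp_pos. Qed.

Lemma cr_cube x : -1 < x < 1 -> cr x ^ 3 = 1 - x ^ 6.
Proof.
  move=> h. have q := pow6_lt x h. rewrite cr_E // -Rpower_pow; last by apply exp_pos.
  rewrite Rpower_mult. replace (1 / 3 * INR 3) with 1 by (simpl; field). by rewrite Rpower_1.
Qed.

Lemma is_derive_cr x : -1 < x < 1 -> is_derive cr x (- 2 * x ^ 5 * cr x / (1 - x ^ 6)).
Proof.
  move=> h. have q := pow6_lt x h.
  apply (is_derive_ext_loc (fun x => Rpower (1 - x ^ 6) (1 / 3))).
    have h0 : 0 < Rmin (x + 1) (1 - x) by apply Rmin_glb_lt; lra.
    exists (mkposreal _ h0) => y. rewrite /ball /= /AbsRing_ball /abs /minus /plus /opp /= => hy.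
    have h1 : Rabs (y + - x) < x + 1 by apply: Rlt_le_trans hy (Rmin_l _ _).
    have h2 : Rabs (y + - x) < 1 - x by apply: Rlt_le_trans hy (Rmin_r _ _).
    move: h1 h2 => /Rabs_def2 h1 /Rabs_def2 h2. rewrite cr_E //. lra.
  rewrite cr_E // /Rpower. simpl in q. auto_derive; first lra. replace (1 - x ^ 6) with (1 + - (x * (x * (x * (x * (x * (x * 1))))))) by ring. field. lra.
Qed.

Lemma cr_cont1 e : 0 < e -> exists d, 0 < d /\ forall s, Rabs (s - 1) < d -> 0 <= cr s < e.
Proof.
  move=> he. have e3 : 0 < e ^ 3 by apply pow_lt.
  exists (Rmin 1 (e ^ 3 / 6)); split; first by apply Rmin_glb_lt; lra.
  move=> s hs. have h1 := Rlt_le_trans _ _ _ hs (Rmin_l _ _). have h2 := Rlt_le_trans _ _ _ hs (Rmin_r _ _).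
  move: h1 h2 => /Rabs_def2 h1 /Rabs_def2 h2.
  case: (Rlt_le_dec s 1) => c; last first.
    rewrite /cr. case: Rle_dec => // n; first lra. case: n. have : 1 <= s ^ 6 by apply pow_R1_Rle. lra.
  have hs' : -1 < s < 1 by lra.
  have c0 := cr_pos s hs'. split; first lra. apply Rnot_le_lt => n.
  have : e ^ 3 <= cr s ^ 3 by apply pow_incr; lra. rewrite cr_cube //.
  have : 1 - s ^ 6 <= 6 * (1 - s).
    replace (1 - s ^ 6) with ((1 - s) * (1 + s + s ^ 2 + s ^ 3 + s ^ 4 + s ^ 5)) by ring.
    have P n' : s ^ n' <= 1 by rewrite -(pow1 n'); apply pow_incr; lra.
    have := P 2%nat. have := P 3%nat. have := P 4%nat. have := P 5%nat. nra.
  lra.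
Qed.

(** The differential (1 - x^6)^(-2/3) dx on the curve x^6 + c^3 = 1, in the coordinate x and, up to
    sign, in the coordinate c. The second form is regular at c = 0, the point x = 1 where the first
    is singular. *)
Definition s1f (y : R) : R := cr y / (1 - y ^ 6).
Definition s2f (y : R) : R := 1 / 2 * Rpower (1 - y ^ 3) (- (5 / 6)).

Lemma s1f_cont y : -1 < y < 1 -> continuous s1f y.
Proof.
  move=> h. have q := pow6_lt y h. have D := is_derive_cr y h.
  apply: (@ex_derive_continuous R_AbsRing R_NormedModule s1f). rewrite /s1f.
  apply ex_derive_div; [by eexists; apply D | by auto_derive | lra].
Qed.

Lemma s2f_cont y : -1 < y < 1 -> continuous s2f y.
Proof.
  move=> h. have q : 0 < 1 - y ^ 3 by simpl; nra.
  apply: (@ex_derive_continuous R_AbsRing R_NormedModule s2f). rewrite /s2f /Rpower. simpl in q. auto_derive. lra.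
Qed.

Definition S2 (s : R) : R := RInt s2f 0 s.
Definition betaL : R := RInt s1f 0 (1 / 2) + S2 (cr (1 / 2)).
(* From 1 on, [Sx] is continued by its limit at 1. *)
Definition Sx (x : R) : R := match Rlt_dec x 1 with left _ => RInt s1f 0 x | right _ => betaL end.

Lemma is_derive_S2 s : -1 < s < 1 -> is_derive S2 s (s2f s).
Proof. move=> h. apply (is_derive_RInt_interval s2f (-1) 1); [exact s2f_cont | lra | lra]. Qed.

Lemma is_derive_Sx x : -1 < x < 1 -> is_derive Sx x (s1f x).
Proof.
  move=> h. apply (is_derive_ext_loc (RInt s1f 0)).
    have h0 : 0 < 1 - x by lra.
    exists (mkposreal _ h0) => y. rewrite /ball /= /AbsRing_ball /abs /minus /plus /opp /= => /Rabs_def2 hy.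
    rewrite /Sx. case: Rlt_dec => // n. lra.
  apply (is_derive_RInt_interval s1f (-1) 1); [exact s1f_cont | lra | lra].
Qed.

Lemma cr_lt_1 x : 0 < x < 1 -> cr x < 1.
Proof.
  move=> h. apply Rnot_le_lt => n. have : 1 ^ 3 <= cr x ^ 3 by apply pow_incr; lra. rewrite cr_cube; last lra.
  have : 0 < x ^ 6 by apply pow_lt; lra. rewrite pow1. lra.
Qed.

(* The curve x^6 + c^3 = 1 parametrized by either coordinate. *)
Lemma Sx_S2 x : 0 < x < 1 -> Sx x + S2 (cr x) = betaL.
Proof.
  move=> hx. have D y : 0 < y < 1 -> is_derive (fun y => Sx y + S2 (cr y)) y 0.
    move=> hy. have c0 := cr_pos y ltac:(lra). have c1 := cr_lt_1 y hy. have q := pow6_lt y ltac:(lra).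
    have DS := is_derive_Sx y ltac:(lra). have Dc := is_derive_cr y ltac:(lra). have D2 := is_derive_S2 (cr y) ltac:(lra).
    have E := is_derive_plus _ _ _ _ _ DS (is_derive_comp _ _ _ _ _ D2 Dc).
    match type of E with is_derive _ _ ?l => replace 0 with l end; first exact E.
    rewrite /plus /scal /= /mult /= /s1f /s2f cr_cube; last lra.
    replace (1 - (1 - y ^ 6)) with (Rpower y 6) by (replace 6 with (INR 6) at 1 by (simpl; ring); rewrite Rpower_pow; [ring|lra]).
    rewrite Rpower_mult. replace (6 * - (5 / 6)) with (- INR 5) by (simpl; field). rewrite Rpower_Ropp Rpower_pow; last lra.
    simpl in q. simpl. field. lra.
  have S12 : Sx (1 / 2) = RInt s1f 0 (1 / 2) by rewrite /Sx; case: Rlt_dec => // n; lra.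
  have K : Sx x + S2 (cr x) = Sx (1 / 2) + S2 (cr (1 / 2)).
    case: (Rle_lt_dec x (1 / 2)) => c.
    - apply (zero_derive_const (fun y => Sx y + S2 (cr y)) x (1 / 2)) => //. move=> t ht. apply D. lra.
    - symmetry. apply (zero_derive_const (fun y => Sx y + S2 (cr y)) (1 / 2) x); last lra. move=> t ht. apply D. lra.
  by rewrite K S12.
Qed.

Lemma Sx_0 : Sx 0 = 0.
Proof. rewrite /Sx. case: Rlt_dec => n; last lra. by rewrite RInt_point. Qed.

Lemma S2_0 : S2 0 = 0.
Proof. by rewrite /S2 RInt_point. Qed.

(** Near x = 1 the integral equals its total minus an integral in the coordinate c, which is
    continuous at c = 0; so the improper endpoint is handled by a change of coordinate. *)
Lemma Sx_cont1 e : 0 < e -> exists d, 0 < d /\ forall s, Rabs (s - 1) < d -> Rabs (Sx s - betaL) < e.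
Proof.
  move=> he. have C2 : continuous S2 0.
    apply: (@ex_derive_continuous R_AbsRing R_NormedModule S2). eexists. apply is_derive_S2. lra.
  have [d hd] := proj1 (filterlim_locally _ _) C2 (mkposreal e he). have d0 := cond_pos d.
  have [d' [d0' H]] := cr_cont1 d d0. exists (Rmin 1 d'); split; first by apply Rmin_glb_lt; lra.
  move=> s hs. have h1 := Rlt_le_trans _ _ _ hs (Rmin_l _ _). have h2 := Rlt_le_trans _ _ _ hs (Rmin_r _ _).
  have [c1 c2] := H s h2. move: h1 => /Rabs_def2 h1.
  case: (Rlt_le_dec s 1) => c; last first.
    rewrite /Sx. case: Rlt_dec => n; first lra. rewrite Rminus_eq_0 Rabs_R0. lra.
  rewrite -(Sx_S2 s); last lra. replace (Sx s - (Sx s + S2 (cr s))) with (- S2 (cr s)) by ring. rewrite Rabs_Ropp.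
  have := hd (cr s). rewrite /ball /= /AbsRing_ball /abs /minus /plus /opp /= S2_0.
  replace (cr s + - 0) with (cr s) by ring. replace (S2 (cr s) + - 0) with (S2 (cr s)) by ring. apply. rewrite Rabs_pos_eq; lra.
Qed.

Definition rt6 (t : R) : R := Rpower t (1 / 6).

Lemma rt6_range t : 0 < t < 1 -> 0 < rt6 t < 1.
Proof.
  move=> h. split; first by apply exp_pos. have l0 : ln t < 0 by rewrite -ln_1; apply ln_increasing; lra.
  rewrite /rt6 /Rpower -[X in _ < X]exp_0. apply exp_increasing. lra.
Qed.

Lemma rt6_pow t : 0 < t -> rt6 t ^ 6 = t.
Proof.
  move=> h. rewrite -Rpower_pow; last by apply exp_pos. rewrite /rt6 Rpower_mult.
  replace (1 / 6 * INR 6) with 1 by (simpl; field). by rewrite Rpower_1.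
Qed.

Definition betaf (t : R) : R := Rpower t (1 / 6 - 1) * Rpower (1 - t) (1 / 3 - 1).
Definition betaF (t : R) : R := 6 * Sx (rt6 t).

Lemma is_derive_betaF t : 0 < t < 1 -> is_derive betaF t (betaf t).
Proof.
  move=> h. have [r1 r2] := rt6_range t h. have r6 := rt6_pow t (proj1 h).
  have D6 : is_derive rt6 t (1 / 6 * Rpower t (1 / 6 - 1)) by apply is_derive_Reals, derivable_pt_lim_power; lra.
  have E := is_derive_scal _ _ 6 _ (is_derive_comp _ _ _ _ _ (is_derive_Sx (rt6 t) ltac:(lra)) D6).
  match type of E with is_derive _ _ ?l => replace (betaf t) with l end; first exact E.
  rewrite /scal /= /mult /= /s1f cr_E ?r6; last lra. rewrite /betaf (Rpower_plus (1 / 3)) Rpower_Ropp (Rpower_1 (1 - t)); last lra.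
  field. lra.
Qed.

Lemma betaf_cont t : 0 < t < 1 -> continuous betaf t.
Proof.
  move=> h. apply: (@ex_derive_continuous R_AbsRing R_NormedModule betaf). rewrite /betaf /Rpower. auto_derive. repeat split; lra.
Qed.

(** The substitution t = x^6 turns t^(-5/6) (1 - t)^(-2/3) dt into 6 (1 - x^6)^(-2/3) dx. *)
Lemma Beta_betaL : Beta (1 / 6) (1 / 3) = 6 * betaL.
Proof.
  rewrite /Beta. apply is_RInt_gen_unique.
  have near : filter_prod (at_right 0) (at_left 1) (fun ab : R * R => forall x, Rmin (fst ab) (snd ab) <= x <= Rmax (fst ab) (snd ab) -> 0 < x < 1).
    apply (Filter_prod _ _ _ (fun x => 0 < x < 1) (fun x => 0 < x < 1)).
    - exists (mkposreal 1 Rlt_0_1) => y. rewrite /ball /= /AbsRing_ball /abs /minus /plus /opp /= => /Rabs_def2. lra.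
    - exists (mkposreal 1 Rlt_0_1) => y. rewrite /ball /= /AbsRing_ball /abs /minus /plus /opp /= => /Rabs_def2. lra.
    - move=> a b ha hb x /=. move=> [h1 h2]. split.
        apply: Rlt_le_trans h1. by apply Rmin_glb_lt; lra. apply: Rle_lt_trans h2 _. by apply Rmax_lub_lt; lra.
  have DF t : 0 < t < 1 -> Derive betaF t = betaf t by move=> h; apply is_derive_unique, is_derive_betaF.
  replace (6 * betaL) with (6 * betaL - 0) by ring.
  apply (is_RInt_gen_ext (Derive betaF)).
    apply: filter_imp near => ab H x hx. apply DF, H. lra.
  apply is_RInt_gen_Derive.
  - apply: filter_imp near => ab H x hx. eexists. apply is_derive_betaF, H, hx.
  - apply: filter_imp near => ab H x hx. have h01 := H x hx.
    apply (continuous_ext_loc _ betaf); last by apply betaf_cont.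
    have h : 0 < Rmin x (1 - x) by apply Rmin_glb_lt; lra.
    exists (mkposreal _ h) => y. rewrite /ball /= /AbsRing_ball /abs /minus /plus /opp /= => hy.
    have h1 : Rabs (y + - x) < x by apply: Rlt_le_trans hy (Rmin_l _ _).
    have h2 : Rabs (y + - x) < 1 - x by apply: Rlt_le_trans hy (Rmin_r _ _).
    move: h1 h2 => /Rabs_def2 h1 /Rabs_def2 h2. rewrite DF //. lra.
  - apply filterlim_locally => e.
    have Cs : continuous Sx 0.
      apply: (@ex_derive_continuous R_AbsRing R_NormedModule Sx). eexists. apply is_derive_Sx. lra.
    have e6 : 0 < e / 6 by have := cond_pos e; lra.
    have [d hd] := proj1 (filterlim_locally _ _) Cs (mkposreal _ e6). have d0 := cond_pos d.
    have m0 : 0 < Rmin 1 d ^ 6 by apply pow_lt, Rmin_glb_lt; lra.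
    exists (mkposreal _ m0) => y. rewrite /ball /= /AbsRing_ball /abs /minus /plus /opp /= => /Rabs_def2 hy y0.
    have hm : rt6 y < Rmin 1 d.
      apply Rnot_le_lt => n. have h1 : 0 <= Rmin 1 d by left; apply Rmin_glb_lt; lra.
      have := pow_incr _ _ 6 (conj h1 n). rewrite rt6_pow // . simpl. simpl in hy. lra.
    have r0 : 0 < rt6 y by apply exp_pos.
    have := hd (rt6 y). rewrite /ball /= /AbsRing_ball /abs /minus /plus /opp /= Sx_0 => q.
    have := q ltac:(rewrite Rabs_pos_eq; [have := Rmin_r 1 d; lra | lra]). rewrite /betaF => /Rabs_def2 q1. apply Rabs_def1; lra.
  - apply filterlim_locally => e.
    have e6 : 0 < e / 6 by have := cond_pos e; lra.
    have [d [d0 H]] := Sx_cont1 _ e6.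
    have C6 : continuous rt6 1.
      apply: (@ex_derive_continuous R_AbsRing R_NormedModule rt6). rewrite /rt6 /Rpower. auto_derive. lra.
    have [d' hd] := proj1 (filterlim_locally _ _) C6 (mkposreal _ d0).
    exists d' => y hy y1. have := hd y hy.
    have -> : rt6 1 = 1 by rewrite /rt6 /Rpower ln_1 Rmult_0_r exp_0.
    rewrite /ball /= /AbsRing_ball /abs /minus /plus /opp /= => q. have := H _ q. rewrite /betaF => /Rabs_def2 q1. apply Rabs_def1; lra.
Qed.

End BetaIntegral.

Lemma rder_opp f t l : rder f t l -> rder (fun s => - f s) t (- l).
Proof. apply (der_opp _ (fun z => f (Re z))). Qed.

Lemma rder_RtoC (t : R) : rder (fun s => RtoC s) t 1.
Proof. apply (rder_of_real (fun s => s)). apply (is_derive_id t). Qed.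

Ltac rder_step := lazymatch goal with
  | |- rder (fun _ => ?c) _ _ => apply rder_const
  | |- rder (fun s => @?f s + @?g s) _ _ => eapply (rder_plus f g)
  | |- rder (fun s => @?f s - @?g s) _ _ => eapply (rder_minus f g)
  | |- rder (fun s => @?f s * @?g s) _ _ => eapply (rder_mult f g)
  | |- rder (fun s => @?f s / @?g s) _ _ => eapply (rder_div f g)
  | |- rder (fun s => @?f s ^ ?n) _ _ => eapply (rder_pow f _ _ n)
  | |- rder (fun s => - @?f s) _ _ => eapply (rder_opp f)
  | |- rder (fun s => RtoC s) _ _ => apply rder_RtoC
  | |- rder _ _ _ => eassumption
  end.

Ltac rder_solve := lazymatch goal with |- rder ?f ?x ?l => eapply (rder_eq f x _ l); [ | repeat rder_step ] end.

Lemma contr_of_real (f : R -> R) t : (forall e, 0 < e -> exists d, 0 < d /\ forall s, Rabs (s - t) < d -> Rabs (f s - f t) < e) -> contr (fun s => RtoC (f s)) t.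
Proof.
  move=> H e he. have [d [d0 hd]] := H e he. exists d; split => // s hs. rewrite -RtoC_minus Cmod_R. by apply hd.
Qed.

Section FromPole.
Variable w : C * C.
Hypothesis hw : Im (snd w * Cconj (fst w)) <> 0%R.
Hypothesis eqn : forall x, off w x -> wpf1 w x ^ 2 = 4 * wpf w x ^ 3 - 4.

(** Combines the two comparisons: the chart is used up to a small parameter a, where V is nonzero
    because -2 / P' is, and X = Z / V, Y = - 2 / V hand over to [propagate] on the interval from a
    to 1. *)
Lemma from_pole (g Z V X Y k : R -> C) (b K : R) : 0 < b -> b < 1 -> g 0%R = 0 -> Z 0%R = 0 -> V 0%R = 0 ->
  contr g 0 -> contr Z 0 -> contr V 0 ->
  (forall t, 0 < t < b -> g t <> 0 /\ Cmod (k t) <= K /\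
     rder Z t (k t * (1 + 3 * V t ^ 2)) /\ rder V t (k t * (3 * Z t ^ 2))) ->
  (forall t, 0 < t < b -> V t <> 0 -> X t = Z t / V t /\ Y t = - (2) / V t) ->
  (forall t, 0 < t < 1 -> rder g t (k t) /\ rder X t (k t * Y t) /\ rder Y t (k t * (6 * X t ^ 2)) /\ contr k t) ->
  contr g 1 -> contr X 1 -> contr Y 1 ->
  off w (g 1%R) /\ wpf w (g 1%R) = X 1%R /\ wpf1 w (g 1%R) = Y 1%R.
Proof.
  move=> b0 b1 g0 Z0 V0 cg cZ cV H1 HX H2 cg1 cX cY.
  have [d [d0 H]] := start_at_pole w hw eqn g Z V k b K b0 g0 Z0 V0 cg cZ cV ltac:(by move=> t ht; have [a1 [a2 [a3 a4]]] := H1 t ht; have [c1 _] := H2 t ltac:(lra)).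
  set a := (Rmin d b / 2)%R. have m0 : 0 < Rmin d b by apply Rmin_glb_lt.
  have m1 : Rmin d b <= d by apply Rmin_l. have m2 : Rmin d b <= b by apply Rmin_r.
  have ha : 0 < a < d by rewrite /a; lra. have ha2 : a < b by rewrite /a; lra.
  have [o [e1 [e2 n]]] := H a ha.
  have nV : V a <> 0.
    rewrite -e2 => E. have h2 : RtoC 2 <> 0 by apply RtoC_neq; lra. apply h2.
    replace (RtoC 2) with (- (- (2) / wpf1 w (g a) * wpf1 w (g a))) by (field; done). rewrite E. ring.
  have [x1 x2] := HX a ltac:(lra) nV.
  have E1 : wpf1 w (g a) = Y a by rewrite x2 -e2; field.
  have E0 : wpf w (g a) = X a by rewrite x1 -e1 -e2; field.
  apply (propagate w hw eqn g X Y k a 1) => //; try lra. move=> t ht. apply H2. lra.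
Qed.
End FromPole.

Lemma rder_cr (t : R) : -1 < t < 1 -> rder (fun s => RtoC (cr s)) t (- (2) * t ^ 5 * cr t / (1 - t ^ 6)).
Proof.
  move=> h. have q := pow6_lt t h. have := rder_of_real _ _ _ (is_derive_cr t h). apply: rder_eq.
  rewrite RtoC_div; last lra. by rewrite RtoC_minus RtoC_pow (RtoC_mult (- 2 * t ^ 5)%R) (RtoC_mult (- 2)%R) RtoC_pow RtoC_opp.
Qed.

Lemma rder_Sx (t : R) : -1 < t < 1 -> rder (fun s => Ci * RtoC (Sx s)) t (Ci * (cr t / (1 - t ^ 6))).
Proof.
  move=> h. have q := pow6_lt t h. apply rder_scal. have := rder_of_real _ _ _ (is_derive_Sx t h). apply: rder_eq.
  rewrite /s1f RtoC_div; last lra. by rewrite RtoC_minus RtoC_pow.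
Qed.

Lemma cr_cubeC (t : R) : -1 < t < 1 -> (cr t : C) * cr t * cr t = 1 - t ^ 6.
Proof. move=> h. rewrite -RtoC_pow -RtoC_minus -cr_cube // -!RtoC_mult. f_equal. ring. Qed.

Lemma one_minus_pow6_neq (t : R) : -1 < t < 1 -> (1 - t ^ 6 : C) <> 0.
Proof. move=> h. rewrite -RtoC_pow -RtoC_minus. apply RtoC_neq. have := pow6_lt t h. lra. Qed.

Lemma Sx_neq (t : R) : 0 < t < 1 -> Ci * RtoC (Sx t) <> 0.
Proof.
  move=> h. apply Cmult_neq_0; first by move=> /(f_equal Im); rewrite /Im /=; lra.
  apply RtoC_neq. case: (MVT_cor2 Sx s1f 0 t (proj1 h)).
    move=> c hc. apply is_derive_Reals, is_derive_Sx. lra.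
  move=> c [E hc]. rewrite Sx_0 in E. have q := pow6_lt c ltac:(lra). have := cr_pos c ltac:(lra) => p.
  have : 0 < s1f c by apply Rdiv_lt_0_compat. nra.
Qed.

Lemma contr_k t (a : C) : -1 < t < 1 -> contr (fun t => a * (Ci * (cr t / (1 - t ^ 6)))) t.
Proof.
  move=> h. have D := rder_cr t h. have n := one_minus_pow6_neq t h. eapply rder_contr. repeat rder_step. exact n.
Qed.

Lemma k_bound t : 0 < t < 1 / 2 -> Cmod (Ci * (cr t / (1 - t ^ 6))) <= 2.
Proof.
  move=> h. rewrite Cmod_mult Cmod_Ci Rmult_1_l. rewrite Cmod_div; last by apply one_minus_pow6_neq; lra.
  rewrite -RtoC_pow -RtoC_minus !Cmod_R. have c1 := cr_lt_1 t ltac:(lra). have c0 := cr_pos t ltac:(lra).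
  have q : 1 / 2 < 1 - t ^ 6.
    have h2 : t * t < 1 / 4 by nra. have h4 : (t * t) * (t * t) < 1 / 4 by nra. have : 0 <= t * t by nra. move=> h0. simpl. nra.
  rewrite !Rabs_pos_eq; try lra. apply (Rmult_le_reg_r (1 - t ^ 6)); first lra.
  replace (cr t / (1 - t ^ 6) * (1 - t ^ 6))%R with (cr t) by (field; lra). lra.
Qed.

Lemma contr_cr1 : contr (fun s => RtoC (cr s)) 1.
Proof.
  apply contr_of_real => e he. have [d [d0 H]] := cr_cont1 e he. exists d; split => // s hs.
  have [h1 h2] := H s hs. have [h3 h4] := cr_cont1 1 Rlt_0_1.
  have -> : cr 1 = 0%R by rewrite /cr; case: Rle_dec => // n; case: n; rewrite pow1; lra.
  rewrite Rminus_0_r Rabs_pos_eq; lra.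
Qed.

Lemma cr_1 : cr 1 = 0%R.
Proof. rewrite /cr; case: Rle_dec => // n; case: n; rewrite pow1; lra. Qed.

Lemma Sx_1 : Sx 1 = betaL.
Proof. rewrite /Sx. case: Rlt_dec => n //. lra. Qed.

Lemma u_o_betaL : u_o = Ci * betaL.
Proof. rewrite /u_o Beta_betaL RtoC_mult. field. Qed.

Lemma contr_const c t : contr (fun _ => c) t.
Proof. eapply rder_contr. apply rder_const. Qed.

Lemma contr_mult f h t : contr f t -> contr h t -> contr (fun s => f s * h s) t.
Proof.
  move=> Hf Hh e he. have [d [K [d0 [K0 HK]]]] := contr_bounded f t Hf.
  have h0 := Cmod_ge_0 (h t).
  have [d1 [d10 H1]] := Hf (e / 2 / (Cmod (h t) + 1))%R ltac:(apply Rdiv_lt_0_compat; lra).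
  have [d2 [d20 H2]] := Hh (e / 2 / K)%R ltac:(apply Rdiv_lt_0_compat; lra).
  exists (Rmin d (Rmin d1 d2)); split; first by repeat apply Rmin_glb_lt.
  move=> s hs. have s1 := Rlt_le_trans _ _ _ hs (Rmin_l _ _). have s2 := Rlt_le_trans _ _ _ hs (Rmin_r _ _).
  have s3 := Rlt_le_trans _ _ _ s2 (Rmin_l _ _). have s4 := Rlt_le_trans _ _ _ s2 (Rmin_r _ _).
  replace (f s * h s - f t * h t) with (f s * (h s - h t) + (f s - f t) * h t) by ring.
  apply: Rle_lt_trans (Cmod_triangle _ _) _. rewrite (Cmod_mult (f s)) (Cmod_mult (f s - f t)).
  have a1 := HK s s1. have a2 := H1 s s3. have a3 := H2 s s4. have f0 := Cmod_ge_0 (f s). have g0 := Cmod_ge_0 (h s - h t). have g1 := Cmod_ge_0 (f s - f t).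
  have b1 : Cmod (f s) * Cmod (h s - h t) <= K * Cmod (h s - h t) by apply Rmult_le_compat_r.
  have b2 : K * Cmod (h s - h t) < e / 2.
    apply (Rmult_lt_compat_l K) in a3 => //. by replace (K * (e / 2 / K))%R with (e / 2)%R in a3 by (field; lra).
  have b3 : Cmod (f s - f t) * Cmod (h t) <= Cmod (f s - f t) * (Cmod (h t) + 1) by apply Rmult_le_compat_l; lra.
  have b4 : Cmod (f s - f t) * (Cmod (h t) + 1) < e / 2.
    apply (Rmult_lt_compat_r (Cmod (h t) + 1)) in a2; last lra. by replace (e / 2 / (Cmod (h t) + 1) * (Cmod (h t) + 1))%R with (e / 2)%R in a2 by (field; lra).
  lra.
Qed.

Lemma contr_Sx1 : contr (fun s => Ci * RtoC (Sx s)) 1.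
Proof.
  apply contr_mult; first by apply contr_const. apply contr_of_real => e he. rewrite Sx_1. by apply Sx_cont1.
Qed.

(** Along g(t) = i S(t) the solution is X = - c / t^2, Y = - 2 i / t^3, for which Y^2 = 4 X^3 - 4 is
    the equation t^6 + c^3 = 1. At t = 1 one has c = 0 and g = u_o. In the chart at the pole the
    same curve is Z = i t c, V = - i t^3. *)
Lemma u_o_value : off W u_o /\ wpf W u_o = 0 /\ wpf1 W u_o = - (2) * Ci.
Proof.
  pose k (t : R) := 1 * (Ci * (cr t / (1 - t ^ 6))).
  have := from_pole W hW W_equation (fun s => Ci * RtoC (Sx s)) (fun t => Ci * (t * cr t)) (fun t => - (Ci * t ^ 3)) (fun t => (- (1) / t ^ 2) * cr t) (fun t => - (2) * Ci / t ^ 3) k (1 / 2) 2.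
  rewrite Sx_1 cr_1 -u_o_betaL. move=> H. have h0 : -1 < 0 < 1 by lra.
  have n1 : (RtoC 1 ^ 2 <> 0) /\ (RtoC 1 ^ 3 <> 0) by split; apply Cpow_nz, RtoC_neq; lra.
  have E : off W u_o /\ wpf W u_o = - (1) / 1 ^ 2 * 0 /\ wpf1 W u_o = - (2) * Ci / 1 ^ 3.
    apply H; clear H; try lra.
    - rewrite Sx_0. ring.
    - ring.
    - ring.
    - eapply rder_contr. by apply rder_Sx.
    - have D := rder_cr 0 h0. eapply rder_contr. repeat rder_step.
    - eapply rder_contr. repeat rder_step.
    - move=> t ht. have ht1 : -1 < t < 1 by lra. have D := rder_cr t ht1. have n := one_minus_pow6_neq t ht1.
      have c3 := cr_cubeC t ht1. have ci := Ci2.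
      split; first by apply Sx_neq; lra. split; first by rewrite /k Cmult_1_l; apply k_bound. split.
      + rder_solve. replace ((- (Ci * t ^ 3)) ^ 2) with (Ci * Ci * t ^ 6) by ring. rewrite ci /k. field. done.
      + rder_solve. rewrite /k. replace (1 * (Ci * (cr t / (1 - t ^ 6))) * (3 * (Ci * (t * cr t)) ^ 2)) with
          (3 * Ci * (Ci * Ci) * t ^ 2 * ((cr t : C) * cr t * cr t) / (1 - t ^ 6)) by (field; done).
        rewrite c3 ci. have -> : INR 3 = 3%R by simpl; lra. cbn [pred]. field. done.
    - move=> t ht nV. have nt : RtoC t <> 0 by apply RtoC_neq; lra. have nc : Ci <> 0 by move=> /(f_equal Im); rewrite /Im /=; lra.
      split; first by field. have ci := Ci2. replace (- (2) / - (Ci * t ^ 3)) with (- (2) * Ci / (Ci * Ci * - t ^ 3)) by (field; auto).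
      rewrite ci. field. done.
    - move=> t ht. have ht1 : -1 < t < 1 by lra. have D := rder_cr t ht1. have n := one_minus_pow6_neq t ht1.
      have c3 := cr_cubeC t ht1. have ci := Ci2. have nt : RtoC t <> 0 by apply RtoC_neq; lra.
      have nt2 : RtoC t ^ 2 <> 0 by apply Cpow_nz. have nt3 : RtoC t ^ 3 <> 0 by apply Cpow_nz.
      have i2 : INR 2 = 2%R by simpl; lra. have i3 : INR 3 = 3%R by simpl; lra.
      split; first by rewrite /k Cmult_1_l; apply rder_Sx. split; last split; last by apply contr_k.
      + rder_solve; last done. rewrite /k. replace (1 * (Ci * (cr t / (1 - t ^ 6))) * (- (2) * Ci / t ^ 3)) with (- (2) * (Ci * Ci) * cr t / ((1 - t ^ 6) * t ^ 3)) by (field; auto).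
        rewrite ci i2. cbn [pred]. field. auto.
      + rder_solve; last done. rewrite /k. replace (1 * (Ci * (cr t / (1 - t ^ 6))) * (6 * (- (1) / t ^ 2 * cr t) ^ 2)) with
          (6 * Ci * ((cr t : C) * cr t * cr t) / ((1 - t ^ 6) * t ^ 4)) by (field; auto).
        rewrite c3 i3. cbn [pred]. field. auto.
    - apply contr_Sx1.
    - apply contr_mult; last by apply contr_cr1. eapply rder_contr. repeat rder_step. exact (proj1 n1).
    - eapply rder_contr. repeat rder_step. exact (proj2 n1).
  have [e1 [e2 e3]] := E. split => //. rewrite e2 e3. split; [ring | field].
Qed.

(** With X^3 = 1 - t^(-6) from the curve of [u_o_value], X^6 - 20 X^3 - 8 equals this polynomial
    divided by t^12. It is the numerator of Y at the doubled point, hence the denominator of the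
    chart coordinates, so it must not vanish near the start. *)
Definition dden (t : C) : C := 1 + 18 * t ^ 6 - 27 * t ^ 12.

Lemma dden_neq (t : R) : 0 <= t < 1 / 2 -> dden t <> 0.
Proof.
  move=> h. rewrite /dden.
  have -> : 1 + 18 * RtoC t ^ 6 - 27 * RtoC t ^ 12 = RtoC (1 + 18 * t ^ 6 - 27 * t ^ 12)%R.
    by rewrite RtoC_minus RtoC_plus (RtoC_mult 18) (RtoC_mult 27) !RtoC_pow.
  apply RtoC_neq. have h1 : t ^ 6 <= (1 / 2) ^ 6 by apply pow_incr; lra. have h0 : 0 <= t ^ 6 by apply pow_le; lra.
  replace (t ^ 12)%R with (t ^ 6 * t ^ 6)%R by ring. simpl in h1. nra.
Qed.

(* The image of the curve of [u_o_value] under the duplication map. *)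
Lemma two_u_o_value : off W (2 * u_o) /\ wpf W (2 * u_o) = 0 /\ wpf1 W (2 * u_o) = 2 * Ci.
Proof.
  pose k (t : R) := 2 * (Ci * (cr t / (1 - t ^ 6))).
  have := from_pole W hW W_equation (fun s => 2 * (Ci * RtoC (Sx s))) (fun t => 2 * Ci * (t * cr t * (1 - 9 * t ^ 6) / (1 + 18 * t ^ 6 - 27 * t ^ 12)))
    (fun t => - (8) * Ci * (t ^ 3 / (1 + 18 * t ^ 6 - 27 * t ^ 12)))
    (fun t => (- (1) / 4 * ((1 - 9 * t ^ 6) / t ^ 2)) * cr t) (fun t => - Ci / 4 * ((1 + 18 * t ^ 6 - 27 * t ^ 12) / t ^ 3)) k (1 / 2) 4.
  rewrite Sx_1 cr_1 -u_o_betaL. move=> H. have h0 : -1 < 0 < 1 by lra.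
  have n1 : (RtoC 1 ^ 2 <> 0) /\ (RtoC 1 ^ 3 <> 0) by split; apply Cpow_nz, RtoC_neq; lra.
  have i2 : INR 2 = 2%R by simpl; lra. have i3 : INR 3 = 3%R by simpl; lra. have i6 : INR 6 = 6%R by simpl; lra. have i12 : INR 12 = 12%R by simpl; lra.
  have nc : Ci <> 0 by move=> /(f_equal Im); rewrite /Im /=; lra. have ci := Ci2.
  have E : off W (2 * u_o) /\ wpf W (2 * u_o) = (- (1) / 4 * ((1 - 9 * 1 ^ 6) / 1 ^ 2)) * 0 /\ wpf1 W (2 * u_o) = - Ci / 4 * ((1 + 18 * 1 ^ 6 - 27 * 1 ^ 12) / 1 ^ 3).
    apply H; clear H; try lra.
    - rewrite Sx_0. ring.
    - rewrite /Cdiv. ring.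
    - rewrite /Cdiv. ring.
    - apply contr_mult; first by apply contr_const. eapply rder_contr. by apply rder_Sx.
    - have D := rder_cr 0 h0. have dn : 1 + 18 * RtoC 0 ^ 6 - 27 * RtoC 0 ^ 12 <> 0 := dden_neq 0 ltac:(lra). eapply rder_contr. repeat rder_step. exact dn.
    - have dn : 1 + 18 * RtoC 0 ^ 6 - 27 * RtoC 0 ^ 12 <> 0 := dden_neq 0 ltac:(lra). eapply rder_contr. repeat rder_step. exact dn.
    - move=> t ht. have ht1 : -1 < t < 1 by lra. have D := rder_cr t ht1. have n := one_minus_pow6_neq t ht1.
      have c3 := cr_cubeC t ht1. have dn : 1 + 18 * RtoC t ^ 6 - 27 * RtoC t ^ 12 <> 0 := dden_neq t ltac:(lra).
      split; first by apply Cmult_neq_0; [apply RtoC_neq; lra | apply Sx_neq; lra]. split.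
        rewrite /k (Cmod_mult 2) Cmod_R Rabs_pos_eq; last lra. have := k_bound t ht. lra.
      split.
      + rder_solve; last done. rewrite /k. set DD := 1 + 18 * RtoC t ^ 6 - 27 * RtoC t ^ 12 in dn *.
        replace ((- (8) * Ci * (t ^ 3 / DD)) ^ 2) with (64 * (Ci * Ci) * t ^ 6 / (DD * DD)) by (field; done).
        rewrite ci i6 i12. cbn [pred]. rewrite /DD in dn *. field. done.
      + rder_solve; last done. rewrite /k. set DD := 1 + 18 * RtoC t ^ 6 - 27 * RtoC t ^ 12 in dn *.
        replace (2 * (Ci * (cr t / (1 - t ^ 6))) * (3 * (2 * Ci * (t * cr t * (1 - 9 * t ^ 6) / DD)) ^ 2)) with
          (24 * Ci * (Ci * Ci) * t ^ 2 * ((cr t : C) * cr t * cr t) * (1 - 9 * t ^ 6) ^ 2 / ((1 - t ^ 6) * DD * DD)) by (field; auto).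
        rewrite c3 ci i3 i6 i12. cbn [pred]. rewrite /DD in dn *. field. done.
    - move=> t ht nV. have nt : RtoC t <> 0 by apply RtoC_neq; lra.
      have dn : 1 + 18 * RtoC t ^ 6 - 27 * RtoC t ^ 12 <> 0 := dden_neq t ltac:(lra).
      split; first by field. replace (- (2) / (- (8) * Ci * (t ^ 3 / (1 + 18 * t ^ 6 - 27 * t ^ 12)))) with (Ci / (4 * (Ci * Ci) * (t ^ 3 / (1 + 18 * t ^ 6 - 27 * t ^ 12)))) by (field; auto).
      rewrite ci. field. auto.
    - move=> t ht. have ht1 : -1 < t < 1 by lra. have D := rder_cr t ht1. have n := one_minus_pow6_neq t ht1.
      have c3 := cr_cubeC t ht1. have nt : RtoC t <> 0 by apply RtoC_neq; lra.
      have nt2 : RtoC t ^ 2 <> 0 by apply Cpow_nz. have nt3 : RtoC t ^ 3 <> 0 by apply Cpow_nz.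
      split; first by rewrite /k; apply rder_scal, rder_Sx. split; last split; last by apply contr_k.
      + rder_solve; last done. rewrite /k.
        replace (2 * (Ci * (cr t / (1 - t ^ 6))) * (- Ci / 4 * ((1 + 18 * t ^ 6 - 27 * t ^ 12) / t ^ 3))) with
          (- (Ci * Ci) / 2 * cr t / ((1 - t ^ 6) * t ^ 3) * (1 + 18 * t ^ 6 - 27 * t ^ 12)) by (field; auto).
        rewrite ci i2 i6. cbn [pred]. field. auto.
      + rder_solve; last done. rewrite /k. replace (2 * (Ci * (cr t / (1 - t ^ 6))) * (6 * (- (1) / 4 * ((1 - 9 * t ^ 6) / t ^ 2) * cr t) ^ 2)) with
          (3 / 4 * Ci * ((cr t : C) * cr t * cr t) * (1 - 9 * t ^ 6) ^ 2 / ((1 - t ^ 6) * t ^ 4)) by (field; auto).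
        rewrite c3 i3 i6 i12. cbn [pred]. field. auto.
    - apply contr_mult; [apply contr_const | apply contr_Sx1].
    - apply contr_mult; last by apply contr_cr1. eapply rder_contr. repeat rder_step. exact (proj1 n1).
    - eapply rder_contr. repeat rder_step. exact (proj2 n1).
  have [e1 [e2 e3]] := E. split => //. rewrite e2 e3. split; [ring | field].
Qed.

(** * The value of the Weierstrass function along the solution *)

Definition dup_Y (X Y : C) : C := 2 * (X ^ 6 - 20 * X ^ 3 - 8) / Y ^ 3.

(** The duplication map carries solutions of the system X' = k Y, Y' = 6 k X^2 on the curve to
    solutions with speed 2k; Y <> 0 keeps its denominators away from zero. *)
Lemma double_path (X Y k : R -> C) (t : R) : rder X t (k t * Y t) -> rder Y t (k t * (6 * X t ^ 2)) ->
  Y t ^ 2 = 4 * X t ^ 3 - 4 -> Y t <> 0 ->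
  rder (fun s => dup_X (X s)) t (2 * k t * dup_Y (X t) (Y t)) /\
  rder (fun s => dup_Y (X s) (Y s)) t (2 * k t * (6 * dup_X (X t) ^ 2)).
Proof.
  move=> DX DY E nY. have n4 : RtoC 4 <> 0 by apply RtoC_neq; lra. have n2 : RtoC 2 <> 0 by apply RtoC_neq; lra.
  have nX : X t ^ 3 - 1 <> 0.
    move=> h. have : Y t ^ 2 = 0 by rewrite E; replace (4 * X t ^ 3 - 4) with (4 * (X t ^ 3 - 1)) by ring; rewrite h; ring.
    by apply Cpow_nz.
  have n3 : 4 * (X t ^ 3 - 1) <> 0 by apply Cmult_neq_0.
  have nY3 : Y t ^ 3 <> 0 by apply Cpow_nz.
  have i3 : INR 3 = 3%R by simpl; lra. have i6 : INR 6 = 6%R by simpl; lra.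
  have E4 : Y t ^ 4 = 16 * (X t ^ 3 - 1) ^ 2 by replace (Y t ^ 4) with ((Y t ^ 2) ^ 2) by ring; rewrite E; ring.
  split.
  - rewrite /dup_X. rder_solve; last done. rewrite /dup_Y.
    replace (2 * k t * (2 * (X t ^ 6 - 20 * X t ^ 3 - 8) / Y t ^ 3)) with (4 * k t * Y t * (X t ^ 6 - 20 * X t ^ 3 - 8) / Y t ^ 4) by (field; done).
    rewrite E4 i3. cbn [pred]. field. done.
  - rewrite /dup_Y. rder_solve; last done.
    rewrite i3 i6. cbn [pred]. rewrite /dup_X.
    replace (2 * k t * (6 * (X t * (X t ^ 3 + 8) / (4 * (X t ^ 3 - 1))) ^ 2)) with (12 * k t * X t ^ 2 * (X t ^ 3 + 8) ^ 2 / (16 * (X t ^ 3 - 1) ^ 2)) by (field; done).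
    rewrite -E4.
    match goal with |- ?l = _ => replace l with (2 * k t * ((6 * X t ^ 5 - 60 * X t ^ 2) * Y t ^ 2 - 18 * X t ^ 2 * (X t ^ 6 - 20 * X t ^ 3 - 8)) / Y t ^ 4) by (field; done) end.
    rewrite E. field. done.
Qed.

(** The value at 2x is transported together with the value at x. This supplies the duplication
    formula where it is used and shows at the same time that 2x is not a pole. *)
Definition val2 (x X Y : C) : Prop :=
  (off W x /\ wpf W x = X /\ wpf1 W x = Y) /\ (off W (2 * x) /\ wpf W (2 * x) = dup_X X /\ wpf1 W (2 * x) = dup_Y X Y).

Lemma propagate2 (g X Y k : R -> C) :
  (forall t, 0 <= t <= 1 -> rder g t (k t) /\ rder X t (k t * Y t) /\ rder Y t (k t * (6 * X t ^ 2)) /\ contr k t /\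
    Y t ^ 2 = 4 * X t ^ 3 - 4 /\ Y t <> 0) ->
  val2 (g 0%R) (X 0%R) (Y 0%R) -> val2 (g 1%R) (X 1%R) (Y 1%R).
Proof.
  move=> H [[a1 [a2 a3]] [b1 [b2 b3]]]. have [h1 [h2 [h3 [h4 [h5 h6]]]]] := H 1%R ltac:(lra).
  have [d1 d2] := double_path X Y k 1 h2 h3 h5 h6.
  split.
  - apply (propagate W hW W_equation g X Y k 0 1) => //; try lra; try by eapply rder_contr; eauto.
    move=> t ht. have [q1 [q2 [q3 [q4 _]]]] := H t ltac:(lra). done.
  - apply (propagate W hW W_equation (fun s => 2 * g s) (fun s => dup_X (X s)) (fun s => dup_Y (X s) (Y s)) (fun s => 2 * k s) 0 1) => //; try lra; try by eapply rder_contr; eauto.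
    + move=> t ht. have [q1 [q2 [q3 [q4 [q5 q6]]]]] := H t ltac:(lra).
      have [e1 e2] := double_path X Y k t q2 q3 q5 q6. split; first by apply rder_scal. split => //. split => //.
      by apply contr_mult; [apply contr_const|].
    + eapply rder_contr. apply rder_scal. exact h1.
Qed.

(** The point (0, - 2 i) is a 3-torsion point of the curve, so doubling only changes the sign of the
    second coordinate. *)
Lemma val2_u_o : val2 u_o 0 (- (2) * Ci).
Proof.
  have nc : Ci <> 0 by move=> /(f_equal Im); rewrite /Im /=; lra. have ci := Ci2.
  split; first by apply u_o_value. have [h1 [h2 h3]] := two_u_o_value. split => //. rewrite h2 h3 /dup_X /dup_Y.
  split; first by rewrite /Cdiv; ring.
  replace ((- (2) * Ci) ^ 3) with (- (8) * Ci * (Ci * Ci)) by ring. rewrite ci.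
  replace (2 * (0 ^ 6 - 20 * 0 ^ 3 - 8) / (- (8) * Ci * - (1))) with (2 * Ci / - (Ci * Ci)) by (field; auto). rewrite ci. field.
Qed.

(** P' along the disc: - 2 i sqrt (1 - z^3), in the branch that takes at z = 0 the value P'(u_o) = -
    2 i. *)
Definition Yd (z : C) : C := - (2) * Ci / Bf (z ^ 3).

Lemma Yd_sq z : Cmod z < 1 -> Yd z ^ 2 = 4 * z ^ 3 - 4.
Proof.
  move=> hz. have hz3 := Cmod_cube_lt z hz. have nB := Bf_neq _ hz3. have e := Bf_sq _ hz3. have ci := Ci2.
  rewrite /Yd. replace ((- (2) * Ci / Bf (z ^ 3)) ^ 2) with (4 * (Ci * Ci) * 1 / (Bf (z ^ 3) * Bf (z ^ 3))) by (field; done).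
  rewrite -e ci. field. done.
Qed.

Lemma Ci_neq : Ci <> 0.
Proof. by move=> /(f_equal Im); rewrite /Im /=; lra. Qed.

Lemma Yd_neq z : Cmod z < 1 -> Yd z <> 0.
Proof.
  move=> hz E. have nB := Bf_neq _ (Cmod_cube_lt z hz). have h2 : RtoC 2 <> 0 by apply RtoC_neq; lra.
  apply (Cmult_neq_0 _ _ h2 Ci_neq). replace (2 * Ci) with (- (Yd z * Bf (z ^ 3))) by (rewrite /Yd; field; done). rewrite E. ring.
Qed.

(** The path is the ray X(t) = t z, on which g' = (i/2) B(X^3) z; multiplied by - 2 i / B(X^3) this
    is z = X', and the initial values are those at u_o. *)
Lemma val2_disc (z : C) : Cmod z < 1 -> val2 (u_o + Ci / 2 * Zf z) z (Yd z).
Proof.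
  move=> hz. pose X (t : R) := RtoC t * z.
  have hX (t : R) : 0 <= t <= 1 -> Cmod (X t) < 1.
    move=> ht. rewrite /X Cmod_mult Cmod_R Rabs_pos_eq; last lra. have := Cmod_ge_0 z. nra.
  have ci := Ci2.
  have P := propagate2 (fun t => u_o + Ci / 2 * Zf (X t)) X (fun t => Yd (X t)) (fun t => Ci / 2 * (Bf (X t ^ 3) * z)).
  have X1 : X 1%R = z by rewrite /X; ring. have X0 : X 0%R = 0 by rewrite /X; ring.
  rewrite X1 X0 in P. apply P; clear P; last first.
    have -> : Zf 0 = 0 by rewrite /Zf; ring. have -> : Yd 0 = - (2) * Ci.
      rewrite /Yd. replace (0 ^ 3) with (RtoC 0) by ring. rewrite Bf_0. field.
    replace (u_o + Ci / 2 * 0) with u_o by ring. apply val2_u_o.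
  move=> t ht. have hx := hX t ht. have hx3 := Cmod_cube_lt _ hx. have nB := Bf_neq _ hx3.
  have DX : rder X t z by rewrite /X; rder_solve; ring.
  have DX3 : rder (fun s => X s ^ 3) t (INR 3 * X t ^ (pred 3) * z) by apply (rder_pow X).
  have DB : rder (fun s => Bf (X s ^ 3)) t (Bf (X t ^ 3) ^ 3 / 2 * (INR 3 * X t ^ (pred 3) * z)).
    apply (rder_comp Bf (fun s => X s ^ 3)) => //. by apply cder_Bf.
  have DZ : rder (fun s => Zf (X s)) t (Bf (X t ^ 3) * z) by apply (rder_comp Zf X) => //; apply cder_Zf.
  have i3 : INR 3 = 3%R by simpl; lra.
  split; first by rder_solve; ring. split.
    apply: rder_eq DX. rewrite /Yd. replace (Ci / 2 * (Bf (X t ^ 3) * z) * (- (2) * Ci / Bf (X t ^ 3))) with (- (Ci * Ci) * z) by (field; done). rewrite ci. ring.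
  split.
    rewrite /Yd. rder_solve; last done. rewrite i3. cbn [pred]. field. done.
  split.
    eapply rder_contr. apply rder_scal. eapply (rder_mult (fun s => Bf (X s ^ 3)) (fun _ => z)); [exact DB | apply rder_const].
  split; [by apply Yd_sq | by apply Yd_neq].
Qed.

Lemma val2_u_series tau : upper_half_plane tau -> Cmod (zt tau) < 1 -> val2 (u_series tau) (zt tau) (Yd (zt tau)).
Proof.
  move=> h hz. have hz' : Cmod (zfun tau) < 1 by rewrite zfun_zt. rewrite u_series_Zf // zfun_zt //. by apply val2_disc.
Qed.

Definition ztp (tau : C) : C := PI * Ci / 2 * (thJ tau / th 0 tau) ^ 2 * (zt tau ^ 3 - 1).

Section Solution.
Variables (g : C -> C) (c : C).
Hypothesis hc : c <> 0.
Hypothesis g_der : forall s, upper_half_plane s -> cder g s (c * th 0 s ^ 4).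
Hypothesis c_eq : forall s, upper_half_plane s -> 4 * (zt s ^ 3 - 1) * (c * th 0 s ^ 4) ^ 2 = ztp s ^ 2.

(** If z = P(g), then P'(g) must be z' / g'. *)
Definition solY (s : C) : C := ztp s / (c * th 0 s ^ 4).

Lemma g1_neq s : upper_half_plane s -> c * th 0 s ^ 4 <> 0.
Proof. move=> h. apply Cmult_neq_0 => //. by apply Cpow_nz, th0_neq. Qed.

Lemma solY_sq s : upper_half_plane s -> solY s ^ 2 = 4 * zt s ^ 3 - 4.
Proof.
  move=> h. have n := g1_neq s h. have E := c_eq s h. rewrite /solY. set d := c * th 0 s ^ 4 in n E *.
  replace ((ztp s / d) ^ 2) with (ztp s ^ 2 / d ^ 2) by (field; done). rewrite -E. field. done.
Qed.

Lemma solY_neq s : upper_half_plane s -> solY s <> 0.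
Proof.
  move=> h E. have := solY_sq s h. rewrite E. have n := zt_cube_neq s h. move=> e. apply n.
  replace (zt s ^ 3 - 1) with ((4 * zt s ^ 3 - 4) / 4) by field. rewrite -e. rewrite /Cdiv. ring.
Qed.

(** Differentiability follows from the quotient rules; the value is found by differentiating solY^2
    = 4 z^3 - 4 and cancelling 2 solY, which is nonzero because z^3 <> 1. *)
Lemma cder_solY s : upper_half_plane s -> cder solY s (c * th 0 s ^ 4 * (6 * zt s ^ 2)).
Proof.
  move=> h. have n := g1_neq s h. have n0 := th0_neq s h.
  have [l Dl] : exists l, cder solY s l.
    have Dz := cder_zt s h. have D0 := cder_th 0 s h. have DJ := cder_thJ s h.
    have E1 := cder_scalf (PI * Ci / 2) _ _ _ (cder_pow _ _ _ 2 (cder_div _ _ _ _ _ DJ D0 n0)).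
    have E2 := cder_minus _ _ _ _ _ (cder_pow _ _ _ 3 Dz) (cder_const 1 s).
    have E3 := cder_scalf c _ _ _ (cder_pow _ _ _ 4 D0).
    eexists. exact (cder_div _ _ _ _ _ (cder_mult _ _ _ _ _ E1 E2) E3 n).
  apply: cder_eq (Dl). have Dz := cder_zt s h. rewrite -/(ztp s) in Dz.
  have D1 : cder (fun y => solY y ^ 2) s (4 * (INR 3 * zt s ^ (pred 3) * ztp s) - 0).
    have [d [d0 H]] := upper_open s h.
    apply: cder_local (cder_minus _ _ _ _ _ (cder_scalf 4 _ _ _ (cder_pow _ _ _ 3 Dz)) (cder_const 4 s)).
    exists d; split => // y hy. by rewrite solY_sq //; apply H.
  have := cder_unique _ _ _ _ (cder_pow _ _ _ 2 Dl) D1. have -> : INR 2 = 2%R by simpl; lra. have -> : INR 3 = 3%R by simpl; lra. cbn [pred].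
  have nY := solY_neq s h. have zE : ztp s = c * th 0 s ^ 4 * solY s by rewrite /solY; field; auto.
  rewrite zE => e. apply (Cmult_cancel_l (2 * solY s)); first by apply Cmult_neq_0 => //; apply RtoC_neq; lra.
  replace (2 * solY s * l) with (2 * solY s ^ 1 * l) by ring. rewrite e. ring.
Qed.

(** The half-plane is convex, so the straight segment from s0 reaches every s. *)
Lemma val2_solution s0 s : upper_half_plane s0 -> val2 (g s0) (zt s0) (solY s0) -> upper_half_plane s -> val2 (g s) (zt s) (solY s).
Proof.
  move=> h0 v0 h. pose p (t : R) := s0 + t * (s - s0).
  have hp (t : R) : 0 <= t <= 1 -> upper_half_plane (p t) by move=> ht; apply convex_upper.
  have p0 : p 0%R = s0 by rewrite /p; ring. have p1 : p 1%R = s by rewrite /p; ring.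
  have P := propagate2 (fun t => g (p t)) (fun t => zt (p t)) (fun t => solY (p t)) (fun t => c * th 0 (p t) ^ 4 * (s - s0)).
  rewrite p0 p1 in P. apply P => // t ht. have hs := hp t ht. have Dp : rder p t (s - s0) by apply rder_line.
  have n := g1_neq _ hs.
  split; first by apply (rder_comp g p) => //; apply g_der.
  split.
    apply (rder_eq _ _ (ztp (p t) * (s - s0))); first by rewrite /solY; field; repeat split => //; apply th0_neq.
    apply (rder_comp zt p) => //. by apply cder_zt.
  split.
    apply (rder_eq _ _ (c * th 0 (p t) ^ 4 * (6 * zt (p t) ^ 2) * (s - s0))); first ring.
    apply (rder_comp solY p) => //. by apply cder_solY.
  split.
    apply contr_mult; last by apply contr_const. apply (contc_contr_comp (fun y => c * th 0 y ^ 4)); last by eapply rder_contr; eauto.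
    apply: cder_contc. apply cder_scalf. exact (cder_pow (th 0) _ _ 4 (cder_th 0 _ hs)).
  split; [by apply solY_sq | by apply solY_neq].
Qed.

End Solution.

(** * Uniqueness of analytic continuation *)

Definition psn (a : nat -> C) (y : C) (n : nat) : C := lsum (fun k => a k * y ^ k) (seq 0 n).

Lemma psn_S a y n : psn a y (S n) = psn a y n + a n * y ^ n.
Proof. by rewrite /psn lsum_S. Qed.

Lemma is_pseries_climit (a : nat -> C) (y s : C) : @is_pseries C_AbsRing C_NormedModule a y s -> climit (psn a y) s.
Proof.
  move=> H e he. have := H (fun z => Cmod (z - s) < e). case.
    apply locally_C_eps. by exists e.
  move=> N hN. exists (S N) => -[|n] hn; first lia. have := hN n ltac:(lia).
  have -> : sum_n (fun k => @scal C_AbsRing C_NormedModule (@pow_n C_AbsRing y k) (a k)) n = psn a y (S n).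
    rewrite /psn -sum_n_lsum. apply sum_n_ext => k.
    have -> : @pow_n C_AbsRing y k = y ^ k by elim: k => [//|k IH] /=; rewrite IH.
    rewrite /scal /= /mult /=. ring.
  done.
Qed.

Lemma climit_terms_bounded (a : nat -> C) (y s : C) : climit (psn a y) s -> exists M, 0 < M /\ forall n, Cmod (a n * y ^ n) <= M.
Proof.
  move=> H. have [N hN] := H 1%R Rlt_0_1.
  have [M [M0 HM]] : exists M, 0 < M /\ forall n, (n < N)%nat -> Cmod (a n * y ^ n) <= M.
    elim: (N) => [|k [M [M0 IH]]]; first by exists 1%R; split; [lra | move=> n; lia].
    exists (M + Cmod (a k * y ^ k))%R. have k0 := Cmod_ge_0 (a k * y ^ k). split; first lra.
    move=> n hn. case: (Nat.eq_dec n k) => [->|hk]; first lra. have := IH n ltac:(lia). lra.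
  exists (M + 2)%R. split; first lra. move=> n. case: (le_lt_dec N n) => h; last by have := HM n h; lra.
  have h1 := hN n h. have h2 := hN (S n) ltac:(lia). rewrite psn_S in h2.
  have -> : a n * y ^ n = (psn a y n + a n * y ^ n - s) - (psn a y n - s) by ring.
  have := Cmod_sub_le (psn a y n + a n * y ^ n - s) (psn a y n - s). lra.
Qed.

(** Unless all coefficients vanish, the first nonzero term a_N y^N dominates the tail on a small
    punctured disc. *)
Lemma isolated_zeros (a : nat -> C) (h : C -> C) (x0 : C) (d : R) : 0 < d ->
  (forall x, Cmod (x - x0) < d -> climit (psn a (x - x0)) (h x)) ->
  (exists e, 0 < e /\ forall x, Cmod (x - x0) < e -> h x = 0) \/
  (exists e, 0 < e /\ forall x, x <> x0 -> Cmod (x - x0) < e -> h x <> 0).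
Proof.
  move=> d0 H. case: (classic (forall n, a n = 0)) => [A0|nA].
    left. exists d; split => // x hx. apply (climit_unique (psn a (x - x0))); first by apply H.
    apply (climit_ext (fun _ => RtoC 0)); last by apply climit_const.
    elim => [|n IH]; first by []. rewrite psn_S -IH A0. ring.
  right.
  have [N [aN low]] : exists N, a N <> 0 /\ forall n, (n < N)%nat -> a n = 0.
    apply NNPP => nE. apply nA. apply (well_founded_induction lt_wf) => n IH. apply NNPP => hn. apply nE. by exists n.
  set r := (d / 2)%R.
  have [M [M0 HM]] : exists M, 0 < M /\ forall n, Cmod (a n) * r ^ n <= M.
    have Hr := H (x0 + r) ltac:(replace (x0 + r - x0) with (RtoC r) by ring; rewrite Cmod_R Rabs_pos_eq /r; lra).
    replace (x0 + r - x0) with (RtoC r) in Hr by ring.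
    have [M [M0 HM]] := climit_terms_bounded _ _ _ Hr. exists M; split => // n.
    have := HM n. rewrite Cmod_mult Cmod_pow Cmod_R Rabs_pos_eq // /r. lra.
  have r0 : 0 < r by rewrite /r; lra.
  have pA := Cmod_pos _ aN. have rN : 0 < r ^ S N by apply pow_lt.
  (* With |a_n| r^n <= M and q = |y| / r <= 1/2 the tail is at most 2 M q^(N+1); the second bound on
     |y| puts this below the leading term. *)
  set e := Rmin (r / 2) (Cmod (a N) * r ^ S N / (2 * M)).
  have e0 : 0 < e by apply Rmin_glb_lt; [lra | apply Rdiv_lt_0_compat; [by apply Rmult_lt_0_compat | lra]].
  exists e; split => // x nx hx E.
  have h1 := Rlt_le_trans _ _ _ hx (Rmin_l _ _). have h2 := Rlt_le_trans _ _ _ hx (Rmin_r _ _).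
  have L := H x ltac:(rewrite /r in h1; lra). rewrite E in L.
  set y := x - x0 in h1 h2 L. have py : 0 < Cmod y by apply Cmod_pos, Cminus_eq_contra.
  set q := (Cmod y / r)%R. have q0 : 0 < q by apply Rdiv_lt_0_compat.
  have q2 : q <= 1 / 2 by apply (Rmult_le_reg_r r) => //; replace (q * r)%R with (Cmod y) by (rewrite /q; field; lra); lra.
  have yq : (Cmod y = q * r)%R by rewrite /q; field; lra.
  have lowsum : psn a y N = 0.
    have : forall n, (n <= N)%nat -> psn a y n = 0; last by apply.
    elim => [|n IH] hn; first by []. rewrite psn_S IH; last lia. rewrite low; last lia. ring.
  have bound m : Cmod (psn a y (S N + m) - a N * y ^ N) <= M * q ^ S N * (2 * (1 - (1 / 2) ^ m)).
    elim: m => [|m IH].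
      rewrite Nat.add_0_r psn_S lowsum. replace (0 + a N * y ^ N - a N * y ^ N) with (RtoC 0) by ring. rewrite Cmod_0. simpl. lra.
    rewrite Nat.add_succ_r psn_S.
    replace (psn a y (S N + m) + a (S N + m)%nat * y ^ (S N + m) - a N * y ^ N) with ((psn a y (S N + m) - a N * y ^ N) + a (S N + m)%nat * y ^ (S N + m)) by ring.
    apply: Rle_trans (Cmod_triangle _ _) _. rewrite (Cmod_mult (a (S N + m)%nat)) Cmod_pow.
    have : Cmod (a (S N + m)%nat) * Cmod y ^ (S N + m) <= M * q ^ S N * (1 / 2) ^ m.
      rewrite yq Rpow_mult_distr. apply Rle_trans with (M * q ^ (S N + m))%R.
        have := HM (S N + m)%nat. have : 0 <= q ^ (S N + m) by apply pow_le; lra. nra.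
      rewrite pow_add -Rmult_assoc. apply Rmult_le_compat_l.
        apply Rmult_le_pos; [lra | apply pow_le; lra]. apply pow_incr. lra.
    have : 0 <= M * q ^ S N by apply Rmult_le_pos; [lra | apply pow_le; lra].
    replace ((1 / 2) ^ S m)%R with (1 / 2 * (1 / 2) ^ m)%R by (simpl; ring). lra.
  have lim : Cmod (a N * y ^ N) <= 2 * M * q ^ S N.
    apply Rnot_lt_le => hlt. have [n0 Hn] := L (Cmod (a N * y ^ N) - 2 * M * q ^ S N)%R ltac:(lra).
    have := Hn (S N + n0)%nat ltac:(lia). replace (psn a y (S N + n0) - 0) with (psn a y (S N + n0)) by ring. move=> b1.
    have b2 := bound n0. have b3 := Cmod_sub_ge (a N * y ^ N) (psn a y (S N + n0)). rewrite Cmod_minus_sym in b3.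
    have : 0 <= M * q ^ S N by apply Rmult_le_pos; [lra | apply pow_le; lra].
    have : 0 < (1 / 2) ^ n0 by apply pow_lt; lra. move=> b4 b5. have : 0 <= M * q ^ S N * (1 / 2) ^ n0 by apply Rmult_le_pos; lra. lra.
  rewrite Cmod_mult Cmod_pow in lim.
  have qr : (q ^ S N * r ^ S N = Cmod y ^ N * Cmod y)%R by rewrite -Rpow_mult_distr -yq; simpl; ring.
  have yN : 0 < Cmod y ^ N by apply pow_lt.
  have : Cmod (a N) * r ^ S N <= 2 * M * Cmod y.
    apply (Rmult_le_reg_l (Cmod y ^ N)) => //.
    apply Rle_trans with (Cmod (a N) * Cmod y ^ N * r ^ S N)%R; first by right; ring.
    apply Rle_trans with (2 * M * q ^ S N * r ^ S N)%R; first by apply Rmult_le_compat_r; lra.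
    right. rewrite Rmult_assoc qr. ring.
  apply (Rmult_lt_compat_l (2 * M)) in h2; last lra.
  replace (2 * M * (Cmod (a N) * r ^ S N / (2 * M)))%R with (Cmod (a N) * r ^ S N)%R in h2 by (field; lra). lra.
Qed.

Lemma analytic_dichotomy (f g : C -> C) (x0 : C) : analytic_at f x0 -> analytic_at g x0 ->
  same_germ x0 f g \/ (exists e, 0 < e /\ forall x, x <> x0 -> Cmod (x - x0) < e -> f x <> g x).
Proof.
  move=> [a /locally_C_eps [d [d0 Ha]]] [b /locally_C_eps [d' [d0' Hb]]].
  have m0 : 0 < Rmin d d' by apply Rmin_glb_lt.
  have := isolated_zeros (PS_minus a b) (fun x => f x - g x) x0 (Rmin d d') m0. case.
  - move=> x hx. apply is_pseries_climit.
    apply (is_pseries_minus a b (x - x0) (f x) (g x)); [apply Ha | apply Hb]; apply: Rlt_le_trans hx _; [apply Rmin_l | apply Rmin_r].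
  - move=> [e [e0 H]]. left. apply locally_C_eps. exists e; split => // x hx. by apply Ceq_minus, H.
  - move=> [e [e0 H]]. right. exists e; split => // x nx hx E. apply (H x nx hx). rewrite E. ring.
Qed.

Lemma path_contr (D : C -> Prop) (gamma : R -> C) (t : R) : path_in D gamma -> 0 <= t <= 1 ->
  forall e, 0 < e -> exists d, 0 < d /\ forall s, 0 <= s <= 1 -> Rabs (s - t) < d -> Cmod (gamma s - gamma t) < e.
Proof.
  move=> [Hc _] ht e he. have := Hc t ht (fun z => Cmod (z - gamma t) < e). case.
    apply locally_C_eps. by exists e.
  move=> d hd. exists d; split; first by apply cond_pos. move=> s hs hst. apply hd => //.
Qed.

(** Real induction on the parameter. Agreement spreads to later parameters because a germ determines
    nearby germs. At a limit parameter two different analytic germs would have distinct values on a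
    punctured disc, although they agree at points of the path arbitrarily close to its centre. *)
Lemma continuation_unique (D : C -> Prop) (f g : C -> C) (gamma : R -> C) (F : R -> C -> C) :
  path_in D gamma -> (forall x, D x -> analytic_at g x) -> same_germ (gamma 0%R) f g ->
  continuation_along f gamma F -> same_germ (gamma 1%R) (F 1%R) g.
Proof.
  move=> hp ga fg [H1 [H2 H3]].
  have loc t : 0 <= t <= 1 -> exists d, 0 < d /\ forall s, 0 <= s <= 1 -> Rabs (s - t) < d -> same_germ (gamma s) (F s) (F t).
    move=> ht. have [d hd] := H3 t ht. exists d; split; first by apply cond_pos. move=> s hs hst. by apply hd.
  have gtrans x u v z : same_germ x u v -> same_germ x v z -> same_germ x u z.
    move=> A B. apply: filter_imp (filter_and _ _ A B) => y [-> ->]. done.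
  apply (real_induction (fun t => same_germ (gamma t) (F t) g) 0 1); try lra.
  - exact (gtrans _ _ _ _ H2 fg).
  - move=> t ht Hs. have St := Hs t ltac:(lra). move: (St) => /locally_C_eps [d [d0 Hd]].
    have [d1 [d10 P1]] := path_contr D gamma t hp ltac:(lra) d d0. have [d2 [d20 P2]] := loc t ltac:(lra).
    exists (Rmin d1 d2); split; first by apply Rmin_glb_lt. move=> s hs hs1.
    have l1 := Rmin_l d1 d2. have l2 := Rmin_r d1 d2.
    apply (gtrans _ _ (F t)); first by apply P2; [lra | rewrite Rabs_pos_eq; lra].
    have near := P1 s ltac:(lra) ltac:(rewrite Rabs_pos_eq; lra).
    apply locally_C_eps. exists (d - Cmod (gamma s - gamma t))%R; split; first lra.
    move=> y hy. apply Hd. have := Cmod_dist y (gamma s) (gamma t). lra.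
  - move=> t ht Hs. have at1 := H1 t ltac:(split; lra). have at2 := ga (gamma t) (proj2 hp t ltac:(split; lra)).
    case: (analytic_dichotomy _ _ _ at1 at2) => // -[e [e0 He]].
    have [d1 [d10 P1]] := path_contr D gamma t hp ltac:(lra) e e0. have [d2 [d20 P2]] := loc t ltac:(lra).
    set m := Rmin (Rmin d1 d2) t. have m0 : 0 < m by repeat apply Rmin_glb_lt; lra.
    have l0 : m <= Rmin d1 d2 by apply Rmin_l. have l3 : m <= t by apply Rmin_r.
    have l1 := Rle_trans _ _ _ l0 (Rmin_l _ _). have l2 := Rle_trans _ _ _ l0 (Rmin_r _ _).
    set s := (t - m / 2)%R. have hs : 0 <= s < t by rewrite /s; lra.
    have ab : Rabs (s - t) < m by rewrite /s Rabs_left; lra.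
    have G1 := Hs s hs. have G2 := P2 s ltac:(lra) ltac:(lra). have near := P1 s ltac:(lra) ltac:(lra).
    have G : same_germ (gamma s) (F t) g.
      apply: filter_imp (filter_and _ _ G1 G2) => y [e1 e2]. by rewrite -e2 e1.
    (* The path may be stationary or return to the same point; then the germ at the earlier
       parameter already is the one required. *)
    case: (classic (gamma s = gamma t)) => [<-|n] //.
    case: (He (gamma s) n near). move: G => /locally_C_eps [d [d0 Hd]]. apply Hd.
    replace (gamma s - gamma s) with (RtoC 0) by ring. by rewrite Cmod_0.
Qed.

(** * The germ of the hypergeometric expression and its global continuation *)

Lemma ztp_neq s : upper_half_plane s -> ztp s <> 0.
Proof.
  move=> h. rewrite /ztp. apply Cmult_neq_0; last by apply zt_cube_neq.
  apply Cmult_neq_0.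
  - have P := PI_RGT_0. rewrite /Cdiv. apply Cmult_neq_0; last by apply Cmod_pos_neq; rewrite -RtoC_inv ?Cmod_R; [apply Rabs_pos_lt|]; lra.
    apply Cmult_neq_0; [apply RtoC_neq; lra | apply Ci_neq].
  - apply Cpow_nz. move=> E. apply (thJ_neq s h).
    replace (thJ s) with (thJ s / th 0 s * th 0 s) by (field; by apply th0_neq). rewrite E. ring.
Qed.

Definition us1 (s : C) : C := Ci / 2 * (Bf (zt s ^ 3) * ztp s).

Lemma cder_u_series s : upper_half_plane s -> Cmod (zt s) < 1 -> cder u_series s (us1 s).
Proof.
  move=> h hz. have Dz := cder_zt s h. have [d [d0 Hd]] := upper_open s h.
  have [d' [d0' Hd']] := cder_contc _ _ _ Dz (1 - Cmod (zt s))%R ltac:(lra).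
  have D : cder (fun y => u_o + Ci / 2 * Zf (zt y)) s (0 + Ci / 2 * (Bf (zt s ^ 3) * ztp s)).
    apply (cder_plus (fun _ => u_o)); first by apply cder_const. apply cder_scalf.
    apply (cder_comp Zf zt); [by apply cder_Zf | exact Dz].
  apply (cder_eq _ _ (0 + Ci / 2 * (Bf (zt s ^ 3) * ztp s))); first by rewrite /us1; ring.
  apply: cder_local D. exists (Rmin d d'); split; first by apply Rmin_glb_lt.
  move=> y hy. have hy' := Hd y (Rlt_le_trans _ _ _ hy (Rmin_l _ _)). have := Hd' y (Rlt_le_trans _ _ _ hy (Rmin_r _ _)).
  have := Cmod_sub_ge (zt y) (zt s) => h1 h2.
  rewrite u_series_Zf zfun_zt //. lra.
Qed.

Lemma us1_contc s : upper_half_plane s -> Cmod (zt s) < 1 -> contc us1 s.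
Proof.
  move=> h hz. have Dz := cder_zt s h. have D0 := cder_th 0 s h. have DJ := cder_thJ s h. have n0 := th0_neq s h.
  have E1 := cder_scalf (PI * Ci / 2) _ _ _ (cder_pow _ _ _ 2 (cder_div _ _ _ _ _ DJ D0 n0)).
  have E2 := cder_minus _ _ _ _ _ (cder_pow _ _ _ 3 Dz) (cder_const 1 s).
  have E3 := cder_comp Bf (fun y => zt y ^ 3) s _ _ (cder_Bf _ (Cmod_cube_lt _ hz)) (cder_pow _ _ _ 3 Dz).
  exact (cder_contc _ _ _ (cder_scalf (Ci / 2) _ _ _ (cder_mult _ _ _ _ _ E3 (cder_mult _ _ _ _ _ E1 E2)))).
Qed.

Lemma us1_sq s : upper_half_plane s -> Cmod (zt s) < 1 -> 4 * (zt s ^ 3 - 1) * us1 s ^ 2 = ztp s ^ 2.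
Proof.
  move=> h hz. have e := Bf_sq _ (Cmod_cube_lt _ hz). have ci := Ci2. rewrite /us1.
  replace (4 * (zt s ^ 3 - 1) * (Ci / 2 * (Bf (zt s ^ 3) * ztp s)) ^ 2) with (- (Ci * Ci) * (Bf (zt s ^ 3) * Bf (zt s ^ 3) * (1 - zt s ^ 3)) * ztp s ^ 2) by field.
  rewrite e ci. ring.
Qed.

(** By the formula for z^3 - 1 both sides are constant multiples of th0^20 / J^4, so agreement at
    one point fixes c^2 and gives agreement everywhere. *)
Lemma constant_speed (c tau0 : C) : upper_half_plane tau0 -> 4 * (zt tau0 ^ 3 - 1) * (c * th 0 tau0 ^ 4) ^ 2 = ztp tau0 ^ 2 ->
  forall s, upper_half_plane s -> 4 * (zt s ^ 3 - 1) * (c * th 0 s ^ 4) ^ 2 = ztp s ^ 2.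
Proof.
  move=> h0 E. have [kappa [k0 K]] := zt_kappa.
  have R s : upper_half_plane s -> 4 * (zt s ^ 3 - 1) * (c * th 0 s ^ 4) ^ 2 - ztp s ^ 2 =
    (4 * c ^ 2 - (PI * Ci / 2) ^ 2 * kappa) * (kappa * (th 0 s ^ 20 / thJ s ^ 4)).
    move=> h. have n0 := th0_neq s h. have nJ := thJ_neq s h. rewrite /ztp K //. field. auto.
  have c2 : 4 * c ^ 2 - (PI * Ci / 2) ^ 2 * kappa = 0.
    have n0 := th0_neq _ h0. have nJ := thJ_neq _ h0.
    apply (Cmult_cancel_l (kappa * (th 0 tau0 ^ 20 / thJ tau0 ^ 4))).
      apply Cmult_neq_0 => //. move=> e. have n20 := Cpow_nz _ 20 n0. apply n20.
      replace (th 0 tau0 ^ 20) with (th 0 tau0 ^ 20 / thJ tau0 ^ 4 * thJ tau0 ^ 4) by (field; done). rewrite e. ring.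
    rewrite Cmult_comm -R // E. ring.
  move=> s h. apply Ceq_minus. rewrite R // c2. ring.
Qed.

(** The constant c makes the derivative of g at tau0 equal to that of the series, and the additive
    constant makes the values agree. Near tau0 the two derivatives have equal squares, and
    continuity selects the same branch, so the germs coincide. *)
Lemma schwarz_germ (tau0 : C) : upper_half_plane tau0 -> Cmod (zt tau0) < 1 -> exists (g : C -> C) (c : C), c <> 0 /\
  (forall s, upper_half_plane s -> cder g s (c * th 0 s ^ 4)) /\
  (forall s, upper_half_plane s -> analytic_at g s) /\
  (forall s, upper_half_plane s -> 4 * (zt s ^ 3 - 1) * (c * th 0 s ^ 4) ^ 2 = ztp s ^ 2) /\
  same_germ tau0 u_series g /\ solY c tau0 = Yd (zt tau0).
Proof.
  move=> h0 hz0. have n0 := th0_neq _ h0. have n4 : th 0 tau0 ^ 4 <> 0 by apply Cpow_nz.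
  have nB := Bf_neq _ (Cmod_cube_lt _ hz0). have nz := ztp_neq _ h0. have ci := Ci2.
  set c := us1 tau0 / th 0 tau0 ^ 4.
  have cE : c * th 0 tau0 ^ 4 = us1 tau0 by rewrite /c; field.
  have n2 : RtoC 2 <> 0 by apply RtoC_neq; lra.
  have nu : us1 tau0 <> 0.
    move=> e. have := us1_sq _ h0 hz0. rewrite e => e2. have := Cpow_nz _ 2 nz. apply. rewrite -e2. ring.
  have nc : c <> 0 by move=> e; apply nu; rewrite -cE e; ring.
  have hc : forall s, upper_half_plane s -> 4 * (zt s ^ 3 - 1) * (c * th 0 s ^ 4) ^ 2 = ztp s ^ 2.
    apply (constant_speed c tau0 h0). rewrite cE. by apply us1_sq.
  pose g s := (u_series tau0 - c * prim tau0) + c * prim s.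
  have gD s : upper_half_plane s -> cder g s (c * th 0 s ^ 4).
    move=> h. apply (cder_eq _ _ (0 + c * th 0 s ^ 4)); first ring.
    apply (cder_plus (fun _ => u_series tau0 - c * prim tau0)); first by apply cder_const. by apply cder_scalf, cder_prim.
  exists g, c. split => //. split => //. split; first by move=> s h; apply analytic_affine, analytic_prim.
  split => //. split; last first.
    rewrite /solY cE /us1 /Yd. replace (ztp tau0 / (Ci / 2 * (Bf (zt tau0 ^ 3) * ztp tau0))) with (2 * Ci / (Ci * Ci) / Bf (zt tau0 ^ 3)).
      rewrite ci. field. done.
    field. repeat split => //. apply Ci_neq.
  have [d1 [d10 H1]] := upper_open _ h0.
  have [d2 [d20 H2]] := cder_contc _ _ _ (cder_zt _ h0) (1 - Cmod (zt tau0))%R ltac:(lra).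
  have pu := Cmod_pos _ nu.
  have [d3 [d30 H3]] := us1_contc _ h0 hz0 _ pu.
  have [d4 [d40 H4]] := cder_contc _ _ _ (cder_scalf c _ _ _ (cder_pow _ _ _ 4 (cder_th 0 _ h0))) _ pu.
  set d := Rmin (Rmin d1 d2) (Rmin d3 d4). have d0 : 0 < d by repeat apply Rmin_glb_lt.
  apply locally_C_eps. exists d; split => // y hy.
  have ball s : Cmod (s - tau0) < d -> upper_half_plane s /\ Cmod (zt s) < 1 /\ us1 s = c * th 0 s ^ 4.
    move=> hs. have a1 := Rlt_le_trans _ _ _ hs (Rmin_l _ _). have a2 := Rlt_le_trans _ _ _ hs (Rmin_r _ _).
    have hH := H1 s (Rlt_le_trans _ _ _ a1 (Rmin_l _ _)). split => //.
    have hZ : Cmod (zt s) < 1.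
      have := H2 s (Rlt_le_trans _ _ _ a1 (Rmin_r _ _)). have := Cmod_sub_ge (zt s) (zt tau0). lra.
    split => //.
    have b1 := H3 s (Rlt_le_trans _ _ _ a2 (Rmin_l _ _)). have b2 := H4 s (Rlt_le_trans _ _ _ a2 (Rmin_r _ _)). rewrite cE in b2.
    have sq : (us1 s + c * th 0 s ^ 4) * us1 s = (us1 s + c * th 0 s ^ 4) * (c * th 0 s ^ 4).
      apply Ceq_minus. have zn := zt_cube_neq s hH. have n4' : 4 * (zt s ^ 3 - 1) <> 0 by apply Cmult_neq_0 => //; apply RtoC_neq; lra.
      apply (Cmult_cancel_l _ _ _ n4').
      replace (4 * (zt s ^ 3 - 1) * ((us1 s + c * th 0 s ^ 4) * us1 s - (us1 s + c * th 0 s ^ 4) * (c * th 0 s ^ 4))) with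
        (4 * (zt s ^ 3 - 1) * us1 s ^ 2 - 4 * (zt s ^ 3 - 1) * (c * th 0 s ^ 4) ^ 2) by ring.
      rewrite hc // us1_sq //. ring.
    (* The sum of the two branches cannot vanish: each stays within |us1 tau0| of the nonzero value
       us1 tau0. *)
    refine (Cmult_cancel_l _ _ _ _ sq).
    move=> e. have : Cmod (us1 s - us1 tau0 + (c * th 0 s ^ 4 - us1 tau0)) = (2 * Cmod (us1 tau0))%R.
      replace (us1 s - us1 tau0 + (c * th 0 s ^ 4 - us1 tau0)) with ((us1 s + c * th 0 s ^ 4) - 2 * us1 tau0) by ring.
      rewrite e. replace (0 - 2 * us1 tau0) with (- (2 * us1 tau0)) by ring. rewrite Cmod_opp (Cmod_mult 2) Cmod_R Rabs_pos_eq; lra.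
    have := Cmod_triangle (us1 s - us1 tau0) (c * th 0 s ^ 4 - us1 tau0). lra.
  have E := cder_zero_const (fun s => Cmod (s - tau0) < d) (fun s => u_series s - g s) y tau0 (convex_ball tau0 d).
  apply Ceq_minus. rewrite E //.
  - rewrite /g. ring.
  - move=> s hs. have [hH [hZ e]] := ball s hs. apply (cder_eq _ _ (us1 s - c * th 0 s ^ 4)); first by rewrite e; ring.
    apply cder_minus; [by apply cder_u_series | by apply gD].
  - replace (tau0 - tau0) with (RtoC 0) by ring. by rewrite Cmod_0.
Qed.

Theorem mainTheorem3 :
  (exists tau0 : C, upper_half_plane tau0 /\ (Cmod (zfun tau0) < 1)%R) /\
  forall (sgn : C) (tau0 : C),
    sgn = 1 \/ sgn = - (1) ->
    upper_half_plane tau0 -> (Cmod (zfun tau0) < 1)%R ->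
    exists u : C -> C,
      single_valued_continuation upper_half_plane u_series tau0
        (fun tau => sgn * u tau) /\
      forall tau : C, upper_half_plane tau ->
        C_derive u tau <> 0 /\
        ~ wp_pole (2 * u tau) 0 4 /\
        schwarz_bracket u tau = - (2) * wp (2 * u tau) 0 4.
Proof.
  split; first exact exists_small_zfun.
  move=> sgn tau0 hs h0. rewrite zfun_zt // => hz0.
  have [g [c [nc [gD [gA [hc [germ Y0]]]]]]] := schwarz_germ tau0 h0 hz0.
  have s2 : sgn * sgn = 1 by case: hs => ->; ring.
  have ns : sgn <> 0 by move=> e; rewrite e in s2; apply C1_nz; rewrite -s2; ring.
  (* Since sgn^2 = 1, the function continuing the series is sgn u = g itself. *)
  exists (fun s => sgn * g s). split.
    have -> : (fun s => sgn * (sgn * g s)) = g by apply functional_extensionality => s; rewrite Cmult_assoc s2; ring.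
    split.
      move=> s h. eexists. apply cder_is_derive. by apply gD.
    move=> gamma hp hg0. split.
    (* The continuation is the constant family g, which is analytic at every point of the
       half-plane. *)
    - exists (fun _ => g). split; first by move=> t ht; apply gA; apply (proj2 hp). split.
        rewrite hg0. apply: filter_imp germ => y. done.
      move=> t _. exists (mkposreal 1 Rlt_0_1) => s _ _. exists (mkposreal 1 Rlt_0_1) => y _. done.
    - move=> F HF. apply (continuation_unique upper_half_plane u_series g gamma F) => //. by rewrite hg0.
  move=> tau h.
  have uD s : upper_half_plane s -> cder (fun s => sgn * g s) s (sgn * c * th 0 s ^ 4).
    move=> hs'. rewrite -Cmult_assoc. by apply cder_scalf, gD.
  have nsc : sgn * c <> 0 by apply Cmult_neq_0.
  split.
    rewrite (cder_C_derive _ _ _ (uD tau h)). apply Cmult_neq_0 => //. by apply Cpow_nz, th0_neq.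
  have v0 : val2 (g tau0) (zt tau0) (solY c tau0).
    have -> : g tau0 = u_series tau0.
      move: germ => /locally_C_eps [d [d0 Hd]]. symmetry. apply Hd. replace (tau0 - tau0) with (RtoC 0) by ring. by rewrite Cmod_0.
    rewrite Y0. by apply val2_u_series.
  have [_ [o [P _]]] := val2_solution g c nc gD hc tau0 tau h0 v0 h.
  have [o' P'] : off W (2 * (sgn * g tau)) /\ wpf W (2 * (sgn * g tau)) = dup_X (zt tau).
    case: hs => ->.
      by replace (2 * (1 * g tau)) with (2 * g tau) by ring.
    (* For the negative sign, evenness of P and symmetry of the lattice transfer both statements. *)
    replace (2 * (- (1) * g tau)) with (- (2 * g tau)) by ring. split; first by apply off_opp. rewrite wpf_opp //. exact hW.
  split => //. rewrite wp_wpf // P'.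
  apply (schwarz_third _ (sgn * c)) => //. rewrite -/(ztp tau) -hc //.
  replace ((sgn * c * th 0 tau ^ 4) ^ 2) with (sgn * sgn * (c * th 0 tau ^ 4) ^ 2) by ring. rewrite s2. ring.
Qed.
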